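(* Assume conditions (A1) and (A2). [i] If $\rho\in(0,1)$, then there exist constants $\alpha>0$ and $c_{\alpha,\rho}>0$ such that for all $0\le x\le \alpha\,\varepsilon_n^{-1}$, \[ \Big|\ln \frac{\mathbf P(X_n>x)}{1-\Phi(x)}\Big|\le c_{\alpha,\rho}\Big(x^{2+\rho}\varepsilon_n^{\rho}+x^2\delta_n^2+(1+x)\big(\varepsilon_n^{\rho}+\delta_n\big)\Big). \] [ii] If $\rho=1$, then there exist constants $\alpha>0$ and $c_{\alpha}>0$ such that for all $0\le x\le \alpha\,\varepsilon_n^{-1}$, \[ \Big|\ln \frac{\mathbf P(X_n>x)}{1-\Phi(x)}\Big|\le c_{\alpha}\Big(x^{3}\varepsilon_n+x^2\delta_n^2+(1+x)\big(\varepsilon_n|\ln\varepsilon_n|+\delta_n\big)\Big). \]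
   Context: Standing setup: Fix $n\ge 1$. Let $(\Omega,\mathcal F,\mathbf P)$ be a probability space with $\sigma$-fields $\{\emptyset,\Omega\}=\mathcal F_0\subseteq\mathcal F_1\subseteq\cdots\subseteq\mathcal F_n\subseteq\mathcal F$, and let $(\xi_i,\mathcal F_i)_{i=0,\dots,n}$ be a sequence of square-integrable martingale differences with $\xi_0=0$ (each $\xi_i$ is $\mathcal F_i$-measurable and $\mathbf E[\xi_i\mid\mathcal F_{i-1}]=0$); the $\xi_i$ may depend on $n$. Set $X_n=\sum_{i=1}^n\xi_i$ and $\langle X\rangle_n=\sum_{i=1}^n\mathbf E[\xi_i^2\mid\mathcal F_{i-1}]$. Write $\xi^+=\max\{\xi,0\}$ and let $\Phi$ be the standard normal distribution function. Relations between random variables hold $\mathbf P$-a.s. Condition (A1): there exist a constant $\rho\in(0,1]$ and a number $\varepsilon_n\in(0,\tfrac12]$ such that $\mathbf E[|\xi_i|^{2+\rho}e^{\varepsilon_n^{-1}\xi_i^+}\mid\mathcal F_{i-1}]\le \varepsilon_n^{\rho}\,\mathbf E[\xi_i^2\mid\mathcal F_{i-1}]$ for all $1\le i\le n$. Condition (A2): there exists a number $\delta_n\in[0,\tfrac12]$ such that $|\langle X\rangle_n-1|\le\delta_n^2$ a.s. Constants such as $\alpha$, $c_{\alpha,\rho}$, $c_\alpha$ depend only on the indicated parameters ($\alpha$, $\rho$), and not on $n$, the martingale, $\varepsilon_n$, $\delta_n$ or $x$. *)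

(* Defs.v *)
From HB Require Import structures.
From mathcomp Require Import all_boot all_order all_algebra.
From mathcomp Require Import all_classical all_reals all_analysis.
From mathcomp Require Import measurable_realfun lebesgue_integral normal_distribution.
Set Implicit Arguments.
Unset Strict Implicit.
Unset Printing Implicit Defensive.
Import Order.TTheory GRing.Theory Num.Def Num.Theory.
Local Open Scope classical_set_scope.
Local Open Scope ring_scope.

Section defs.
Context {R : realType} {d : measure_display} {T : measurableType d}.
Variable P : probability T R.

Definition sub_sigma_field (G : set (set T)) :=
  sigma_algebra setT G /\ (forall A, G A -> measurable A).

Definition G_measurable {d' : measure_display} {U : measurableType d'}
  (G : set (set T)) (f : T -> U) :=
  forall B : set U, measurable B -> G (f @^-1` B).

Definition cexp_nonneg (G : set (set T)) (Y Z : T -> \bar R) :=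
  [/\ (forall w, (0 <= Y w)%E), (forall w, (0 <= Z w)%E), G_measurable (U:=\bar R) G Z &
      forall A, G A -> (\int[P]_(w in A) Z w = \int[P]_(w in A) Y w)%E].

Definition cexp_int (G : set (set T)) (Y Z : T -> R) :=
  [/\ P.-integrable setT (EFin \o Y), P.-integrable setT (EFin \o Z),
      G_measurable (U:=R) G Z &
      forall A, G A -> (\int[P]_(w in A) (Z w)%:E = \int[P]_(w in A) (Y w)%:E)%E].

(** Standing setup: filtration F_0 = {emptyset, Omega} <= F_1 <= ... <= F_n <= F,
    square-integrable martingale differences xi_1..xi_n (xi_0 = 0, indices
    outside 1..n are irrelevant), and s2 i a version of E[xi_i^2 | F_{i-1}]. *)
Definition mds_setup (n : nat) (F : nat -> set (set T)) (xi : nat -> T -> R)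
  (s2 : nat -> T -> R) :=
  [/\ F 0%N = [set set0; setT],
      (forall i, (i <= n)%N -> sub_sigma_field (F i)),
      (forall i, (i < n)%N -> F i `<=` F i.+1),
      xi 0%N = (fun=> 0) &
      forall i, (1 <= i <= n)%N ->
        [/\ G_measurable (U:=R) (F i) (xi i),
            P.-integrable setT (fun w => ((xi i w) ^+ 2)%:E),
            cexp_int (F i.-1) (xi i) (fun=> 0) &
            cexp_nonneg (F i.-1) (fun w => ((xi i w) ^+ 2)%:E)
                                 (fun w => (s2 i w)%:E)]].

Definition qvar (n : nat) (s2 : nat -> T -> R) (w : T) : R :=
  \sum_(1 <= i < n.+1) s2 i w.

Definition Xsum (n : nat) (xi : nat -> T -> R) (w : T) : R :=
  \sum_(1 <= i < n.+1) xi i w.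

Definition condA1 (n : nat) (F : nat -> set (set T)) (xi : nat -> T -> R)
  (s2 : nat -> T -> R) (rho eps : R) :=
  [/\ 0 < rho <= 1, 0 < eps <= 2^-1 &
      forall i, (1 <= i <= n)%N ->
        exists Z : T -> \bar R,
          cexp_nonneg (F i.-1)
            (fun w => (`|xi i w| `^ (2 + rho) * expR (eps^-1 * Num.max (xi i w) 0))%:E) Z
          /\ {ae P, forall w, (Z w <= (eps `^ rho * s2 i w)%:E)%E}].

Definition condA2 (n : nat) (s2 : nat -> T -> R) (delta : R) :=
  0 <= delta <= 2^-1 /\
  {ae P, forall w, `|qvar n s2 w - 1| <= delta ^+ 2}.

Definition tailX (n : nat) (xi : nat -> T -> R) (x : R) : R :=
  fine (P [set w | x < Xsum n xi w]).

End defs.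

Definition Phi {R : realType} (x : R) : R :=
  fine (normal_prob 0 1 `]-oo, x]).

(* Main.v *)
Require Import Defs.
From HB Require Import structures.
From mathcomp Require Import all_boot all_order all_algebra.
From mathcomp Require Import all_classical all_reals all_analysis.
From mathcomp Require Import measurable_realfun lebesgue_integral normal_distribution.
From mathcomp Require Import ring lra.
Import Order.TTheory GRing.Theory Num.Def Num.Theory.
Import numFieldNormedType.Exports.
Set Implicit Arguments.
Unset Strict Implicit.
Unset Printing Implicit Defensive.
Local Open Scope classical_set_scope.
Local Open Scope ring_scope.

(* For [lam >= 0] tilt [P] by the normalized product of the [exp (lam xi_i)], conditionally normalized
   at each step. Under the tilted probability [Q], [X = Y + lam V] where [V] is the quadratic
   variation and [Y] is the sum of martingale differences whose conditional moments are those of the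
   [xi_i] up to relative errors [(lam eps)^rho]; moreover
   [P(X > x) = exp (O(lam^(2+rho) eps^rho)) E_Q[exp (- lam Y - lam^2 V / 2); X > x]].
   A Lindeberg argument in the time scale of the quadratic variation shows that [Y] is normal under
   [Q] up to a Kolmogorov error [kap]: the third order Taylor remainder of [Phi], weighted by
   [(v + (Y_k - t)^2)^(-1-rho/2)], is transported from time [k] to time [n] by convexity (Jensen), which
   bounds it by the Kolmogorov error at small balls, i.e. by the quantity being estimated, and a dyadic
   decomposition closes this self-bounding inequality.
   Taking [lam (1 + delta^2) = x] gives the upper bound and [lam (1 - delta^2) = x] the lower bound, as
   long as [kap] is small compared with the Mills ratio. In the remaining ranges of the lower bound
   the claimed error is bounded below, and cruder events than [X > x] suffice. *)

(** * Taylor expansions of the normal distribution function *)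

Section gauss.
Context {R : realType}.
Implicit Types x y z t w u s v : R.

(** The Taylor remainder at time [k] is weighted by a kernel concentrated near [Y_k = t], so its
    expectation depends on how much mass [Y_k] puts near [t], whereas the Kolmogorov error is that
    of [Y_n]. The transport to time [n] rests on [(Y_k - t)^2 - V_k] being nearly a martingale under
    [Q]. At time [n] the sum over [k] telescopes path by path to a multiple of
    [max (r, |Y_n - t|)^(-rho)], where [r] is a regularizing scale. In the expectation of this
    function the small balls contribute [sum_j (2^j r)^(1 - rho)] over the scales [2^j r <= 1]:
    bounded if [rho < 1], one unit per dyadic scale if [rho = 1]. This is the origin of [|ln eps|].
    The Kolmogorov error itself enters with the factor [(eps / r)^rho], which is made small by
    taking [r = K eps] with [K] large. The uncertainty [delta^2] of the final variance acts as a
    smoothing at the scale [delta], whence the linear term in [delta]. The factor [1 + x] of the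
    error is the inverse of the Mills ratio, with which the Kolmogorov error is compared. *)

Definition phi x : R := normal_pdf 0 1 x.

Lemma phiE x : phi x = phi 0 * expR (- x ^+ 2 / 2).
Proof.
rewrite /phi /normal_pdf oner_eq0 /normal_fun !subr0 expr0n/= oppr0 mul0r.
by rewrite expR0 mulr1 expr1n.
Qed.

Lemma phi0_gt0 : 0 < phi 0.
Proof.
rewrite /phi /normal_pdf oner_eq0 mulr_gt0 ?expR_gt0 ?normal_peak_gt0//.

Qed.

Lemma phi0_le1 : phi 0 <= 1.
Proof.
apply: le_trans (normal_pdf_ub _ _ (oner_neq0 R)) _.
have pi1 : 1 <= pi *+ 2 :> R by have := pi_ge2 R; rewrite -mulr_natr; lra.
rewrite /normal_peak expr1n mul1r invf_le1 ?sqrtr_gt0 ?(lt_le_trans _ pi1)//.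
by rewrite -[leLHS]sqrtr1 ler_sqrt// (le_trans _ pi1).
Qed.

Lemma phi_gt0 x : 0 < phi x.
Proof. by rewrite phiE mulr_gt0 ?phi0_gt0 ?expR_gt0. Qed.

Lemma phi_ge0 x : 0 <= phi x. Proof. exact/ltW/phi_gt0. Qed.

Lemma phi_le0 x : phi x <= phi 0.
Proof.
rewrite phiE ler_piMr ?phi_ge0// -[leRHS]expR0 ler_expR mulNr oppr_le0.
by rewrite divr_ge0// sqr_ge0.
Qed.

Lemma phi_le1 x : phi x <= 1.
Proof. exact: le_trans (phi_le0 x) phi0_le1. Qed.

Lemma phiN x : phi (- x) = phi x.
Proof. by rewrite phiE [RHS]phiE sqrrN. Qed.

Lemma is_derive_phi x : is_derive x 1 phi (- x * phi x).
Proof.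
have -> : phi = (fun y => phi 0 * expR (- y ^+ 2 / 2)).
  by apply/funext => y; rewrite phiE.
apply: is_derive_eq.
by rewrite /GRing.scale/=; field.
Qed.

Lemma is_derive_Phi x : is_derive x 1 (@Phi R) (phi x).
Proof.
have [||||dF F'] := @continuous_FTC1 R phi -oo%O x (x + 1).
- by rewrite ltrDl.
- by apply: integrableS (integrable_normal_pdf 0 1).
- by rewrite ltNyr.
- exact/continuous_normal_pdf/oner_neq0.
by split; [exact: dF|rewrite -derive1E].
Qed.

Lemma MVT_everywhere (f df : R -> R) a b : (forall x, is_derive x 1 f (df x)) ->
  exists c, `|c - a| <= `|b - a| /\ f b - f a = df c * (b - a) /\ (a <= b -> a <= c <= b).
Proof.
move=> fdf; have cf : continuous f.
  by move=> x; apply: differentiable_continuous; apply/derivable1_diffP; case: (fdf x).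
have cfw A : {within A, continuous f} by exact: continuous_subspaceT.
have [ab|/ltW ba] := leP a b.
  have [c /[!in_itv]/= /andP[ac cb] ->] := MVT_segment ab (fun x _ => fdf x) (cfw _).
  exists c; split; last by split => // _; rewrite ac cb.
  by rewrite !ger0_norm ?subr_ge0// lerB.
have [c /[!in_itv]/= /andP[ac cb] fE] := MVT_segment ba (fun x _ => fdf x) (cfw _).
exists c; split; first by rewrite !ler0_norm ?subr_le0// !opprB; lra.
split=> [|ab']; first by rewrite -opprB fE; ring.
by lra.
Qed.

Lemma Phi_ge0 x : 0 <= Phi x.
Proof. by rewrite /Phi fine_ge0. Qed.

Lemma Phi_le1 x : Phi x <= 1.
Proof.
rewrite /Phi -lee_fin fineK ?fin_num_measure//.
exact: probability_le1.
Qed.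

Lemma cvg_Phiy : Phi x @[x --> +oo] --> (1 : R).
Proof.
have mid : @measurable_fun _ _ (measurableTypeR R) R setT idfun := @measurable_id _ _ setT.
have := @cvg_cdfy1 _ _ R (normal_prob 0 1) (@mfun_Sub _ _ (measurableTypeR R) R idfun (mem_set mid)).
by move=> /fine_cvg.
Qed.

Lemma cvg_PhiNy : Phi x @[x --> -oo] --> (0 : R).
Proof.
have mid : @measurable_fun _ _ (measurableTypeR R) R setT idfun := @measurable_id _ _ setT.
have := @cvg_cdfNy0 _ _ R (normal_prob 0 1) (@mfun_Sub _ _ (measurableTypeR R) R idfun (mem_set mid)).
by move=> /fine_cvg.
Qed.

(** The left-hand side has zero derivative, so it equals its limit at infinity. *)
Lemma Phi_sum x : Phi x + Phi (- x) = 1 :> R.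
Proof.
have dS y : is_derive y 1 (fun y => Phi y + Phi (- y)) 0.
  have dP := is_derive_Phi y; have dN := is_derive_Phi (- y).
  have dC : is_derive y 1 (fun y => Phi (- y)) (- phi y).
    by apply: is_derive_eq (is_derive1_comp dN _) _; rewrite phiN mulrN1.
  by apply: is_derive_eq; rewrite subrr.
have hcst y : Phi y + Phi (- y) = Phi x + Phi (- x).
  exact: (is_derive_0_is_cst y x dS).
have : (Phi y + Phi (- y)) @[y --> +oo] --> (1 + 0 : R).
  apply: cvgD; first exact: cvg_Phiy.
  exact: (cvgNy_compNP _ _).1 cvg_PhiNy.
rewrite addr0 => h; apply: (cvg_unique _ _ h) => //.
rewrite (_ : (fun y => _) = cst (Phi x + Phi (- x))); first exact: cvg_cst.
by apply/funext => y; rewrite hcst.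
Qed.

Lemma Phi0 : Phi 0 = 2^-1 :> R.
Proof. by have := Phi_sum 0; rewrite oppr0; lra. Qed.

Lemma Phi_lip x y : `|Phi x - Phi y| <= `|x - y| :> R.
Proof.
have [c [_ [-> _]]] := MVT_everywhere y x is_derive_Phi.
by rewrite normrM ler_piMl// ger0_norm ?phi_ge0// phi_le1.
Qed.

(** The constant comes from the fourth power of [1 + u <= 8 exp (u / 8)], taken at [u = x^2]. *)
Definition cphi : R := 8 ^+ 4.

Lemma cphi_ge1 : 1 <= cphi. Proof. by rewrite exprn_ege1//; lra. Qed.

Lemma sqr1_gt0 x : 0 < 1 + x ^+ 2. Proof. by rewrite ltr_pwDl ?sqr_ge0. Qed.
Lemma sqr1_ge1 x : 1 <= 1 + x ^+ 2. Proof. by rewrite lerDl sqr_ge0. Qed.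

Lemma phi_decay x : phi x <= cphi / (1 + x ^+ 2) ^+ 4.
Proof.
rewrite phiE ler_pdivlMr ?exprn_gt0 ?sqr1_gt0//.
have u0 := sqr_ge0 x; set u := x ^+ 2 in u0 *.
have h : (1 + u) ^+ 4 <= cphi * expR (u / 2).
  have -> : u / 2 = 4 * (u / 8) by field.
  rewrite expRM_natl /cphi -exprMn lerXn2r ?nnegrE ?mulr_ge0 ?expR_ge0 ?addr_ge0//.
  by have := expR_ge1Dx (u / 8); lra.
rewrite -mulrA mulNr expRN; apply: le_trans (ler_piMl _ phi0_le1) _.
  by rewrite mulr_ge0 ?invr_ge0 ?expR_ge0// exprn_ge0// addr_ge0.
by rewrite mulrC ler_pdivrMr ?expR_gt0.
Qed.

Lemma phi_decayn k x : (k <= 4)%N -> (1 + x ^+ 2) ^+ k * phi x <= cphi / (1 + x ^+ 2) ^+ (4 - k).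
Proof.
move=> k4; rewrite ler_pdivlMr ?exprn_gt0 ?sqr1_gt0// mulrAC -exprD subnKC//.
by rewrite mulrC -ler_pdivlMr ?phi_decay// exprn_gt0 ?sqr1_gt0.
Qed.

(** [Phi + g] is nonincreasing beyond [x], so [Phi y <= Phi x + g x] there; then [y] tends to
    infinity. *)
Lemma Phi_tail_by (g dg : R -> R) x : (forall y, is_derive y 1 g (dg y)) ->
  (forall y, x <= y -> phi y + dg y <= 0) -> (forall y, x <= y -> 0 <= g y) ->
  1 - Phi x <= g x.
Proof.
move=> gdg neg g0; pose G y := Phi y + g y.
have dG y : is_derive y 1 G (phi y + dg y).
  by have dP := is_derive_Phi y; have dg' := gdg y; apply: is_derive_eq.
have PhiG y : x <= y -> Phi y <= G x.
  move=> xy; have [c [_ [GE /(_ xy) /andP[xc cy]]]] := MVT_everywhere x y dG.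
  have : G y <= G x by rewrite -subr_le0 GE mulr_le0_ge0 ?subr_ge0// neg.
  by apply: le_trans; rewrite lerDl g0.
rewrite lerBlDl -[leLHS](cvg_lim _ cvg_Phiy)//.
apply: limr_le; first by apply/cvg_ex; exists 1; exact: cvg_Phiy.
by near=> y; apply: PhiG; near: y; apply: nbhs_pinfty_ge; exact: num_real.
Unshelve. all: by end_near. Qed.

Lemma Phi_tail x : 0 <= x -> 1 - Phi x <= cphi / (1 + x ^+ 2).
Proof.
move=> x0; have c1 := cphi_ge1.
have [x1|x1] := leP x 1.
  rewrite ler_pdivlMr ?sqr1_gt0//; have := Phi_ge0 x; have := Phi_le1 x.
  have : 2 <= cphi by rewrite /cphi (@le_trans _ _ (8 ^+ 1)) ?ler_eXn2l//; lra.
  nra.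
pose g y := cphi * (1 + y ^+ 2)^-1.
have dg y : is_derive y 1 g (- (cphi * (y *+ 2) / (1 + y ^+ 2) ^+ 2)).
  have dV : is_derive y 1 (fun y => (1 + y ^+ 2)^-1) (- (1 + y ^+ 2) ^- 2 *: (y *+ 2)).
    apply: is_deriveV; first by rewrite gt_eqF// sqr1_gt0.
    by apply: is_derive_eq; rewrite /GRing.scale/=; ring.
  rewrite /g; apply: is_derive_eq; rewrite /GRing.scale/=.
  by field; rewrite gt_eqF// sqr1_gt0.
apply: (Phi_tail_by dg) => c xc.
  rewrite subr_le0; apply: le_trans (phi_decay c) _.
  rewrite -mulrA ler_wpM2l ?(le_trans _ c1)//.
  rewrite ler_pdivlMr ?exprn_gt0 ?sqr1_gt0// mulrC ler_pdivrMr ?exprn_gt0 ?sqr1_gt0//.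
  have c21 : 1 <= c *+ 2 by rewrite -mulr_natr; lra.
  apply: le_trans (ler_peMl _ c21); last by rewrite exprn_ge0 ?(ltW (sqr1_gt0 _)).
  by rewrite ler_weXn2l ?sqr1_ge1.
by rewrite mulr_ge0 ?invr_ge0 ?(ltW (sqr1_gt0 _))// (le_trans _ c1).
Qed.

(** One integration by the mean value theorem. The factor [1 / (k + 1)] is given up, so that the
    same [M] serves at every order of the iteration. *)
Lemma taylor_step (g dg : R -> R) k M w :
  (forall u, is_derive u 1 g (dg u)) -> g 0 = 0 ->
  (forall u, `|u| <= `|w| -> `|dg u| <= M * `|u| ^+ k) -> 0 <= M ->
  forall u, `|u| <= `|w| -> `|g u| <= M * `|u| ^+ k.+1.
Proof.
move=> dgP g0 hM M0 u uw; have [c [cu [gE _]]] := MVT_everywhere 0 u dgP.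
rewrite !subr0 in cu gE; rewrite g0 subr0 in gE; rewrite gE normrM exprSr mulrA.
rewrite ler_wpM2r//; apply: le_trans (hM _ (le_trans cu uw)) _.
by rewrite ler_wpM2l// lerXn2r ?nnegrE.
Qed.

Lemma is_derive_shiftl (f df : R -> R) z u : (forall x, is_derive x 1 f (df x)) ->
  is_derive u 1 (fun v => f (z + v)) (df (z + u)).
Proof.
move=> fdf; have h := fdf (z + u).
apply: is_derive_eq (is_derive1_comp h _) _.
by rewrite add0r mulr1.
Qed.

Lemma is_derive_phi' x : is_derive x 1 (fun x => - x * phi x) ((x ^+ 2 - 1) * phi x).
Proof.
have h := is_derive_phi x; apply: is_derive_eq.
by rewrite /GRing.scale/=; ring.
Qed.

Lemma Phi_taylor3 z w : `|w| <= 1 ->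
  `|Phi (z + w) - Phi z - w * phi z - w ^+ 2 / 2 * (- z * phi z)|
   <= cphi * 27 / (1 + z ^+ 2) ^+ 2 * `|w| ^+ 3.
Proof.
move=> w1; have M0 : 0 <= cphi * 27 / (1 + z ^+ 2) ^+ 2.
  by rewrite divr_ge0 ?exprn_ge0 ?(ltW (sqr1_gt0 _))// mulr_ge0// (le_trans _ cphi_ge1).
set M := cphi * 27 / _ in M0 *.
have d3 u : `|u| <= `|w| -> `|((z + u) ^+ 2 - 1) * phi (z + u)| <= M * `|u| ^+ 0.
  move=> uw; rewrite expr0 mulr1 normrM (ger0_norm (phi_ge0 _)).
  apply: (@le_trans _ _ ((1 + (z + u) ^+ 2) ^+ 1 * phi (z + u))).
    rewrite ler_wpM2r ?phi_ge0// expr1 ler_norml.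
    by have := sqr_ge0 (z + u); lra.
  apply: le_trans (phi_decayn _ _) _ => //.
  rewrite /M -mulrA ler_wpM2l ?(le_trans _ cphi_ge1)//.
  have u1 : u ^+ 2 <= 1 by rewrite -real_normK ?num_real// expr_le1// (le_trans uw).
  (* A shift by at most 1 changes [1 + z^2] by a factor at most 3; its cube is the 27 of the
     statement. *)
  have hz : 1 + z ^+ 2 <= 3 * (1 + (z + u) ^+ 2) by have := sqr_ge0 (z + 2 * u); nra.
  rewrite ler_pdivlMr ?exprn_gt0 ?sqr1_gt0// mulrC ler_pdivrMr ?exprn_gt0 ?sqr1_gt0//.
  apply: (@le_trans _ _ ((1 + z ^+ 2) ^+ 3)); first by rewrite ler_weXn2l ?sqr1_ge1//.
  apply: le_trans (lerXn2r 3 _ _ hz) _; rewrite ?nnegrE ?mulr_ge0 ?(ltW (sqr1_gt0 _))//.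
  by rewrite exprMn; lra.
have D2 u : is_derive u 1 (fun u => - (z + u) * phi (z + u) - (- z * phi z)) (((z + u) ^+ 2 - 1) * phi (z + u)).
  have h := is_derive_shiftl z u is_derive_phi'.
  by apply: is_derive_eq; rewrite subr0.
have b2 := taylor_step D2 _ d3 M0.
have D1 u : is_derive u 1 (fun u => phi (z + u) - phi z - u * (- z * phi z)) (- (z + u) * phi (z + u) - (- z * phi z)).
  have h := is_derive_shiftl z u is_derive_phi.
  by apply: is_derive_eq; rewrite /GRing.scale/=; ring.
have b1 := taylor_step D1 _ (b2 _) M0.
have D0 u : is_derive u 1 (fun u => Phi (z + u) - Phi z - u * phi z - u ^+ 2 / 2 * (- z * phi z))
    (phi (z + u) - phi z - u * (- z * phi z)).
  have h := is_derive_shiftl z u is_derive_Phi.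
  by apply: is_derive_eq; rewrite /GRing.scale/=; field.
have b0 := taylor_step D0 _ (b1 _ _) M0.
by apply: b0 => //; rewrite !addr0; ring.
Qed.

Lemma normr_PhiB_le1 x y : `|Phi x - Phi y| <= 1 :> R.
Proof.
by rewrite ler_norml; have := Phi_ge0 x; have := Phi_ge0 y; have := Phi_le1 x; have := Phi_le1 y; lra.
Qed.

Lemma powR_le_sqr (a p : R) : 1 <= a -> p <= 2 -> a `^ p <= a ^+ 2.
Proof.
by move=> a1 p2; rewrite -powR_mulrn ?ler_powR// (le_trans _ a1).
Qed.

Lemma powR_kernel_le p z : p <= 2 -> (1 + z ^+ 2) ^- 2 <= ((1 + z ^+ 2) `^ p)^-1.
Proof.
move=> p2; rewrite lef_pV2 ?posrE ?powR_gt0 ?exprn_gt0 ?sqr1_gt0//.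
by rewrite powR_le_sqr ?sqr1_ge1.
Qed.

(* The kernel [(1 + z^2) ^ - (1 + rho/2)] decays so slowly that, for [|w| >= |z|/2], the right-hand
   side exceeds 1 and the bound holds without any restriction on [w]. *)
Lemma Phi_taylor rho z w : 0 <= rho <= 1 ->
  `|Phi (z + w) - Phi z - w * phi z - w ^+ 2 / 2 * (- z * phi z)|
   <= 300 * cphi * (`|w| `^ (2 + rho) / (1 + z ^+ 2) `^ (1 + rho / 2)).
Proof.
move=> /andP[r0 r1]; have c1 := cphi_ge1.
have p2 : 1 + rho / 2 <= 2 by lra.
have Kge := powR_kernel_le z p2.
set K := (_ `^ (1 + rho / 2))^-1 in Kge *.
have K0 : 0 <= K by rewrite invr_ge0 powR_ge0.
have c0 : 0 <= cphi by lra.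
have [w1|w1] := leP `|w| 1.
  apply: le_trans (Phi_taylor3 z w1) _.
  rewrite -mulrA; apply: (@le_trans _ _ (cphi * 27 * (K * `|w| `^ (2 + rho)))).
    rewrite ler_wpM2l ?mulr_ge0// ler_pM ?invr_ge0 ?exprn_ge0 ?(ltW (sqr1_gt0 _))//.
    have [->|w0] := eqVneq `|w| 0; first by rewrite expr0n powR_ge0.
    rewrite -powR_mulrn// ger_powR ?w1 ?lt_def ?w0 ?normr_ge0//; lra.
  rewrite (mulrC K) ler_wpM2r ?mulr_ge0 ?powR_ge0//; nra.
have wp : `|w| ^+ 2 <= `|w| `^ (2 + rho).
  by rewrite -powR_mulrn// ler_powR ?(ltW w1)//; lra.
have w2 : `|w| <= `|w| ^+ 2 by nra.
have W0 : 0 <= `|w| ^+ 2 by rewrite exprn_ge0.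
set W := `|w| `^ _ in wp *.
have phK k : (k <= 2)%N -> (1 + z ^+ 2) ^+ k * phi z <= cphi * K.
  move=> k2; apply: le_trans (phi_decayn _ _) _; first by rewrite (leq_trans k2).
  rewrite ler_wpM2l//; apply: le_trans Kge.
  by rewrite lef_pV2 ?posrE ?exprn_gt0 ?sqr1_gt0// ler_weXn2l ?sqr1_ge1//; case: k k2 => [|[|[|]]].
have t1 : `|w * phi z| <= cphi * (W * K).
  rewrite normrM (ger0_norm (phi_ge0 _)) mulrCA ler_pM ?phi_ge0 ?(le_trans w2)//.
  by have := phK 0%N isT; rewrite expr0 mul1r.
have t2 : `|w ^+ 2 / 2 * (- z * phi z)| <= cphi * (W * K).
  rewrite normrM mulrCA ler_pM//.
    rewrite normrM normrX; apply: le_trans wp; rewrite ler_piMr// ger0_norm; lra.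
  rewrite normrM normrN (ger0_norm (phi_ge0 _)); apply: le_trans (phK 1%N isT).
  rewrite expr1 ler_wpM2r ?phi_ge0// ler_norml; nra.
have t0 : `|Phi (z + w) - Phi z| <= 256 * cphi * (W * K).
  have [zw|wz] := leP `|z| (2 * `|w|).
    apply: le_trans (normr_PhiB_le1 _ _) _.
    have : 1 <= 25 * (W * K).
      rewrite mulrA ler_pdivlMr ?mul1r ?powR_gt0 ?sqr1_gt0//.
      have h : 1 + z ^+ 2 <= 5 * `|w| ^+ 2.
        have : z ^+ 2 <= (2 * `|w|) ^+ 2 by rewrite -[z ^+ 2]real_normK ?num_real// lerXn2r ?nnegrE ?mulr_ge0.
        by rewrite exprMn; nra.
      apply: le_trans (ge0_ler_powR _ _ _ h) _; rewrite ?nnegrE ?(ltW (sqr1_gt0 _)) ?mulr_ge0//.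
        lra.
      rewrite powRM// ler_pM ?powR_ge0//.
        by apply: le_trans (powR_le_sqr _ p2) _; lra.
      rewrite /W -powR_mulrn// -powRrM ler_powR ?(ltW w1)//; lra.
    have WK0 : 0 <= W * K by rewrite mulr_ge0 ?powR_ge0.
    by nra.
  (* Now [|w| < |z| / 2], so the intermediate point satisfies [|c| >= |z| / 2] and [phi c] decays in
     [z]. *)
  have [c [cz [-> _]]] := MVT_everywhere z (z + w) is_derive_Phi.
  have -> : z + w - z = w by ring.
  rewrite (_ : z + w - z = w) in cz; last by ring.
  rewrite normrM (ger0_norm (phi_ge0 _)).
  have hc : 1 + z ^+ 2 <= 4 * (1 + c ^+ 2).
    have : `|z| <= 2 * `|c|.
      have := ler_distD c z 0; rewrite !subr0 distrC; lra.
    move=> zc; have : z ^+ 2 <= (2 * `|c|) ^+ 2 by rewrite -[z ^+ 2]real_normK ?num_real// lerXn2r ?nnegrE ?mulr_ge0.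
    by rewrite exprMn real_normK ?num_real//; nra.
  rewrite mulrC mulrCA ler_pM ?phi_ge0 ?(le_trans w2)//.
    apply: le_trans (phi_decay c) _.
    rewrite (_ : 256 * cphi * K = cphi * (256 * K)) 1?ler_wpM2l//; last by ring.
    apply: le_trans (_ : 256 * (1 + z ^+ 2) ^- 2 <= _); last by rewrite ler_wpM2l.
    rewrite ler_pdivlMr ?exprn_gt0 ?sqr1_gt0// mulrC ler_pdivrMr ?exprn_gt0 ?sqr1_gt0//.
    apply: (@le_trans _ _ ((1 + z ^+ 2) ^+ 4)); first by rewrite ler_weXn2l ?sqr1_ge1.
    apply: le_trans (lerXn2r 4 _ _ hc) _; rewrite ?nnegrE ?mulr_ge0 ?(ltW (sqr1_gt0 _))//.
    by rewrite exprMn; lra.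
have WK0 : 0 <= W * K by rewrite mulr_ge0 ?powR_ge0.
apply: le_trans (ler_normB _ _) _; apply: le_trans (lerD (ler_normB _ _) t2) _.
by move: t0 t1; nra.
Qed.

(** Everything is required on [[0, u]] only, since the square root in [Phi_time_taylor] is
    differentiable only where its argument is positive. *)
Lemma taylor2 (g g1 g2 : R -> R) M u : 0 <= u -> 0 <= M ->
  (forall s, 0 <= s <= u -> is_derive s 1 g (g1 s)) ->
  (forall s, 0 <= s <= u -> is_derive s 1 g1 (g2 s)) ->
  (forall s, 0 <= s <= u -> `|g2 s| <= M) ->
  `|g u - g 0 - u * g1 0| <= M * u ^+ 2.
Proof.
move=> u0 M0 d1 d2 hM.
have cont (h dh : R -> R) v : v <= u -> (forall s, 0 <= s <= u -> is_derive s 1 h (dh s)) ->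
    {within `[0, v], continuous h}.
  move=> vu hd; apply: derivable_within_continuous => s /[!in_itv]/= /andP[s0 sv].
  by have [] := hd s _; rewrite ?s0 ?(le_trans sv).
have mvt (h dh : R -> R) v : 0 <= v <= u -> (forall s, 0 <= s <= u -> is_derive s 1 h (dh s)) ->
    exists2 c, 0 <= c <= v & h v - h 0 = dh c * v.
  move=> /andP[v0 vu] hd.
  have hd' s : s \in `]0, v[ -> is_derive s 1 h (dh s).
    by move=> /[!in_itv]/= /andP[s0 sv]; apply: hd; rewrite (ltW s0)/= (le_trans (ltW sv)).
  have [c /[!in_itv]/= c0 hE] := MVT_segment v0 hd' (cont _ _ _ vu hd).
  by exists c => //; rewrite hE subr0.
have [c /andP[c0 cu] gE] := mvt _ _ u (introT andP (conj u0 (lexx u))) d1.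
rewrite gE (mulrC u) -mulrBl normrM (ger0_norm u0) expr2 mulrA ler_wpM2r//.
have [|e /andP[e0 ec] ->] := mvt _ _ c _ d2; first by rewrite c0.
rewrite normrM (ger0_norm c0) ler_pM// hM// e0 (le_trans ec)//.
Qed.

(** The linear term in [u] is half the second derivative of [Phi]: this is the heat equation. It is
    what cancels the second order term of [Phi_taylor] in the Lindeberg step. *)
Lemma Phi_time_taylor z u : 0 <= u <= 1 ->
  `|Phi (z / Num.sqrt (1 + u)) - Phi z - u / 2 * (- z * phi z)| <= 64 * cphi * u ^+ 2 / (1 + z ^+ 2) ^+ 2.
Proof.
move=> /andP[u0 u1].
pose q s : R := (Num.sqrt (1 + s))^-1.
have q2 s : 0 <= s -> q s ^+ 2 = (1 + s)^-1.
  by move=> s0; rewrite /q exprVn sqr_sqrtr// addr_ge0.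
have q0 s : 0 <= s -> 0 < q s by move=> s0; rewrite invr_gt0 sqrtr_gt0 ltr_pwDl.
have q1 s : 0 <= s -> q s <= 1.
  move=> s0; rewrite invf_le1 ?sqrtr_gt0 ?ltr_pwDl// -[leLHS]sqrtr1 ler_sqrt ?addr_ge0//.
  by rewrite lerDl.
have dq s : 0 <= s <= u -> is_derive s 1 q (- q s ^+ 3 / 2).
  move=> /andP[s0 su].
  have d1 : is_derive s (1 : R) (fun s : R => 1 + s) (1 : R).
    apply: is_derive_eq.
    by rewrite add0r mulr1.
  have p : 0 < 1 + s by rewrite ltr_pwDl.
  have d2 := is_derive1_sqrt p.
  have d3 : is_derive s 1 (fun s : R => Num.sqrt (1 + s)) ((2 * Num.sqrt (1 + s))^-1).
    by apply: is_derive_eq (is_derive1_comp d2 d1) _; rewrite mulr1.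
  apply: is_derive_eq (is_deriveV _ d3) _; first by rewrite gt_eqF// sqrtr_gt0.
  by rewrite /GRing.scale/= /q; field; rewrite gt_eqF// sqrtr_gt0.
have dg s : 0 <= s <= u -> is_derive s 1 (fun s => Phi (z * q s)) (phi (z * q s) * (z * (- q s ^+ 3 / 2))).
  move=> su; have d0 := dq _ su.
  have d1 : is_derive s 1 (fun s => z * q s) (z * (- q s ^+ 3 / 2)).
    by apply: is_derive_eq; rewrite /GRing.scale/=; ring.
  exact: (is_derive1_comp (is_derive_Phi _) d1).
pose g2 s := phi (z * q s) * z * q s ^+ 5 * (3 / 4 - (z * q s) ^+ 2 / 4).
have dg1 s : 0 <= s <= u -> is_derive s 1 (fun s => phi (z * q s) * (z * (- q s ^+ 3 / 2))) (g2 s).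
  move=> su; have d0 := dq _ su.
  have d1 : is_derive s 1 (fun s => z * q s) (z * (- q s ^+ 3 / 2)).
    by apply: is_derive_eq; rewrite /GRing.scale/=; ring.
  have d2 := is_derive1_comp (is_derive_phi _) d1.
  have d3 : is_derive s 1 (fun s => z * (- q s ^+ 3 / 2)) (z * (3 / 4 * q s ^+ 5)).
    by apply: is_derive_eq; rewrite /GRing.scale/=; field.
  by apply: is_derive_eq (is_deriveM d2 d3) _; rewrite /GRing.scale/= /g2; field.
have c1 := cphi_ge1; have c0 : 0 <= cphi by lra.
have M0 : 0 <= 64 * cphi / (1 + z ^+ 2) ^+ 2.
  by apply: divr_ge0; [apply: mulr_ge0|exact: sqr_ge0].
have := taylor2 u0 M0 dg dg1.
rewrite /q addr0 sqrtr1 invr1 mulr1 expr1n.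
rewrite (_ : u * (phi z * (z * (- 1 / 2))) = u / 2 * (- z * phi z)); last by field.
rewrite (_ : 64 * cphi / _ * _ = 64 * cphi * u ^+ 2 / (1 + z ^+ 2) ^+ 2); last by ring.
apply => s /andP[s0 su].
rewrite -/(q s) /g2; set y := z * q s.
have qs0 := q0 _ s0; have qs1 := q1 _ s0.
have q12 : 1 / 2 <= q s ^+ 2.
  rewrite q2// div1r lef_pV2 ?posrE//; lra.
have hy : 1 + z ^+ 2 <= 2 * (1 + y ^+ 2).
  by rewrite /y exprMn; have := sqr_ge0 z; nra.
have q51 : `|q s ^+ 4| <= 1 by rewrite normrX exprn_ile1// ger0_norm// ltW.
rewrite (_ : phi y * z * q s ^+ 5 * (3 / 4 - y ^+ 2 / 4) = q s ^+ 4 * (y * (3 / 4 - y ^+ 2 / 4)) * phi y); last by rewrite /y; ring.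
rewrite normrM (ger0_norm (phi_ge0 _)) normrM.
apply: (@le_trans _ _ ((1 + y ^+ 2) ^+ 2 * phi y)).
  rewrite ler_wpM2r ?phi_ge0//; apply: le_trans (ler_piMl _ q51) _ => //.
  rewrite normrM.
  have h1 : `|y| <= 1 + y ^+ 2.
    by rewrite ler_norml; have := sqr_ge0 (y - 1); have := sqr_ge0 (y + 1); nra.
  rewrite [leRHS]expr2 ler_pM// ler_norml; have := sqr_ge0 y; lra.
apply: le_trans (phi_decayn _ _) _ => //.
rewrite (_ : 64 * cphi / _ = cphi * (64 / (1 + z ^+ 2) ^+ 2)); last by ring.
rewrite ler_wpM2l// ler_pdivlMr ?exprn_gt0 ?sqr1_gt0// mulrC ler_pdivrMr ?exprn_gt0 ?sqr1_gt0//.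
apply: le_trans (lerXn2r 2 _ _ hy) _; rewrite ?nnegrE ?mulr_ge0 ?(ltW (sqr1_gt0 _))//.
rewrite exprMn ler_wpM2r ?exprn_ge0 ?(ltW (sqr1_gt0 _))//; lra.
Qed.

End gauss.

(** * Kernels of the heat equation and their dyadic decomposition *)

Section kernels.
Context {R : realType}.
Implicit Types x y z t w u s v eta rho eps lam q r A : R.

Definition isq v : R := v `^ (- 2^-1).

Lemma isq_gt0 v : 0 < v -> 0 < isq v. Proof. exact: powR_gt0. Qed.

Lemma isq_ge0 v : 0 <= isq v. Proof. exact: powR_ge0. Qed.

Lemma isqE v : 0 <= v -> isq v = (Num.sqrt v)^-1.
Proof. by move=> v0; rewrite /isq powRN powR12_sqrt. Qed.

Lemma isq2 v : 0 < v -> isq v ^+ 2 = v^-1.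
Proof. by move=> v0; rewrite isqE ?ltW// exprVn sqr_sqrtr ?ltW. Qed.

(** Parabolic scaling, which reduces the bounds in [(y, v)] to those in [z = y / sqrt v]. *)
Lemma kernel_scale q y v : 0 < v ->
  (v + y ^+ 2) `^ (- q) = v `^ (- q) * (1 + (y * isq v) ^+ 2) `^ (- q).
Proof.
move=> v0; rewrite -powRM ?ltW// ?(sqr1_gt0 _)//; congr (_ `^ _).
by rewrite exprMn isq2//; field; rewrite gt_eqF.
Qed.

Lemma powRX2 x q : 0 <= x -> x `^ (2 * q) = (x ^+ 2) `^ q.
Proof. by move=> x0; rewrite powRrM powR_mulrn. Qed.

Lemma isq_powR v q : 0 <= v -> isq v `^ (2 * q) = v `^ (- q).
Proof. by move=> v0; rewrite /isq -powRrM; congr (_ `^ _); field. Qed.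

(** The first two space derivatives of [u (y, v) = Phi (y / sqrt v)], a solution of
    [u_v = u_yy / 2]. *)
Definition u_y y v := isq v * phi (y * isq v).
Definition u_yy y v := isq v ^+ 2 * (- (y * isq v) * phi (y * isq v)).

Lemma lindeberg_space rho y eta v : 0 <= rho <= 1 -> 0 < v ->
  `|Phi ((y + eta) * isq v) - Phi (y * isq v) - eta * u_y y v - eta ^+ 2 / 2 * u_yy y v|
   <= 300 * cphi * (`|eta| `^ (2 + rho) * (v + y ^+ 2) `^ (- (1 + rho / 2))).
Proof.
move=> r01 v0; have := Phi_taylor (y * isq v) (eta * isq v) r01.
rewrite -mulrDl normrM (ger0_norm (isq_ge0 v)) powRM ?isq_ge0//.
rewrite (_ : 2 + rho = 2 * (1 + rho / 2)); last by field.
have v0' := ltW v0.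
rewrite (isq_powR _ v0') (kernel_scale _ _ v0) (powRN (1 + _)) => h.
apply: le_trans (le_trans _ h) _; last by rewrite !mulrA.
by rewrite le_eqVlt; apply/orP; left; apply/eqP; congr (`|_|); rewrite /u_y /u_yy; field.
Qed.

Lemma lindeberg_time rho eps y s v : 0 <= rho <= 1 -> 0 <= eps -> 0 < v -> 0 <= s <= v -> s <= eps ^+ 2 ->
  `|Phi (y * isq (v + s)) - Phi (y * isq v) - s / 2 * u_yy y v|
   <= 64 * cphi * (s * eps `^ rho * (v + y ^+ 2) `^ (- (1 + rho / 2))).
Proof.
move=> /andP[r0 r1] e0 v0 /andP[s0 sv] se.
have sv1 : 0 <= s / v <= 1 by rewrite ler_pdivrMr// mul1r sv divr_ge0// ltW.
have := Phi_time_taylor (y * isq v) sv1.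
have v0' := ltW v0.
have -> : y * isq v / Num.sqrt (1 + s / v) = y * isq (v + s).
  rewrite !isqE ?addr_ge0// -mulrA -invfM -sqrtrM//.
  by congr (_ * (Num.sqrt _)^-1); field; rewrite gt_eqF.
have -> : s / v / 2 * (- (y * isq v) * phi (y * isq v)) = s / 2 * u_yy y v.
  by rewrite /u_yy isq2//; ring.
move/le_trans; apply.
rewrite [(y * _) ^+ 2]exprMn isq2// -mulrA ler_wpM2l ?mulr_ge0 ?(le_trans _ cphi_ge1)//.
set B := v + y ^+ 2.
have B0 : 0 < B by rewrite ltr_pwDl ?sqr_ge0.
have -> : (s / v) ^+ 2 / (1 + y ^+ 2 / v) ^+ 2 = s ^+ 2 / B ^+ 2.
  by rewrite /B; field; rewrite !gt_eqF.
(* Interpolation: the middle factor is at most [eps^rho], because [s] is bounded both by [eps^2]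
   (used with the power [rho / 2]) and by [B] (used with the power [1 - rho / 2]). *)
have -> : s ^+ 2 / B ^+ 2 = s * (s / B `^ (1 - rho / 2)) * B `^ (- (1 + rho / 2)).
  rewrite powRN -mulrA -[X in _ = s * X]mulrA -invfM -powRD; last first.
    by rewrite (gt_eqF B0) implybT.
  rewrite (_ : 1 - rho / 2 + (1 + rho / 2) = 2%:R); last by field.
  by rewrite powR_mulrn ?ltW//; ring.
rewrite ler_wpM2r ?powR_ge0// ler_wpM2l// ler_pdivrMr ?powR_gt0//.
have [->|sn0] := eqVneq s 0; first by rewrite mulr_ge0 ?powR_ge0.
have -> : s = s `^ (rho / 2) * s `^ (1 - rho / 2).
  by rewrite -powRD ?sn0 ?implybT// addrC subrK powRr1.
have -> : eps `^ rho = (eps ^+ 2) `^ (rho / 2).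
  by rewrite -powRX2//; congr (_ `^ _); field.
rewrite ler_pM ?powR_ge0// ge0_ler_powR ?nnegrE ?divr_ge0 ?sqr_ge0//.
- by rewrite subr_ge0; lra.
- exact: ltW.
- by rewrite (le_trans sv)// lerDl sqr_ge0.
Qed.

Lemma abs_u_y y v : `|u_y y v| <= isq v.
Proof.
rewrite normrM !ger0_norm ?isq_ge0 ?phi_ge0//.
by rewrite ler_piMr ?isq_ge0// phi_le1.
Qed.

Lemma abs_zphi z : `|- z * phi z| <= cphi / (1 + z ^+ 2) ^+ 3.
Proof.
apply: le_trans (phi_decayn z (isT : 1 <= 4)%N).
rewrite normrM normrN (ger0_norm (phi_ge0 _)) ler_wpM2r ?phi_ge0//.
by rewrite expr1 ler_norml; have := sqr_ge0 (z - 1); have := sqr_ge0 (z + 1); nra.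
Qed.

Lemma abs_u_yy_le y v : 0 < v -> `|u_yy y v| <= cphi * v^-1.
Proof.
move=> v0; have vi : 0 <= v^-1 by rewrite invr_ge0 ltW.
rewrite normrM isq2// (ger0_norm vi) mulrC ler_wpM2r//.
apply: le_trans (abs_zphi _) _; rewrite ler_pdivrMr ?exprn_gt0 ?sqr1_gt0//.
by rewrite ler_peMr ?(le_trans _ cphi_ge1)// exprn_ege1// sqr1_ge1.
Qed.

(** The error in the conditional variance carries the factor [lam^rho]. If [lam <= 1 / sqrt v], this
    factor is absorbed by the main kernel; otherwise [1 / v <= lam / sqrt v], which is the weight of
    the drift error. *)
Lemma abs_u_yy rho lam y v : 0 <= rho <= 1 -> 0 <= lam -> 0 < v ->
  lam `^ rho * `|u_yy y v| <= cphi * ((v + y ^+ 2) `^ (- (1 + rho / 2)) + lam `^ (1 + rho) * isq v).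
Proof.
move=> /andP[r0 r1] l0 v0; have c0 : 0 <= cphi :> R by rewrite (le_trans _ cphi_ge1).
set p := 1 + rho / 2; set z := y * isq v.
pose q := (1 + z ^+ 2) `^ (- p).
have q0 : 0 <= q by exact: powR_ge0.
have q1 : q <= 1 by rewrite /q powRN invf_le1 ?powR_gt0 ?sqr1_gt0// -[leLHS](powRr0 (1 + z ^+ 2)) ler_powR ?sqr1_ge1//; rewrite /p; lra.
have u2 : `|u_yy y v| <= cphi * (v^-1 * q).
  have vi : 0 <= v^-1 by rewrite invr_ge0 ltW.
  rewrite normrM isq2// (ger0_norm vi) mulrCA ler_wpM2l//.
  apply: le_trans (abs_zphi _) _; rewrite ler_wpM2l//.
  apply: (@le_trans _ _ ((1 + z ^+ 2) ^- 2)).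
    by rewrite lef_pV2 ?posrE ?exprn_gt0 ?sqr1_gt0// ler_weXn2l ?sqr1_ge1.
  by rewrite /q powRN powR_kernel_le// /p; lra.
apply: le_trans (ler_wpM2l (powR_ge0 _ _) u2) _.
rewrite mulrCA ler_wpM2l// kernel_scale// -/z -/q mulrA.
have key : lam `^ rho * v^-1 <= v `^ (- p) + lam `^ (1 + rho) * isq v.
  have [h|h] := leP lam (isq v).
    apply: ler_wpDr; first by rewrite mulr_ge0 ?powR_ge0.
    apply: (@le_trans _ _ (isq v `^ rho * v^-1)).
      by rewrite ler_wpM2r ?invr_ge0 ?(ltW v0)// ge0_ler_powR ?nnegrE ?powR_ge0.
    rewrite (_ : rho = 2 * (rho / 2)); last by field.
    have v0' := ltW v0.
    rewrite (isq_powR _ v0') -(powR_inv1 v0') -powRD ?(gt_eqF v0) ?implybT//.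
    by rewrite (_ : - (rho / 2) + -1 = - p)// /p; field.
  apply: ler_wpDl; first by rewrite powR_ge0.
  have lp : 0 < lam by apply: le_lt_trans h; exact: isq_ge0.
  rewrite -isq2// powRD ?(gt_eqF lp) ?implybT// powRr1// (mulrC lam) -mulrA.
  by rewrite ler_wpM2l ?powR_ge0// expr2 ler_wpM2r ?isq_ge0// ltW.
apply: le_trans (ler_wpM2r q0 key) _; rewrite mulrDl lerD2l.
by rewrite ler_piMr// mulr_ge0 ?powR_ge0.
Qed.

(** Convexity. After division by [A^(-q)] it is [1 + u <= exp u], used at [u = - q ln (x / A)] and
    then at [u = ln (x / A)]. *)
Lemma powR_tangent q x A : 0 <= q -> 0 < A -> 0 < x ->
  A `^ (- q) - q * A `^ (- (q + 1)) * (x - A) <= x `^ (- q).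
Proof.
move=> q0 A0 x0.
have -> : A `^ (- (q + 1)) = A `^ (- q) / A.
  by rewrite opprD powRD ?(gt_eqF A0) ?implybT// powR_inv1// ltW.
have -> : x `^ (- q) = A `^ (- q) * (x / A) `^ (- q).
  by rewrite -powRM ?divr_ge0 ?ltW//; congr (_ `^ _); field; rewrite gt_eqF.
rewrite (_ : _ - _ = A `^ (- q) * (1 - q * (x / A - 1))); last by field; rewrite gt_eqF.
rewrite ler_wpM2l ?powR_ge0//.
have xA : 0 < x / A by rewrite divr_gt0.
rewrite /powR gt_eqF//; apply: le_trans (expR_ge1Dx _).
rewrite mulNr lerD2l lerN2 ler_wpM2l//.
have := expR_ge1Dx (ln (x / A)); rewrite lnK ?posrE//; lra.
Qed.

(** The induction doubles [r]. If [|y| <= 2 r] the first layer is already enough; otherwise the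
    maximum does not change when [r] becomes [2 r]. *)
Lemma dyadic_le q r y (J : nat) : 0 <= q -> 0 < r ->
  Num.max r `|y| `^ (- q) <=
  \sum_(0 <= j < J) (2 ^+ j * r) `^ (- q) * (`|y| <= 2 ^+ j.+1 * r)%R%:R + (2 ^+ J * r) `^ (- q).
Proof.
move=> q0; have dec a b : 0 < a -> a <= b -> b `^ (- q) <= a `^ (- q).
  move=> a0 ab; rewrite !powRN lef_pV2 ?posrE ?powR_gt0 ?(lt_le_trans a0)//.
  by apply: ge0_ler_powR => //; rewrite nnegrE ltW// (lt_le_trans a0).
elim: J r => [|J IH] r r0.
  by rewrite big_nil add0r expr0 mul1r dec// le_max lexx.
rewrite big_nat_recl//= expr0 mul1r -addrA.
have r2 : 0 < 2 * r by rewrite mulr_gt0.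
have e1 k : 2 ^+ k.+1 * r = 2 ^+ k * (2 * r) by rewrite exprSr mulrA.
have {IH} := IH _ r2 => IH; rewrite !e1.
have -> : \sum_(0 <= i < J) (2 ^+ i.+1 * r) `^ (- q) * (`|y| <= 2 ^+ i.+2 * r)%R%:R =
  \sum_(0 <= j < J) (2 ^+ j * (2 * r)) `^ (- q) * (`|y| <= 2 ^+ j.+1 * (2 * r))%R%:R.
  by apply: eq_bigr => i _; rewrite !e1.
rewrite expr0 mul1r; case: (leP `|y| (2 * r)) => h.
  rewrite mulr1; apply: ler_wpDr; last by rewrite dec// le_max lexx.
  by rewrite addr_ge0 ?powR_ge0// sumr_ge0// => i _; rewrite mulr_ge0 ?powR_ge0.
rewrite mulr0 add0r; apply: le_trans IH.
have rh : r < `|y| by apply: lt_trans h; rewrite ltr_pMl// ltr1n.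
by rewrite (max_idPr (ltW rh)) (max_idPr (ltW h)).
Qed.

Lemma Phi_scale t u : 0 <= u -> `|Phi (t * isq (1 + u)) - Phi t| <= 100 * cphi * u.
Proof.
move=> u0; have c1 : 1 <= cphi :> R := cphi_ge1.
have [u1|u1] := leP u 1; last first.
  by apply: le_trans (normr_PhiB_le1 _ _) _; nra.
have u01 : 0 <= u <= 1 by rewrite u0.
have := Phi_time_taylor t u01; rewrite isqE ?addr_ge0//.
have := abs_zphi t; set A := - t * phi t; move=> hA h.
have E : forall k, (1 + t ^+ 2) ^- k <= 1.
  by move=> k; rewrite invf_le1 ?exprn_gt0 ?sqr1_gt0// exprn_ege1// sqr1_ge1.
have hA' : `|A| <= cphi by apply: le_trans hA _; rewrite ler_piMr ?E; lra.
have h2 : 64 * cphi * u ^+ 2 / (1 + t ^+ 2) ^+ 2 <= 64 * cphi * u.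
  have c64 : 0 <= 64 * cphi :> R by lra.
  rewrite -mulrA ler_wpM2l//; apply: (@le_trans _ _ (u ^+ 2)).
    by rewrite ler_piMr ?E ?sqr_ge0.
  by rewrite expr2 ler_piMl.
rewrite (_ : _ - _ = (Phi (t / Num.sqrt (1 + u)) - Phi t - u / 2 * A) + u / 2 * A); last by ring.
apply: le_trans (ler_normD _ _) _.
rewrite (normrM _ A) (ger0_norm (_ : 0 <= u / 2)); last by rewrite divr_ge0.
have : u / 2 * `|A| <= u / 2 * cphi by rewrite ler_wpM2l// divr_ge0.
by nra.
Qed.

End kernels.

(** * Densities and conditional expectations *)

Import HBSimple HBNNSimple.

Section density.
Local Open Scope ereal_scope.
Context {d} {T : measurableType d} {R : realType}.
Variables (mu : {measure set T -> \bar R}) (f : T -> \bar R).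
Hypotheses (mf : measurable_fun setT f) (f0 : forall x, 0 <= f x).

(** The two proofs are arguments so that the measure structure can be attached to the resulting
    term. *)
Definition density (_ : measurable_fun setT f) (_ : forall x, 0 <= f x) (A : set T) :=
  \int[mu]_(x in A) f x.

Let density0 : density mf f0 set0 = 0.
Proof. by rewrite /density integral_set0. Qed.

Let density_ge0 A : 0 <= density mf f0 A.
Proof. exact: integral_ge0. Qed.

Let density_semi_sigma_additive : semi_sigma_additive (density mf f0).
Proof. exact: semi_sigma_additive_nng_induced. Qed.

HB.instance Definition _ := isMeasure.Build _ _ _ (density mf f0)
  density0 density_ge0 density_semi_sigma_additive.

End density.

Section pullout.
Local Open Scope ereal_scope.
Context {d d'} {T : measurableType d} {T' : measurableType d'} {R : realType}.
Variables (mu : {measure set T -> \bar R}) (nu : {measure set T' -> \bar R}).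
Variables (pr : T -> T') (f : T -> \bar R).
Hypotheses (mpr : measurable_fun setT pr) (mf : measurable_fun setT f)
  (f0 : forall x, 0 <= f x)
  (nuE : forall A, measurable A -> nu A = \int[mu]_(x in pr @^-1` A) f x).

Let nnsfun_integral_density (h : {nnsfun T' >-> R}) :
  \int[nu]_y (h y)%:E = \int[mu]_x ((h (pr x))%:E * f x).
Proof.
have mh r : measurable (pr @^-1` (h @^-1` [set r])).
  by rewrite -[X in measurable X]setTI; exact: mpr.
under [RHS]eq_integral => x _.
  rewrite fimfunE -fsumEFin// ge0_mule_fsuml; last first.
    by move=> r; exact: nnfun_muleindic_ge0.
  over.
rewrite ge0_integral_fsum//; last 2 first.
- move=> r; apply: emeasurable_funM => //; apply/measurable_EFinP.
  apply: measurable_funM => //.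
  apply: measurableT_comp => //.
- by move=> r x _; rewrite mule_ge0// nnfun_muleindic_ge0.
rewrite integralT_nnsfun sintegralE; apply: eq_fsbigr => r /[!inE] -[y _ yr].
have r0 : (0 <= r)%R by rewrite -yr.
rewrite nuE// integral_mkcond -ge0_integralZl//.
- apply: eq_integral => x _; rewrite EFinM -muleA patchE indicE.
  rewrite /preimage/= -[pr x \in _]/(x \in pr @^-1` (h @^-1` [set r])).
  by case: ifPn => _; rewrite ?mul1e ?mul0e.
- by apply/(measurable_restrictT _ _).1 => //; exact: measurable_funTS.
- by move=> x _; rewrite patchE; case: ifPn.
Qed.

Let cvg_mul_nnsfun (g : T' -> \bar R) (mg : measurable_fun setT g) x :
  (forall y, 0 <= g y) ->
  (nnsfun_approx measurableT mg n (pr x))%:E * f x @[n --> \oo] --> g (pr x) * f x.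
Proof.
move=> g0; have gcvg : (nnsfun_approx measurableT mg n (pr x))%:E @[n --> \oo] --> g (pr x).
  by apply: cvg_nnsfun_approx.
case E : (f x) => [r||]; first by apply: cvgeZr.
(* Where [f] is infinite the products take only the values 0 and [+oo]: they vanish if [g] does, and
   otherwise are infinite as soon as one approximation of [g] is positive. *)
- have [gx0|] := eqVneq (g (pr x)) 0.
    rewrite gx0 mul0e; apply: cvg_near_cst; apply: nearW => n.
    have : (nnsfun_approx measurableT mg n (pr x))%:E <= g (pr x) by rewrite nnsfun_approxE le_approx.
    rewrite gx0 lee_fin => h; have : (nnsfun_approx measurableT mg n (pr x) = 0)%R.
      by apply/eqP; rewrite eq_le h/=.
    by move=> ->; rewrite mul0e.
  move=> gx; have gx0 : 0 < g (pr x) by rewrite lt0e gx g0.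
  rewrite gt0_muley//; apply: cvg_near_cst.
  have [N gN] : exists N, 0 < (nnsfun_approx measurableT mg N (pr x))%:E.
    apply: contrapT => /forallNP gN; have : g (pr x) <= 0.
      apply: (cvge_le _ gcvg); apply: nearW => n.
      by rewrite leNgt; apply/negP; exact: gN.
    by rewrite leNgt gx0.
  exists N => // n /= Nn; rewrite gt0_muley// (lt_le_trans gN)// lee_fin.
  exact/lefP/nd_nnsfun_approx.
- by have := f0 x; rewrite E.
Qed.

(** Simple functions, then monotone convergence. With [pr] the identity of [T] this is the change of
    measure; with [pr] the identity onto the smaller sigma-field it gives the pull-out property. *)
Lemma ge0_integral_density (g : T' -> \bar R) : measurable_fun setT g ->
  (forall y, 0 <= g y) -> \int[nu]_y g y = \int[mu]_x (g (pr x) * f x).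
Proof.
move=> mg g0; pose g_ := nnsfun_approx measurableT mg.
have gcvg y : (g_ n y)%:E @[n --> \oo] --> g y by apply: cvg_nnsfun_approx.
have gnd y m n : (m <= n)%N -> (g_ m y <= g_ n y)%R.
  by move=> mn; exact/lefP/nd_nnsfun_approx.
transitivity (limn (fun n => \int[nu]_y (g_ n y)%:E)).
  rewrite -monotone_convergence//=.
  - by apply: eq_integral => y _; apply/esym/cvg_lim.
  - by move=> n; exact/measurable_EFinP.
  - by move=> n x _; rewrite lee_fin.
  - by move=> x _ a b ab; rewrite lee_fin gnd.
rewrite (_ : (fun n => _) = (fun n => \int[mu]_x ((g_ n (pr x))%:E * f x))).
  rewrite -monotone_convergence//=.
  - apply: eq_integral => x _; apply/cvg_lim => //.
    exact: cvg_mul_nnsfun.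
  - move=> n; apply: emeasurable_funM => //; apply/measurable_EFinP.
    exact: measurableT_comp.
  - by move=> n x _; rewrite mule_ge0 ?lee_fin.
  - by move=> x _ a b ab; rewrite lee_wpmul2r// lee_fin gnd.
by apply/funext => n; rewrite nnsfun_integral_density.
Qed.

End pullout.

Section cond.
Local Open Scope ereal_scope.
Context {d} {T : measurableType d} {R : realType}.
Variables (P : {measure set T -> \bar R}) (G : set (set T)).
Hypothesis (sG : sub_sigma_field G).

Lemma G_measurableP d' (U : measurableType d') (f : T -> U) :
  G_measurable G f <-> measurable_fun [set: g_sigma_algebraType G] f.
Proof.
have [sA sM] := sG; split=> [mf _ B mB|mf B mB].
  by rewrite setTI; apply: sub_gen_smallest; exact: mf.
have := mf measurableT B mB; rewrite setTI /measurable/=.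
by rewrite /measurable/= sigma_algebra_id.
Qed.

Lemma measurable_sub_sigma : measurable_fun setT (idfun : T -> g_sigma_algebraType G).
Proof.
have [sA sM] := sG; move=> _ B; rewrite /measurable/= sigma_algebra_id// => GB.
by rewrite setTI preimage_id; exact: sM.
Qed.

Lemma G_measurable_meas d' (U : measurableType d') (f : T -> U) :
  G_measurable G f -> measurable_fun setT f.
Proof. by have [sA sM] := sG; move=> mf _ B mB; rewrite setTI; apply/sM/mf. Qed.

(** The densities [f] and [g] define the same measure on [G], and both sides are the integral of [H]
    with respect to it. *)
Lemma cond_pullout (f g H : T -> \bar R) :
  measurable_fun setT f -> measurable_fun setT g ->
  (forall x, 0 <= f x) -> (forall x, 0 <= g x) ->
  (forall A, G A -> \int[P]_(x in A) f x = \int[P]_(x in A) g x) ->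
  G_measurable G H -> (forall x, 0 <= H x) ->
  \int[P]_x (H x * f x) = \int[P]_x (H x * g x).
Proof.
move=> mf mg f0 g0 fg /G_measurableP mH H0.
pose nu := pushforward (density P mf f0) (idfun : T -> g_sigma_algebraType G).
have [sA _] := sG.
have mid := measurable_sub_sigma.
pose nuM : {measure set _ -> \bar R} := nu.
rewrite -(@ge0_integral_density _ _ _ _ _ P (nuM mid) idfun f)//.
apply: (@ge0_integral_density _ _ _ _ _ P (nuM mid) idfun g) => // A.
rewrite {1}/measurable/= sigma_algebra_id// => GA.
by rewrite -fg.
Qed.

End cond.

Section sub_density.
Local Open Scope ereal_scope.
Context {d} {T : measurableType d} {R : realType}.
Variables (P : {measure set T -> \bar R}) (G : set (set T)) (f : T -> \bar R).
Hypotheses (sG : sub_sigma_field G) (intf : P.-integrable setT f)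
  (f0 : forall x, 0 <= f x).

Let mf : measurable_fun setT f. Proof. exact: measurable_int intf. Qed.

Definition sub_density (_ : sub_sigma_field G) (_ : P.-integrable setT f) (_ : forall x, 0 <= f x)
  (A : set (g_sigma_algebraType G)) := \int[P]_(x in A) f x.

Let nu := sub_density sG intf f0.

Let mG (A : set (g_sigma_algebraType G)) : measurable A -> measurable (A : set T).
Proof. by have [sA sM] := sG; rewrite {1}/measurable/= sigma_algebra_id//; exact: sM. Qed.

Let nu0 : nu set0 = 0. Proof. exact: integral_set0. Qed.

Let nu_ge0 A : 0 <= nu A. Proof. exact: integral_ge0. Qed.

Let nu_sigma : semi_sigma_additive nu.
Proof.
move=> F mF tF mUF; apply: (semi_sigma_additive_nng_induced mf f0) => //.
- by move=> i; exact: mG.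
- exact: mG.
Qed.

HB.instance Definition _ := isMeasure.Build _ _ _ (sub_density sG intf f0) nu0 nu_ge0 nu_sigma.

Let nu_fin : fin_num_fun nu.
Proof.
move=> A mA; rewrite /nu /sub_density; apply: integrable_fin_num; first exact: mG.
by apply: integrableS intf => //; exact: mG.
Qed.

HB.instance Definition _ := Measure_isFinite.Build _ _ _ (sub_density sG intf f0) nu_fin.

End sub_density.

Section condexp.
Local Open Scope ereal_scope.
Context {d} {T : measurableType d} {R : realType}.
Variables (P : probability T R) (G : set (set T)).
Hypothesis (sG : sub_sigma_field G).

Let int1 : P.-integrable setT (fun=> 1).
Proof. exact: finite_measure_integrable_cst. Qed.

Let ge1 (x : T) : 0 <= 1 :> \bar R. Proof. by []. Qed.

(** Radon-Nikodym theorem on the smaller sigma-field, for the restriction of [P] and the measure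
    with density [h]. *)
Lemma condexp_exists (h : T -> R) : P.-integrable setT (EFin \o h) -> (forall x, (0 <= h x)%R) ->
  exists m : T -> R, [/\ G_measurable G m, forall x, (0 <= m x)%R &
    forall A, G A -> \int[P]_(x in A) (m x)%:E = \int[P]_(x in A) (h x)%:E].
Proof.
move=> ih h0; have h0' x : 0 <= (EFin \o h) x by rewrite lee_fin.
have [sA sM] := sG.
pose mu : {finite_measure set _ -> \bar R} := sub_density sG int1 ge1.
pose nu : {finite_measure set _ -> \bar R} := sub_density sG ih h0'.
have muE (A : set (g_sigma_algebraType G)) : measurable A -> mu A = \int[P]_(x in A) 1 by [].
have [|m [m0 mfin im mE]] := @radon_nikodym_sigma_finite _ _ _ mu nu.
  apply/null_content_dominatesP => A mA.
  have mA' : measurable (A : set T) by move: mA; rewrite {1}/measurable/= sigma_algebra_id//; exact: sM.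
  move=> muA0; have PA0 : P A = 0.
    by rewrite -[LHS]mul1e -(@integral_cst _ _ _ P A mA' 1); exact: muA0.
  apply: null_set_integral => //; exact: measurable_int (integrableS measurableT mA' (@subsetT _ _) ih).
have mm : measurable_fun setT m by exact: measurable_int im.
have mid := measurable_sub_sigma sG.
(* The Radon-Nikodym derivative is finite everywhere, so [fine] loses nothing. *)
exists (fine \o m); split.
- apply/(G_measurableP sG) => //=.
  by apply: measurableT_comp.
- by move=> x; rewrite fine_ge0.
- move=> A GA; have mA : measurable (A : set (g_sigma_algebraType G)).
    by rewrite /measurable/= sigma_algebra_id.
  transitivity (\int[mu]_(x in A) m x); last by rewrite -(mE A mA).
  rewrite integral_mkcond [RHS]integral_mkcond.
  rewrite (@ge0_integral_density _ _ _ _ _ P mu idfun (fun=> 1))//.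
  + apply: eq_integral => x _; rewrite mule1 !patchE; case: ifPn => // _.
    by rewrite fineK.
  + by apply/(measurable_restrictT _ _).1 => //; exact: measurable_funTS.
  + by move=> x; rewrite patchE; case: ifPn.
Qed.

End condexp.

Section density_probability.
Local Open Scope ereal_scope.
Context {d} {T : measurableType d} {R : realType}.
Variables (P : {measure set T -> \bar R}) (f : T -> \bar R).
Hypotheses (mf : measurable_fun setT f) (f0 : forall x, 0 <= f x)
  (f1 : \int[P]_x f x = 1).

Definition density_prob (_ : \int[P]_x f x = 1) := density P mf f0.

HB.instance Definition _ := Measure.on (density_prob f1).

Let density_setT : density_prob f1 setT = 1. Proof. exact: f1. Qed.

HB.instance Definition _ := @Measure_isProbability.Build _ _ _ (density_prob f1) density_setT.

End density_probability.

(** * Mills ratio *)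

Section mills.
Context {R : realType}.
Implicit Types x y z t w u s v lam b r : R.

Lemma expR_half_le2 : expR (2^-1) <= 2 :> R.
Proof.
rewrite -[leLHS]invrK -expRN -[leRHS]invrK lef_pV2 ?posrE ?invr_gt0 ?expR_gt0//.
by have := expR_ge1Dx (- 2^-1 : R); lra.
Qed.

Lemma phi_shift x h : phi (x + h) = phi x * expR (- (x * h) - h ^+ 2 / 2).
Proof. by rewrite phiE (phiE x) -mulrA -expRD; congr (_ * expR _); field. Qed.

Lemma phi_le_homo x y : 0 <= x -> x <= y -> phi y <= phi x.
Proof.
move=> x0 xy; rewrite phiE (phiE x) ler_wpM2l ?(ltW phi0_gt0)// ler_expR.
by rewrite ler_pM2r ?invr_gt0// lerN2 lerXn2r ?nnegrE// (le_trans x0).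
Qed.

Lemma Phi_incr x y : 0 <= x -> x <= y ->
  phi y * (y - x) <= Phi y - Phi x <= phi x * (y - x).
Proof.
move=> x0 xy; have [c [_ [-> /(_ xy) /andP[xc cy]]]] := MVT_everywhere x y is_derive_Phi.
by rewrite !ler_wpM2r ?subr_ge0// phi_le_homo// (le_trans x0).
Qed.

(** On a window of length [1 / (1 + x)] after [x] the density drops by at most the factor
    [exp (- 3 / 2) >= 1 / 8]. *)
Lemma mills_lower x : 0 <= x -> phi x / (8 * (1 + x)) <= 1 - Phi x.
Proof.
move=> x0; have x1 : 0 < 1 + x by rewrite ltr_pwDl.
pose h := (1 + x)^-1; have h0 : 0 < h by rewrite invr_gt0.
have [|+ _] := andP (Phi_incr (y := x + h) x0 _); first by rewrite lerDl ltW.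
have P1 := @Phi_le1 R (x + h).
rewrite (_ : x + h - x = h); last by ring.
rewrite phi_shift => H; apply: (@le_trans _ _ (Phi (x + h) - Phi x)); last by rewrite lerD2r.
apply: le_trans H; rewrite invfM mulrA ler_wpM2r ?(ltW h0)//.
rewrite ler_wpM2l ?phi_ge0//.
have e8 : expR (3 / 2) <= 8 :> R.
  rewrite expRM_natl; apply: le_trans (lerXn2r 3 _ _ expR_half_le2) _; rewrite ?nnegrE ?expR_ge0//.
  by rewrite -natrX ler_nat.
apply: (@le_trans _ _ (expR (- (3 / 2)))); first by rewrite expRN lef_pV2 ?posrE ?expR_gt0.
have h1 : h <= 1 by rewrite invf_le1// lerDl.
have xh : x * h <= 1 by rewrite ler_pdivrMr// mul1r lerDr.
by rewrite ler_expR; nra.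
Qed.

Lemma Phi_lt1 x : 0 <= x -> 0 < 1 - Phi x.
Proof.
move=> x0; apply: lt_le_trans (mills_lower x0).
by rewrite divr_gt0 ?phi_gt0// mulr_gt0// ltr_pwDl.
Qed.

Lemma mills_upper x : 0 <= x -> 1 - Phi x <= 4 / phi 0 * (phi x / (1 + x)).
Proof.
move=> x0; have x1 : 0 < 1 + x by rewrite ltr_pwDl.
have p0 := @phi0_gt0 R; have p1 := @phi0_le1 R.
have [xl|xl] := leP x 1.
  have h : phi 0 * (1 - Phi x) <= 2 * phi x.
    have : 1 - Phi x <= 1 by rewrite gerBl ?Phi_ge0.
    have : phi 0 <= 2 * phi x.
      rewrite (phiE x) mulrCA ler_peMr ?(ltW p0)//.
      rewrite mulNr expRN ler_pdivlMr ?expR_gt0// mul1r; apply: le_trans expR_half_le2.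
      by rewrite ler_expR; nra.
    have := Phi_lt1 x0; nra.
  rewrite mulrA ler_pdivlMr// mulrAC ler_pdivlMr//.
  have := Phi_lt1 x0; have := phi_gt0 x; nra.
(* Twice the classical lower bound [y phi y / (1 + y^2)] of the tail; beyond 1 it decreases at least
   as fast as the tail, since [phi + g'] has the sign of [1 - y^2]. *)
pose g y := phi y * (2 * y) * (1 + y ^+ 2)^-1.
have dg y : is_derive y 1 g (phi y * (- (2 * y ^+ 2) / (1 + y ^+ 2) + 2 * (1 - y ^+ 2) / (1 + y ^+ 2) ^+ 2)).
  have dP := is_derive_phi y.
  have dV : is_derive y 1 (fun y => (1 + y ^+ 2)^-1) (- (1 + y ^+ 2) ^- 2 *: (y *+ 2)).
    apply: is_deriveV; first by rewrite gt_eqF// sqr1_gt0.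
    by apply: is_derive_eq; rewrite /GRing.scale/=; ring.
  rewrite /g; apply: is_derive_eq; rewrite /GRing.scale/=.
  by field; rewrite gt_eqF// sqr1_gt0.
have := Phi_tail_by dg (x := x); move=> H.
apply: le_trans (H _ _) _.
- move=> y xy; have y1 : 1 < y := lt_le_trans xl xy.
  rewrite -{1}(mulr1 (phi y)) -mulrDr mulr_ge0_le0 ?phi_ge0//.
  have s0 := sqr1_gt0 y.
  have -> : 1 + (- (2 * y ^+ 2) / (1 + y ^+ 2) + 2 * (1 - y ^+ 2) / (1 + y ^+ 2) ^+ 2)
     = ((1 - y ^+ 2) * (3 + y ^+ 2)) / (1 + y ^+ 2) ^+ 2.
    by field; rewrite gt_eqF.
  rewrite mulr_le0_ge0 ?invr_ge0 ?exprn_ge0 ?(ltW s0)//.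
  have : 1 <= y ^+ 2 by rewrite exprn_ege1// ltW.
  by move=> h; rewrite mulr_le0_ge0//; nra.
- move=> y xy; have y1 : 1 < y := lt_le_trans xl xy.
  by rewrite !mulr_ge0 ?phi_ge0 ?invr_ge0 ?(ltW (sqr1_gt0 _))//; lra.
rewrite /g -mulrA (mulrCA (4 / _)) ler_wpM2l ?phi_ge0//.
apply: (@le_trans _ _ (4 / (1 + x))).
  rewrite ler_pdivlMr// mulrAC ler_pdivrMr ?sqr1_gt0//; nra.
by rewrite ler_wpM2r ?invr_ge0 ?(ltW x1)// ler_pdivlMr//; nra.
Qed.

(** The mass between [lam] and [x] is at most [phi x exp (x (x - lam)) (x - lam)], and [phi x] is at
    most [8 (1 + x)] times the tail at [x]. This is the price of evaluating the normal tail at [x]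
    and not at the tilting parameter. *)
Lemma Phi_ratio lam x : 0 <= lam -> lam <= x ->
  1 - Phi lam <= (1 - Phi x) * expR (9 * (1 + x) * (x - lam)).
Proof.
move=> l0 lx; have x0 := le_trans l0 lx.
have [_ hi] := andP (Phi_incr l0 lx).
have ml := mills_lower x0; have xl0 : 0 <= x - lam by rewrite subr_ge0.
have x1 : 0 < 1 + x by rewrite ltr_pwDl.
have pl : phi lam <= phi x * expR (x * (x - lam)).
  rewrite phiE (phiE x) -mulrA ler_wpM2l ?(ltW phi0_gt0)// -expRD ler_expR; nra.
have px : phi x <= 8 * (1 + x) * (1 - Phi x) by move: ml; rewrite ler_pdivrMr 1?mulrC// mulr_gt0.
have P0 := Phi_lt1 x0.
apply: (@le_trans _ _ ((1 - Phi x) * (1 + 8 * (1 + x) * (x - lam) * expR (x * (x - lam))))).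
  have -> : 1 - Phi lam = (1 - Phi x) + (Phi x - Phi lam) by ring.
  rewrite mulrDr mulr1 lerD2l; apply: le_trans hi _.
  apply: le_trans (ler_wpM2r xl0 pl) _.
  apply: le_trans (ler_wpM2r xl0 (ler_wpM2r (expR_ge0 _) px)) _.
  by rewrite le_eqVlt; apply/orP; left; apply/eqP; ring.
rewrite ler_wpM2l ?(ltW P0)//.
have -> : 9 * (1 + x) * (x - lam) = (8 * (1 + x) * (x - lam) + (x - lam)) + x * (x - lam) by ring.
rewrite expRD; set e := expR (x * _).
have e1 : 1 <= e by rewrite -expR0 ler_expR mulr_ge0.
have := expR_ge1Dx (8 * (1 + x) * (x - lam) + (x - lam)).
set A := 8 * (1 + x) * (x - lam); have A0 : 0 <= A by rewrite !mulr_ge0 ?(ltW x1).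
nra.
Qed.

(** For a standard normal [N] this is the expectation of [exp (- lam N)] on [N > 0] (see
    [normal_tilt_pos]); it is of order [1 / (1 + lam)]. *)
Definition mills lam := expR (lam ^+ 2 / 2) * (1 - Phi lam).

Lemma mills_ge lam : 0 <= lam -> phi 0 / (8 * (1 + lam)) <= mills lam.
Proof.
move=> l0; have := mills_lower l0; rewrite phiE /mills mulNr expRN => h.
have := ler_wpM2l (expR_ge0 (lam ^+ 2 / 2)) h; apply: le_trans.
rewrite le_eqVlt; apply/orP; left; apply/eqP; field.
by rewrite !lt0r_neq0 ?expR_gt0// ltr_pwDl.
Qed.

Lemma mills_le lam : 0 <= lam -> mills lam <= 4 / (1 + lam).
Proof.
move=> l0; have := mills_upper l0; rewrite (phiE lam) mulNr expRN => h.
have := ler_wpM2l (expR_ge0 (lam ^+ 2 / 2)) h; rewrite -/(mills lam) => /le_trans; apply.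
rewrite le_eqVlt; apply/orP; left; apply/eqP; field.
by rewrite !lt0r_neq0 ?expR_gt0 ?phi0_gt0// ltr_pwDl.
Qed.

Definition tilt_pos lam y : R := if 0 < y then expR (- (lam * y)) else 0.

Lemma tilt_pos_ge0 lam y : 0 <= tilt_pos lam y.
Proof. by rewrite /tilt_pos; case: ifP => // _; exact: expR_ge0. Qed.

Lemma tilt_pos_le1 lam y : 0 <= lam -> tilt_pos lam y <= 1.
Proof.
move=> l0; rewrite /tilt_pos; case: ifPn => // y0.
by rewrite -expR0 ler_expR oppr_le0 mulr_ge0// ltW.
Qed.

Lemma measurable_tilt_pos lam : measurable_fun setT (tilt_pos lam).
Proof.
apply: measurable_fun_ifT => //.
  exact: measurable_fun_ltr.
apply: measurableT_comp => //; apply: measurableT_comp => //.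
Qed.

(** Completing the square gives [exp (- lam y) phi y = exp (lam^2 / 2) phi (lam + y)], whose
    primitive is explicit. *)
Lemma normal_tilt_pos lam : 0 <= lam ->
  (\int[normal_prob 0 1]_y (tilt_pos lam y)%:E = (mills lam)%:E)%E.
Proof.
move=> l0.
pose nu : {measure set _ -> \bar R} := normal_prob 0 1.
have mphi : measurable_fun setT (fun x : R => (phi x)%:E).
  by apply/measurable_EFinP; exact: measurable_normal_pdf.
have mW : measurable_fun setT (fun y => (tilt_pos lam y)%:E).
  by apply/measurable_EFinP; exact: measurable_tilt_pos.
rewrite (@ge0_integral_density _ _ _ _ _ lebesgue_measure nu idfun (fun x => (phi x)%:E))//=; last 3 first.
- exact: measurable_id.
- by move=> x; rewrite lee_fin phi_ge0.
- by move=> x; rewrite lee_fin tilt_pos_ge0.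
transitivity (\int[lebesgue_measure]_(y in `]0%R, +oo[) (expR (- (lam * y)) * phi y)%:E)%E.
  rewrite [RHS]integral_mkcond; apply: eq_integral => y _.
  rewrite patchE /tilt_pos -EFinM; case: ifPn => y0.
    by rewrite mem_set//= in_itv/= andbT.
  by rewrite memNset ?mul0r//= in_itv/= andbT; exact/negP.
pose F y := expR (lam ^+ 2 / 2) * Phi (lam + y).
have FE y : expR (- (lam * y)) * phi y = expR (lam ^+ 2 / 2) * phi (lam + y).
  by rewrite phiE (phiE (_ + _)) mulrCA [RHS]mulrCA -!expRD; congr (_ * expR _); field.
have dF y : is_derive y 1 F (expR (- (lam * y)) * phi y).
  have h := is_derive_shiftl lam y is_derive_Phi.
  rewrite FE /F; apply: is_derive_eq; by rewrite /GRing.scale/=; ring.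
have cf : continuous (fun y => expR (- (lam * y)) * phi y).
  move=> y; apply: cvgM; last exact: continuous_normal_pdf (oner_neq0 R) _.
  apply: (cvg_comp _ expR); last exact: continuous_expR.
  by apply: cvgN; apply: cvgM; [exact: cvg_cst|exact: cvg_id].
rewrite integral_itv_obnd_cbnd; last first.
  apply/measurable_EFinP/measurable_funTS; exact: continuous_measurable_fun.
rewrite (@ge0_continuous_FTC2y _ _ F 0 (expR (lam ^+ 2 / 2))).
- by rewrite /F addr0 -EFinB /mills; congr EFin; ring.
- by move=> y _; rewrite mulr_ge0 ?expR_ge0 ?phi_ge0.
- exact: continuous_subspaceT.
- rewrite -[X in _ --> X]mulr1; apply: cvgM; first exact: cvg_cst.
  apply: (cvg_comp _ _ _ (@cvg_Phiy R)).
  exact: cvg_addrl.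
- by move=> y _; case: (dF y).
- have : {for 0, continuous F}.
    by apply: differentiable_continuous; apply/derivable1_diffP; case: (dF 0).
  by move/cvg_at_right_filter; exact.
- by move=> y _; rewrite derive1E; case: (dF y).
Qed.

End mills.

(** * Expectations and Kolmogorov distance *)

Section expect.
Context {d} {T : measurableType d} {R : realType}.
Variable Q : probability T R.
Implicit Types (f g : T -> R) (c M : R).

(** A real number, hence silent about integrability (an infinite integral gives 0); integrability is
    carried separately by [Ig]. *)
Definition Ex f : R := \int[Q]_w f w.
Definition Ig f := Q.-integrable setT (EFin \o f).
Definition Pr (A : set T) : R := fine (Q A).

Lemma Ig_mf f : Ig f -> measurable_fun setT f.
Proof. by move=> /measurable_int /measurable_EFinP. Qed.

Lemma Ig_dom f g : measurable_fun setT f -> (forall w, `|f w| <= g w) -> Ig g -> Ig f.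
Proof.
move=> mf fg ig; apply: le_integrable ig => //; first exact/measurable_EFinP.
by move=> w _ /=; rewrite lee_fin (le_trans (fg w))// ler_norm.
Qed.

Lemma Ig_cst c : Ig (fun=> c).
Proof. exact: finite_measure_integrable_cst. Qed.

Lemma Ig_bdd M f : measurable_fun setT f -> (forall w, `|f w| <= M) -> Ig f.
Proof. by move=> mf fM; apply: Ig_dom mf fM (Ig_cst M). Qed.

Lemma IgD f g : Ig f -> Ig g -> Ig (fun w => f w + g w).
Proof. by move=> hf hg; have := integrableD measurableT hf hg; apply: eq_integrable. Qed.

Lemma IgB f g : Ig f -> Ig g -> Ig (fun w => f w - g w).
Proof. by move=> hf hg; have := integrableB measurableT hf hg; apply: eq_integrable. Qed.

Lemma IgZ c f : Ig f -> Ig (fun w => c * f w).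
Proof.
move=> hf; have := integrableZl measurableT c hf.
by apply: eq_integrable.
Qed.

Lemma Ig_abs f : Ig f -> Ig (fun w => `|f w|).
Proof.
move=> hf; apply: (@Ig_dom _ (fun w => `|f w|)).
- by apply: measurableT_comp => //; exact: Ig_mf.
- by move=> w; rewrite normr_id.
- by have := integrable_abse hf; apply: eq_integrable.
Qed.

Lemma Ig_sum (I : Type) (r : seq I) (F : I -> T -> R) : (forall i, Ig (F i)) ->
  Ig (fun w => \sum_(i <- r) F i w).
Proof.
move=> hF; elim: r => [|i r IH].
  rewrite (_ : (fun _ => _) = (fun=> 0)); first exact: Ig_cst.
  by apply/funext => w; rewrite big_nil.
rewrite (_ : (fun _ => _) = (fun w => F i w + \sum_(j <- r) F j w)); first exact: IgD.
by apply/funext => w; rewrite big_cons.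
Qed.

Lemma Ex_eq f g : (forall w, f w = g w) -> Ex f = Ex g.
Proof. by move=> fg; congr Ex; exact/funext. Qed.

Lemma ExD f g : Ig f -> Ig g -> Ex (fun w => f w + g w) = Ex f + Ex g.
Proof. by move=> hf hg; rewrite /Ex RintegralD. Qed.

Lemma ExB f g : Ig f -> Ig g -> Ex (fun w => f w - g w) = Ex f - Ex g.
Proof. by move=> hf hg; rewrite /Ex RintegralB. Qed.

Lemma ExZ c f : Ig f -> Ex (fun w => c * f w) = c * Ex f.
Proof. by move=> hf; rewrite /Ex RintegralZl. Qed.

Lemma Ex_cst c : Ex (fun=> c) = c.
Proof. by rewrite /Ex Rintegral_cst// -[X in fine X]/(Q setT) probability_setT mulr1. Qed.

Lemma Ex_sum (I : Type) (r : seq I) (F : I -> T -> R) : (forall i, Ig (F i)) ->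
  Ex (fun w => \sum_(i <- r) F i w) = \sum_(i <- r) Ex (F i).
Proof.
move=> hF; elim: r => [|i r IH].
  rewrite big_nil -[RHS](Ex_cst 0); congr Ex.
  by apply/funext => w; rewrite big_nil.
rewrite big_cons -IH -ExD//; last exact: Ig_sum.
by congr Ex; apply/funext => w; rewrite big_cons.
Qed.

Lemma Ex_le f g : Ig f -> Ig g -> (forall w, f w <= g w) -> Ex f <= Ex g.
Proof. by move=> hf hg fg; apply: le_Rintegral => // w _. Qed.

Lemma Ex_ge0 f : (forall w, 0 <= f w) -> 0 <= Ex f.
Proof. by move=> f0; apply: Rintegral_ge0. Qed.

Lemma Ex_abs_le f g : Ig f -> Ig g -> (forall w, `|f w| <= g w) -> `|Ex f| <= Ex g.
Proof.
move=> hf hg fg; apply: le_trans (le_normr_Rintegral _ _ ) _ => //.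
by apply: Ex_le => //; exact: Ig_abs.
Qed.

Lemma Ex_le_cst c f : Ig f -> (forall w, f w <= c) -> Ex f <= c.
Proof. by move=> hf fc; rewrite -(Ex_cst c); apply: Ex_le => //; exact: Ig_cst. Qed.

Lemma Ex_fin f : Ig f -> (Ex f)%:E = (\int[Q]_w (f w)%:E)%E.
Proof. by move=> hf; rewrite /Ex /Rintegral fineK// integrable_fin_num. Qed.

Lemma Ex_bool (b : T -> bool) : measurable [set w | b w] -> Ex (fun w => (b w)%:R) = Pr [set w | b w].
Proof.
move=> mb; rewrite /Ex /Rintegral /Pr -[X in fine (Q X)]setIT -integral_indic//.
congr fine; apply: eq_integral => w _; rewrite indicE; congr (_%:R)%:E.
by case E : (b w); [rewrite mem_set|rewrite memNset//= E].
Qed.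

Lemma Ig_bool (b : T -> bool) : measurable_fun setT b -> Ig (fun w => (b w)%:R).
Proof.
move=> mb; apply: (@Ig_bdd 1) => [|w]; last by case: (b w); rewrite ?normr1 ?normr0.
rewrite (_ : (fun _ => _) = (fun w => if b w then 1 else 0)).
  exact: measurable_fun_ifT.
by apply/funext => w; case: (b w).
Qed.

Lemma Pr_ge0 A : 0 <= Pr A. Proof. exact: fine_ge0. Qed.

Lemma Pr_fin A : measurable A -> (Pr A)%:E = Q A.
Proof. by move=> mA; rewrite /Pr fineK// fin_num_measure. Qed.

Lemma Pr_le1 A : measurable A -> Pr A <= 1.
Proof. by move=> mA; rewrite -lee_fin Pr_fin// probability_le1. Qed.

Lemma Pr_le A B : measurable A -> measurable B -> A `<=` B -> Pr A <= Pr B.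
Proof. by move=> mA mB AB; rewrite -lee_fin !Pr_fin// le_measure// inE. Qed.

Lemma PrD A B : measurable A -> measurable B -> B `<=` A -> Pr (A `\` B) = Pr A - Pr B.
Proof.
move=> mA mB AB; apply: EFin_inj; rewrite EFinB !Pr_fin//; last exact: measurableD.
rewrite measureD//; first by rewrite setIidr.
by rewrite -ge0_fin_numE// fin_num_measure.
Qed.

Lemma PrC A : measurable A -> Pr (~` A) = 1 - Pr A.
Proof.
move=> mA; rewrite -setTD PrD//; congr (_ - _).
by rewrite /Pr probability_setT.
Qed.

Lemma measurable_tail f : measurable_fun setT f -> (forall w, 0 <= f w) ->
  measurable_fun setT (fun r : R => (Pr [set w | r < f w])%:E).
Proof.
move=> mf f0; pose X : {RV Q >-> R} := mfun_Sub (mem_set mf).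
apply: (eq_measurable_fun (ccdf X)); last exact: ccdf_measurable.
move=> r _; rewrite /ccdf /distribution /pushforward/= Pr_fin.
  by congr (Q _); apply/seteqP; split => w /=; rewrite in_itv/= andbT.
rewrite -[X in measurable X]setTI; exact: measurable_fun_ltr.
Qed.

Lemma Ex_tail f : measurable_fun setT f -> (forall w, 0 <= f w <= 1) ->
  ((Ex f)%:E = \int[lebesgue_measure]_(r in `[0%R, +oo[) (Pr [set w | (r < f w)%R])%:E)%E.
Proof.
move=> mf f01; have f0 w : 0 <= f w by have /andP[] := f01 w.
have := @ge0_expectation_ccdf _ _ _ Q (mfun_Sub (mem_set mf)) f0.
rewrite unlock => h; rewrite Ex_fin; last first.
  by apply: (@Ig_bdd 1) => // w; rewrite ger0_norm//; have /andP[] := f01 w.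
rewrite [LHS]h; apply: eq_integral => r _; rewrite /ccdf /distribution /pushforward/= Pr_fin.
  by congr (Q _); apply/seteqP; split => w /=; rewrite in_itv/= andbT.
rewrite -[X in measurable X]setTI; exact: measurable_fun_ltr.
Qed.

End expect.

Section kolmogorov.
Context {d} {T : measurableType d} {R : realType}.
Variable Q : probability T R.
Variables (Y : T -> R) (kap : R).
Hypotheses (mY : measurable_fun setT Y)
  (KS : forall t, `|Pr Q [set w | Y w <= t] - Phi t| <= kap).

Let mle t : measurable [set w | Y w <= t].
Proof. by rewrite -[X in measurable X]setTI; exact: measurable_fun_ler. Qed.

Let mlt t : measurable [set w | Y w < t].
Proof. by rewrite -[X in measurable X]setTI; exact: measurable_fun_ltr. Qed.

(** The hypothesis at [t - e], and the continuity of [Phi] as [e] tends to 0. *)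
Lemma KS_lt t : `|Pr Q [set w | Y w < t] - Phi t| <= kap.
Proof.
rewrite ler_norml; apply/andP; split.
  apply/ler_addgt0Pr => e e0.
  have := KS (t - e); rewrite ler_norml => /andP[h _].
  have := Phi_lip (t - e) t; rewrite (_ : t - e - t = - e) ?normrN ?(ger0_norm (ltW e0)) ?ler_norml; [move=> /andP[h2 _]|by ring].
  have : Pr Q [set w | Y w <= t - e] <= Pr Q [set w | Y w < t].
    apply: Pr_le => // w /= /le_lt_trans; apply; by rewrite ltrBlDr ltrDl.
  lra.
have := KS t; rewrite ler_norml => /andP[_ h].
have : Pr Q [set w | Y w < t] <= Pr Q [set w | Y w <= t] by apply: Pr_le => // w /= /ltW.
lra.
Qed.

Lemma KS_gt t : `|Pr Q [set w | t < Y w] - (1 - Phi t)| <= kap.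
Proof.
have -> : [set w | t < Y w] = ~` [set w | Y w <= t].
  by apply/seteqP; split => w /=; rewrite ltNge; move/negP.
by rewrite PrC// (_ : _ - _ - _ = - (Pr Q [set w | Y w <= t] - Phi t)) ?normrN//; ring.
Qed.

Lemma KS_oo a b : a <= b -> `|Pr Q [set w | a < Y w < b] - (Phi b - Phi a)| <= kap + kap.
Proof.
move=> ab; have [ba|ab'] := leP b a.
  have -> : [set w | a < Y w < b] = set0.
    apply/seteqP; split => w //= /andP[h1 h2].
    by have := lt_trans h1 h2; rewrite ltNge ba.
  have -> : a = b by apply/eqP; rewrite eq_le ab ba.
  rewrite /Pr measure0 subrr subrr normr0; have := normr_ge0 (Pr Q [set w | Y w <= 0] - Phi 0).
  by have := KS 0; lra.
have -> : [set w | a < Y w < b] = [set w | Y w < b] `\` [set w | Y w <= a].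
  apply/seteqP; split => w /=; first by move=> /andP[aY ->]; split => //; apply/negP; rewrite -ltNge.
  by move=> [-> /negP]; rewrite -ltNge => ->.
rewrite PrD//; last by move=> w /= /le_lt_trans; apply.
have := KS_lt b; have := KS a; rewrite !ler_norml => /andP[? ?] /andP[? ?].
by apply/andP; split; lra.
Qed.

Lemma KS_ball t r : 0 <= r -> Pr Q [set w | `|Y w - t| <= r] <= 2 * r + 2 * kap.
Proof.
move=> r0.
have -> : [set w | `|Y w - t| <= r] = [set w | Y w <= t + r] `\` [set w | Y w < t - r].
  apply/seteqP; split => w /=; rewrite ler_norml.
    by move=> /andP[h1 h2]; split; [lra|apply/negP; rewrite -leNgt; lra].
  by move=> [h1 /negP]; rewrite -leNgt => h2; apply/andP; split; lra.
rewrite PrD//; last by move=> w /= h; lra.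
have := KS (t + r); have := KS_lt (t - r); have := Phi_lip (t + r) (t - r).
rewrite (_ : t + r - (t - r) = 2 * r); last by ring.
rewrite (ger0_norm (mulr_ge0 _ r0))// !ler_norml => /andP[? ?] /andP[? ?] /andP[? ?]; lra.
Qed.

End kolmogorov.

(** * Exponential functionals under a Kolmogorov bound *)

Section tilt_comparison.
Context {R : realType}.
Implicit Types (lam r t kap : R).

(** [tilt_pos] jumps up at 0 and then decreases, so its superlevel sets are intervals, whose masses
    are controlled by the Kolmogorov distance. *)
Lemma tilt_pos_superlevel lam r : 0 <= lam -> 0 <= r -> r < 1 ->
  (forall y, (r < tilt_pos lam y) = (0 < y)) \/
  exists b, 0 <= b /\ forall y, (r < tilt_pos lam y) = (0 < y < b).
Proof.
move=> l0 r0 r1; have [->|ln0] := eqVneq lam 0.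
  left => y; rewrite /tilt_pos mul0r oppr0 expR0; case: ifPn => // _.
  by rewrite ltNge r0.
have [->|rn0] := eqVneq r 0.
  by left => y; rewrite /tilt_pos; case: ifPn => // _; rewrite ?expR_gt0 ?ltxx.
have lp : 0 < lam by rewrite lt_def ln0.
have rp : 0 < r by rewrite lt_def rn0.
right; exists (- ln r / lam); split.
  by rewrite divr_ge0// oppr_ge0 ln_le0// ltW.
move=> y; rewrite /tilt_pos; case: ifPn => //= y0; last by rewrite ltNge r0.
by rewrite ltr_pdivlMr// -{1}(@lnK _ r) ?posrE// ltr_expR ltrNr mulrC.
Qed.

Definition superlevel_mass lam r : R :=
  Pr (normal_prob 0 1) [set y | r < tilt_pos lam y].

Lemma normal_KS t : `|Pr (normal_prob 0 1) [set y : R | y <= t] - Phi t| <= 0.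
Proof.
rewrite (_ : [set y | y <= t] = `]-oo, t]%classic) ?subrr ?normr0//.
Qed.

Lemma KS_superlevel d (T : measurableType d) (Q : probability T R) (Y : T -> R) kap lam r :
  measurable_fun setT Y -> (forall t, `|Pr Q [set w | Y w <= t] - Phi t| <= kap) ->
  0 <= lam -> 0 <= r -> r < 1 ->
  `|Pr Q [set w | r < tilt_pos lam (Y w)] - superlevel_mass lam r| <= 2 * kap.
Proof.
move=> mY KS l0 r0 r1; have k0 : 0 <= kap by exact: le_trans (normr_ge0 _) (KS 0).
have mid : measurable_fun setT (idfun : measurableTypeR R -> R) by exact: measurable_id.
rewrite /superlevel_mass; have [E|[b [b0 E]]] := tilt_pos_superlevel l0 r0 r1.
  rewrite (_ : [set w | _] = [set w | 0 < Y w]); last by apply/funext => w /=; rewrite E.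
  rewrite (_ : [set y | _] = [set y | 0 < y]); last by apply/funext => w /=; rewrite E.
  have := KS_gt mY KS 0; have := KS_gt mid normal_KS 0.
  rewrite !ler_norml => /andP[? ?] /andP[? ?]; lra.
rewrite (_ : [set w | _] = [set w | 0 < Y w < b]); last by apply/funext => w /=; rewrite E.
rewrite (_ : [set y | _] = [set y | 0 < y < b]); last by apply/funext => w /=; rewrite E.
have := KS_oo mY KS b0; have := KS_oo mid normal_KS b0.
rewrite !ler_norml => /andP[? ?] /andP[? ?]; lra.
Qed.

Let tail_le (q p : R -> R) kap : 0 <= kap ->
  measurable_fun setT (fun r => (q r)%:E) -> measurable_fun setT (fun r => (p r)%:E) ->
  (forall r, 0 <= q r) -> (forall r, 0 <= p r) ->
  (forall r, 0 <= r -> q r <= p r + kap * (r \in `[0, 1])%:R) ->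
  (\int[lebesgue_measure]_(r in `[0%R, +oo[) (q r)%:E <=
   \int[lebesgue_measure]_(r in `[0%R, +oo[) (p r)%:E + kap%:E)%E.
Proof.
move=> k0 mq mp q0 p0 qp.
have m1 : measurable_fun setT (fun r : R => (kap * (r \in `[0, 1])%:R)%:E).
  apply/measurable_EFinP; apply: measurable_funM => //.
  rewrite (_ : (fun _ => _) = \1_`[0, 1]%classic); first exact: measurable_indic.
  by apply/funext => r; rewrite indicE mem_setE.
apply: (@le_trans _ _ (\int[lebesgue_measure]_(r in `[0%R, +oo[) ((p r)%:E + (kap * (r \in `[0, 1])%:R)%:E))%E).
  apply: ge0_le_integral => //.
  - by move=> r _; rewrite lee_fin.
  - exact: measurable_funTS.
  - by apply: emeasurable_funD; exact: measurable_funTS.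
  - by move=> r /=; rewrite in_itv/= andbT lee_fin => /qp.
rewrite ge0_integralD//; last 4 first.
- by move=> r _; rewrite lee_fin.
- exact: measurable_funTS.
- by move=> r _; rewrite lee_fin mulr_ge0.
- exact: measurable_funTS.
rewrite leeD2l//.
under eq_integral do rewrite EFinM.
rewrite ge0_integralZl_EFin//; last first.
  apply: measurable_funTS; apply/measurable_EFinP.
  rewrite (_ : (fun _ => _) = \1_`[0, 1]%classic); first exact: measurable_indic.
  by apply/funext => r; rewrite indicE mem_setE.
rewrite -[leRHS]mule1 lee_wpmul2l ?lee_fin//.
have -> : (\int[lebesgue_measure]_(r in `[0%R, +oo[) ((r \in `[0, 1])%:R)%:E =
    \int[lebesgue_measure]_(r in `[0%R, +oo[) (\1_(`[0, 1]%classic : set R) r)%:E)%E.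
  by apply: eq_integral => r _; rewrite indicE mem_setE.
rewrite integral_indic//; apply: (@le_trans _ _ (lebesgue_measure `[0, 1]%classic)).
  by rewrite le_measure ?inE//; exact: measurableI.
by rewrite lebesgue_measure_itv/= lte_fin ltr01 oppr0 adde0.
Qed.

(** Layer-cake formula: both quantities are integrals over [r] of the masses of the superlevel sets,
    which differ by at most [2 kap] and vanish for [r >= 1]. The factor is therefore 2 whatever
    [lam] is. *)
Lemma KS_tilt d (T : measurableType d) (Q : probability T R) (Y : T -> R) kap lam :
  measurable_fun setT Y -> (forall t, `|Pr Q [set w | Y w <= t] - Phi t| <= kap) ->
  0 <= lam -> `|Ex Q (fun w => tilt_pos lam (Y w)) - mills lam| <= 2 * kap.
Proof.
move=> mY KS l0; have k0 : 0 <= kap by exact: le_trans (normr_ge0 _) (KS 0).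
have mW : measurable_fun setT (fun w => tilt_pos lam (Y w)).
  by apply: measurableT_comp => //; exact: measurable_tilt_pos.
have W01 y : 0 <= tilt_pos lam y <= 1 by rewrite tilt_pos_ge0 tilt_pos_le1.
have := Ex_tail Q mW (fun w => W01 _); set q := fun r => Pr Q [set w | r < tilt_pos lam (Y w)].
have mN : measurable_fun setT (tilt_pos lam : measurableTypeR R -> R) by exact: measurable_tilt_pos.
have EN : Ex (normal_prob 0 1) (tilt_pos lam) = mills lam.
  apply: EFin_inj; rewrite Ex_fin; first exact: normal_tilt_pos.
  by apply: (@Ig_bdd _ _ _ _ 1) => // w; rewrite ger0_norm ?tilt_pos_ge0 ?tilt_pos_le1.
have := @Ex_tail _ _ _ (normal_prob 0 1) _ mN W01; rewrite EN => pE qE.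
have mq := measurable_tail Q mW (fun w => tilt_pos_ge0 _ _).
have mp := measurable_tail (normal_prob 0 1) mN (fun w => tilt_pos_ge0 _ _).
have out d' (T' : measurableType d') (Q' : probability T' R) (Y' : T' -> R) r : 1 < r ->
    Pr Q' [set w | r < tilt_pos lam (Y' w)] = 0.
  move=> r1; rewrite (_ : [set w | _] = set0) ?/Pr ?measure0//.
  by apply/seteqP; split => // w /=; rewrite ltNge (le_trans (tilt_pos_le1 _ l0))// ltW.
(* The level 1 is treated apart because [KS_superlevel] is for levels below 1. *)
have cmp r : 0 <= r -> r != 1 -> `|q r - superlevel_mass lam r| <= 2 * kap * (r \in `[0, 1])%:R.
  move=> r0 rn1; have [r1|r1|r1] := ltgtP r 1; last by rewrite r1 eqxx in rn1.
    by rewrite in_itv/= r0 (ltW r1)/= mulr1; exact: KS_superlevel.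
  by rewrite /q /superlevel_mass !out// subrr normr0 mulr_ge0// mulr_ge0.
have cmp1 : `|q 1 - superlevel_mass lam 1| <= 2 * kap * ((1 : R) \in `[0, 1])%:R.
  rewrite /q /superlevel_mass.
  have out1 d' (T' : measurableType d') (Q' : probability T' R) (Y' : T' -> R) :
      Pr Q' [set w | 1 < tilt_pos lam (Y' w)] = 0.
    rewrite (_ : [set w | _] = set0) ?/Pr ?measure0//.
    by apply/seteqP; split => // w /=; rewrite ltNge tilt_pos_le1.
  by rewrite !out1 subrr normr0 mulr_ge0// mulr_ge0.
have cmp' r : 0 <= r -> `|q r - superlevel_mass lam r| <= 2 * kap * (r \in `[0, 1])%:R.
  by move=> r0; have [->|/cmp] := eqVneq r 1; [exact: cmp1|exact].
have k20 : 0 <= 2 * kap by rewrite mulr_ge0.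
rewrite ler_norml; apply/andP; split.
  suff : mills lam <= Ex Q (fun w => tilt_pos lam (Y w)) + 2 * kap by lra.
  rewrite -lee_fin EFinD qE pE; apply: tail_le => //.
  - by move=> r; exact: Pr_ge0.
  - by move=> r; exact: Pr_ge0.
  by move=> r /cmp'; rewrite ler_distl lerBlDr => /andP[].
rewrite lerBlDl -lee_fin EFinD qE pE; apply: tail_le => //.
- by move=> r; exact: Pr_ge0.
- by move=> r; exact: Pr_ge0.
by move=> r /cmp'; rewrite ler_distl => /andP[].
Qed.

End tilt_comparison.

(** * Approximate martingale differences: a Berry-Esseen bound *)

Section real_aux.
Context {R : realType}.

Lemma powR_anti (q x y : R) : 0 <= q -> 0 < x -> x <= y -> y `^ (- q) <= x `^ (- q).
Proof.
move=> q0 x0 xy; rewrite !powRN lef_pV2 ?posrE ?powR_gt0 ?(lt_le_trans x0)//.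
by apply: ge0_ler_powR => //; rewrite nnegrE ltW// (lt_le_trans x0).
Qed.

Lemma abs_le_1powR q (x : R) : 1 <= q -> `|x| <= 1 + `|x| `^ q.
Proof.
move=> q1; have [x1|x1] := leP `|x| 1.
  by apply: le_trans x1 _; rewrite lerDl powR_ge0.
apply: ler_wpDl => //; rewrite -{1}(powRr1 (normr_ge0 x)) ler_powR// ltW//.
Qed.

Lemma ler_norm4 (x1 x2 z1 z2 z3 z4 : R) : `|z1| <= 300 * x1 -> `|z2| <= 64 * x1 ->
  `|z3| <= x2 -> `|z4| <= x1 + x2 -> 0 <= x1 -> 0 <= x2 ->
  `|z1 - z2 + z3 + z4| <= 400 * x1 + 400 * x2.
Proof.
move=> h1 h2 h3 h4 x10 x20; apply: le_trans (ler_normD _ _) _.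
apply: le_trans (lerD (ler_normD _ _) h4) _.
by apply: le_trans (lerD (lerD (ler_normB _ _) h3) (lexx _)) _; lra.
Qed.

Lemma sqr_le_1powR q (x : R) : 2 <= q -> x ^+ 2 <= 1 + `|x| `^ q.
Proof.
move=> q2; rewrite -[x ^+ 2]real_normK ?num_real//; have [x1|x1] := leP `|x| 1.
  by rewrite ler_wpDr ?powR_ge0// expr_le1.
by apply: ler_wpDl => //; rewrite -powR_mulrn// ler_powR// ltW.
Qed.

End real_aux.

Section measurable_aux.
Context {d} {T : measurableType d} {R : realType}.
Implicit Types (f g : T -> R).

Lemma measurable_powRl q f : measurable_fun setT f -> measurable_fun setT (fun w => f w `^ q).
Proof. by move=> mf; apply: (@measurableT_comp _ _ _ _ _ _ (@powR R ^~ q)). Qed.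

Lemma measurable_isq f : measurable_fun setT f -> measurable_fun setT (fun w => isq (f w)).
Proof. exact: measurable_powRl. Qed.

Lemma measurable_Phi f : measurable_fun setT f -> measurable_fun setT (fun w => Phi (f w)).
Proof.
move=> mf; apply: measurableT_comp => //; apply: continuous_measurable_fun => x.
by apply: differentiable_continuous; apply/derivable1_diffP; case: (is_derive_Phi x).
Qed.

Lemma measurable_phi f : measurable_fun setT f -> measurable_fun setT (fun w => phi (f w)).
Proof. by move=> mf; apply: measurableT_comp => //; exact: measurable_normal_pdf. Qed.

Lemma measurable_expRl f : measurable_fun setT f -> measurable_fun setT (fun w => expR (f w)).
Proof. by move=> mf; apply: measurableT_comp. Qed.

Lemma measurable_u_y f g : measurable_fun setT f -> measurable_fun setT g ->
  measurable_fun setT (fun w => u_y (f w) (g w)).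
Proof.
move=> mf mg; have mi := measurable_isq mg; rewrite /u_y.
by apply: measurable_funM => //; apply: measurable_phi; apply: measurable_funM.
Qed.

Lemma measurable_u_yy f g : measurable_fun setT f -> measurable_fun setT g ->
  measurable_fun setT (fun w => u_yy (f w) (g w)).
Proof.
move=> mf mg; have mi := measurable_isq mg; rewrite /u_yy.
have mz : measurable_fun setT (fun w => f w * isq (g w)) by apply: measurable_funM.
apply: measurable_funM; first exact: measurable_funX.
by apply: measurable_funM; [exact: measurableT_comp|exact: measurable_phi].
Qed.

End measurable_aux.

Section Ig_aux.
Context {d} {T : measurableType d} {R : realType}.
Variable Q : probability T R.
Implicit Types (f g H : T -> R).

Lemma Ig_bM M H f : measurable_fun setT H -> (forall w, `|H w| <= M) -> Ig Q f ->
  Ig Q (fun w => H w * f w).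
Proof.
move=> mH HM If; apply: (@Ig_dom _ _ _ _ _ (fun w => M * `|f w|)).
- by apply: measurable_funM => //; exact: Ig_mf If.
- by move=> w; rewrite normrM ler_wpM2r.
- by apply: IgZ; exact: Ig_abs.
Qed.

End Ig_aux.

Section approx_mds.
Context {d} {T : measurableType d} {R : realType}.
Variables (Q : probability T R) (n : nat) (F : nat -> set (set T)) (eta s : nat -> T -> R).
Variables (rho eps lam C0 : R).

Definition Fmeas k (f : T -> R) := measurable_fun [set: g_sigma_algebraType (F k)] f.
Definition bounded_rv (f : T -> R) := exists M, forall w, `|f w| <= M.
Definition psum (f : nat -> T -> R) k w := \sum_(1 <= i < k.+1) f i w.

(* Approximate martingale differences: [s k.+1] is the predictable quadratic variation; the
   conditional mean and variance are only controlled up to relative errors of the size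
   produced by an exponential change of measure with parameter [lam]. *)
Definition approx_mds :=
  [/\ (forall k, (k <= n)%N -> sub_sigma_field (F k)),
      (forall k, (k < n)%N -> F k `<=` F k.+1),
      (forall k, (k < n)%N -> Fmeas k.+1 (eta k.+1) /\ Fmeas k (s k.+1)),
      (forall k w, 0 <= s k w <= eps ^+ 2) &
      forall k, (k < n)%N -> Ig Q (fun w => `|eta k.+1 w| `^ (2 + rho)) /\
        forall H, Fmeas k H -> bounded_rv H ->
        [/\ `|Ex Q (fun w => H w * eta k.+1 w)|
              <= C0 * (lam `^ (1 + rho) * eps `^ rho) * Ex Q (fun w => `|H w| * s k.+1 w),
            `|Ex Q (fun w => H w * (eta k.+1 w ^+ 2 - s k.+1 w))|
              <= C0 * (lam `^ rho * eps `^ rho) * Ex Q (fun w => `|H w| * s k.+1 w) &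
            Ex Q (fun w => `|H w| * `|eta k.+1 w| `^ (2 + rho))
              <= C0 * eps `^ rho * Ex Q (fun w => `|H w| * s k.+1 w)]].

Hypothesis amds : approx_mds.
Hypothesis rho01 : 0 < rho <= 1.
Hypothesis eps0 : 0 < eps.
Hypothesis lam0 : 0 <= lam.
Hypothesis C01 : 1 <= C0.

Let sF k : (k <= n)%N -> sub_sigma_field (F k). Proof. by case: amds => h *; exact: h. Qed.

Local Notation Y := (psum eta).
Local Notation V := (psum s).
Local Notation a := (lam `^ (1 + rho) * eps `^ rho).
Local Notation b := (lam `^ rho * eps `^ rho).
Local Notation p := (1 + rho / 2).

Let r0 : 0 < rho. Proof. by case/andP: rho01. Qed.
Let r1 : rho <= 1. Proof. by case/andP: rho01. Qed.
Let s0 k w : 0 <= s k w. Proof. by case: amds => _ _ _ /(_ k w) /andP[]. Qed.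
Let s_eps k w : s k w <= eps ^+ 2. Proof. by case: amds => _ _ _ /(_ k w) /andP[]. Qed.
Let C0_ge0 : 0 <= C0. Proof. exact: le_trans C01. Qed.
Let a_ge0 : 0 <= a. Proof. by rewrite mulr_ge0 ?powR_ge0. Qed.
Let b_ge0 : 0 <= b. Proof. by rewrite mulr_ge0 ?powR_ge0. Qed.

Lemma psumS f k w : psum f k.+1 w = psum f k w + f k.+1 w.
Proof. by rewrite /psum big_nat_recr. Qed.

Lemma psum0 f w : psum f 0 w = 0.
Proof. by rewrite /psum big_geq. Qed.

Lemma Fmeas_T k f : (k <= n)%N -> Fmeas k f -> measurable_fun setT f.
Proof. by move=> kn /(G_measurableP (sF kn)) h; exact: (G_measurable_meas (sF kn)). Qed.

Lemma Fmeas_S k f : (k < n)%N -> Fmeas k f -> Fmeas k.+1 f.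
Proof.
move=> kn /(G_measurableP (sF (ltnW kn))) h; apply/(G_measurableP (sF kn)) => B mB.
by case: amds => _ /(_ k kn) FF _ _ _; apply: FF; exact: h.
Qed.

Lemma Fmeas_le k j f : (k <= j)%N -> (j <= n)%N -> Fmeas k f -> Fmeas j f.
Proof.
move=> /subnK <-; elim: (j - k)%N => // i IH; rewrite addSn => h kf.
by apply: Fmeas_S => //; apply: IH => //; exact: ltnW.
Qed.

Let m_eta k : (k < n)%N -> Fmeas k.+1 (eta k.+1). Proof. by case: amds => _ _ /(_ k) h _ _ /h []. Qed.
Let m_s k : (k < n)%N -> Fmeas k (s k.+1). Proof. by case: amds => _ _ /(_ k) h _ _ /h []. Qed.

Lemma Fmeas_Y k : (k <= n)%N -> Fmeas k (Y k).
Proof.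
elim: k => [_|k IH kn].
  rewrite (_ : Y 0 = fun=> 0); first exact: measurable_cst.
  by apply/funext => w; rewrite psum0.
rewrite (_ : Y k.+1 = fun w => Y k w + eta k.+1 w); last by apply/funext => w; rewrite psumS.
apply: measurable_funD; last exact: m_eta.
by apply: Fmeas_S => //; apply: IH; exact: ltnW.
Qed.

(** Predictability: [V_(k+1)] is known at time [k], so the remaining time after the step [k + 1] may
    enter the weights of [approx_mds]. *)
Lemma Fmeas_VS k : (k < n)%N -> Fmeas k (V k.+1).
Proof.
elim: k => [|k IH] kn.
  rewrite (_ : V 1 = s 1); first exact: m_s.
  by apply/funext => w; rewrite psumS psum0 add0r.
rewrite (_ : V k.+2 = fun w => V k.+1 w + s k.+2 w); last by apply/funext => w; rewrite psumS.
apply: measurable_funD; last exact: m_s.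
by apply: Fmeas_S; [exact: ltnW|apply: IH; exact: ltnW].
Qed.

Lemma Fmeas_V k : (k <= n)%N -> Fmeas k (V k).
Proof.
case: k => [_|k kn]; last by apply: Fmeas_S => //; exact: Fmeas_VS.
rewrite (_ : V 0 = fun=> 0); first exact: measurable_cst.
by apply/funext => w; rewrite psum0.
Qed.

Lemma V_homo k j w : (k <= j)%N -> V k w <= V j w.
Proof.
move=> /subnK <-; elim: (j - k)%N => // i IH; rewrite addSn psumS.
by apply: le_trans IH _; rewrite lerDl.
Qed.

Lemma V_ge0 k w : 0 <= V k w.
Proof. by rewrite -(psum0 s w) V_homo. Qed.

Let Ig_etap k : (k < n)%N -> Ig Q (fun w => `|eta k.+1 w| `^ (2 + rho)).
Proof. by case: amds => _ _ _ _ /(_ k) h /h []. Qed.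

Let mT_eta k : (k < n)%N -> measurable_fun setT (eta k.+1).
Proof. by move=> kn; apply: (Fmeas_T kn); exact: m_eta. Qed.

Let mT_s k : (k < n)%N -> measurable_fun setT (s k.+1).
Proof. by move=> kn; apply: (Fmeas_T (ltnW kn)); exact: m_s. Qed.

Lemma Ig_eta k : (k < n)%N -> Ig Q (eta k.+1).
Proof.
move=> kn; apply: Ig_dom (mT_eta kn) _ (IgD (Ig_cst Q 1) (Ig_etap kn)) => w.
by apply: abs_le_1powR; have := r0; lra.
Qed.

Lemma Ig_eta2 k : (k < n)%N -> Ig Q (fun w => eta k.+1 w ^+ 2).
Proof.
move=> kn; apply: Ig_dom _ _ (IgD (Ig_cst Q 1) (Ig_etap kn)) => [|w].
  by apply: measurable_funX; exact: mT_eta.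
by rewrite ger0_norm ?sqr_ge0//; apply: sqr_le_1powR; have := r0; lra.
Qed.

Lemma Ig_s k : (k < n)%N -> Ig Q (s k.+1).
Proof.
move=> kn; apply: (@Ig_bdd _ _ _ _ (eps ^+ 2)); first exact: mT_s.
by move=> w; rewrite ger0_norm.
Qed.

Let moments k H : (k < n)%N -> Fmeas k H -> bounded_rv H ->
        [/\ `|Ex Q (fun w => H w * eta k.+1 w)|
              <= C0 * a * Ex Q (fun w => `|H w| * s k.+1 w),
            `|Ex Q (fun w => H w * (eta k.+1 w ^+ 2 - s k.+1 w))|
              <= C0 * b * Ex Q (fun w => `|H w| * s k.+1 w) &
            Ex Q (fun w => `|H w| * `|eta k.+1 w| `^ (2 + rho))
              <= C0 * eps `^ rho * Ex Q (fun w => `|H w| * s k.+1 w)].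
Proof. by case: amds => _ _ _ _ /(_ k) h /h [_]; apply. Qed.

(** * Transport of the kernel from time [k] to time [n] *)

Section jensen.
Variables (k : nat) (G W beta : T -> R) (c t w0 M : R).
Hypotheses (kn : (k <= n)%N) (mG : Fmeas k G) (mW : Fmeas k W) (mb : Fmeas k beta).
Hypotheses (G0 : forall w, 0 <= G w <= M) (w00 : 0 < w0) (Ww0 : forall w, w0 <= W w).
Hypotheses (Vc : forall w, V n w <= c) (beta0 : forall w, 0 <= beta w)
  (betaP : forall w, C0 * (4 * a * isq (W w) + 2 * b / W w) <= beta w)
  (betaV : forall w, beta w * (V n w - V k w) <= 2^-1).

(** The sum of [(Y_j - t)^2 - V_j], a martingale up to the errors of [approx_mds], and of terms
    known at time [k]; [W] keeps it away from 0. The exponential weight in [Ew] compensates for the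
    errors, which are relative to [s], that is, to the increments of [V]. *)
Let A j w := W w + (c - V j w) + (Y j w - t) ^+ 2.
Let Ew j w := G w * expR (2 * beta w * (V j w - V k w)).

Let A_ge j w : (j <= n)%N -> W w <= A j w.
Proof.
move=> jn; rewrite /A -addrA lerDl addr_ge0 ?sqr_ge0// subr_ge0.
exact: le_trans (V_homo w jn) (Vc w).
Qed.

Let A_gt0 j w : (j <= n)%N -> 0 < A j w.
Proof. by move=> jn; apply: lt_le_trans (A_ge w jn); exact: lt_le_trans (Ww0 w). Qed.

Let Fmeas_A j : (k <= j)%N -> (j <= n)%N -> Fmeas j (A j).
Proof.
move=> kj jn; have mWj := Fmeas_le kj jn mW.
apply: measurable_funD; first apply: measurable_funD => //.
  by apply: measurable_funB; [exact: measurable_cst|exact: Fmeas_V].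
apply: measurable_funX; apply: measurable_funB; [exact: Fmeas_Y|exact: measurable_cst].
Qed.

Let Ew_bd j w : (k <= j)%N -> (j <= n)%N -> 0 <= Ew j w <= M * expR 1.
Proof.
move=> kj jn; have /andP[g0 gM] := G0 w.
rewrite mulr_ge0 ?expR_ge0//= ler_pM ?expR_ge0// ler_expR.
have h : beta w * (V j w - V k w) <= beta w * (V n w - V k w).
  by rewrite ler_wpM2l ?lerB ?V_homo.
by have := betaV w; rewrite -mulrA; lra.
Qed.

Let Fmeas_EwS j : (k <= j)%N -> (j < n)%N -> Fmeas j (Ew j.+1).
Proof.
move=> kj jn; apply: measurable_funM; first exact: Fmeas_le kj (ltnW jn) mG.
apply: measurable_expRl; apply: measurable_funM.
  by apply: measurable_funM; [exact: measurable_cst|exact: Fmeas_le kj (ltnW jn) mb].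
apply: measurable_funB; first exact: Fmeas_VS.
exact: Fmeas_le kj (ltnW jn) (Fmeas_V kn).
Qed.

Let pot_bd j w : (j <= n)%N -> 0 <= A j w `^ (- p) <= w0 `^ (- p).
Proof.
move=> jn; rewrite powR_ge0/= powR_anti//; first by have := r0; lra.
exact: le_trans (Ww0 w) (A_ge w jn).
Qed.

Let Ig_pot j : (k <= j)%N -> (j <= n)%N -> Ig Q (fun w => Ew j w * A j w `^ (- p)).
Proof.
move=> kj jn; apply: (@Ig_bdd _ _ _ _ (M * expR 1 * w0 `^ (- p))).
  apply: measurable_funM.
    apply: (Fmeas_T jn); apply: measurable_funM; first exact: Fmeas_le kj jn mG.
    apply: measurable_expRl; apply: measurable_funM.
      by apply: measurable_funM; [exact: measurable_cst|exact: Fmeas_le kj jn mb].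
    apply: measurable_funB; first exact: Fmeas_V.
    exact: Fmeas_le kj jn (Fmeas_V kn).
  by apply: measurable_powRl; apply: (Fmeas_T jn); exact: Fmeas_A.
move=> w; have /andP[h1 h2] := Ew_bd w kj jn; have /andP[h3 h4] := pot_bd w jn.
by rewrite normrM !ger0_norm// ler_pM.
Qed.

(** The tangent at [A_j] gives an increment linear in [eta] and in [eta^2 - s], whose expectation is
    at least that of [- X u], with [X] the weighted kernel and [u = beta s]. The weight grows by
    [exp (2 u)], and [exp (2 u) (1 - u) >= 1] for [u <= 1 / 2]. *)
Let step j : (k <= j)%N -> (j < n)%N ->
  Ex Q (fun w => Ew j w * A j w `^ (- p)) <= Ex Q (fun w => Ew j.+1 w * A j.+1 w `^ (- p)).
Proof.
move=> kj jn; have jn' := ltnW jn; have kj1 := leqW kj.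
pose y w := Y j w - t.
pose H2 w := Ew j.+1 w * (p * A j w `^ (- (p + 1))).
pose H1 w := H2 w * (2 * y w).
have mA := Fmeas_A kj jn'.
have my : Fmeas j y by apply: measurable_funB; [exact: Fmeas_Y|exact: measurable_cst].
have mEw := Fmeas_EwS kj jn.
have mH2 : Fmeas j H2.
  by apply: measurable_funM => //; apply: measurable_funM; [exact: measurable_cst|exact: measurable_powRl].
have mH1 : Fmeas j H1.
  by apply: measurable_funM => //; apply: measurable_funM => //; exact: measurable_cst.
have Ai w : A j w `^ (- (p + 1)) = A j w `^ (- p) / A j w.
  have A0 := A_gt0 w jn'.
  by rewrite opprD powRD ?(gt_eqF A0) ?implybT// powR_inv1// ltW.
(* From [(Y_j - t)^2 <= A_j]. Together with [p <= 2] this is the origin of [4 a / sqrt W] (drift)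
   and [2 b / W] (variance) in the hypothesis on [beta]. *)
have yA w : `|y w| / A j w <= isq (W w).
  have A0 := A_gt0 w jn'; have W0 := lt_le_trans w00 (Ww0 w).
  apply: (@le_trans _ _ (isq (A j w))); last by apply: powR_anti => //; exact: A_ge.
  rewrite ler_pdivrMr//; have sA : 0 < Num.sqrt (A j w) by rewrite sqrtr_gt0.
  rewrite isqE ?(ltW A0)// -{2}[A j w]sqr_sqrtr ?(ltW A0)// expr2 mulrA mulVf ?gt_eqF// mul1r.
  by rewrite -sqrtr_sqr ler_sqrt ?(ltW A0)// /A lerDr -/(y w) addr_ge0 ?(ltW W0)// subr_ge0 (le_trans (V_homo w jn') (Vc w)).
have H2E w : H2 w = Ew j.+1 w * A j w `^ (- p) * (p / A j w) by rewrite /H2 Ai; ring.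
have [p0 p2] : 0 <= p /\ p <= 2 by have := r0; have := r1; lra.
have H20 w : 0 <= H2 w.
  have /andP[h1 _] := Ew_bd w kj1 jn.
  rewrite H2E; apply: mulr_ge0; first by rewrite mulr_ge0 ?powR_ge0.
  by rewrite divr_ge0// ltW// A_gt0.
have H2W w : H2 w <= Ew j.+1 w * A j w `^ (- p) * (2 / W w).
  have /andP[h1 _] := Ew_bd w kj1 jn; have W0 := lt_le_trans w00 (Ww0 w).
  have Ai0 : 0 <= (A j w)^-1 by rewrite invr_ge0 ltW// A_gt0.
  have AW : (A j w)^-1 <= (W w)^-1 by rewrite lef_pV2 ?posrE ?A_gt0// A_ge.
  have EA0 : 0 <= Ew j.+1 w * A j w `^ (- p) by rewrite mulr_ge0 ?powR_ge0.
  by rewrite H2E; apply: (ler_wpM2l EA0); exact: ler_pM.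
have H1W w : `|H1 w| <= Ew j.+1 w * A j w `^ (- p) * (4 * isq (W w)).
  have /andP[h1 _] := Ew_bd w kj1 jn; have A0 := A_gt0 w jn'.
  have EA0 : 0 <= Ew j.+1 w * A j w `^ (- p) by rewrite mulr_ge0 ?powR_ge0.
  rewrite /H1 normrM (ger0_norm (H20 w)) H2E normrM (ger0_norm (ler0n _ 2)).
  apply: (@le_trans _ _ (Ew j.+1 w * A j w `^ (- p) * ((2 * p) * (`|y w| / A j w)))).
    by rewrite le_eqVlt; apply/orP; left; apply/eqP; ring.
  apply: (ler_wpM2l EA0).
  by apply: ler_pM => //; [lra|rewrite divr_ge0// ltW|lra].
have EA w : 0 <= Ew j.+1 w * A j w `^ (- p) <= M * expR 1 * w0 `^ (- p).
  have /andP[h1 h2] := Ew_bd w kj1 jn; have /andP[h3 h4] := pot_bd w jn'.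
  by rewrite mulr_ge0//= ler_pM.
have W0 w := lt_le_trans w00 (Ww0 w).
have bH2 : bounded_rv H2.
  exists (M * expR 1 * w0 `^ (- p) * (2 / w0)) => w; rewrite ger0_norm//.
  have /andP[h1 h2] := EA w; apply: le_trans (H2W w) _; apply: ler_pM => //.
    by rewrite divr_ge0// ltW.
  by apply: ler_wpM2l => //; rewrite lef_pV2 ?posrE.
have bH1 : bounded_rv H1.
  exists (M * expR 1 * w0 `^ (- p) * (4 * isq w0)) => w.
  have /andP[h1 h2] := EA w; apply: le_trans (H1W w) _; apply: ler_pM => //.
    by rewrite mulr_ge0 ?isq_ge0.
  by apply: ler_wpM2l => //; apply: powR_anti.
have [M1 _ _] := moments jn mH1 bH1.
have [_ M2 _] := moments jn mH2 bH2.
have mT f := @Fmeas_T j f jn'.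
have IEA : Ig Q (fun w => Ew j.+1 w * A j w `^ (- p)).
  apply: (@Ig_bdd _ _ _ _ (M * expR 1 * w0 `^ (- p))).
    by apply: mT; apply: measurable_funM => //; exact: measurable_powRl.
  by move=> w; have /andP[h1 h2] := EA w; rewrite ger0_norm.
have [B1 hB1] := bH1; have [B2 hB2] := bH2.
have I1 : Ig Q (fun w => H1 w * eta j.+1 w) by apply: Ig_bM hB1 (Ig_eta jn); exact: mT.
have I2 : Ig Q (fun w => H2 w * (eta j.+1 w ^+ 2 - s j.+1 w)).
  by apply: Ig_bM hB2 (IgB (Ig_eta2 jn) (Ig_s jn)); exact: mT.
have I1s : Ig Q (fun w => `|H1 w| * s j.+1 w).
  apply: (@Ig_bM _ _ _ _ B1) (Ig_s jn); last by move=> w; rewrite normr_id.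
  by apply: measurableT_comp => //; exact: mT.
have I2s : Ig Q (fun w => `|H2 w| * s j.+1 w).
  apply: (@Ig_bM _ _ _ _ B2) (Ig_s jn); last by move=> w; rewrite normr_id.
  by apply: measurableT_comp => //; exact: mT.
apply: (@le_trans _ _ (Ex Q (fun w => Ew j.+1 w * A j w `^ (- p)
    - C0 * a * (`|H1 w| * s j.+1 w) - C0 * b * (`|H2 w| * s j.+1 w)))).
  apply: Ex_le; first exact: Ig_pot.
    by apply: IgB; [apply: IgB => //; exact: IgZ|exact: IgZ].
  move=> w; have /andP[h1 _] := Ew_bd w kj jn'; have A0 := A_gt0 w jn'.
  have sw := s0 j.+1 w.
  set u := beta w * s j.+1 w.
  have u0 : 0 <= u by rewrite mulr_ge0.
  have u1 : u <= 2^-1.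
    apply: le_trans (betaV w); rewrite ler_wpM2l// -(lerD2r (V k w)) subrK.
    by rewrite addrC; apply: le_trans (V_homo w jn); rewrite psumS lerD2r V_homo.
  have EwS : Ew j.+1 w = Ew j w * expR (2 * u).
    rewrite /Ew psumS -[RHS]mulrA -expRD; congr (_ * expR _); rewrite /u; ring.
  set X := Ew j.+1 w * A j w `^ (- p).
  have X0 : 0 <= X by have /andP[] := EA w.
  apply: (@le_trans _ _ (X * (1 - u))).
    have X'0 : 0 <= Ew j w * A j w `^ (- p) by rewrite mulr_ge0 ?powR_ge0.
    have e1 : 1 <= expR (2 * u) * (1 - u) by have := expR_ge1Dx (2 * u); nra.
    rewrite -[leLHS]mulr1 (_ : X * (1 - u) = Ew j w * A j w `^ (- p) * (expR (2 * u) * (1 - u))).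
      exact: (ler_wpM2l X'0).
    by rewrite /X EwS; ring.
  rewrite mulrBr mulr1 -addrA -opprD lerD2l lerN2.
  have h : C0 * a * `|H1 w| + C0 * b * `|H2 w| <= X * beta w.
    apply: le_trans (_ : X * (C0 * (4 * a * isq (W w) + 2 * b / W w)) <= _); last by rewrite ler_wpM2l.
    rewrite (_ : X * _ = C0 * a * (X * (4 * isq (W w))) + C0 * b * (X * (2 / W w))); last by ring.
    by rewrite lerD// ler_wpM2l ?(mulr_ge0 C0_ge0)// ger0_norm.
  by have := ler_wpM2r sw h; rewrite /u; lra.
apply: (@le_trans _ _ (Ex Q (fun w => Ew j.+1 w * A j w `^ (- p)
    - H1 w * eta j.+1 w - H2 w * (eta j.+1 w ^+ 2 - s j.+1 w)))).
  rewrite !ExB ?IgB ?IgZ//; try by apply: IgB => //; exact: IgZ.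
  rewrite !ExZ// -!addrA !lerD2l -!opprD lerN2 lerD//.
    exact: le_trans (ler_norm _) M1.
  exact: le_trans (ler_norm _) M2.
apply: Ex_le.
- by apply: IgB => //; exact: IgB.
- exact: Ig_pot.
move=> w; have /andP[h1 _] := Ew_bd w kj1 jn.
have A0 := A_gt0 w jn'; have A1 := A_gt0 w jn.
have := powR_tangent p0 A0 A1.
have -> : A j.+1 w - A j w = 2 * y w * eta j.+1 w + eta j.+1 w ^+ 2 - s j.+1 w.
  by rewrite /A !psumS /y; ring.
move=> /(ler_wpM2l h1); apply: le_trans.
by rewrite le_eqVlt; apply/orP; left; apply/eqP; rewrite /H1 /H2; ring.
Qed.

(* [x |-> x `^ (- p)] lies above its tangents, so [Ew j * A j `^ (- p)] has increasing expectation in [j]. *)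
Lemma jensen_bound :
  Ex Q (fun w => G w * A k w `^ (- p)) <= expR 1 * Ex Q (fun w => G w * A n w `^ (- p)).
Proof.
have chain j : (k <= j)%N -> (j <= n)%N ->
    Ex Q (fun w => Ew k w * A k w `^ (- p)) <= Ex Q (fun w => Ew j w * A j w `^ (- p)).
  elim: j => [|j IH] kj jn; first by rewrite (_ : k = 0%N)//; apply/eqP; rewrite -leqn0.
  have [kj'|kj'] := leqP k j; last by rewrite (_ : k = j.+1)//; apply/eqP; rewrite eqn_leq kj kj'.
  exact: le_trans (IH kj' (ltnW jn)) (step kj' jn).
have Ek : (fun w => Ew k w * A k w `^ (- p)) = (fun w => G w * A k w `^ (- p)).
  by apply/funext => w; rewrite /Ew subrr mulr0 expR0 mulr1.
have := chain n kn (leqnn n); rewrite Ek => /le_trans; apply.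
have Gp : Ig Q (fun w => G w * A n w `^ (- p)).
  apply: (@Ig_bdd _ _ _ _ (M * w0 `^ (- p))).
    apply: measurable_funM; first exact: (Fmeas_T kn).
    by apply: measurable_powRl; apply: (Fmeas_T (leqnn n)); exact: Fmeas_A.
  move=> w; have /andP[h1 h2] := G0 w; have /andP[h3 h4] := pot_bd w (leqnn n).
  by rewrite normrM !ger0_norm// ler_pM.
rewrite -ExZ//; apply: Ex_le; [exact: Ig_pot|exact: IgZ|move=> w].
rewrite mulrA ler_wpM2r ?powR_ge0// /Ew mulrC ler_wpM2r//; first by have /andP[] := G0 w.
rewrite ler_expR -mulrA; have := betaV w; lra.
Qed.

End jensen.

(** * One step of the Lindeberg replacement *)

Section lindeberg.
Variables (c v0 t : R).
Hypotheses (v00 : 0 < v0) (eps_v0 : eps ^+ 2 <= v0) (Vc : forall w, V n w + v0 <= c).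

Let v k w := c - V k w.
Let U k w := Phi ((Y k w - t) * isq (v k w)).
Let kap k w := (v k.+1 w + (Y k w - t) ^+ 2) `^ (- p).

Let v_ge k w : (k <= n)%N -> v0 <= v k w.
Proof. by move=> kn; rewrite /v lerBrDr addrC; apply: le_trans (Vc w); rewrite lerD2r V_homo. Qed.

Let v_gt0 k w : (k <= n)%N -> 0 < v k w.
Proof. by move=> kn; apply: lt_le_trans (v_ge w kn). Qed.

Let Fmeas_v k : (k < n)%N -> Fmeas k (v k.+1).
Proof. by move=> kn; apply: measurable_funB; [exact: measurable_cst|exact: Fmeas_VS]. Qed.

Let Fmeas_y k : (k <= n)%N -> Fmeas k (fun w => Y k w - t).
Proof. by move=> kn; apply: measurable_funB; [exact: Fmeas_Y|exact: measurable_cst]. Qed.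

Let Fmeas_kap k : (k < n)%N -> Fmeas k (kap k).
Proof.
move=> kn; apply: measurable_powRl; apply: measurable_funD; first exact: Fmeas_v.
by apply: measurable_funX; exact: Fmeas_y (ltnW kn).
Qed.

Let kap_bd k w : (k < n)%N -> 0 <= kap k w <= v0 `^ (- p).
Proof.
move=> kn; rewrite powR_ge0/= powR_anti//; first by have := r0; lra.
by apply: le_trans (v_ge w kn) _; rewrite lerDl sqr_ge0.
Qed.

Let isq_bd k w : (k <= n)%N -> 0 <= isq (v k w) <= isq v0.
Proof. by move=> kn; rewrite isq_ge0/= powR_anti// v_ge. Qed.

Let mT_U k : (k <= n)%N -> measurable_fun setT (U k).
Proof.
move=> kn; apply: measurable_Phi; apply: measurable_funM.
  exact: (Fmeas_T kn (Fmeas_y kn)).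
apply: measurable_isq; apply: measurable_funB => //; exact: (Fmeas_T kn (Fmeas_V kn)).
Qed.

Let Ig_Phi f : measurable_fun setT f -> Ig Q (fun w => Phi (f w)).
Proof.
move=> mf; apply: (@Ig_bdd _ _ _ _ 1); first exact: measurable_Phi.
by move=> w; rewrite ger0_norm ?Phi_ge0 ?Phi_le1.
Qed.

Let Ig_U k : (k <= n)%N -> Ig Q (U k).
Proof.
move=> kn; apply: (@Ig_bdd _ _ _ _ 1); first exact: mT_U.
by move=> w; rewrite ger0_norm ?Phi_ge0 ?Phi_le1.
Qed.

Lemma Ig_s_kernel k : (k < n)%N -> Ig Q (fun w => s k.+1 w * kap k w).
Proof.
move=> kn; rewrite (_ : (fun _ => _) = fun w => kap k w * s k.+1 w); last first.
  by apply/funext => w; rewrite mulrC.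
apply: (@Ig_bM _ _ _ _ (v0 `^ (- p))) (Ig_s kn).
  exact: (Fmeas_T (ltnW kn) (Fmeas_kap kn)).
by move=> w; have /andP[h1 h2] := kap_bd w kn; rewrite ger0_norm.
Qed.

Lemma Ig_s_isq k : (k < n)%N -> Ig Q (fun w => s k.+1 w * isq (v k.+1 w)).
Proof.
move=> kn; rewrite (_ : (fun _ => _) = fun w => isq (v k.+1 w) * s k.+1 w); last first.
  by apply/funext => w; rewrite mulrC.
apply: (@Ig_bM _ _ _ _ (isq v0)) (Ig_s kn).
  by apply: measurable_isq; exact: (Fmeas_T (ltnW kn) (Fmeas_v kn)).
by move=> w; have /andP[h1 h2] := isq_bd w kn; rewrite ger0_norm.
Qed.

(** Both [U_k] and [U_(k+1)] are expanded about [P0], which has the position of time [k] and the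
    remaining variance of time [k + 1]: in time for the former, in space for the latter. By the heat
    equation only [H1 eta] and [H2 (eta^2 - s) / 2] survive; [H1] and [H2] are known at time [k], so
    [approx_mds] applies. *)
Lemma lindeberg_step k : (k < n)%N ->
  `|Ex Q (U k.+1) - Ex Q (U k)| <= 400 * C0 * cphi *
     (eps `^ rho * Ex Q (fun w => s k.+1 w * kap k w) + a * Ex Q (fun w => s k.+1 w * isq (v k.+1 w))).
Proof.
move=> kn; have kn' := ltnW kn; have c1 : 1 <= cphi :> R := cphi_ge1.
have c0 : 0 <= cphi :> R by lra.
pose y w := Y k w - t.
pose H1 w := u_y (y w) (v k.+1 w).
pose H2 w := u_yy (y w) (v k.+1 w).
have mv := Fmeas_v kn; have my := Fmeas_y kn'.
have mH1 : Fmeas k H1 by apply: measurable_u_y.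
have mH2 : Fmeas k H2 by apply: measurable_u_yy.
have bH1 w : `|H1 w| <= isq v0.
  by apply: le_trans (abs_u_y _ _) _; have /andP[] := isq_bd w kn.
have bH2 w : `|H2 w| <= cphi * v0^-1.
  apply: le_trans (abs_u_yy_le _ (v_gt0 w kn)) _; apply: ler_wpM2l => //.
  by rewrite lef_pV2 ?posrE ?v_gt0 ?v_ge.
have bkap w : `|kap k w| <= v0 `^ (- p) by have /andP[h1 h2] := kap_bd w kn; rewrite ger0_norm.
have [M1 _ _] := moments kn mH1 (ex_intro _ _ bH1).
have [_ M2 _] := moments kn mH2 (ex_intro _ _ bH2).
have [_ _ M3] := moments kn (Fmeas_kap kn) (ex_intro _ _ bkap).
have mT f := @Fmeas_T k f kn'.
have I1 : Ig Q (fun w => H1 w * eta k.+1 w) by apply: Ig_bM bH1 (Ig_eta kn); exact: mT.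
have I2 : Ig Q (fun w => H2 w * (eta k.+1 w ^+ 2 - s k.+1 w)).
  by apply: Ig_bM bH2 (IgB (Ig_eta2 kn) (Ig_s kn)); exact: mT.
have I2a : Ig Q (fun w => H2 w * (eta k.+1 w ^+ 2)).
  by apply: Ig_bM bH2 (Ig_eta2 kn); exact: mT.
have I2b : Ig Q (fun w => H2 w * s k.+1 w).
  by apply: Ig_bM bH2 (Ig_s kn); exact: mT.
pose P0 w := Phi (y w * isq (v k.+1 w)).
have IP0 : Ig Q P0.
  apply: Ig_Phi; apply: mT; apply: measurable_funM => //; exact: measurable_isq.
pose R1 w := U k.+1 w - P0 w - H1 w * eta k.+1 w - 2^-1 * (H2 w * eta k.+1 w ^+ 2).
pose R2 w := U k w - P0 w - 2^-1 * (H2 w * s k.+1 w).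
have IR1 : Ig Q R1 := IgB (IgB (IgB (Ig_U kn) IP0) I1) (IgZ 2^-1 I2a).
have IR2 : Ig Q R2 := IgB (IgB (Ig_U kn') IP0) (IgZ 2^-1 I2b).
have E0 : Ex Q (U k.+1) - Ex Q (U k) = Ex Q R1 - Ex Q R2 + Ex Q (fun w => H1 w * eta k.+1 w)
    + 2^-1 * Ex Q (fun w => H2 w * (eta k.+1 w ^+ 2 - s k.+1 w)).
  have Ia := IgB IR1 IR2; have Ib := IgD Ia I1; have Ic := IgZ 2^-1 I2.
  rewrite -(ExZ 2^-1 I2) -(ExB (Ig_U kn) (Ig_U kn')) -(ExB IR1 IR2) -(ExD Ia I1) -(ExD Ib Ic).
  apply: Ex_eq => w; rewrite /R1 /R2.
  move: (U k.+1 w) (U k w) (P0 w) (H1 w) (H2 w) (eta k.+1 w) (s k.+1 w) => *; ring.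
have Iks := Ig_s_kernel kn; have Iis := Ig_s_isq kn.
set K := Ex Q (fun w => s k.+1 w * kap k w) in M3 *.
set S := Ex Q (fun w => s k.+1 w * isq (v k.+1 w)).
have K0 : 0 <= K by apply: Ex_ge0 => w; apply: mulr_ge0; [exact: s0|have /andP[] := kap_bd w kn].
have S0 : 0 <= S by apply: Ex_ge0 => w; apply: mulr_ge0; [exact: s0|exact: isq_ge0].
have e0 : 0 <= eps `^ rho by exact: powR_ge0.
have B1 : `|Ex Q R1| <= 300 * C0 * cphi * (eps `^ rho * K).
  have Ike : Ig Q (fun w => kap k w * `|eta k.+1 w| `^ (2 + rho)).
    by apply: Ig_bM bkap (Ig_etap kn); apply: mT; exact: Fmeas_kap.
  apply: (@le_trans _ _ (300 * cphi * Ex Q (fun w => `|kap k w| * `|eta k.+1 w| `^ (2 + rho)))).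
    rewrite (_ : (fun w => `|kap k w| * _) = fun w => kap k w * `|eta k.+1 w| `^ (2 + rho)); last first.
      by apply/funext => w; have /andP[h1 h2] := kap_bd w kn; rewrite ger0_norm.
    rewrite -ExZ//; apply: Ex_abs_le => //; first exact: IgZ.
    move=> w; have r01 : 0 <= rho <= 1 by rewrite (ltW r0) r1.
    have := lindeberg_space (y w) (eta k.+1 w) r01 (v_gt0 w kn).
    rewrite (mulrC (kap k w)); apply: le_trans.
    rewrite le_eqVlt; apply/orP; left; apply/eqP; congr (`|_|).
    rewrite /R1 /U /P0 /H1 /H2 psumS -/(y w).
    have -> : Y k w + eta k.+1 w - t = y w + eta k.+1 w by rewrite /y addrAC.
    move: (eta k.+1 w) (u_yy _ _) (u_y _ _) (Phi _) (Phi _) => *; by field.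
  rewrite (_ : 300 * C0 * cphi * (eps `^ rho * K) = 300 * cphi * (C0 * eps `^ rho * K)); last by ring.
  have c3 : 0 <= 300 * cphi :> R by rewrite mulr_ge0// (le_trans ler01 cphi_ge1).
  apply: (ler_wpM2l c3); apply: le_trans M3 _; apply: (ler_wpM2l (mulr_ge0 C0_ge0 e0)).
  rewrite /K le_eqVlt; apply/orP; left; apply/eqP; apply: Ex_eq => w.
  by have /andP[h1 h2] := kap_bd w kn; rewrite ger0_norm// mulrC.
have B2 : `|Ex Q R2| <= 64 * cphi * (eps `^ rho * K).
  rewrite mulrA /K -ExZ//; apply: Ex_abs_le => //; first exact: IgZ.
  move=> w; have r01 : 0 <= rho <= 1 by rewrite (ltW r0) r1.
  have sv : 0 <= s k.+1 w <= v k.+1 w.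
    by rewrite s0/= (le_trans (s_eps _ _))// (le_trans eps_v0)// v_ge.
  have := lindeberg_time (y w) r01 (ltW eps0) (v_gt0 w kn) sv (s_eps _ _).
  have -> : v k.+1 w + s k.+1 w = v k w by rewrite /v psumS opprD addrA subrK.
  rewrite -/(kap k w) => h; apply: le_trans (le_trans _ h) _; last first.
    by rewrite le_eqVlt; apply/orP; left; apply/eqP; ring.
  rewrite le_eqVlt; apply/orP; left; apply/eqP; congr (`|_|).
  rewrite /R2 /U /P0 /H2 -/(y w); move: (s k.+1 w) (u_yy _ _) (Phi _) (Phi _) => *; by field.
have B3 : `|Ex Q (fun w => H1 w * eta k.+1 w)| <= C0 * (a * S).
  have I1s : Ig Q (fun w => `|H1 w| * s k.+1 w).
    apply: (@Ig_bM _ _ _ _ (isq v0)) (Ig_s kn); last by move=> w; rewrite normr_id.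
    by apply: measurableT_comp => //; exact: mT.
  apply: le_trans M1 _; rewrite -mulrA; apply: (ler_wpM2l C0_ge0); apply: (ler_wpM2l a_ge0).
  apply: (Ex_le I1s Iis) => w; rewrite mulrC; apply: (ler_wpM2l (s0 _ _)); exact: abs_u_y.
have B4 : `|Ex Q (fun w => H2 w * (eta k.+1 w ^+ 2 - s k.+1 w))| <= C0 * cphi * (eps `^ rho * K + a * S).
  have I2s : Ig Q (fun w => `|H2 w| * s k.+1 w).
    apply: (@Ig_bM _ _ _ _ (cphi * v0^-1)) (Ig_s kn); last by move=> w; rewrite normr_id.
    by apply: measurableT_comp => //; exact: mT.
  apply: le_trans M2 _; set X' := Ex Q (fun w => `|H2 w| * s k.+1 w).
  rewrite (_ : C0 * b * X' = C0 * (eps `^ rho * (lam `^ rho * X'))); last by ring.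
  rewrite (_ : C0 * cphi * _ = C0 * (eps `^ rho * (cphi * (K + lam `^ (1 + rho) * S)))); last by ring.
  apply: (ler_wpM2l C0_ge0); apply: (ler_wpM2l e0); rewrite /X'.
  have J1 := IgZ (lam `^ (1 + rho)) Iis; have J2 := IgD Iks J1.
  rewrite -(ExZ _ I2s) /K /S -(ExZ _ Iis) -(ExD Iks J1) -(ExZ _ J2).
  apply: (Ex_le (IgZ _ I2s) (IgZ _ J2)) => w.
  have r01 : 0 <= rho <= 1 by rewrite (ltW r0) r1.
  have := ler_wpM2l (s0 k.+1 w) (abs_u_yy (y w) r01 lam0 (v_gt0 w kn)).
  rewrite -/(H2 w) -/(y w) => h.
  rewrite (_ : lam `^ rho * _ = s k.+1 w * (lam `^ rho * `|H2 w|)); last by ring.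
  by apply: le_trans h _; rewrite le_eqVlt; apply/orP; left; apply/eqP; rewrite /kap; ring.
rewrite E0; set X := Ex Q (fun w => H1 w * _) in B3 *; set Z := Ex Q (fun w => H2 w * _) in B4 *.
have EK0 : 0 <= eps `^ rho * K := mulr_ge0 e0 K0.
have aS0 : 0 <= a * S := mulr_ge0 a_ge0 S0.
set ek := eps `^ rho * K in B1 B2 B4 EK0 *; set as_ := a * S in B3 B4 aS0 *.
have Cc : cphi <= C0 * cphi by rewrite ler_peMl.
have CC0 : C0 <= C0 * cphi by rewrite (ler_peMr C0_ge0).
have b1 : `|Ex Q R1| <= 300 * (C0 * cphi * ek).
  by rewrite [leRHS](_ : _ = 300 * C0 * cphi * ek); [exact: B1|ring].
have b2 : `|Ex Q R2| <= 64 * (C0 * cphi * ek).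
  apply: le_trans B2 _; rewrite -mulrA; apply: (ler_wpM2l (ler0n _ _)); exact: (ler_wpM2r EK0 Cc).
have b3 : `|X| <= C0 * cphi * as_ by apply: le_trans B3 _; exact: (ler_wpM2r aS0 CC0).
have b4 : `|2^-1 * Z| <= C0 * cphi * ek + C0 * cphi * as_.
  rewrite -mulrDr; apply: le_trans B4; rewrite normrM ger0_norm//.
  by rewrite ler_piMl// invf_le1// ler1n.
rewrite (_ : 400 * C0 * cphi * (ek + as_) = 400 * (C0 * cphi * ek) + 400 * (C0 * cphi * as_)); last by ring.
have e1 : 0 <= C0 * cphi * ek := mulr_ge0 (mulr_ge0 C0_ge0 c0) EK0.
have e2 : 0 <= C0 * cphi * as_ := mulr_ge0 (mulr_ge0 C0_ge0 c0) aS0.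
exact: (ler_norm4 b1 b2 b3 b4 e1 e2).
Qed.

End lindeberg.

End approx_mds.

(** * Dyadic sums and small balls *)

Section dyadic.
Context {R : realType}.
Implicit Types (q r : R).

Lemma powR_exp2 q j : ((2 : R) ^+ j) `^ q = (2 `^ q) ^+ j.
Proof. by rewrite -[2 ^+ j]powR_mulrn// -powRrM mulrC powRrM powR_mulrn ?powR_ge0. Qed.

Lemma powR2_gt1 q : 0 < q -> 1 < (2 : R) `^ q.
Proof.
move=> q0; have : 1 `^ q < (2 : R) `^ q by rewrite gt0_ltr_powR ?nnegrE// ltr1n.
by rewrite powR1.
Qed.

Lemma powR2N_lt1 q : 0 < q -> (2 : R) `^ (- q) < 1.
Proof. by move=> q0; rewrite powRN invf_lt1 ?powR_gt0// powR2_gt1. Qed.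

Lemma dyadic_sumN q r J : 0 < q -> 0 < r ->
  \sum_(0 <= j < J) (2 ^+ j * r) `^ (- q) <= r `^ (- q) / (1 - 2 `^ (- q)).
Proof.
move=> q0 r0; set x := 2 `^ (- q); have x1 : x < 1 := powR2N_lt1 q0.
have x0 : 0 <= x by exact: powR_ge0.
have y0 : 0 <= r `^ (- q) by exact: powR_ge0.
have d0 : 0 < 1 - x by lra.
rewrite ler_pdivlMr//.
suff : (\sum_(0 <= j < J) (2 ^+ j * r) `^ (- q)) * (1 - x) <= r `^ (- q) * (1 - x ^+ J).
  by move=> /le_trans; apply; rewrite ler_piMr// lerBlDr lerDl exprn_ge0.
elim: J => [|J IH]; first by rewrite big_geq// mul0r expr0 subrr mulr0.
rewrite big_nat_recr//= mulrDl powRM ?(ltW r0)// powR_exp2 -/x exprS; nra.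
Qed.

Lemma dyadic_sum q r J : 0 < q -> 0 < r ->
  \sum_(0 <= j < J) (2 ^+ j * r) `^ q <= (2 ^+ J * r) `^ q / (2 `^ q - 1).
Proof.
move=> q0 r0; set x := 2 `^ q; have x1 : 1 < x := powR2_gt1 q0.
have d0 : 0 < x - 1 by lra.
rewrite ler_pdivlMr//.
elim: J => [|J IH]; first by rewrite big_geq// mul0r powR_ge0.
rewrite big_nat_recr//= mulrDl; apply: le_trans (lerD IH (lexx _)) _.
rewrite !powRM ?(ltW r0)// !powR_exp2 -/x exprS; have := powR_ge0 r q; nra.
Qed.

Lemma dyadic_stop r : 0 < r -> r <= 1 -> exists J : nat, 2^-1 <= 2 ^+ J * r <= 1.
Proof.
move=> r0 r1.
have [N hN] : exists N : nat, 1 < 2 ^+ N * r.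
  exists (truncn r^-1).+1; rewrite -ltr_pdivrMr// mul1r.
  apply: lt_le_trans (truncnS_gt _) _; rewrite -natrX ler_nat ltnW// ltn_expl//.
have exN : exists N : nat, 1 < 2 ^+ N * r by exists N.
case: (ex_minnP exN) => -[|J] hJ mJ; first by move: hJ; rewrite expr0 mul1r ltNge r1.
exists J; apply/andP; split; first by move: hJ; rewrite exprS; lra.
by rewrite leNgt; apply/negP => /mJ; rewrite ltnn.
Qed.

(** The number of dyadic scales between [r] and 1, from [ln 2 >= 1 / 2]: the source of the logarithm
    when [rho = 1]. *)
Lemma dyadic_count r J : 0 < r -> 2 ^+ J * r <= 1 -> J%:R <= 2 * `|ln r|.
Proof.
move=> r0 h; have r1 : r <= 1.
  by apply: le_trans h; rewrite ler_peMl ?(ltW r0)// exprn_ege1// ler1n.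
rewrite ler0_norm ?ln_le0//.
have h2 : ln (2 ^+ J * r) <= 0 by apply: ln_le0.
have l2 : 2^-1 <= ln 2 :> R.
  have h3 : -1 < - 2^-1 :> R by lra.
  have := le_ln1Dx h3; rewrite (_ : 1 + - 2^-1 = 2^-1 :> R); last by lra.
  by rewrite lnV ?posrE//; lra.
move: h2; rewrite lnM ?posrE ?exprn_gt0// lnXn// => h2.
have : J%:R * 2^-1 <= J%:R * ln 2 :> R by rewrite ler_wpM2l.
move: h2; rewrite -[ln 2 *+ J]mulr_natl; move: (J%:R * ln 2) => z; lra.
Qed.

End dyadic.

Section dyadic_Ex.
Context {d} {T : measurableType d} {R : realType}.
Variables (Q : probability T R) (Y : T -> R) (kap : R).
Hypotheses (mY : measurable_fun setT Y)
  (KS : forall t, `|Pr Q [set w | Y w <= t] - Phi t| <= kap).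

Lemma measurable_maxdist r t : measurable_fun setT (fun w => Num.max r `|Y w - t|).
Proof.
apply: measurable_maxr => //; apply: measurableT_comp => //.
exact: measurable_funB.
Qed.

Lemma Ig_maxdist q r t : 0 <= q -> 0 < r -> Ig Q (fun w => Num.max r `|Y w - t| `^ (- q)).
Proof.
move=> q0 r0; apply: (@Ig_bdd _ _ _ _ (r `^ (- q))).
  by apply: measurable_powRl; exact: measurable_maxdist.
by move=> w; rewrite ger0_norm ?powR_ge0//; apply: powR_anti => //; rewrite le_max lexx.
Qed.

(** Integrates [dyadic_le]: the ball of radius [2^(j+1) r] has mass at most [4 2^j r + 2 kap]. The
    part with [kap] is summed as a geometric series; the other one is kept as a sum because its size
    depends on whether [q] is below, at or above 1. *)
Lemma dyadic_Ex (q r t : R) J : 0 < q -> 0 < r ->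
  Ex Q (fun w => Num.max r `|Y w - t| `^ (- q)) <=
  4 * (\sum_(0 <= j < J) (2 ^+ j * r) `^ (1 - q)) + 2 * kap * (r `^ (- q) / (1 - 2 `^ (- q)))
    + (2 ^+ J * r) `^ (- q).
Proof.
move=> q0 r0; have k0 : 0 <= kap by exact: le_trans (normr_ge0 _) (KS 0).
have mball e : measurable_fun setT (fun w => `|Y w - t| <= e).
  by apply: measurable_fun_ler => //; apply: measurableT_comp => //; exact: measurable_funB.
have mset e : measurable [set w | `|Y w - t| <= e].
  by rewrite -[X in measurable X]setTI; exact: mball.
pose g (j : nat) w := (2 ^+ j * r) `^ (- q) * (`|Y w - t| <= 2 ^+ j.+1 * r)%R%:R.
have Ig1 j : Ig Q (fun w => (`|Y w - t| <= 2 ^+ j.+1 * r)%R%:R) by apply: Ig_bool; exact: mball.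
have Igg j : Ig Q (g j) := IgZ _ (Ig1 j).
have S1 := Ig_sum (index_iota 0 J) Igg.
have C1 := Ig_cst Q ((2 ^+ J * r) `^ (- q)).
apply: le_trans (Ex_le (Ig_maxdist t (ltW q0) r0) (IgD S1 C1) _) _.
  by move=> w; exact: dyadic_le (ltW q0) r0.
rewrite ExD// Ex_cst (Ex_sum _ Igg) lerD2r.
apply: (@le_trans _ _ (\sum_(0 <= j < J) (4 * (2 ^+ j * r) `^ (1 - q) + 2 * kap * (2 ^+ j * r) `^ (- q)))).
  apply: ler_sum => j _; rewrite /g ExZ// Ex_bool//.
  have x0 : 0 < 2 ^+ j * r by rewrite mulr_gt0 ?exprn_gt0.
  have h := KS_ball mY KS t (mulr_ge0 (exprn_ge0 j.+1 (ler0n _ 2)) (ltW r0)).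
  rewrite powRD ?(gt_eqF x0) ?implybT// powRr1 ?(ltW x0)//.
  have := ler_wpM2l (powR_ge0 (2 ^+ j * r) (- q)) h; rewrite exprS; lra.
rewrite big_split/= -!mulr_sumr lerD2l; apply: ler_wpM2l; first by rewrite mulr_ge0.
exact: dyadic_sumN.
Qed.

(** For exponent 2 both series are dominated by the smallest scale; [J] is taken so large that the
    last term is at most [1 / r]. *)
Lemma dyadic_Ex2 (r t : R) : 0 < r ->
  Ex Q (fun w => Num.max r `|Y w - t| `^ (- 2)) <= 9 / r + 3 * kap / r ^+ 2.
Proof.
move=> r0; have k0 : 0 <= kap by exact: le_trans (normr_ge0 _) (KS 0).
have [J hJ] : exists J : nat, r^-1 < 2 ^+ J.
  exists (truncn r^-1).+1; apply: lt_le_trans (truncnS_gt _) _.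
  by rewrite -natrX ler_nat ltnW// ltn_expl.
have rE : r `^ (- 2) = (r ^+ 2)^-1 by rewrite powRN (powR_mulrn 2)// ltW.
apply: le_trans (dyadic_Ex t J _ r0) _ => //.
have -> : 1 - 2 = -1 :> R by lra.
have s1 := dyadic_sumN J (@ltr01 R) r0.
have x0 : 0 < 2 ^+ J * r by rewrite mulr_gt0 ?exprn_gt0.
have -> : (2 ^+ J * r) `^ (- 2) = ((2 ^+ J * r) ^+ 2)^-1 by rewrite powRN (powR_mulrn 2)// ltW.
have -> : 2 `^ (- 2) = 4^-1 :> R by rewrite powRN (powR_mulrn 2)// -natrX.
rewrite rE; move: s1; rewrite !powR_inv1 ?(ltW r0)// => s1.
have s2 : ((2 ^+ J * r) ^+ 2)^-1 <= r^-1.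
  have x1 : 1 <= 2 ^+ J * r by rewrite -ler_pdivrMr// mul1r ltW.
  rewrite lef_pV2 ?posrE ?exprn_gt0 ?mulr_gt0 ?exprn_gt0//.
  rewrite exprMn expr2; have : 1 <= (2 ^+ J : R) by rewrite exprn_ege1// ler1n.
  nra.
have p2 : 0 <= kap / r ^+ 2 by rewrite divr_ge0// sqr_ge0.
have -> : 2 * kap * (r ^- 2 / (1 - 4^-1)) = 8 / 3 * (kap / r ^+ 2) by field; rewrite gt_eqF.
move: s1; rewrite (_ : r^-1 / (1 - 2^-1) = 2 * r^-1) -?[3 * kap / _]mulrA; last by field; rewrite gt_eqF.
move: (kap / _) p2 (\sum_(_ <= _ < _) _) s2 => z p2 u s2 s1; lra.
Qed.

End dyadic_Ex.

Lemma powR4_le8 {R : realType} (q : R) : q <= 3 / 2 -> 4 `^ q <= 8.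
Proof.
move=> q32; have -> : 8 = 4 `^ (3 / 2) :> R.
  have {1}-> : 4 = 2 `^ 2 :> R by rewrite powR_mulrn// -natrX.
  by rewrite -powRrM (_ : 2 * (3 / 2) = 3%:R :> R) ?powR_mulrn// -?natrX//; lra.
by rewrite ler_powR// ler1n.
Qed.

Lemma kernel_arg_le {R : realType} (v1 v2 s e r q : R) :
  v1 = v2 + s -> s <= e -> e <= r -> r <= v2 -> 0 <= q -> v1 + v1 + q <= 4 * (v2 + q).
Proof. lra. Qed.

Section telescoping.
Context {R : realType}.
Implicit Types (v : nat -> R) (q B : R).

Lemma dist_le_sum (f : nat -> R) n : `|f n - f 0| <= \sum_(i < n) `|f i.+1 - f i|.
Proof.
elim: n => [|n IH]; first by rewrite big_ord0 subrr normr0.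
rewrite big_ord_recr/=; apply: le_trans (lerD IH (lexx _)).
by rewrite -[f n.+1 - _](subrKA (f n)) addrC ler_normD.
Qed.

(** Comparison of a Riemann sum with the integral of [x^(-q-1)]. The integrand is taken at [v_i],
    the left value of each step, so that the tangent inequality goes in the right direction. *)
Lemma sum_powR_telescope v n q B : 0 < q -> 0 <= B -> (forall k, (k <= n)%N -> 0 < v k) ->
  \sum_(i < n) (v i - v i.+1) * (v i + B) `^ (- (q + 1)) <= q^-1 * (v n + B) `^ (- q).
Proof.
move=> q0 B0; elim: n => [|n IH] vp; first by rewrite big_ord0 mulr_ge0 ?powR_ge0 ?invr_ge0// ltW.
rewrite big_ord_recr/=; apply: le_trans (lerD (IH _) (lexx _)) _.
  by move=> k kn; apply: vp; exact: leqW.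
have v0 : 0 < v n + B by rewrite ltr_pwDl// vp.
have v1 : 0 < v n.+1 + B by rewrite ltr_pwDl// vp.
have := powR_tangent (ltW q0) v0 v1.
set x := _ `^ (- (q + 1)); set y := _ `^ (- q); set z := _ `^ (- q).
rewrite (_ : v n.+1 + B - (v n + B) = - (v n - v n.+1)); last by ring.
move=> h; rewrite -(ler_pM2l q0) mulrDr !mulrA divff ?gt_eqF// !mul1r; lra.
Qed.

(** Here the integrand is taken at the smaller end of each step; [v_i <= 2 v_(i+1)] makes the two
    ends comparable, at the cost of the constant 3. *)
Lemma sum_isq_telescope v n : (forall k, (k <= n)%N -> 0 < v k) ->
  (forall k, (k < n)%N -> v k.+1 <= v k <= 2 * v k.+1) ->
  \sum_(i < n) (v i - v i.+1) * isq (v i.+1) <= 3 * (Num.sqrt (v 0) - Num.sqrt (v n)).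
Proof.
elim: n => [|n IH] vp vv; first by rewrite big_ord0 subrr mulr0.
rewrite big_ord_recr/=; apply: le_trans (lerD (IH _ _) (lexx _)) _.
- by move=> k kn; apply: vp; exact: leqW.
- by move=> k kn; apply: vv; exact: ltnW.
have v0 := vp n (leqnSn n); have v1 := vp n.+1 (leqnn _).
have /andP[h1 h2] := vv n (ltnSn n).
have x1 : 0 < Num.sqrt (v n.+1) by rewrite sqrtr_gt0.
have h3 : Num.sqrt (v n.+1) <= Num.sqrt (v n) by rewrite ler_sqrt ?(ltW v0).
have h4 : Num.sqrt (v n) <= 2 * Num.sqrt (v n.+1).
  rewrite -(@ger0_norm _ 2)// -sqrtr_sqr -sqrtrM ?sqr_ge0// ler_sqrt ?mulr_gt0//; lra.
suff : (v n - v n.+1) / Num.sqrt (v n.+1) <= 3 * (Num.sqrt (v n) - Num.sqrt (v n.+1)).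
  by rewrite isqE ?(ltW v1)//; lra.
rewrite ler_pdivrMr//.
have := sqr_sqrtr (ltW v0); have := sqr_sqrtr (ltW v1); nra.
Qed.

End telescoping.

Section berry_esseen.
Context {d} {T : measurableType d} {R : realType}.
Variables (Q : probability T R) (n : nat) (F : nat -> set (set T)) (eta s : nat -> T -> R).
Variables (rho eps lam C0 : R).
Hypothesis amds : approx_mds Q n F eta s rho eps lam C0.
Hypothesis rho01 : 0 < rho <= 1.
Hypothesis eps0 : 0 < eps.
Hypothesis lam0 : 0 <= lam.
Hypothesis C01 : 1 <= C0.

Local Notation Y := (psum eta).
Local Notation V := (psum s).
Local Notation a := (lam `^ (1 + rho) * eps `^ rho).
Local Notation b := (lam `^ rho * eps `^ rho).
Local Notation p := (1 + rho / 2).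

Hypotheses (aC : C0 * a <= 32^-1) (bC : C0 * b <= 8^-1).
Variables (c r : R).
Hypotheses (r01 : 0 < r <= 1) (eps_r : eps <= r) (c2 : c <= 9 / 4)
  (Vc : forall w, V n w + r ^+ 2 <= c).

Let r0 : 0 < r. Proof. by case/andP: r01. Qed.
Let rho0 : 0 < rho. Proof. by case/andP: rho01. Qed.
Let rho1 : rho <= 1. Proof. by case/andP: rho01. Qed.
Let C00 : 0 <= C0. Proof. exact: le_trans C01. Qed.
Let v00 : 0 < r ^+ 2. Proof. by rewrite exprn_gt0. Qed.
Let eps_v : eps ^+ 2 <= r ^+ 2. Proof. by rewrite ler_pXn2r ?nnegrE// ltW. Qed.
Let a0 : 0 <= a. Proof. by rewrite mulr_ge0 ?powR_ge0. Qed.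
Let b0 : 0 <= b. Proof. by rewrite mulr_ge0 ?powR_ge0. Qed.

Let s0 k w : 0 <= s k w. Proof. by case: amds => _ _ _ /(_ k w) /andP[]. Qed.
Let s_eps k w : s k w <= eps ^+ 2. Proof. by case: amds => _ _ _ /(_ k w) /andP[]. Qed.

Let v k w := c - V k w.

Let v_ge k w : (k <= n)%N -> r ^+ 2 <= v k w.
Proof.
by move=> kn; rewrite /v lerBrDr addrC; apply: le_trans (Vc w); rewrite lerD2r (V_homo amds).
Qed.

Let v_gt0 k w : (k <= n)%N -> 0 < v k w.
Proof. by move=> kn; apply: lt_le_trans (v_ge w kn). Qed.

Let v_le k w : v k w <= 9 / 4.
Proof. by apply: le_trans c2; rewrite gerBl (V_ge0 amds). Qed.

Let vS k w : v k.+1 w = v k w - s k.+1 w.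
Proof. by rewrite /v psumS opprD addrA. Qed.

Let p0 : 0 <= p. Proof. by have := rho0; lra. Qed.
Let p4_le8 : 4 `^ p <= 8 :> R. Proof. by apply: powR4_le8; have := rho1; lra. Qed.

(** [jensen_bound] with weight [s_(k+1)] and [W = v_k]. Its potential at time [k] is
    [2 v_k + (Y_k - t)^2], at most 4 times the kernel argument on the left, and [4^p <= 8]. At time
    [n] the nonnegative term [v_n] is dropped, which leaves [v_k], as [sum_powR_telescope]
    requires. *)
Lemma s_kernel_le k t : (k < n)%N ->
  Ex Q (fun w => s k.+1 w * (v k.+1 w + (Y k w - t) ^+ 2) `^ (- p)) <=
  8 * expR 1 * Ex Q (fun w => s k.+1 w * (v k w + (Y n w - t) ^+ 2) `^ (- p)).
Proof.
move=> kn; have kn' := ltnW kn.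
have mv : Fmeas F k (v k) by apply: measurable_funB; [exact: measurable_cst|exact: (Fmeas_V amds)].
have ms : Fmeas F k (s k.+1) by case: amds => _ _ /(_ k kn) [].
have mT (f : T -> R) : Fmeas F k f -> measurable_fun setT f by move=> h; exact: (Fmeas_T amds kn' h).
have mTn (f : T -> R) : Fmeas F n f -> measurable_fun setT f by move=> h; exact: (Fmeas_T amds (leqnn n) h).
have mYk := mT _ (Fmeas_Y amds kn'); have mYn := mTn _ (Fmeas_Y amds (leqnn n)).
have mVn := mTn _ (Fmeas_V amds (leqnn n)).
have Ig1 (g : T -> R) : measurable_fun setT g -> (forall w, r ^+ 2 <= g w) ->
    Ig Q (fun w => s k.+1 w * g w `^ (- p)).
  move=> mg gr; apply: (@Ig_bdd _ _ _ _ (eps ^+ 2 * (r ^+ 2) `^ (- p))).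
    by apply: measurable_funM; [exact: mT|exact: measurable_powRl].
  move=> w; rewrite normrM !ger0_norm ?powR_ge0// ler_pM ?powR_ge0//.
  exact: powR_anti.
pose beta w := C0 * (4 * a * isq (v k w) + 2 * b / v k w).
have mbeta : Fmeas F k beta.
  apply: measurable_funM; first exact: measurable_cst.
  apply: measurable_funD; apply: measurable_funM; try exact: measurable_cst.
    exact: measurable_isq.
  rewrite (_ : (fun w => (v k w)^-1) = fun w => v k w `^ (-1)); first exact: measurable_powRl.
  by apply/funext => w; rewrite powR_inv1// ltW// v_gt0.
have beta0 w : 0 <= beta w.
  have h1 : 0 <= 4 * a * isq (v k w) := mulr_ge0 (mulr_ge0 (ler0n _ 4) a0) (isq_ge0 _).
  have h2 : 0 <= 2 * b / v k w := divr_ge0 (mulr_ge0 (ler0n _ 2) b0) (ltW (v_gt0 w kn')).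
  exact: mulr_ge0 C00 (addr_ge0 h1 h2).
(* The bounds [1/32] and [1/8] on [C0 a] and [C0 b] are made for this: with [sqrt v <= 3 / 2], the
   product is at most [4 (1/32) (3/2) + 2 (1/8) < 1 / 2]. *)
have betaV w : beta w * (V n w - V k w) <= 2^-1.
  have vn := ltW (v_gt0 w (leqnn n)); have vk := v_gt0 w kn'.
  apply: (@le_trans _ _ (beta w * v k w)).
    by apply: (ler_wpM2l (beta0 w)); rewrite /v lerD2r; move: vn; rewrite subr_ge0.
  rewrite /beta isqE ?(ltW vk)//; set x := Num.sqrt (v k w).
  have x0 : 0 < x by rewrite sqrtr_gt0.
  have x1 : x <= 3 / 2.
    rewrite -(@ger0_norm _ (3/2))// -sqrtr_sqr ler_sqrt ?exprn_gt0//.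
    by apply: le_trans (v_le k w) _; lra.
  rewrite -(sqr_sqrtr (ltW vk)) -/x.
  rewrite (_ : _ * _ * _ = 4 * (C0 * a) * x + 2 * (C0 * b)); last by field; rewrite gt_eqF.
  have Ca := mulr_ge0 C00 a0; move: (C0 * a) (C0 * b) aC bC Ca => A B; nra.
have J := @jensen_bound _ _ _ _ _ _ _ _ _ _ _ _ amds rho01 C01 k (s k.+1) (v k) beta c t
  (r ^+ 2) (eps ^+ 2) kn' ms mv mbeta _ v00 (fun w => v_ge w kn') _ beta0 (fun w => lexx _) betaV.
apply: le_trans (_ : 8 * Ex Q (fun w => s k.+1 w * (v k w + (c - V k w) + (Y k w - t) ^+ 2) `^ (- p)) <= _).
  rewrite -ExZ; last first.
    apply: Ig1 => [|w].
      apply: measurable_funD; last by apply: measurable_funX; exact: measurable_funB.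
      by apply: mT; exact: measurable_funD.
    by rewrite -addrA ler_wpDr ?v_ge// addr_ge0 ?sqr_ge0// ltW// v_gt0.
  apply: Ex_le.
  - apply: Ig1 => [|w]; last by rewrite ler_wpDr ?v_ge// sqr_ge0.
    apply: measurable_funD; last by apply: measurable_funX; exact: measurable_funB.
    apply: mT; apply: measurable_funB; [exact: measurable_cst|exact: (Fmeas_VS amds)].
  - apply: IgZ; apply: Ig1 => [|w].
      apply: measurable_funD; last by apply: measurable_funX; exact: measurable_funB.
      by apply: mT; exact: measurable_funD.
    by rewrite -addrA ler_wpDr ?v_ge// addr_ge0 ?sqr_ge0// ltW// v_gt0.
  move=> w; rewrite -/(v k w) mulrCA; apply: (ler_wpM2l (s0 _ _)).
  have vk1 := v_gt0 w kn.
  set A := v k.+1 w + _; set B := v k w + (v k w) + _.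
  have A0 : 0 < A by rewrite ltr_pwDl ?sqr_ge0.
  have B0 : 0 < B := ltr_wpDr (sqr_ge0 _) (addr_gt0 (v_gt0 w kn') (v_gt0 w kn')).
  have BA : B <= 4 * A.
    have vE : v k w = v k.+1 w + s k.+1 w by rewrite vS subrK.
    exact: kernel_arg_le vE (s_eps k.+1 w) eps_v (v_ge w kn) (sqr_ge0 _).
  have A40 : 0 < 4 * A by rewrite mulr_gt0.
  have h := powR_anti p0 B0 BA.
  have h2 : A `^ (- p) = 4 `^ p * (4 * A) `^ (- p).
    by rewrite powRM ?(ltW A0)// mulrA -powRD ?subrr ?powRr0 ?mul1r// pnatr_eq0 implybT.
  rewrite h2; apply: ler_pM; rewrite ?powR_ge0//.
rewrite -mulrA; apply: ler_wpM2l => //; apply: le_trans (J _ _) _.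
- by move=> w; rewrite s0 s_eps.
- by move=> w; have := ltW (v_gt0 w (leqnn n)); rewrite subr_ge0.
apply: ler_wpM2l; first exact: expR_ge0.
apply: Ex_le.
- apply: Ig1 => [|w].
    apply: measurable_funD; last by apply: measurable_funX; exact: measurable_funB.
    apply: measurable_funD; [exact: mT|exact: measurable_funB].
  by rewrite -addrA ler_wpDr ?v_ge// addr_ge0 ?sqr_ge0// ltW// (v_gt0 w (leqnn n)).
- apply: Ig1 => [|w]; last by rewrite ler_wpDr ?v_ge// sqr_ge0.
  apply: measurable_funD; last by apply: measurable_funX; exact: measurable_funB.
  exact: mT.
move=> w; apply: (ler_wpM2l (s0 _ _)); apply: powR_anti => //.
  by rewrite ltr_pwDl ?sqr_ge0// v_gt0.
by rewrite lerD2r lerDl ltW// (v_gt0 w (leqnn n)).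
Qed.

(** Once every kernel is at time [n], the sum over [k] is done for a fixed path and telescopes to a
    multiple of [(v_n + (Y_n - t)^2)^(- rho / 2)], where [v_n >= r^2]. The drift terms telescope to
    [sqrt v_0 <= 3 / 2]. *)
Lemma lindeberg_sum t :
  `|Ex Q (fun w => Phi ((Y n w - t) * isq (c - V n w))) - Phi (- t * isq c)| <=
  400 * C0 * cphi * (16 * expR 1 / rho * eps `^ rho * Ex Q (fun w => Num.max r `|Y n w - t| `^ (- rho))
    + 9 / 2 * a).
Proof.
have mTn (f : T -> R) : Fmeas F n f -> measurable_fun setT f by move=> h; exact: (Fmeas_T amds (leqnn n) h).
have mT k (f : T -> R) : (k < n)%N -> Fmeas F k f -> measurable_fun setT f by move=> kn h; exact: (Fmeas_T amds (ltnW kn) h).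
have mYn := mTn _ (Fmeas_Y amds (leqnn n)).
have ms k : (k < n)%N -> Fmeas F k (s k.+1) by move=> kn; case: amds => _ _ /(_ k kn) [].
have Ik k : (k < n)%N -> Ig Q (fun w => s k.+1 w * (v k w + (Y n w - t) ^+ 2) `^ (- p)).
  move=> kn; apply: (@Ig_bdd _ _ _ _ (eps ^+ 2 * (r ^+ 2) `^ (- p))).
    apply: measurable_funM; first exact: (mT _ _ kn (ms _ kn)).
    apply: measurable_powRl; apply: measurable_funD.
      apply: measurable_funB => //; apply: (mT _ _ kn); exact: (Fmeas_V amds (ltnW kn)).
    by apply: measurable_funX; exact: measurable_funB.
  move=> w; rewrite normrM !ger0_norm ?powR_ge0// ler_pM ?powR_ge0//.
  by apply: powR_anti => //; rewrite ler_wpDr ?sqr_ge0// v_ge// ltnW.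
pose f k := Ex Q (fun w => Phi ((Y k w - t) * isq (c - V k w))).
have f0 : f 0 = Phi (- t * isq c).
  by rewrite -[RHS](Ex_cst Q); apply: Ex_eq => w; rewrite !psum0 sub0r subr0.
rewrite -f0 -/(f n); apply: le_trans (dist_le_sum f n) _.
have stp (i : 'I_n) := @lindeberg_step _ _ _ _ _ _ _ _ _ _ _ _ amds rho01 eps0 lam0 C01 c (r ^+ 2) t v00 eps_v Vc i (ltn_ord i).
apply: le_trans (ler_sum _ (fun i _ => stp i)) _.
rewrite -mulr_sumr; apply: ler_wpM2l.
  exact: mulr_ge0 (mulr_ge0 (ler0n _ 400) C00) (le_trans ler01 cphi_ge1).
rewrite big_split; apply: lerD; rewrite -mulr_sumr.
  rewrite (mulrC (16 * expR 1 / rho)) -[leRHS]mulrA; apply: ler_wpM2l; first exact: powR_ge0.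
  apply: (@le_trans _ _ (8 * expR 1 * \sum_(i < n) Ex Q (fun w => s i.+1 w * (v i w + (Y n w - t) ^+ 2) `^ (- p)))).
    by rewrite mulr_sumr; apply: ler_sum => i _; exact: s_kernel_le (ltn_ord i).
  have Iki (i : 'I_n) := Ik i (ltn_ord i).
  rewrite -(Ex_sum _ Iki) (_ : 16 * expR 1 / rho = 8 * expR 1 * (2 / rho)); last by field; rewrite gt_eqF.
  have Im := Ig_maxdist Q mYn t (ltW rho0) r0.
  rewrite -[leRHS]mulrA -(ExZ (2 / rho) Im); apply: ler_wpM2l; first by rewrite mulr_ge0 ?expR_ge0.
  apply: Ex_le => [||w]; [exact: Ig_sum|exact: IgZ|].
  have q0 : 0 < rho / 2 by rewrite divr_gt0.
  have := @sum_powR_telescope R (fun k => v k w) n _ _ q0 (sqr_ge0 (Y n w - t)) (fun k h => v_gt0 w h).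
  rewrite (_ : \sum_(i < n) _ = \sum_(i < n) s i.+1 w * (v i w + (Y n w - t) ^+ 2) `^ (- p)); last first.
    by apply: eq_bigr => i _; rewrite vS (addrC (rho / 2)); congr (_ * _); ring.
  move=> /le_trans; apply; rewrite (_ : (rho / 2)^-1 = 2 / rho); last by field; rewrite gt_eqF.
  apply: ler_wpM2l; first by rewrite divr_ge0// ltW.
  set m := Num.max r _; have m0 : 0 < m by rewrite lt_max r0.
  rewrite (_ : m `^ (- rho) = (m ^+ 2) `^ (- (rho / 2))); last first.
    rewrite -powR_mulrn ?(ltW m0)// -powRrM; congr (_ `^ _); lra.
  apply: powR_anti; [exact: ltW|by rewrite exprn_gt0|].
  rewrite /m; have := v_ge w (leqnn n); have := sqr_ge0 (Y n w - t).
  have := ltW v00; rewrite -(real_normK (num_real (Y n w - t))).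
  by case: (leP r `|Y n w - t|) => _ *; lra.
rewrite mulrC; apply: ler_wpM2r => //.
have Iki (i : 'I_n) := @Ig_s_isq _ _ _ _ _ _ _ _ _ _ _ _ amds c _ v00 Vc i (ltn_ord i).
rewrite -(Ex_sum _ Iki); apply: Ex_le_cst => [|w]; first exact: Ig_sum.
have := @sum_isq_telescope R (fun k => v k w) n (fun k h => v_gt0 w h).
rewrite (_ : \sum_(i < n) _ = \sum_(i < n) s i.+1 w * isq (v i.+1 w)); last first.
  by apply: eq_bigr => i _; rewrite vS; congr (_ * _); ring.
move=> h; apply: le_trans (h _) _.
  move=> k kn; have := vS k w; have := s_eps k.+1 w; have := v_ge w kn; have := eps_v.
  by have := s0 k.+1 w; move=> *; apply/andP; split; lra.
have : Num.sqrt (v 0 w) <= 3 / 2.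
  rewrite -(@ger0_norm _ (3/2))// -sqrtr_sqr ler_sqrt ?exprn_gt0//.
  by apply: le_trans (v_le 0 w) _; lra.
by have := sqrtr_ge0 (v n w); lra.
Qed.

End berry_esseen.

Section ae.
Context {d} {T : measurableType d} {R : realType}.
Variable Q : probability T R.

Lemma Ex_ae_ge0 (f : T -> R) : Ig Q f -> {ae Q, forall w, 0 <= f w} -> 0 <= Ex Q f.
Proof.
move=> If f0; rewrite (_ : Ex Q f = Ex Q (fun w => Num.max (f w) 0)); first by apply: Ex_ge0 => w; rewrite le_max lexx orbT.
rewrite /Ex /Rintegral; congr fine; apply: ae_eq_integral => //.
- exact/measurable_EFinP/(Ig_mf If).
- by apply/measurable_EFinP; apply: measurable_maxr => //; exact: Ig_mf If.
- by apply: filterS f0 => w h _ /=; rewrite max_l.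
Qed.

Lemma Ex_ae_le (f g : T -> R) : Ig Q f -> Ig Q g -> {ae Q, forall w, f w <= g w} -> Ex Q f <= Ex Q g.
Proof.
move=> If Ig_ fg; rewrite -subr_ge0 -ExB//; apply: Ex_ae_ge0; first exact: IgB.
by apply: filterS fg => w; rewrite subr_ge0.
Qed.

End ae.

Section smoothing.
Context {R : realType}.

(** Of the decay of the tail only [1 / z^2] is kept, which is what [dyadic_Ex2] can average. *)
Lemma Phi_smooth (v V2 D z : R) : 0 < v -> v <= V2 -> 0 < D -> D <= z ->
  1 - Phi (z * isq v) <= cphi * V2 * Num.max D `|z| `^ (- 2).
Proof.
move=> v0 vV D0 Dz; have z0 : 0 < z by exact: lt_le_trans Dz.
have i0 := isq_gt0 v0; have zi : 0 < z * isq v by rewrite mulr_gt0.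
rewrite (ger0_norm (ltW z0)) max_r// powRN (powR_mulrn 2) ?(ltW z0)//.
apply: le_trans (Phi_tail (ltW zi)) _; have c0 : 0 <= cphi :> R := le_trans ler01 cphi_ge1.
rewrite -mulrA; apply: (ler_wpM2l c0); rewrite exprMn isq2//.
rewrite -[leRHS]invrK lef_pV2 ?posrE.
- rewrite invfM invrK.
  apply: (@le_trans _ _ (z ^+ 2 / v)); last by lra.
  by rewrite mulrC ler_wpM2l ?sqr_ge0// lef_pV2 ?posrE// (lt_le_trans v0).
- by rewrite ltr_pwDl// divr_ge0 ?sqr_ge0// ltW.
- by rewrite invr_gt0 divr_gt0 ?exprn_gt0// (lt_le_trans v0).
Qed.

End smoothing.

(** * Smoothing, and closing the self-bounding inequality *)

Section be_step.
Context {d} {T : measurableType d} {R : realType}.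
Variables (Q : probability T R) (n : nat) (F : nat -> set (set T)) (eta s : nat -> T -> R).
Variables (rho eps lam C0 : R).
Hypothesis amds : approx_mds Q n F eta s rho eps lam C0.
Hypothesis rho01 : 0 < rho <= 1.
Hypothesis eps0 : 0 < eps.
Hypothesis lam0 : 0 <= lam.
Hypothesis C01 : 1 <= C0.

Local Notation Y := (psum eta).
Local Notation V := (psum s).
Local Notation a := (lam `^ (1 + rho) * eps `^ rho).
Local Notation b := (lam `^ rho * eps `^ rho).

Hypotheses (aC : C0 * a <= 32^-1) (bC : C0 * b <= 8^-1).
Variables (r del : R).
Hypotheses (r01 : 0 < r <= 1) (eps_r : eps <= r) (del01 : 0 <= del <= 2^-1)
  (Vle : forall w, V n w <= 1 + del ^+ 2) (Vge : {ae Q, forall w, 1 - del ^+ 2 <= V n w}).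

Let r0 : 0 < r. Proof. by case/andP: r01. Qed.
Let rho0 : 0 < rho. Proof. by case/andP: rho01. Qed.
Let rho1 : rho <= 1. Proof. by case/andP: rho01. Qed.

(** With this total variance the remainder [c - V_n] lies almost surely between [r^2] and [rp^2].
    The shift [D] is a large multiple of [rp], so that in [smooth_err] the Kolmogorov error comes
    back with a factor at most [1 / 8]. *)
Let c := 1 + (del ^+ 2 + r ^+ 2).
Let rp := r + 2 * del.
Let D := 24 * cphi * rp.

Let d0 : 0 <= del. Proof. by case/andP: del01. Qed.
Let c2 : c <= 9 / 4.
Proof. by have := r01; have := del01; rewrite /c; nra. Qed.
Let Vc w : V n w + r ^+ 2 <= c. Proof. by rewrite /c addrA lerD2r. Qed.
Let vn0 w : 0 < c - V n w.
Proof. by have r2 : 0 < r ^+ 2 := exprn_gt0 2 r0; have := Vc w; lra. Qed.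
Let rp0 : 0 < rp. Proof. by have := r0; have := d0; rewrite /rp; lra. Qed.
Let cphi0 : 0 < cphi :> R. Proof. exact: lt_le_trans cphi_ge1. Qed.
Let D0 : 0 < D. Proof. by rewrite /D !mulr_gt0. Qed.

Variables (kap : R) (J : nat).
Hypotheses (KS : forall t, `|Pr Q [set w | Y n w <= t] - Phi t| <= kap)
  (hJ : 2^-1 <= 2 ^+ J * r).

Let kap0 : 0 <= kap. Proof. exact: le_trans (normr_ge0 _) (KS 0). Qed.

Let mY : measurable_fun setT (Y n).
Proof. exact: (Fmeas_T amds (leqnn n) (Fmeas_Y amds (leqnn n))). Qed.
Let mV : measurable_fun setT (V n).
Proof. exact: (Fmeas_T amds (leqnn n) (Fmeas_V amds (leqnn n))). Qed.

Let E1 := 400 * C0 * cphi * (16 * expR 1 / rho * eps `^ rho *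
  (4 * (\sum_(0 <= j < J) (2 ^+ j * r) `^ (1 - rho)) + 2 * kap * (r `^ (- rho) / (1 - 2 `^ (- rho))) + 2)
   + 9 / 2 * a).

Let lind t : `|Ex Q (fun w => Phi ((Y n w - t) * isq (c - V n w))) - Phi (- t * isq c)| <= E1.
Proof.
apply: le_trans (lindeberg_sum amds rho01 eps0 lam0 C01 aC bC r01 eps_r c2 Vc t) _.
have c1 : 0 <= 400 * C0 * cphi := mulr_ge0 (mulr_ge0 (ler0n _ 400) (le_trans ler01 C01)) (ltW cphi0).
apply: (ler_wpM2l c1); rewrite lerD2r; apply: ler_wpM2l.
  by rewrite mulr_ge0 ?powR_ge0// divr_ge0 ?mulr_ge0 ?expR_ge0// ltW.
apply: le_trans (dyadic_Ex mY KS t J rho0 r0) _; rewrite lerD2l.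
have h2 : 0 < (2^-1 : R) by rewrite invr_gt0.
apply: le_trans (powR_anti (ltW rho0) h2 hJ) _.
rewrite powRN -[X in _ <= X]invrK lef_pV2 ?posrE ?powR_gt0 ?invr_gt0//.
rewrite -{1}[2^-1]powRr1//; apply: ger_powR => //.
by rewrite invr_gt0 ltr0n invf_le1// ler1n.
Qed.

Let E2 := rp + kap / 8.

Let smooth_err t : cphi * rp ^+ 2 * Ex Q (fun w => Num.max D `|Y n w - t| `^ (- 2)) <= E2.
Proof.
apply: le_trans (ler_wpM2l _ (dyadic_Ex2 mY KS t D0)) _.
  by rewrite mulr_ge0 ?sqr_ge0// ltW.
have -> : cphi * rp ^+ 2 * (9 / D + 3 * kap / D ^+ 2) = 9 / 24 * rp + kap * (3 / 576 / cphi).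
  by rewrite /D; field; rewrite !gt_eqF.
have : kap * (3 / 576 / cphi) <= kap * 8^-1.
  apply: (ler_wpM2l kap0); rewrite ler_pdivrMr//; have := @cphi_ge1 R; lra.
by have := rp0; rewrite /E2; lra.
Qed.

Let Ig_U t : Ig Q (fun w => Phi ((Y n w - t) * isq (c - V n w))).
Proof.
apply: (@Ig_bdd _ _ _ _ 1) => [|w]; last by rewrite ger0_norm ?Phi_ge0 ?Phi_le1.
apply: measurable_Phi; apply: measurable_funM; first exact: measurable_funB.
by apply: measurable_isq; exact: measurable_funB.
Qed.

Let mgt (t : R) : measurable_fun setT (fun w => t < Y n w).
Proof. by apply: measurable_fun_ltr. Qed.

Let vn_le : {ae Q, forall w, c - V n w <= rp ^+ 2}.
Proof.
apply: filterS Vge => w h; rewrite /c /rp; have := r0; have := del01; nra.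
Qed.

Let shift z : `|Phi (- z * isq c) - Phi (- z)| <= 100 * cphi * (del ^+ 2 + r ^+ 2).
Proof. by rewrite /c; apply: Phi_scale; rewrite addr_ge0// sqr_ge0. Qed.

(** [Phi ((Y_n - t) / sqrt (c - V_n))] is an indicator smoothed at the scale [rp]. Shifting [t] by
    [D] either way makes it an upper or lower bound of the true indicator up to a quadratic tail,
    whose mean is estimated by the Kolmogorov error itself. *)
Lemma be_step (t : R) : `|Pr Q [set w | Y n w <= t] - Phi t| <=
  E1 + E2 + D + 100 * cphi * (del ^+ 2 + r ^+ 2).
Proof.
have mle : measurable [set w | Y n w <= t].
  by rewrite -[X in measurable X]setTI; exact: measurable_fun_ler.
have mg : measurable [set w | t < Y n w].
  by rewrite -[X in measurable X]setTI; exact: mgt.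
have EP : Ex Q (fun w => (t < Y n w)%R%:R) = 1 - Pr Q [set w | Y n w <= t].
  rewrite Ex_bool// -PrC//; congr Pr; apply/seteqP; split => w /=; rewrite ltNge; first by move/negP.
  by move=> h; apply/negP.
have Ib : Ig Q (fun w => (t < Y n w)%R%:R) by apply: Ig_bool; exact: mgt.
have Im z := IgZ (cphi * rp ^+ 2) (Ig_maxdist Q mY z (ler0n _ 2) D0).
have up : Ex Q (fun w => (t < Y n w)%R%:R) <= Ex Q (fun w => Phi ((Y n w - (t - D)) * isq (c - V n w))) + E2.
  apply: le_trans (lerD (lexx _) (smooth_err (t - D))).
  rewrite -(ExZ _ (Ig_maxdist Q mY _ (ler0n _ 2) D0)) -(ExD (Ig_U _) (Im _)).
  apply: (Ex_ae_le Ib (IgD (Ig_U _) (Im _))); apply: filterS vn_le => w vw.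
  have m0 : 0 <= cphi * rp ^+ 2 * maxr D `|Y n w - (t - D)| `^ (- 2).
    by rewrite mulr_ge0 ?powR_ge0// mulr_ge0 ?sqr_ge0// ltW.
  case: ltP => h; last by rewrite addr_ge0// Phi_ge0.
  have Dz : D <= Y n w - (t - D) by lra.
  by have := Phi_smooth (vn0 w) vw D0 Dz; rewrite mulr1n; lra.
have dn : Ex Q (fun w => Phi ((Y n w - (t + D)) * isq (c - V n w))) <= Ex Q (fun w => (t < Y n w)%R%:R) + E2.
  apply: le_trans (lerD (lexx _) (smooth_err (t + D))).
  rewrite -(ExZ _ (Ig_maxdist Q mY _ (ler0n _ 2) D0)) -(ExD Ib (Im _)).
  apply: (Ex_ae_le (Ig_U _) (IgD Ib (Im _))); apply: filterS vn_le => w vw.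
  have m0 : 0 <= cphi * rp ^+ 2 * maxr D `|Y n w - (t + D)| `^ (- 2).
    by rewrite mulr_ge0 ?powR_ge0// mulr_ge0 ?sqr_ge0// ltW.
  case: ltP => h; first by rewrite (le_trans (Phi_le1 _))// lerDl.
  have Dz : D <= - (Y n w - (t + D)) by lra.
  have := Phi_smooth (vn0 w) vw D0 Dz; rewrite mulr0n.
  by rewrite normrN mulNr; have := Phi_sum ((Y n w - (t + D)) * isq (c - V n w)); lra.
have l1 := lind (t - D); have l2 := lind (t + D).
have s1 := shift (t - D); have s2 := shift (t + D).
have p1 := Phi_lip (- (t - D)) (- t); have p2 := Phi_lip (- (t + D)) (- t).
have ps := Phi_sum t.
move: p1 p2; rewrite (_ : - (t - D) - - t = D) 1?(_ : - (t + D) - - t = - D); [|ring|ring].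
rewrite normrN (ger0_norm (ltW D0)).
rewrite EP in up dn; move: l1 l2 s1 s2; rewrite !ler_norml.
set u1 := Ex Q _ in up *; set u2 := Ex Q _ in dn *; set q := Pr Q _ in up dn *.
move: (Phi (- (t - D) * isq c)) (Phi (- (t + D) * isq c)) => f1 f2.
move: (Phi (- (t - D))) (Phi (- (t + D))) (Phi (- t)) (Phi t) ps => g1 g2 g3 g4 ps.
move: E1 E2 D (100 * _ * _) up dn => e1 e2 D' u up dn.
move=> /andP[? ?] /andP[? ?] /andP[? ?] /andP[? ?] /andP[? ?] /andP[? ?].
apply/andP; split; lra.
Qed.

End be_step.

Section be_rate.
Context {R : realType}.
Implicit Types (rho eps r : R).

Definition be_rate rho eps := if rho == 1 then eps * `|ln eps| else eps `^ rho.

Lemma norm_ln_ge eps : 0 < eps <= 2^-1 -> 2^-1 <= `|ln eps|.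
Proof.
move=> /andP[e0 e1]; have h3 : -1 < eps - 1 by lra.
have := le_ln1Dx h3; rewrite addrC subrK => h.
by rewrite ler0_norm; lra.
Qed.

Lemma be_rate_ge rho eps : 0 < rho <= 1 -> 0 < eps <= 2^-1 -> eps `^ rho <= 2 * be_rate rho eps.
Proof.
move=> r01 e01; have /andP[e0 e1] := e01; rewrite /be_rate; case: eqP => [->|_].
  rewrite powRr1 ?(ltW e0)//; have := norm_ln_ge e01; nra.
by have := powR_ge0 eps rho; lra.
Qed.

Lemma be_rate_ge_eps rho eps : 0 < rho <= 1 -> 0 < eps <= 2^-1 -> eps <= 2 * be_rate rho eps.
Proof.
move=> r01 e01; apply: le_trans (be_rate_ge r01 e01).
have /andP[e0 e1] := e01; have /andP[r0 r1] := r01.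
rewrite -{1}[eps]powRr1 ?(ltW e0)//; apply: ger_powR => //.
by rewrite e0/=; lra.
Qed.

Lemma be_rate_ge0 rho eps : 0 < eps -> 0 <= be_rate rho eps.
Proof. by move=> e0; rewrite /be_rate; case: ifP => _; rewrite ?powR_ge0// mulr_ge0// ltW. Qed.

(** For [rho < 1] the sum is geometric and dominated by the scale 1, with a constant that
    degenerates as [rho] tends to 1; for [rho = 1] every term is 1 and their number is at most
    [2 |ln r|]. *)
Lemma be_rate_dyadic rho : 0 < rho <= 1 -> exists A : R, 0 <= A /\ forall eps r J,
  0 < eps <= 2^-1 -> eps <= r -> 2 ^+ J * r <= 1 ->
  eps `^ rho * (4 * (\sum_(0 <= j < J) (2 ^+ j * r) `^ (1 - rho)) + 2) <= A * be_rate rho eps.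
Proof.
move=> /andP[r0 r1]; have [->|rn1] := eqVneq rho 1.
  exists 12; split => // eps r J e01 er Jr; have /andP[e0 e1] := e01.
  have rp : 0 < r by lra.
  rewrite /be_rate eqxx powRr1 ?(ltW e0)// subrr.
  under eq_bigr do rewrite powRr0.
  rewrite sumr_const_nat subn0; have := dyadic_count rp Jr.
  have r1' : r <= 1 by apply: le_trans Jr; rewrite ler_peMl ?(ltW rp)// exprn_ege1// ler1n.
  have l1 : `|ln r| <= `|ln eps|.
    by rewrite !ler0_norm ?ln_le0// ?lerN2 ?ler_ln ?posrE//; lra.
  have := norm_ln_ge e01; move: (J%:R : R) => j; nra.
have q0 : 0 < 1 - rho by rewrite subr_gt0 lt_neqAle rn1.
have x0 : 0 < (2 : R) `^ (1 - rho) - 1 by rewrite subr_gt0 powR2_gt1.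
exists (4 / (2 `^ (1 - rho) - 1) + 2); split; first by rewrite addr_ge0// divr_ge0// ltW.
move=> eps r J /andP[e0 e1] er Jr; have rp : 0 < r by lra.
rewrite /be_rate (negbTE rn1) mulrC; apply: ler_wpM2r; first exact: powR_ge0.
rewrite lerD2r ler_wpM2l//; apply: le_trans (dyadic_sum J q0 rp) _.
rewrite ler_piMl ?invr_ge0 ?(ltW x0)//.
have := @ger_powR _ (2 ^+ J * r) _ _ _ (ltW q0); rewrite powRr0; apply.
by rewrite Jr mulr_gt0 ?exprn_gt0.
Qed.

End be_rate.

Lemma KS_le1 {d} {T : measurableType d} {R : realType} (Q : probability T R) (Y : T -> R) (t : R) :
  measurable_fun setT Y -> `|Pr Q [set w | Y w <= t] - Phi t| <= 1.
Proof.
move=> mY; have mle : measurable [set w | Y w <= t].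
  by rewrite -[X in measurable X]setTI; exact: measurable_fun_ler.
have := Pr_ge0 Q [set w | Y w <= t]; have := Pr_le1 Q mle.
have := Phi_ge0 t; have := Phi_le1 t; move: (Pr _ _) (Phi t) => x y *.
by rewrite ler_norml; apply/andP; split; lra.
Qed.

(** Iteration from the trivial bound 1: after [m] rounds the error is at most [2^(-m) + 2 B]. *)
Lemma KS_self_bounding {d} {T : measurableType d} {R : realType} (Q : probability T R) (Y : T -> R)
    (B : R) : measurable_fun setT Y -> 0 <= B ->
  (forall kap, (forall t, `|Pr Q [set w | Y w <= t] - Phi t| <= kap) ->
    forall t, `|Pr Q [set w | Y w <= t] - Phi t| <= kap / 2 + B) ->
  forall t, `|Pr Q [set w | Y w <= t] - Phi t| <= 2 * B.
Proof.
move=> mY B0 H t.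
have it m : forall t, `|Pr Q [set w | Y w <= t] - Phi t| <= (2^-1) ^+ m + 2 * B.
  elim: m => [|m IH] u; last first.
    by apply: le_trans (H _ IH u) _; rewrite exprS; lra.
  apply: le_trans (KS_le1 Q u mY) _; rewrite expr0; lra.
apply/ler_addgt0Pl => e e0.
have [m hm] : exists m : nat, (2^-1 : R) ^+ m <= e.
  exists (truncn e^-1).+1; rewrite exprVn -[leRHS]invrK lef_pV2 ?posrE ?exprn_gt0 ?invr_gt0//.
  by apply: le_trans (ltW (truncnS_gt _)) _; rewrite -natrX ler_nat ltnW// ltn_expl.
by apply: le_trans (it m t) _; rewrite lerD2r.
Qed.

(** The constants of [be_step] put together: [1800 = 400 * 9 / 2], and the two coefficients of
    [kap], at most [1 / 8] each, stay below [1 / 2]. *)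
Lemma be_step_arith {R : realType} (G A c C0 K L a del kap z X r : R) :
  0 <= G -> 0 <= A -> 0 <= c -> 0 <= C0 -> 0 <= K -> 0 <= L -> 0 <= a -> 0 <= del <= 2^-1 ->
  0 <= kap -> z <= 8^-1 -> X <= G * (A * L) -> 0 <= r <= 1 -> r <= K * (2 * L) ->
  X + kap * z + 1800 * C0 * c * a + (r + 2 * del + kap / 8) + 24 * c * (r + 2 * del)
    + 100 * c * (del ^+ 2 + r ^+ 2) <=
  kap / 2 + (G * A + 1800 * C0 * c + (24 * c + 1) * (2 * K + 2) + 100 * c * (1 + 2 * K)) * (L + a + del).
Proof.
move=> G0 A0 c0 C00 K0 L0 a0 /andP[d0 d1] kap0 z8 XG /andP[r0 r1] rK.
have S0 : 0 <= L + a + del by lra.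
have d2 : del ^+ 2 <= del by rewrite expr2 ler_piMl//; lra.
have r2 : r ^+ 2 <= r by rewrite expr2 ler_piMl//; lra.
have Ka := mulr_ge0 K0 a0; have Kd := mulr_ge0 K0 d0.
have T2 : r + 2 * del <= (2 * K + 2) * (L + a + del) by lra.
have T1 := ler_wpM2l c0 T2.
have T3 : del ^+ 2 + r ^+ 2 <= (1 + 2 * K) * (L + a + del) by lra.
have T4 := ler_wpM2l c0 T3.
have T5 : G * (A * L) <= G * A * (L + a + del).
  by rewrite mulrA; apply: ler_wpM2l; [exact: mulr_ge0|lra].
have T6 : C0 * c * a <= C0 * c * (L + a + del).
  by apply: ler_wpM2l; [exact: mulr_ge0|lra].
have T7 := ler_wpM2l kap0 z8.
rewrite (_ : kap / 2 + _ = kap / 2 + G * A * (L + a + del) + 1800 * (C0 * c * (L + a + del))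
   + 24 * (c * ((2 * K + 2) * (L + a + del))) + (2 * K + 2) * (L + a + del)
   + 100 * (c * ((1 + 2 * K) * (L + a + del)))); last by ring.
rewrite (_ : X + _ + _ + _ + _ + _ = X + kap * z + 1800 * (C0 * c * a) + (r + 2 * del + kap / 8)
   + 24 * (c * (r + 2 * del)) + 100 * (c * (del ^+ 2 + r ^+ 2))); last by ring.
move: T1 T2 T4 T5 T6 T7 XG.
move: ((2 * K + 2) * _) (C0 * c * a) (c * (r + _)) (c * (_ + r ^+ 2)) (C0 * c * _) (c * (_ * _)) (c * (_ * _))
  (kap * z) (G * (A * L)) (G * A * _) => z7 z1 z2 z3 z4 z5 z6 z9 z10 z11.
move: {S0 T3 rK r2 r1 r0 d2 Ka Kd G0 A0 c0 C00 K0 L0 a0 d1 z8} kap0 => kap0; lra.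
Qed.

Lemma approx_mds_berry_esseen {R : realType} (rho C0 : R) : 0 < rho <= 1 -> 1 <= C0 ->
  exists C1 : R, 1 <= C1 /\
  forall (d : measure_display) (T : measurableType d) (Q : probability T R) (n : nat)
    (F : nat -> set (set T)) (eta s : nat -> T -> R) (eps lam del : R),
  approx_mds Q n F eta s rho eps lam C0 -> 0 < eps <= 2^-1 -> 0 <= lam ->
  C0 * (lam `^ rho * eps `^ rho) <= 8^-1 -> 0 <= del <= 2^-1 ->
  (forall w, psum s n w <= 1 + del ^+ 2) ->
  {ae Q, forall w, 1 - del ^+ 2 <= psum s n w} ->
  forall t, `|Pr Q [set w | psum eta n w <= t] - Phi t| <=
    C1 * (be_rate rho eps + lam `^ (1 + rho) * eps `^ rho + del).
Proof.
move=> rho01 C01; have /andP[rho0 rho1] := rho01.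
have [A [A0 HA]] := be_rate_dyadic rho01.
have cp : 0 < cphi :> R := lt_le_trans ltr01 cphi_ge1.
have Cp : 0 < C0 := lt_le_trans ltr01 C01.
have x0 : 0 < 1 - (2 : R) `^ (- rho) by rewrite subr_gt0 powR2N_lt1.
have c0 := ltW cp; have C00 := ltW Cp.
pose G := 400 * C0 * cphi * (16 * expR 1 / rho).
have G0 : 0 <= G := mulr_ge0 (mulr_ge0 (mulr_ge0 (ler0n _ 400) C00) c0)
  (divr_ge0 (mulr_ge0 (ler0n _ 16) (expR_ge0 _)) (ltW rho0)).
(* [A2 (eps / r)^rho] is the coefficient of the Kolmogorov error in the Lindeberg part of [be_step];
   [K] is the ratio [r / eps] that makes it at most [1 / 8]. *)
pose A2 := G * (2 / (1 - 2 `^ (- rho))).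
have A20 : 0 <= A2 := mulr_ge0 G0 (divr_ge0 (ler0n _ 2) (ltW x0)).
pose K := (8 * A2 + 1) `^ rho^-1.
have K1 : 1 <= K.
  by rewrite -(powRr0 (8 * A2 + 1)); apply: ler_powR; [lra|rewrite invr_ge0 ltW].
have K0 : 0 <= K by lra.
have KN : A2 * K `^ (- rho) <= 8^-1.
  rewrite /K -powRrM mulrN mulVf ?gt_eqF// powR_inv1; last by lra.
  rewrite ler_pdivrMr; lra.
pose B := G * A + 1800 * C0 * cphi + (24 * cphi + 1) * (2 * K + 2) + 100 * cphi * (1 + 2 * K).
have B0 : 0 <= B.
  have h1 := mulr_ge0 G0 A0; have h2 := mulr_ge0 C00 c0; have h3 := mulr_ge0 c0 K0.
  by rewrite /B; lra.
exists (2 * B + 32 * C0 + 2 * K); split; first by move: (B) B0 => B' B'0; lra.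
move=> d T Q n F eta s eps lam del amds e01 lam0 bC del01 Vle Vge t.
set a := lam `^ (1 + rho) * eps `^ rho; set L := be_rate rho eps.
have /andP[e0 e1] := e01; have /andP[d0 d1] := del01.
have a0 : 0 <= a by rewrite mulr_ge0 ?powR_ge0.
have L0 : 0 <= L := be_rate_ge0 rho e0.
have eL : eps <= 2 * L := be_rate_ge_eps rho01 e01.
have S0 : 0 <= L + a + del := addr_ge0 (addr_ge0 L0 a0) d0.
have mY : measurable_fun setT (psum eta n) := Fmeas_T amds (leqnn n) (Fmeas_Y amds (leqnn n)).
have triv x y z : 0 <= x -> 0 <= y -> 1 <= z * (L + a + del) ->
    1 <= (x + y + z) * (L + a + del).
  move=> h1 h2 /le_trans; apply; apply: (ler_wpM2r S0); rewrite -{1}[z]add0r lerD2r; exact: addr_ge0.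
(* If [C0 a > 1 / 32] or [K eps > 1] the claimed bound exceeds 1; the terms [32 C0] and [2 K] of the
   constant serve these two cases. *)
have [aC|aC] := leP (C0 * a) (32^-1); last first.
  apply: le_trans (KS_le1 Q t mY) _; rewrite addrAC; apply: triv.
  - exact: mulr_ge0.
  - exact: mulr_ge0.
  rewrite -mulrA; apply: (@le_trans _ _ (32 * (C0 * a))); first by move: (C0 * a) aC => z; lra.
  by apply: ler_wpM2l => //; apply: (ler_wpM2l C00); rewrite [L + a]addrC -addrA lerDl addr_ge0.
have [Ke|Ke] := leP (K * eps) 1; last first.
  apply: le_trans (KS_le1 Q t mY) _; apply: triv.
  - exact: mulr_ge0.
  - exact: mulr_ge0.
  apply: le_trans (ltW Ke) _; rewrite [2 * K]mulrC -mulrA; apply: (ler_wpM2l K0).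
  by apply: le_trans eL _; apply: ler_wpM2l => //; rewrite -addrA lerDl addr_ge0.
have r01 : 0 < K * eps <= 1 by rewrite Ke andbT mulr_gt0// (lt_le_trans ltr01).
have er : eps <= K * eps by rewrite ler_peMl// ltW.
have /andP[rp _] := r01.
have [J /andP[J1 J2]] := dyadic_stop rp Ke.
apply: (@le_trans _ _ (2 * (B * (L + a + del)))); last first.
  rewrite mulrA; apply: (ler_wpM2r S0); rewrite -addrA lerDl addr_ge0// mulr_ge0//.
apply: (KS_self_bounding mY) => [|kap KS u]; first exact: mulr_ge0.
apply: le_trans (be_step amds rho01 e0 lam0 C01 aC bC r01 er del01 Vle Vge KS J1 u) _.
have kap0 : 0 <= kap := le_trans (normr_ge0 _) (KS 0).
have hA := ler_wpM2l G0 (HA _ _ _ e01 er J2).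
have eK : eps `^ rho * (K * eps) `^ (- rho) = K `^ (- rho).
  by rewrite powRM ?(ltW e0)// mulrCA -powRD ?(gt_eqF e0) ?implybT// subrr powRr0 mulr1.
have rK : K * eps <= K * (2 * L) := ler_wpM2l K0 eL.
have r01' : 0 <= K * eps <= 1 by rewrite (ltW rp).
rewrite -eK in KN.
apply: le_trans (be_step_arith G0 A0 c0 C00 K0 L0 a0 del01 kap0 KN hA r01' rK).
rewrite -/a le_eqVlt; apply/orP; left; apply/eqP.
rewrite /A2 /G; move: ((K * eps) `^ _) (eps `^ rho) (2 `^ _) x0 (\sum_(_ <= _ < _) _) => y1 y2 y3 y4 y5.
by move: (K * eps) (expR 1) cphi => y6 y7 y8; field; rewrite !gt_eqF.
Qed.

(** Information that survives when [a] is large and the Berry-Esseen bound is void. By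
    [jensen_bound] from time 0, with a constant [W = z^2], the mean of [A_n^(-p)] is at least a
    fixed fraction of [W^(-p)]; outside the ball [A_n >= 100 W], so the ball cannot have small mass.
    The size of [z] keeps [beta] below [2 / 5]. *)
Lemma approx_mds_concentration {d} {T : measurableType d} {R : realType} (Q : probability T R) (n : nat)
    (F : nat -> set (set T)) (eta s : nat -> T -> R) (rho eps lam C0 : R) :
  approx_mds Q n F eta s rho eps lam C0 -> 0 < rho <= 1 -> 1 <= C0 ->
  C0 * (lam `^ rho * eps `^ rho) <= 8^-1 -> (forall w, psum s n w <= 5 / 4) ->
  20^-1 <= Pr Q [set w | `|psum eta n w| <= 10 * (2 + 20 * (C0 * (lam `^ (1 + rho) * eps `^ rho)))].
Proof.
move=> amds rho01 C01 bC V54; have /andP[rho0 rho1] := rho01.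
set a := lam `^ (1 + rho) * eps `^ rho; set b := lam `^ rho * eps `^ rho in bC *.
have a0 : 0 <= a by rewrite mulr_ge0 ?powR_ge0.
have b0 : 0 <= b by rewrite mulr_ge0 ?powR_ge0.
have C00 : 0 <= C0 := le_trans ler01 C01.
have Ca := mulr_ge0 C00 a0; have Cb := mulr_ge0 C00 b0.
pose z := 2 + 20 * (C0 * a); have z2 : 2 <= z by rewrite /z; move: (C0 * a) Ca => u; lra.
have z0 : 0 < z := lt_le_trans (ltr0n _ 2) z2.
pose W := z ^+ 2; have W4 : 4 <= W by rewrite /W; nra.
have W0 : 0 < W by rewrite exprn_gt0.
set p := 1 + rho / 2; have p1 : 1 <= p by rewrite /p; lra.
have p2 : p <= 2 by rewrite /p; lra.
have p0 : 0 <= p by lra.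
have iW : isq W = z^-1 by rewrite isqE ?(ltW W0)// /W sqrtr_sqr gtr0_norm.
pose beta : R := C0 * (4 * a * isq W + 2 * b / W).
have beta0 : 0 <= beta.
  apply: mulr_ge0 C00 (addr_ge0 (mulr_ge0 (mulr_ge0 (ler0n _ 4) a0) (isq_ge0 _)) _).
  exact: divr_ge0 (mulr_ge0 (ler0n _ 2) b0) (ltW W0).
have beta25 : beta <= 2 / 5.
  rewrite /beta iW (_ : _ * _ = 4 * ((C0 * a) / z) + 2 * ((C0 * b) / W)); last by ring.
  have h1 : C0 * a / z <= 20^-1 by rewrite ler_pdivrMr// /z; move: (C0 * a) => u; lra.
  have h2 : C0 * b / W <= 32^-1 by rewrite ler_pdivrMr//; move: (C0 * b) bC => u; lra.
  lra.
have mc k (x : R) : Fmeas F k (fun=> x) by exact: measurable_cst.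
have mY := Fmeas_T amds (leqnn n) (Fmeas_Y amds (leqnn n)).
have mV := Fmeas_T amds (leqnn n) (Fmeas_V amds (leqnn n)).
have Vn w : 0 <= psum s n w := V_ge0 amds n w.
have betaV w : beta * (psum s n w - psum s 0 w) <= 2^-1.
  rewrite psum0 subr0; have := V54 w; have := Vn w.
  move: (psum s n w) => v v0 v1; have := ler_pM beta0 v0 beta25 v1; lra.
have J := @jensen_bound _ _ _ Q n F eta s rho eps lam C0 amds rho01 C01 0 (fun=> 1) (fun=> W)
  (fun=> beta) (5 / 4) 0 W 1 (leq0n n) (mc _ _) (mc _ _) (mc _ _) (fun=> introT andP (conj ler01 (lexx _))) W0 (fun=> lexx _) V54
  (fun=> beta0) (fun=> lexx _) betaV.
pose rad := 10 * z; pose B w := `|psum eta n w| <= rad.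
have mB : measurable_fun setT B by apply: measurable_fun_ler => //; exact: measurableT_comp.
have mBs : measurable [set w | B w] by rewrite -[X in measurable X]setTI; exact: mB.
have IB := Ig_bool Q mB.
pose K (w : T) := W + (5 / 4 - psum s n w) + (psum eta n w - 0) ^+ 2.
have KW w : W <= K w by rewrite /K -addrA lerDl addr_ge0 ?sqr_ge0// subr_ge0.
have mK : measurable_fun setT K.
  apply: measurable_funD; last by apply: measurable_funX; exact: measurable_funB.
  by apply: measurable_funD => //; exact: measurable_funB.
have IK : Ig Q (fun w => 1 * K w `^ (- p)).
  apply: (@Ig_bdd _ _ _ _ (W `^ (- p))).
    by apply: measurable_funM => //; exact: measurable_powRl.
  by move=> w; rewrite mul1r ger0_norm ?powR_ge0//; exact: powR_anti.
have Wp0 : 0 < W `^ (- p) by exact: powR_gt0.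
move: J.
rewrite (_ : Ex Q _ = (W + 5 / 4) `^ (- p)); last first.
  by rewrite -[RHS](Ex_cst Q); apply: Ex_eq => w; rewrite !psum0 !subr0 expr0n/= addr0 mul1r.
have up : Ex Q (fun w => 1 * K w `^ (- p)) <= W `^ (- p) * (Pr Q [set w | B w] + 100^-1).
  rewrite mulrDr -(Ex_bool Q mBs) -(ExZ _ IB) -[X in _ <= _ + X](Ex_cst Q) -(ExD (IgZ _ IB) (Ig_cst _ _)).
  apply: (Ex_le IK (IgD (IgZ _ IB) (Ig_cst _ _))) => w; rewrite mul1r.
  case: (boolP (B w)) => Bw.
    rewrite mulr1n mulr1; apply: le_trans (powR_anti p0 W0 (KW w)) _.
    by rewrite lerDl mulr_ge0 ?invr_ge0// ltW.
  rewrite mulr0n mulr0 add0r; move: Bw; rewrite /B -ltNge => Bw.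
  have K100 : 100 * W <= K w.
    have := V54 w; rewrite /K subr0 -(real_normK (num_real (psum eta n w))).
    have : rad ^+ 2 <= `|psum eta n w| ^+ 2.
      by rewrite ler_pXn2r ?nnegrE ?(ltW Bw)// /rad mulr_ge0// ltW.
    by rewrite /rad exprMn -/W; lra.
  have W100 : 0 < 100 * W by rewrite mulr_gt0.
  apply: le_trans (powR_anti p0 W100 K100) _; rewrite powRM ?(ltW W0)// mulrC.
  apply: (ler_wpM2l (ltW Wp0)); rewrite powRN lef_pV2 ?posrE ?powR_gt0//.
  by rewrite -{1}[100]powRr1//; apply: ler_powR => //; rewrite ler1n.
have dn : 3 / 8 * W `^ (- p) <= (W + 5 / 4) `^ (- p).
  have W1 : 0 < 21 / 16 * W by rewrite mulr_gt0.
  have W2 : W + 5 / 4 <= 21 / 16 * W by lra.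
  have W3 : 0 < W + 5 / 4 by lra.
  apply: le_trans (powR_anti p0 W3 W2); rewrite [(21 / 16 * W) `^ _]powRM ?(ltW W0)//.
  apply: ler_wpM2r; first exact: ltW.
  apply: (@le_trans _ _ ((21 / 16) `^ (- 2))).
    by rewrite powRN (powR_mulrn 2)//; lra.
  by rewrite ler_powR//; lra.
have e3 : expR 1 <= 4 :> R.
  have -> : expR 1 = expR (2^-1) ^+ 2 :> R by rewrite -expRM_natl; congr expR; lra.
  by apply: le_trans (lerXn2r 2 _ _ expR_half_le2) _; rewrite ?nnegrE ?expR_ge0// -natrX.
move=> h; have {h} : 3 / 8 * W `^ (- p) <= 4 * (W `^ (- p) * (Pr Q [set w | B w] + 100^-1)).
  apply: le_trans dn _; apply: le_trans h _; apply: ler_pM; rewrite ?expR_ge0//.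
  by apply: Ex_ge0 => w; rewrite mul1r powR_ge0.
rewrite mulrCA mulrC ler_pM2l//; rewrite /B; move: (Pr Q _) => q; lra.
Qed.

(** * Exponential change of measure *)

Section exp_taylor.
Context {R : realType}.
Implicit Types (x rho : R).

Let expR1_le4 : expR 1 <= 4 :> R.
Proof.
have -> : expR 1 = expR (2^-1) ^+ 2 :> R by rewrite -expRM_natl; congr expR; lra.
by apply: le_trans (lerXn2r 2 _ _ expR_half_le2) _; rewrite ?nnegrE ?expR_ge0// -natrX.
Qed.

Let small x : `|x| <= 1 -> [/\ `|expR x - 1| <= 4 * `|x|, `|expR x - 1 - x| <= 4 * `|x| ^+ 2 &
  `|expR x - 1 - x - x ^+ 2 / 2| <= 4 * `|x| ^+ 3].
Proof.
move=> x1.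
have d0 (u : R) : is_derive u 1 (expR : R -> R) (expR u) by exact: is_derive_expR.
have h0 (u : R) : `|u| <= `|x| -> `|expR u| <= 4 * `|u| ^+ 0.
  move=> ux; rewrite expr0 mulr1 ger0_norm ?expR_ge0//; apply: le_trans expR1_le4.
  by rewrite ler_expR (le_trans (ler_norm _))// (le_trans ux).
have h1 (u : R) : `|u| <= `|x| -> `|expR u - 1| <= 4 * `|u| ^+ 1.
  move: u; apply: (@taylor_step _ (fun u => expR u - 1) expR 0 4 x) => //; last by rewrite expR0 subrr.
  by move=> u; have := is_deriveB (d0 u) (is_derive_cst (1 : R) u 1); rewrite subr0.
have h2 (u : R) : `|u| <= `|x| -> `|expR u - 1 - u| <= 4 * `|u| ^+ 2.
  move: u; apply: (@taylor_step _ (fun u => expR u - 1 - u) (fun u => expR u - 1) 1 4 x) => //; last by rewrite expR0 subrr subr0.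
  move=> u; have dB := is_deriveB (d0 u) (is_derive_cst (1 : R) u 1).
  by have := is_deriveB dB (is_derive_id u 1); rewrite subr0.
have h3 (u : R) : `|u| <= `|x| -> `|expR u - 1 - u - u ^+ 2 / 2| <= 4 * `|u| ^+ 3.
  move: u; apply: (@taylor_step _ (fun u => expR u - 1 - u - u ^+ 2 / 2) (fun u => expR u - 1 - u) 2 4 x) => //; last first.
    by rewrite expR0 subrr subr0 expr0n/= mul0r subr0.
  by move=> u; apply: is_derive_eq; rewrite !scaler0 /GRing.scale/=; lra.
split; [exact: h1|exact: h2|exact: h3].
Qed.

Let expR_max x : 1 <= expR (Num.max x 0) /\ expR x <= expR (Num.max x 0).
Proof. by rewrite -{1}(expR0 R) !ler_expR !le_max !lexx orbT. Qed.

Let pow_small x q (k : nat) : `|x| <= 1 -> 0 < q -> q <= k%:R -> `|x| ^+ k <= `|x| `^ q.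
Proof.
move=> x1 q0 qk; have [->|x0] := eqVneq x 0.
  rewrite normr0 powR0 ?gt_eqF// expr0n.
  by case: k qk => // qk; move: (lt_le_trans q0 qk); rewrite ltxx.
by rewrite -powR_mulrn//; apply: ger_powR; rewrite ?x1 ?normr_gt0 ?x0.
Qed.

Let pow_big x q (k : nat) : 1 <= `|x| -> k%:R <= q -> `|x| ^+ k <= `|x| `^ q.
Proof. by move=> x1 kq; rewrite -powR_mulrn//; apply: ler_powR. Qed.

(** For [|x| <= 1] a Taylor bound of integer order, weakened to the exponent [rho]; for [|x| > 1]
    each term is dominated by the right-hand side. The exponential factor sees only the positive
    part of [x], as in (A1); the two expansions of higher order go the same way. *)
Lemma expR_taylor0 rho x : 0 < rho <= 1 -> `|expR x - 1| <= 4 * (`|x| `^ rho * expR (Num.max x 0)).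
Proof.
move=> /andP[r0 r1]; have [E1 Ex] := expR_max x; set E := expR (Num.max x 0) in E1 Ex *.
have [x1|x1] := leP `|x| 1.
  have [h _ _] := small x1; apply: le_trans h _; rewrite ler_pM2l//.
  have := @pow_small x rho 1 x1 r0 r1; rewrite expr1; have := powR_ge0 `|x| rho; nra.
have := @pow_big x rho 0 (ltW x1) (ltW r0); rewrite expr0 => h.
have := expR_ge0 x; rewrite ler_norml => e0.
have h' : E <= `|x| `^ rho * E by rewrite ler_peMl//; lra.
by apply/andP; split; lra.
Qed.

Lemma expR_taylor1 rho x : 0 < rho <= 1 ->
  `|expR x - 1 - x| <= 4 * (`|x| `^ (1 + rho) * expR (Num.max x 0)).
Proof.
move=> /andP[r0 r1]; have [E1 Ex] := expR_max x; set E := expR (Num.max x 0) in E1 Ex *.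
have [x1|x1] := leP `|x| 1.
  have [_ h _] := small x1; apply: le_trans h _; rewrite ler_pM2l//.
  have p0 : 0 < 1 + rho by lra. have p1 : 1 + rho <= 2%:R by lra.
  have := @pow_small x (1 + rho) 2 x1 p0 p1; have := powR_ge0 `|x| (1 + rho); nra.
have p1 : 1 <= 1 + rho by lra.
have h1 := @pow_big x (1 + rho) 1 (ltW x1) p1; rewrite expr1 in h1.
have h' : `|x| `^ (1 + rho) <= `|x| `^ (1 + rho) * E by rewrite ler_peMr// powR_ge0.
have h'' : E <= `|x| `^ (1 + rho) * E by rewrite ler_peMl//; lra.
have := expR_ge0 x; have := ler_norm x; have := ler_norm (- x); rewrite normrN ler_norml => *.
by apply/andP; split; lra.
Qed.

Lemma expR_taylor2 rho x : 0 < rho <= 1 ->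
  `|expR x - 1 - x - x ^+ 2 / 2| <= 4 * (`|x| `^ (2 + rho) * expR (Num.max x 0)).
Proof.
move=> /andP[r0 r1]; have [E1 Ex] := expR_max x; set E := expR (Num.max x 0) in E1 Ex *.
have [x1|x1] := leP `|x| 1.
  have [_ _ h] := small x1; apply: le_trans h _; rewrite ler_pM2l//.
  have p0 : 0 < 2 + rho by lra. have p1 : 2 + rho <= 3%:R by lra.
  have := @pow_small x (2 + rho) 3 x1 p0 p1; have := powR_ge0 `|x| (2 + rho); nra.
have p1 : 1 <= 2 + rho by lra. have p2 : 2%:R <= 2 + rho by lra.
have h1 := @pow_big x (2 + rho) 1 (ltW x1) p1; rewrite expr1 in h1.
have h2 := @pow_big x (2 + rho) 2 (ltW x1) p2.
have h' : `|x| `^ (2 + rho) <= `|x| `^ (2 + rho) * E by rewrite ler_peMr// powR_ge0.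
have h'' : E <= `|x| `^ (2 + rho) * E by rewrite ler_peMl//; lra.
have := expR_ge0 x; have := ler_norm x; have := ler_norm (- x); have := sqr_ge0 x.
rewrite -(real_normK (num_real x)) normrN ler_norml => *.
by apply/andP; split; lra.
Qed.

(** Young's inequality for [x^2] and [eps^rho] with the exponents [(2 + rho) / 2] and
    [(2 + rho) / rho]. *)
Lemma sqr_young (rho eps x : R) : 0 < rho -> 0 < eps ->
  (1 + rho / 2) * (x ^+ 2 * eps `^ rho) <= `|x| `^ (2 + rho) + rho / 2 * eps `^ (2 + rho).
Proof.
move=> r0 e0.
have p0 : 0 < (2 + rho) / 2 by lra. have q0 : 0 < (2 + rho) / rho by rewrite divr_gt0//; lra.
have pq : ((2 + rho) / 2)^-1 + ((2 + rho) / rho)^-1 = 1.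
  by field; rewrite ?gt_eqF//=; lra.
have := conjugate_powR (sqr_ge0 `|x|) (powR_ge0 eps rho) p0 q0 pq.
have -> : (`|x| ^+ 2) `^ ((2 + rho) / 2) = `|x| `^ (2 + rho).
  by rewrite -powR_mulrn// -powRrM; congr (_ `^ _); field.
have -> : (eps `^ rho) `^ ((2 + rho) / rho) = eps `^ (2 + rho).
  by rewrite -powRrM; congr (_ `^ _); field; rewrite gt_eqF.
rewrite real_normK ?num_real// => h; have h2 := ler_wpM2l (ltW p0) h.
rewrite (_ : 1 + rho / 2 = (2 + rho) / 2); last by lra.
apply: le_trans h2 _; rewrite le_eqVlt; apply/orP; left; apply/eqP.
by move: (_ `^ _) (eps `^ _) => *; field; rewrite !gt_eqF//; lra.
Qed.

End exp_taylor.

Section Ig_int.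
Context {d} {T : measurableType d} {R : realType}.
Variable Q : probability T R.
Implicit Types (f g : T -> R).

Lemma Ig_ge0 f : measurable_fun setT f -> (forall w, 0 <= f w) ->
  (\int[Q]_w (f w)%:E < +oo)%E -> Ig Q f.
Proof.
move=> mf f0 fin; apply/integrableP; split; first exact/measurable_EFinP.
by under eq_integral do rewrite /= ger0_norm//.
Qed.

Lemma Ex_int_le f g : measurable_fun setT f -> (forall w, 0 <= f w) -> Ig Q g ->
  (\int[Q]_w (f w)%:E <= \int[Q]_w (g w)%:E)%E -> Ig Q f /\ Ex Q f <= Ex Q g.
Proof.
move=> mf f0 Ig_ fg; have If : Ig Q f.
  by apply: Ig_ge0 => //; apply: le_lt_trans fg _; rewrite -Ex_fin// ltry.
by split => //; rewrite -lee_fin !Ex_fin.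
Qed.

Lemma Ex_int_eq f g : measurable_fun setT f -> (forall w, 0 <= f w) -> Ig Q g ->
  (\int[Q]_w (f w)%:E = \int[Q]_w (g w)%:E)%E -> Ig Q f /\ Ex Q f = Ex Q g.
Proof.
move=> mf f0 Ig_ fg; have [|If _] := Ex_int_le mf f0 Ig_; first by rewrite fg.
by split => //; apply: EFin_inj; rewrite !Ex_fin.
Qed.

Lemma ae_of_Ex0 f : Ig Q f -> (forall w, 0 <= f w) -> Ex Q f <= 0 -> {ae Q, forall w, f w = 0}.
Proof.
move=> If f0 E0; have mf := Ig_mf If.
have : (\int[Q]_w `|(f w)%:E| = 0)%E.
  under eq_integral do rewrite /= ger0_norm//.
  by rewrite -Ex_fin//; congr _%:E; apply/eqP; rewrite eq_le E0 Ex_ge0.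
move=> /(ae_eq_integral_abs Q measurableT (proj2 (measurable_EFinP _ _) mf)).
by apply: filterS => w /= h; apply: EFin_inj; exact: h.
Qed.

End Ig_int.

Lemma powRD_gt0 {R : realType} (x r s : R) : 0 < r + s -> x `^ (r + s) = x `^ r * x `^ s.
Proof. by move=> rs; rewrite powRD// gt_eqF. Qed.

(** * Conditional moments of one increment *)

Section one_step.
Context {d} {T : measurableType d} {R : realType}.
Variables (P : probability T R) (G : set (set T)) (x s2 : T -> R) (Z : T -> \bar R) (rho eps : R).

Local Notation Zf w := (`|x w| `^ (2 + rho) * expR (eps^-1 * Num.max (x w) 0)).

Hypotheses (sG : sub_sigma_field G) (rho01 : 0 < rho <= 1) (eps0 : 0 < eps)
  (mx : measurable_fun setT x) (Ix2 : Ig P (fun w => x w ^+ 2))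
  (cx : cexp_int P G x (fun=> 0))
  (cx2 : cexp_nonneg P G (fun w => (x w ^+ 2)%:E) (fun w => (s2 w)%:E))
  (cZ : cexp_nonneg P G (fun w => (Zf w)%:E) Z)
  (Zle : {ae P, forall w, (Z w <= (eps `^ rho * s2 w)%:E)%E}).

Let mG (f : T -> R) := measurable_fun [set: g_sigma_algebraType G] f.

Let mGT (f : T -> R) : mG f -> measurable_fun setT f.
Proof. by move=> /(G_measurableP sG); exact: G_measurable_meas. Qed.

Let mGE (f : T -> R) : mG f -> G_measurable (U:=\bar R) G (EFin \o f).
Proof. by move=> mf; apply/(G_measurableP sG)/measurable_EFinP. Qed.

Lemma step_ms2 : mG s2.
Proof. by case: cx2 => _ _ /(G_measurableP sG) /measurable_EFinP. Qed.

Let s20 w : 0 <= s2 w. Proof. by case: cx2 => _ h _ _; have := h w; rewrite lee_fin. Qed.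

Let rho0 : 0 < rho. Proof. by case/andP: rho01. Qed.

Let mZ : measurable_fun setT (fun w => Zf w).
Proof.
apply: measurable_funM; first by apply: measurable_powRl; exact: measurableT_comp.
by apply: measurable_expRl; apply: measurable_funM => //; exact: measurable_maxr.
Qed.

Let Zf0 w : 0 <= Zf w. Proof. by rewrite mulr_ge0 ?powR_ge0 ?expR_ge0. Qed.

Let KZ_int (K : T -> R) : mG K -> (forall w, 0 <= K w) ->
  (\int[P]_w (K w * Zf w)%:E <= \int[P]_w (K w * (eps `^ rho * s2 w))%:E)%E.
Proof.
move=> mK K0; have [_ Z0 mZG ZE] := cZ.
under eq_integral do rewrite EFinM.
have -> : (\int[P]_w ((K w)%:E * (Zf w)%:E) = \int[P]_w ((K w)%:E * Z w))%E.
  apply: (cond_pullout sG _ _ _ _ _ (mGE mK)).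
  - exact/measurable_EFinP.
  - exact: (G_measurable_meas sG mZG).
  - by move=> w; rewrite lee_fin.
  - by [].
  - by move=> A GA; rewrite -ZE.
  - by move=> w; rewrite lee_fin.
apply: ae_ge0_le_integral => //.
- by move=> w _; rewrite mule_ge0 ?lee_fin.
- apply: emeasurable_funM; first exact/measurable_EFinP/mGT.
  exact: (G_measurable_meas sG mZG).
- by move=> w _; rewrite lee_fin !mulr_ge0 ?powR_ge0.
- apply/measurable_EFinP; apply: measurable_funM; first exact: mGT.
  by apply: measurable_funM => //; exact: (mGT step_ms2).
by apply: filterS Zle => w h _; rewrite EFinM; apply: lee_wpmul2l => //; rewrite lee_fin.
Qed.

Let Kx2_int (K : T -> R) : mG K -> (forall w, 0 <= K w) ->
  (\int[P]_w (K w * x w ^+ 2)%:E = \int[P]_w (K w * s2 w)%:E)%E.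
Proof.
move=> mK K0; have [_ S0 mS SE] := cx2.
under eq_integral do rewrite EFinM.
under [RHS]eq_integral do rewrite EFinM.
apply: (cond_pullout sG _ _ _ _ _ (mGE mK)).
- by apply/measurable_EFinP; exact: measurable_funX.
- exact/measurable_EFinP/(mGT step_ms2).
- by move=> w; rewrite lee_fin sqr_ge0.
- by move=> w; rewrite lee_fin.
- by move=> A GA; rewrite SE.
- by move=> w; rewrite lee_fin.
Qed.

Let int_ind (A : set T) (h : T -> R) : measurable A -> Ig P h ->
  (\int[P]_(w in A) (h w)%:E = (Ex P (fun w => h w * \1_A w))%:E)%E.
Proof.
move=> mA Ih; rewrite Ex_fin; last first.
  apply: (@Ig_dom _ _ _ _ _ (fun w => `|h w|)); last exact: Ig_abs.
    by apply: measurable_funM; [exact: Ig_mf Ih|exact: measurable_indic].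
  by move=> w; rewrite normrM ler_piMr// indicE; case: (_ \in _); rewrite ?normr1 ?normr0.
rewrite integral_mkcond; apply: eq_integral => w _; rewrite patchE indicE.
by case: ifPn => _; rewrite ?mulr1 ?mulr0.
Qed.

(** The centering, stated through positive and negative parts so that [cond_pullout], which is for
    nonnegative functions, applies. *)
Let Kx_int (K : T -> R) : mG K -> (forall w, 0 <= K w) ->
  (\int[P]_w (K w * Num.max (x w) 0)%:E = \int[P]_w (K w * Num.max (- x w) 0)%:E)%E.
Proof.
move=> mK K0; have [Ix _ _ xE] := cx; have Ix' : Ig P x := Ix.
have mp : measurable_fun setT (fun w => Num.max (x w) 0) by exact: measurable_maxr.
have mn : measurable_fun setT (fun w => Num.max (- x w) 0).
  by apply: measurable_maxr => //; exact: measurableT_comp.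
have Ip : Ig P (fun w => Num.max (x w) 0).
  apply: Ig_dom mp _ (Ig_abs Ix') => w; rewrite ger0_norm ?le_max ?lexx ?orbT// ge_max normr_ge0.
  by rewrite ler_norm.
have In : Ig P (fun w => Num.max (- x w) 0).
  apply: Ig_dom mn _ (Ig_abs Ix') => w; rewrite ger0_norm ?le_max ?lexx ?orbT// ge_max normr_ge0.
  by rewrite -normrN ler_norm.
under eq_integral do rewrite EFinM.
under [RHS]eq_integral do rewrite EFinM.
have [sA sM] := sG.
apply: (cond_pullout sG _ _ _ _ _ (mGE mK)).
- exact/measurable_EFinP.
- exact/measurable_EFinP.
- by move=> w; rewrite lee_fin le_max lexx orbT.
- by move=> w; rewrite lee_fin le_max lexx orbT.
- move=> A GA; have mA := sM A GA.
  have e0 : Ex P (fun w => x w * \1_A w) = 0.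
    by apply: EFin_inj; rewrite -(int_ind mA Ix') -(xE A GA) integral0_eq.
  rewrite (int_ind mA Ip) (int_ind mA In); congr _%:E.
  have Ib (h : T -> R) : Ig P h -> Ig P (fun w => h w * \1_A w).
    move=> Ih; apply: (@Ig_dom _ _ _ _ _ (fun w => `|h w|)); last exact: Ig_abs.
      by apply: measurable_funM; [exact: Ig_mf Ih|exact: measurable_indic].
    by move=> w; rewrite normrM ler_piMr// indicE; case: (_ \in _); rewrite ?normr1 ?normr0.
  apply/eqP; rewrite -subr_eq0 -ExB; [|exact: Ib|exact: Ib]; apply/eqP; rewrite -[RHS]e0.
  apply: Ex_eq => w; rewrite -mulrBl; congr (_ * _).
  by case: (leP (x w) 0); case: (leP (- x w) 0) => *; lra.
- by move=> w; rewrite lee_fin.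
Qed.

Let Is2 : Ig P s2.
Proof.
have m1 : mG (fun=> 1) by exact: measurable_cst.
have e := Kx2_int m1 (fun=> ler01).
have I1 : Ig P (fun w => 1 * x w ^+ 2) by apply: IgZ.
have [|//|I _] := Ex_int_eq _ _ I1 (esym e).
- by apply: measurable_funM => //; exact: (mGT step_ms2).
- by move=> w; rewrite mul1r.
by move: I; rewrite (_ : (fun w => 1 * s2 w) = s2)//; apply/funext => w; rewrite mul1r.
Qed.

(* On [s2 > eps^2], (A1) would contradict the conditional Jensen inequality between the moments of
   order [2] and [2 + rho]; [sqr_young] replaces the latter. *)
Lemma step_s2_le : {ae P, forall w, s2 w <= eps ^+ 2}.
Proof.
pose A := [set w | eps ^+ 2 < s2 w]; pose K w := (eps ^+ 2 < s2 w)%R%:R : R.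
have mb : measurable_fun [set: g_sigma_algebraType G] (fun w => eps ^+ 2 < s2 w).
  by apply: measurable_fun_ltr => //; exact: step_ms2.
have mK : mG K.
  rewrite /mG /K (_ : (fun _ => _) = (fun w => if eps ^+ 2 < s2 w then 1 else 0)).
    exact: measurable_fun_ifT.
  by apply/funext => w; case: ifP.
have K01 w : 0 <= K w <= 1 by rewrite /K; case: (_ < _); rewrite ?lexx ?ler01.
have K0 w : 0 <= K w by have /andP[] := K01 w.
have Kn w : `|K w| <= 1 by rewrite ger0_norm//; have /andP[] := K01 w.
have e0 : 0 < eps `^ rho by exact: powR_gt0.
have IKs : Ig P (fun w => K w * s2 w) := Ig_bM (mGT mK) Kn Is2.
have IKe : Ig P (fun w => K w * (eps `^ rho * s2 w)) := Ig_bM (mGT mK) Kn (IgZ _ Is2).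
have [||IKx2 EKx2] := Ex_int_eq _ _ IKs (Kx2_int mK K0).
- by apply: measurable_funM; [exact: mGT|exact: measurable_funX].
- by move=> w; rewrite mulr_ge0 ?sqr_ge0.
have [||IKZ EKZ] := Ex_int_le _ _ IKe (KZ_int mK K0).
- by apply: measurable_funM; [exact: mGT|exact: mZ].
- by move=> w; rewrite mulr_ge0.
have IK : Ig P K := Ig_bdd P (mGT mK) Kn.
have Kd : Ig P (fun w => K w * (s2 w - eps ^+ 2)).
  exact: (Ig_bM (mGT mK) Kn (IgB Is2 (Ig_cst _ _))).
have d0 w : 0 <= K w * (s2 w - eps ^+ 2).
  by rewrite /K; case: ltP => h; rewrite ?mul0r// mul1r subr_ge0 ltW.
(* [sqr_young] tested against the indicator [K] gives [(1 + rho/2) eps^rho E[K s2] - (rho/2)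
   eps^(2+rho) E[K] <= eps^rho E[K s2]]; what remains is the claim times [(rho/2) eps^rho]. *)
have : Ex P (fun w => K w * (s2 w - eps ^+ 2)) <= 0.
  have I1 := IgB (IgZ (1 + rho / 2) (IgZ (eps `^ rho) IKx2)) (IgZ (rho / 2 * eps `^ (2 + rho)) IK).
  have := Ex_le I1 IKZ => h.
  have := le_trans (h _) EKZ; rewrite ExB; last 2 first.
  - exact: IgZ _ (IgZ _ IKx2).
  - exact: IgZ _ IK.
  rewrite (ExZ _ (IgZ _ IKx2)) !ExZ// EKx2.
  rewrite (_ : Ex P (fun w => K w * (eps `^ rho * s2 w)) = eps `^ rho * Ex P (fun w => K w * s2 w)); last first.
    by rewrite -ExZ//; apply: Ex_eq => w; ring.
  have epsE : eps `^ (2 + rho) = eps `^ rho * eps ^+ 2.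
    by rewrite addrC powRD ?(gt_eqF eps0) ?implybT// powR_mulrn// ltW.
  rewrite epsE.
  have -> : Ex P (fun w => K w * (s2 w - eps ^+ 2)) = Ex P (fun w => K w * s2 w) - eps ^+ 2 * Ex P K.
    by rewrite -(ExZ _ IK) -(ExB IKs (IgZ _ IK)); apply: Ex_eq => w; ring.
  move: (Ex P _) (Ex P K) => u v h1.
  have : eps `^ rho * (rho / 2) * (u - eps ^+ 2 * v) <= 0.
    apply: le_trans (_ : (1 + rho / 2) * (eps `^ rho * u) - rho / 2 * (eps `^ rho * eps ^+ 2) * v - eps `^ rho * u <= _); first by lra.
    rewrite subr_le0; apply: h1 => w.
    have := sqr_young (x w) rho0 eps0 => h2; have := ler_wpM2l (K0 w) h2.
    have z1 : `|x w| `^ (2 + rho) <= Zf w.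
      rewrite ler_peMr ?powR_ge0// -[X in X <= _]expR0 ler_expR mulr_ge0 ?invr_ge0 ?(ltW eps0)//.
      by rewrite le_max lexx orbT.
    have := ler_wpM2l (K0 w) z1.
    by rewrite epsE; lra.
  by rewrite pmulr_rle0// mulr_gt0// divr_gt0.
move=> /(ae_of_Ex0 Kd d0); apply: filterS => w h; rewrite leNgt; apply/negP => h2.
by move: h; rewrite /K h2 mul1r => /eqP; rewrite subr_eq0 => /eqP h3; rewrite h3 ltxx in h2.
Qed.

Variable s : T -> R.
Hypotheses (ms : mG s) (s01 : forall w, 0 <= s w <= eps ^+ 2) (sE : {ae P, forall w, s2 w = s w}).

Let s0 w : 0 <= s w. Proof. by have /andP[] := s01 w. Qed.

Let Kn (K : T -> R) (K0 : forall w, 0 <= K w) w : `|K w| = K w.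
Proof. by rewrite ger0_norm. Qed.

Let Ig_Ks (K : T -> R) : Ig P K -> Ig P (fun w => K w * s w).
Proof.
move=> IK; rewrite (_ : (fun _ => _) = fun w => s w * K w); last by apply/funext => w; rewrite mulrC.
apply: (@Ig_bM _ _ _ _ (eps ^+ 2)) IK; first exact: mGT.
by move=> w; rewrite ger0_norm//; have /andP[] := s01 w.
Qed.

Let Ks_int (K : T -> R) c : mG K -> (\int[P]_w (K w * (c * s2 w))%:E = \int[P]_w (K w * (c * s w))%:E)%E.
Proof.
move=> mK; apply: ae_eq_integral => //.
- apply/measurable_EFinP; apply: measurable_funM; first exact: mGT.
  by apply: measurable_funM => //; exact: (mGT step_ms2).
- apply/measurable_EFinP; apply: measurable_funM; first exact: mGT.
  by apply: measurable_funM => //; exact: mGT.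
by apply: filterS sE => w -> _.
Qed.

(** The weight is integrable and possibly unbounded, because it will contain the density of the
    previous steps; the bound [s <= eps^2] everywhere yields the integrability of the products. *)
Lemma step_moments K : mG K -> (forall w, 0 <= K w) -> Ig P K ->
  [/\ Ig P (fun w => K w * Zf w),
      Ex P (fun w => K w * Zf w) <= eps `^ rho * Ex P (fun w => K w * s w),
      Ig P (fun w => K w * x w ^+ 2) /\ Ex P (fun w => K w * x w ^+ 2) = Ex P (fun w => K w * s w) &
      Ig P (fun w => K w * x w) /\ Ex P (fun w => K w * x w) = 0].
Proof.
move=> mK K0 IK; have IKs := Ig_Ks IK.
have IKe : Ig P (fun w => K w * (eps `^ rho * s w)).
  rewrite (_ : (fun _ => _) = fun w => eps `^ rho * (K w * s w)); first exact: IgZ.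
  by apply/funext => w; rewrite mulrCA.
have hZ := KZ_int mK K0; rewrite (Ks_int _ mK) in hZ.
have [||IKZ EKZ] := Ex_int_le _ _ IKe hZ.
- by apply: measurable_funM; [exact: mGT|exact: mZ].
- by move=> w; rewrite mulr_ge0.
have hx : (\int[P]_w (K w * x w ^+ 2)%:E = \int[P]_w (K w * s w)%:E)%E.
  rewrite Kx2_int//; have := Ks_int 1 mK.
  by under eq_integral do rewrite mul1r; under [in RHS]eq_integral do rewrite mul1r.
have [||IKx2 EKx2] := Ex_int_eq _ _ IKs hx.
- by apply: measurable_funM; [exact: mGT|exact: measurable_funX mx].
- by move=> w; rewrite mulr_ge0 ?sqr_ge0.
have bd w : Num.max (x w) 0 <= 1 + x w ^+ 2 /\ Num.max (- x w) 0 <= 1 + x w ^+ 2.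
  by split; rewrite ge_max; apply/andP; split; nra.
have IK2 : Ig P (fun w => K w * (1 + x w ^+ 2)).
  rewrite (_ : (fun _ => _) = fun w => K w + K w * x w ^+ 2); first exact: IgD.
  by apply/funext => w; ring.
have Ip : Ig P (fun w => K w * Num.max (x w) 0).
  apply: Ig_dom _ _ IK2 => [|w].
    by apply: measurable_funM; [exact: mGT|exact: measurable_maxr].
  have [b1 _] := bd w; rewrite ger0_norm ?mulr_ge0// ?le_max ?lexx ?orbT//; exact: ler_wpM2l.
have In : Ig P (fun w => K w * Num.max (- x w) 0).
  apply: Ig_dom _ _ IK2 => [|w].
    apply: measurable_funM; [exact: mGT|apply: measurable_maxr => //; exact: measurableT_comp].
  have [_ b1] := bd w; rewrite ger0_norm ?mulr_ge0// ?le_max ?lexx ?orbT//; exact: ler_wpM2l.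
have xE w : K w * x w = K w * Num.max (x w) 0 - K w * Num.max (- x w) 0.
  rewrite -mulrBr; congr (_ * _).
  by case: (leP (x w) 0); case: (leP (- x w) 0) => *; lra.
split => //.
- apply: le_trans EKZ _; rewrite -ExZ// le_eqVlt; apply/orP; left; apply/eqP.
  by apply: Ex_eq => w; rewrite mulrCA.
- split; first by rewrite (_ : (fun w => K w * x w) = fun w => K w * Num.max (x w) 0 - K w * Num.max (- x w) 0); [exact: (IgB Ip In)|apply/funext => w; exact: xE].
  rewrite (Ex_eq _ xE) ExB//; apply/eqP; rewrite subr_eq0; apply/eqP.
  by apply: EFin_inj; rewrite !Ex_fin// Kx_int.
Qed.

Variable lam : R.
Hypotheses (lam0 : 0 <= lam) (le1 : lam * eps <= 1).

Local Notation tau := (lam `^ (2 + rho) * eps `^ rho).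

Let lam_le : lam <= eps^-1. Proof. by rewrite -div1r ler_pdivlMr. Qed.

Let max_le w : expR (Num.max (lam * x w) 0) <= expR (eps^-1 * Num.max (x w) 0).
Proof.
rewrite ler_expR (_ : Num.max (lam * x w) 0 = lam * Num.max (x w) 0); last by rewrite maxr_pMr// mulr0.
by apply: ler_wpM2r => //; rewrite le_max lexx orbT.
Qed.

Let exp_le w : expR (lam * x w) <= expR (eps^-1 * Num.max (x w) 0).
Proof. by apply: le_trans (max_le w); rewrite ler_expR le_max lexx. Qed.

(** Since [lam * eps <= 1], the factor [exp (lam x^+)] is at most the exponential weight of (A1). *)
Lemma step_e2 w : `|expR (lam * x w) - 1 - lam * x w - (lam * x w) ^+ 2 / 2| <= 4 * lam `^ (2 + rho) * Zf w.
Proof.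
apply: le_trans (expR_taylor2 _ rho01) _; rewrite -mulrA ler_pM2l// normrM (ger0_norm lam0).
rewrite powRM// -!mulrA; do 2 (apply: ler_wpM2l; first exact: powR_ge0); exact: max_le.
Qed.

Lemma step_e1 w : `|x w * expR (lam * x w) - x w - lam * x w ^+ 2| <= 4 * lam `^ (1 + rho) * Zf w.
Proof.
have -> : x w * expR (lam * x w) - x w - lam * x w ^+ 2 = x w * (expR (lam * x w) - 1 - lam * x w) by ring.
rewrite normrM; apply: le_trans (ler_wpM2l (normr_ge0 _) (expR_taylor1 _ rho01)) _.
rewrite normrM (ger0_norm lam0) powRM//.
have -> : `|x w| `^ (2 + rho) = `|x w| * `|x w| `^ (1 + rho).
  by rewrite -{2}[`|x w|]powRr1// -powRD_gt0 ?addrA//; have := rho0; lra.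
apply: (@le_trans _ _ (4 * lam `^ (1 + rho) * (`|x w| * `|x w| `^ (1 + rho) * expR (Num.max (lam * x w) 0)))).
  by rewrite le_eqVlt; apply/orP; left; apply/eqP; ring.
apply: ler_wpM2l; first by rewrite mulr_ge0 ?powR_ge0.
by apply: ler_wpM2l; [rewrite mulr_ge0 ?powR_ge0|exact: max_le].
Qed.

Lemma step_e0 w : `|x w ^+ 2 * expR (lam * x w) - x w ^+ 2| <= 4 * lam `^ rho * Zf w.
Proof.
have -> : x w ^+ 2 * expR (lam * x w) - x w ^+ 2 = x w ^+ 2 * (expR (lam * x w) - 1) by ring.
rewrite normrM (ger0_norm (sqr_ge0 _)); apply: le_trans (ler_wpM2l (sqr_ge0 _) (expR_taylor0 _ rho01)) _.
rewrite normrM (ger0_norm lam0) powRM//.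
have -> : `|x w| `^ (2 + rho) = x w ^+ 2 * `|x w| `^ rho.
  by rewrite powRD_gt0 ?(powR_mulrn 2)// ?real_normK ?num_real//; have := rho0; lra.
apply: (@le_trans _ _ (4 * lam `^ rho * (x w ^+ 2 * `|x w| `^ rho * expR (Num.max (lam * x w) 0)))).
  by rewrite le_eqVlt; apply/orP; left; apply/eqP; ring.
apply: ler_wpM2l; first by rewrite mulr_ge0 ?powR_ge0.
by apply: ler_wpM2l; [rewrite mulr_ge0 ?sqr_ge0 ?powR_ge0|exact: max_le].
Qed.

Let Z_ge w : 1 <= `|x w| -> `|x w| `^ (2 + rho) <= Zf w /\ expR (lam * x w) <= Zf w.
Proof.
move=> x1; have p1 : 1 <= `|x w| `^ (2 + rho).
  have p0 : 0 <= 2 + rho by have := rho0; lra.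
  by have := ler_powR x1 p0; rewrite powRr0.
have E1 : 1 <= expR (eps^-1 * Num.max (x w) 0).
  by rewrite -[X in X <= _]expR0 ler_expR mulr_ge0 ?invr_ge0 ?(ltW eps0)// le_max lexx orbT.
split; first by rewrite ler_peMr// (le_trans ler01).
by apply: le_trans (exp_le w) _; rewrite ler_peMl// (le_trans ler01).
Qed.

Let exp_bd w : expR (lam * x w) <= expR lam * (1 + Zf w).
Proof.
have l1 : 1 <= expR lam by rewrite -[X in X <= _]expR0 ler_expR.
have [x1|x1] := leP 1 `|x w|.
  have [_ h] := Z_ge x1; apply: le_trans h _.
  by have := Zf0 w; move: (Zf w) => z; nra.
apply: (@le_trans _ _ (expR lam)).
  rewrite ler_expR ler_piMr// (le_trans (ler_norm _))// ltW//.
by rewrite ler_peMr ?expR_ge0// lerDl.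
Qed.

Lemma step_Ig (K f : T -> R) (c : R) : mG K -> (forall w, 0 <= K w) -> Ig P K -> measurable_fun setT f ->
  (forall w, `|f w| <= c * (1 + Zf w)) -> Ig P (fun w => K w * f w).
Proof.
move=> mK K0 IK mf fc; have [IZ _ _ _] := step_moments mK K0 IK.
apply: Ig_dom (IgZ c (IgD IK IZ)) => [|w]; first by apply: measurable_funM => //; exact: mGT.
rewrite normrM (Kn K0)//; apply: le_trans (ler_wpM2l (K0 w) (fc w)) _.
by rewrite le_eqVlt; apply/orP; left; apply/eqP; ring.
Qed.

Lemma step_exp_Ig K : mG K -> (forall w, 0 <= K w) -> Ig P K -> Ig P (fun w => K w * expR (lam * x w)).
Proof.
move=> mK K0 IK; apply: (@step_Ig _ _ (expR lam)) => //.
  by apply: measurable_expRl; exact: measurable_funM.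
by move=> w; rewrite ger0_norm ?expR_ge0.
Qed.

Lemma step_exp K : mG K -> (forall w, 0 <= K w) -> Ig P K ->
  `|Ex P (fun w => K w * expR (lam * x w)) - Ex P (fun w => K w * (1 + lam ^+ 2 / 2 * s w))| <=
    4 * tau * Ex P (fun w => K w * s w).
Proof.
move=> mK K0 IK; have [IZ EZ [I2 E2] [I1 E1]] := step_moments mK K0 IK.
have Ie := step_exp_Ig mK K0 IK; have IKs := Ig_Ks IK.
have -> : Ex P (fun w => K w * (1 + lam ^+ 2 / 2 * s w)) =
    Ex P (fun w => K w + lam * (K w * x w) + lam ^+ 2 / 2 * (K w * x w ^+ 2)).
  rewrite (ExD (IgD IK (IgZ lam I1)) (IgZ (lam ^+ 2 / 2) I2)) (ExD IK (IgZ lam I1)) !ExZ// E1 E2 mulr0 addr0.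
  by rewrite -(ExZ _ IKs) -(ExD IK (IgZ _ IKs)); apply: Ex_eq => w; ring.
have I3 := IgD (IgD IK (IgZ lam I1)) (IgZ (lam ^+ 2 / 2) I2).
rewrite -(ExB Ie I3); apply: (@le_trans _ _ (4 * lam `^ (2 + rho) * Ex P (fun w => K w * Zf w))).
  rewrite -(ExZ _ IZ); apply: (Ex_abs_le (IgB Ie I3) (IgZ _ IZ)) => w.
  rewrite (_ : _ - _ = K w * (expR (lam * x w) - 1 - lam * x w - (lam * x w) ^+ 2 / 2)); last by ring.
  rewrite normrM (Kn K0)// mulrCA; apply: ler_wpM2l => //; exact: step_e2.
rewrite mulrA -[leRHS]mulrA; apply: ler_wpM2l => //; by rewrite mulr_ge0 ?powR_ge0.
Qed.

Lemma step_expx K : mG K -> (forall w, 0 <= K w) -> Ig P K ->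
  Ig P (fun w => K w * (x w * expR (lam * x w))) /\
  `|Ex P (fun w => K w * (x w * expR (lam * x w))) - lam * Ex P (fun w => K w * s w)| <=
    4 * (lam `^ (1 + rho) * eps `^ rho) * Ex P (fun w => K w * s w).
Proof.
move=> mK K0 IK; have [IZ EZ [I2 E2] [I1 E1]] := step_moments mK K0 IK.
have c0 : 0 <= 4 * lam `^ (1 + rho) by rewrite mulr_ge0 ?powR_ge0.
have Ie : Ig P (fun w => K w * (x w * expR (lam * x w))).
  have Id := IgD (IgZ (4 * lam `^ (1 + rho)) IZ) (Ig_abs (IgD I1 (IgZ lam I2))).
  apply: Ig_dom Id => [|w].
    apply: measurable_funM; first exact: mGT.
    by apply: measurable_funM => //; apply: measurable_expRl; exact: measurable_funM.
  have -> : K w * (x w * expR (lam * x w)) =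
      K w * (x w * expR (lam * x w) - x w - lam * x w ^+ 2) + (K w * x w + lam * (K w * x w ^+ 2)) by ring.
  apply: le_trans (ler_normD _ _) _; rewrite lerD2r normrM (Kn K0) [leRHS]mulrCA; apply: (ler_wpM2l (K0 w)); exact: step_e1.
split => //; rewrite -E2.
have -> : lam * Ex P (fun w => K w * x w ^+ 2) = Ex P (fun w => K w * x w + lam * (K w * x w ^+ 2)).
  by rewrite (ExD I1 (IgZ _ I2)) E1 add0r ExZ.
have I3 := IgD I1 (IgZ lam I2).
rewrite -(ExB Ie I3) E2; apply: (@le_trans _ _ (4 * lam `^ (1 + rho) * Ex P (fun w => K w * Zf w))).
  rewrite -(ExZ _ IZ); apply: (Ex_abs_le (IgB Ie I3) (IgZ _ IZ)) => w.
  rewrite (_ : _ - _ = K w * (x w * expR (lam * x w) - x w - lam * x w ^+ 2)); last by ring.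
  rewrite normrM (Kn K0) [leRHS]mulrCA; apply: (ler_wpM2l (K0 w)); exact: step_e1.
by rewrite mulrA -[leRHS]mulrA; apply: ler_wpM2l.
Qed.

Lemma step_expx2 K : mG K -> (forall w, 0 <= K w) -> Ig P K ->
  Ig P (fun w => K w * (x w ^+ 2 * expR (lam * x w))) /\
  `|Ex P (fun w => K w * (x w ^+ 2 * expR (lam * x w))) - Ex P (fun w => K w * s w)| <=
    4 * (lam `^ rho * eps `^ rho) * Ex P (fun w => K w * s w).
Proof.
move=> mK K0 IK; have [IZ EZ [I2 E2] _] := step_moments mK K0 IK.
have c0 : 0 <= 4 * lam `^ rho by rewrite mulr_ge0 ?powR_ge0.
have Ie : Ig P (fun w => K w * (x w ^+ 2 * expR (lam * x w))).
  have Id := IgD (IgZ (4 * lam `^ rho) IZ) (Ig_abs I2).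
  apply: Ig_dom Id => [|w].
    apply: measurable_funM; first exact: mGT.
    apply: measurable_funM; first exact: measurable_funX.
    by apply: measurable_expRl; exact: measurable_funM.
  have -> : K w * (x w ^+ 2 * expR (lam * x w)) =
      K w * (x w ^+ 2 * expR (lam * x w) - x w ^+ 2) + K w * x w ^+ 2 by ring.
  apply: le_trans (ler_normD _ _) _; rewrite lerD2r normrM (Kn K0)// mulrCA; apply: ler_wpM2l => //; exact: step_e0.
split => //; rewrite -{1}E2 -(ExB Ie I2).
apply: (@le_trans _ _ (4 * lam `^ rho * Ex P (fun w => K w * Zf w))).
  rewrite -(ExZ _ IZ); apply: (Ex_abs_le (IgB Ie I2) (IgZ _ IZ)) => w.
  rewrite -mulrBr normrM (Kn K0)// mulrCA; apply: ler_wpM2l => //; exact: step_e0.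
by rewrite mulrA -[leRHS]mulrA; apply: ler_wpM2l.
Qed.

Lemma step_expp K : mG K -> (forall w, 0 <= K w) -> Ig P K ->
  Ig P (fun w => K w * (`|x w| `^ (2 + rho) * expR (lam * x w))) /\
  Ex P (fun w => K w * (`|x w| `^ (2 + rho) * expR (lam * x w))) <= eps `^ rho * Ex P (fun w => K w * s w).
Proof.
move=> mK K0 IK; have [IZ EZ _ _] := step_moments mK K0 IK.
have h w : `|x w| `^ (2 + rho) * expR (lam * x w) <= Zf w by apply: ler_wpM2l; rewrite ?powR_ge0.
have Ie : Ig P (fun w => K w * (`|x w| `^ (2 + rho) * expR (lam * x w))).
  apply: Ig_dom IZ => [|w].
    apply: measurable_funM; first exact: mGT.
    apply: measurable_funM; first by apply: measurable_powRl; exact: measurableT_comp.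
    by apply: measurable_expRl; exact: measurable_funM.
  rewrite normrM (Kn K0)// ger0_norm ?mulr_ge0 ?powR_ge0 ?expR_ge0//; exact: ler_wpM2l.
split => //; apply: le_trans EZ; apply: (Ex_le Ie IZ) => w; exact: (ler_wpM2l (K0 w) (h w)).
Qed.

(** [m] is the conditional expectation of [exp (lam x)], for which the estimate holds almost surely;
    where it fails, [m] is replaced by [1 + lam^2 s / 2], so that the estimate holds everywhere and
    [m] can be divided by. *)
Lemma step_normalizer : exists m : T -> R, [/\ mG m,
  (forall w, `|m w - (1 + lam ^+ 2 / 2 * s w)| <= 4 * tau * s w) &
  forall K, mG K -> (forall w, 0 <= K w) ->
    (\int[P]_w (K w * expR (lam * x w))%:E = \int[P]_w (K w * m w)%:E)%E].
Proof.
have t0 : 0 <= 4 * tau by rewrite mulr_ge0 ?mulr_ge0 ?powR_ge0.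
have m1 : mG (fun=> 1) by exact: measurable_cst.
have mexp : measurable_fun setT (fun w => expR (lam * x w)) by apply: measurable_expRl; exact: measurable_funM.
have Iexp : Ig P (fun w => expR (lam * x w)).
  have := step_exp_Ig m1 (fun=> ler01) (Ig_cst P 1).
  by rewrite (_ : (fun _ => _) = fun w => expR (lam * x w))//; apply/funext => w; rewrite mul1r.
have [m0 [/(G_measurableP sG) mm m00 mE]] := condexp_exists sG Iexp (fun w => expR_ge0 (lam * x w)).
have pull K : mG K -> (forall w, 0 <= K w) ->
    (\int[P]_w (K w * expR (lam * x w))%:E = \int[P]_w (K w * m0 w)%:E)%E.
  move=> mK K0; under eq_integral do rewrite EFinM.
  under [RHS]eq_integral do rewrite EFinM.
  apply: (cond_pullout sG _ _ _ _ _ (mGE mK)).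
  - exact/measurable_EFinP.
  - exact/measurable_EFinP/mGT.
  - by move=> w; rewrite lee_fin expR_ge0.
  - by move=> w; rewrite lee_fin.
  - by move=> A GA; rewrite mE.
  - by move=> w; rewrite lee_fin.
pose c w := 1 + lam ^+ 2 / 2 * s w; pose e w := 4 * tau * s w.
have mc : mG c by apply: measurable_funD; [exact: measurable_cst|apply: measurable_funM; [exact: measurable_cst|]].
have me : mG e by apply: measurable_funM; [exact: measurable_cst|].
have Im0 : Ig P m0.
  apply: Ig_ge0; [exact: mGT|by []|].
  have := pull _ m1 (fun=> ler01).
  under eq_integral do rewrite mul1r.
  under [RHS]eq_integral do rewrite mul1r.
  by move=> <-; rewrite -Ex_fin// ltry.
have Is : Ig P s by have := Ig_Ks (Ig_cst P 1); rewrite (_ : (fun _ => _) = s)//; apply/funext => w; rewrite mul1r.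
have Ic : Ig P c := IgD (Ig_cst P 1) (IgZ _ Is).
have Ie : Ig P e := IgZ _ Is.
(* An almost sure inequality follows by testing against the indicator of the set where it fails,
   which is [G]-measurable. *)
have ae_le (f g : T -> R) : mG f -> mG g -> Ig P f -> Ig P g ->
    (forall K, mG K -> (forall w, 0 <= K w) -> (forall w, `|K w| <= 1) -> Ex P (fun w => K w * (f w - g w)) <= 0) ->
    {ae P, forall w, f w <= g w}.
  move=> mf mg If Ig_ H; pose K w := (g w < f w)%R%:R : R.
  have mK : mG K.
    rewrite /mG /K (_ : (fun _ => _) = (fun w => if g w < f w then 1 else 0)).
      by apply: measurable_fun_ifT => //; exact: measurable_fun_ltr.
    by apply/funext => w; case: ifP.
  have K0 w : 0 <= K w by rewrite /K; case: (_ < _).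
  have K1 w : `|K w| <= 1 by rewrite (Kn K0)// /K; case: (_ < _).
  have IK := Ig_bM (mGT mK) K1 (IgB If Ig_).
  have k0 w : 0 <= K w * (f w - g w).
    by rewrite /K; case: ltP => h'; rewrite ?mul0r// mul1r subr_ge0 ltW.
  apply: filterS (ae_of_Ex0 IK k0 (H K mK K0 K1)) => w hw; rewrite leNgt; apply/negP => h2.
  by move: hw; rewrite /K h2 mul1r => /eqP; rewrite subr_eq0 => /eqP h3; rewrite h3 ltxx in h2.
have Kfacts K : mG K -> (forall w, 0 <= K w) -> (forall w, `|K w| <= 1) ->
    `|Ex P (fun w => K w * m0 w) - Ex P (fun w => K w * c w)| <= Ex P (fun w => K w * e w).
  move=> mK K0 K1; have IK := Ig_bdd P (mGT mK) K1.
  have -> : Ex P (fun w => K w * m0 w) = Ex P (fun w => K w * expR (lam * x w)).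
    apply: EFin_inj; rewrite !Ex_fin; [by rewrite pull|exact: step_exp_Ig|].
    exact: (Ig_bM (mGT mK) K1 Im0).
  apply: le_trans (step_exp mK K0 IK) _; rewrite -(ExZ _ (Ig_Ks IK)).
  by rewrite le_eqVlt; apply/orP; left; apply/eqP; apply: Ex_eq => w; rewrite /e; ring.
have up : {ae P, forall w, m0 w <= c w + e w}.
  apply: ae_le => //; [exact: measurable_funD|exact: IgD|].
  move=> K mK K0 K1; have := Kfacts K mK K0 K1; rewrite ler_norml => /andP[_ h].
  have i1 := Ig_bM (mGT mK) K1 Im0; have i2 := Ig_bM (mGT mK) K1 Ic; have i3 := Ig_bM (mGT mK) K1 Ie.
  move: h; rewrite -subr_le0 -(ExB i1 i2) -(ExB (IgB i1 i2) i3); congr (_ <= _).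
  by apply: Ex_eq => w; ring.
have dn : {ae P, forall w, c w - e w <= m0 w}.
  apply: ae_le => //; [exact: measurable_funB|exact: IgB|].
  move=> K mK K0 K1; have := Kfacts K mK K0 K1; rewrite ler_norml => /andP[h _].
  have i1 := Ig_bM (mGT mK) K1 Im0; have i2 := Ig_bM (mGT mK) K1 Ic; have i3 := Ig_bM (mGT mK) K1 Ie.
  move: h; rewrite -(ExB i1 i2) -subr_ge0 opprK -(ExD (IgB i1 i2) i3) => h.
  rewrite -oppr_ge0; apply: le_trans h _; rewrite -mulN1r.
  rewrite -(ExZ _ (Ig_bM (mGT mK) K1 (IgB (IgB Ic Ie) Im0))) le_eqVlt; apply/orP; left; apply/eqP.
  by apply: Ex_eq => w; ring.
pose m w := if (c w - e w <= m0 w) && (m0 w <= c w + e w) then m0 w else c w.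
exists m; split.
- apply: measurable_fun_ifT => //; apply: measurable_and.
  + by apply: measurable_fun_ler => //; exact: measurable_funB.
  + by apply: measurable_fun_ler => //; exact: measurable_funD.
- move=> w; rewrite -/(c w) -/(e w) /m; case: ifP => [/andP[h1 h2]|_].
    by rewrite ler_norml; apply/andP; split; lra.
  by rewrite subrr normr0 mulr_ge0.
- move=> K mK K0; rewrite pull//; apply: ae_eq_integral => //.
  + by apply/measurable_EFinP; apply: measurable_funM; exact: mGT.
  + apply/measurable_EFinP; apply: measurable_funM; first exact: mGT.
    apply: mGT; apply: measurable_fun_ifT => //; apply: measurable_and.
    * by apply: measurable_fun_ler => //; exact: measurable_funB.
    * by apply: measurable_fun_ler => //; exact: measurable_funD.
  + by apply: filterS2 up dn => w h1 h2 _; rewrite /m h1 h2.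
Qed.

End one_step.

Lemma powR_normB_le {R : realType} (q x y : R) : 0 <= q <= 3 ->
  `|x - y| `^ q <= 8 * (`|x| `^ q + `|y| `^ q).
Proof.
move=> /andP[q0 q3]; set M := Num.max `|x| `|y|.
have M0 : 0 <= M by rewrite le_max normr_ge0.
apply: (@le_trans _ _ ((2 * M) `^ q)).
  apply: ge0_ler_powR; rewrite ?nnegrE ?mulr_ge0//; apply: le_trans (ler_normB _ _) _.
  have : `|x| <= M by rewrite le_max lexx.
  have : `|y| <= M by rewrite le_max lexx orbT.
  lra.
rewrite powRM//; apply: ler_pM; rewrite ?powR_ge0//.
  rewrite (_ : 8 = 2 `^ 3%:R :> R); first by apply: ler_powR => //; rewrite ler1n.
  by rewrite powR_mulrn// -natrX.
by rewrite /M; case: (leP `|x| `|y|) => _; rewrite ?lerDl ?lerDr powR_ge0.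
Qed.

(** * The tilted measure *)

Section tilted.
Context {d} {T : measurableType d} {R : realType}.
Variables (P : probability T R) (n : nat) (F : nat -> set (set T)) (x s m : nat -> T -> R).
Variables (rho eps lam : R).
Hypotheses (sF : forall k, (k <= n)%N -> sub_sigma_field (F k))
  (FF : forall k, (k < n)%N -> F k `<=` F k.+1)
  (mx : forall k, (k < n)%N -> Fmeas F k.+1 (x k.+1))
  (ms : forall k, (k < n)%N -> Fmeas F k (s k.+1))
  (mm : forall k, (k < n)%N -> Fmeas F k (m k))
  (s01 : forall k w, 0 <= s k w <= eps ^+ 2)
  (rho01 : 0 < rho <= 1) (eps0 : 0 < eps) (lam0 : 0 <= lam)
  (small : (lam * eps) `^ rho <= 8^-1).

Local Notation a := (lam `^ (1 + rho) * eps `^ rho).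
Local Notation b := (lam `^ rho * eps `^ rho).
Local Notation tau := (lam `^ (2 + rho) * eps `^ rho).

Hypotheses
  (mP : forall k w, (k < n)%N -> `|m k w - (1 + lam ^+ 2 / 2 * s k.+1 w)| <= 4 * tau * s k.+1 w)
  (mE : forall k K, (k < n)%N -> Fmeas F k K -> (forall w, 0 <= K w) ->
    (\int[P]_w (K w * expR (lam * x k.+1 w))%:E = \int[P]_w (K w * m k w)%:E)%E)
  (stepP : forall k K, (k < n)%N -> Fmeas F k K -> (forall w, 0 <= K w) -> Ig P K ->
    [/\ Ig P (fun w => K w * (x k.+1 w * expR (lam * x k.+1 w))) /\
        `|Ex P (fun w => K w * (x k.+1 w * expR (lam * x k.+1 w))) - lam * Ex P (fun w => K w * s k.+1 w)| <=
        4 * a * Ex P (fun w => K w * s k.+1 w),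
      Ig P (fun w => K w * (x k.+1 w ^+ 2 * expR (lam * x k.+1 w))) /\
        `|Ex P (fun w => K w * (x k.+1 w ^+ 2 * expR (lam * x k.+1 w))) - Ex P (fun w => K w * s k.+1 w)| <=
        4 * b * Ex P (fun w => K w * s k.+1 w) &
      Ig P (fun w => K w * (`|x k.+1 w| `^ (2 + rho) * expR (lam * x k.+1 w))) /\
        Ex P (fun w => K w * (`|x k.+1 w| `^ (2 + rho) * expR (lam * x k.+1 w))) <=
        eps `^ rho * Ex P (fun w => K w * s k.+1 w)]).

Let s0 k w : 0 <= s k w. Proof. by have /andP[] := s01 k w. Qed.
Let se k w : s k w <= eps ^+ 2. Proof. by have /andP[] := s01 k w. Qed.
Let rho0 : 0 < rho. Proof. by case/andP: rho01. Qed.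
Let rho1 : rho <= 1. Proof. by case/andP: rho01. Qed.
Let le0 : 0 <= lam * eps. Proof. by rewrite mulr_ge0// ltW. Qed.

Let le1 : lam * eps <= 1.
Proof.
rewrite leNgt; apply/negP => h; have : 1 <= (lam * eps) `^ rho.
  have := ler_powR (ltW h) (ltW rho0); rewrite powRr0; exact.
by move=> /le_trans /(_ small); rewrite invf_ge1//; lra.
Qed.

Let bE : b = (lam * eps) `^ rho. Proof. by rewrite powRM// ltW. Qed.
Let b0 : 0 <= b. Proof. by rewrite mulr_ge0 ?powR_ge0. Qed.
Let a0 : 0 <= a. Proof. by rewrite mulr_ge0 ?powR_ge0. Qed.
Let tau0 : 0 <= tau. Proof. by rewrite mulr_ge0 ?powR_ge0. Qed.
Let e0 : 0 <= eps `^ rho. Proof. exact: powR_ge0. Qed.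

Let aE : a = lam * b.
Proof. by rewrite powRD_gt0 ?powRr1 ?mulrA//; have := rho0; lra. Qed.

Let tauE : tau = lam ^+ 2 * b.
Proof. by rewrite powRD_gt0 ?(powR_mulrn 2) ?mulrA//; have := rho0; lra. Qed.

Let le2b : (lam * eps) ^+ 2 <= b.
Proof.
rewrite bE; have [->|e] := eqVneq (lam * eps) 0; first by rewrite expr0n powR_ge0.
rewrite -powR_mulrn//; apply: ger_powR; first by rewrite le1 lt_def e le0.
by have := rho1; lra.
Qed.

Let l2s k w : lam ^+ 2 * s k w <= (lam * eps) ^+ 2.
Proof. by rewrite exprMn; apply: ler_wpM2l; rewrite ?sqr_ge0. Qed.

(** The smallness [(lam eps)^rho <= 1 / 8] makes the error [4 tau s] at most the main term
    [lam^2 s / 2], whence [m >= 1]. *)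
Let m_bd k w : (k < n)%N -> 1 <= m k w <= 1 + lam ^+ 2 * s k.+1 w.
Proof.
move=> kn; have := mP w kn; have h : 4 * tau * s k.+1 w <= lam ^+ 2 / 2 * s k.+1 w.
  apply: ler_wpM2r => //; rewrite tauE bE; have := sqr_ge0 lam; have := small.
  by move: (_ `^ _) => z; nra.
by rewrite ler_norml => /andP[h1 h2]; apply/andP; split; lra.
Qed.

Let m_gt0 k w : (k < n)%N -> 0 < m k w.
Proof. by move=> kn; have /andP[h _] := m_bd w kn; exact: lt_le_trans h. Qed.

Let Fmeas_T' k (f : T -> R) : (k <= n)%N -> Fmeas F k f -> measurable_fun setT f.
Proof. by move=> kn /(G_measurableP (sF kn)) h; exact: (G_measurable_meas (sF kn)). Qed.

Let Fmeas_S' k (f : T -> R) : (k < n)%N -> Fmeas F k f -> Fmeas F k.+1 f.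
Proof.
move=> kn /(G_measurableP (sF (ltnW kn))) h; apply/(G_measurableP (sF kn)) => B mB.
by apply: (FF kn); exact: h.
Qed.

Let Fmeas_le' k j (f : T -> R) : (k <= j)%N -> (j <= n)%N -> Fmeas F k f -> Fmeas F j f.
Proof.
move=> /subnK <-; elim: (j - k)%N => // i IH; rewrite addSn => h kf.
by apply: Fmeas_S' => //; apply: IH => //; exact: ltnW.
Qed.

Let Fmeas_inv k (f : T -> R) : Fmeas F k f -> (forall w, 0 < f w) -> Fmeas F k (fun w => (f w)^-1).
Proof.
move=> mf f0; rewrite (_ : (fun _ => _) = fun w => f w `^ (-1)); first exact: measurable_powRl.
by apply/funext => w; rewrite powR_inv1// ltW.
Qed.

Definition tilt_density k w := \prod_(i < k) (expR (lam * x i.+1 w) / m i w).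

Local Notation D := tilt_density.

Let DS k w : D k.+1 w = D k w * (expR (lam * x k.+1 w) / m k w).
Proof. by rewrite /tilt_density big_ord_recr. Qed.

Let D_gt0 k w : (k <= n)%N -> 0 < D k w.
Proof.
move=> kn; apply: prodr_gt0 => i _; rewrite divr_gt0 ?expR_gt0// m_gt0//.
exact: leq_trans (ltn_ord i) kn.
Qed.

Let Fmeas_D k : (k <= n)%N -> Fmeas F k (D k).
Proof.
elim: k => [_|k IH kn].
  rewrite (_ : D 0 = fun=> 1); first exact: measurable_cst.
  by apply/funext => w; rewrite /tilt_density big_ord0.
rewrite (_ : D k.+1 = fun w => D k w * (expR (lam * x k.+1 w) * (m k w)^-1)); last by apply/funext => w; exact: DS.
apply: measurable_funM; first exact: Fmeas_S' kn (IH (ltnW kn)).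
apply: measurable_funM.
  apply: measurable_expRl; apply: measurable_funM; [exact: measurable_cst|exact: mx].
apply: Fmeas_S' => //; apply: Fmeas_inv; first exact: mm.
by move=> w; exact: m_gt0.
Qed.

Let step_int k H : (k < n)%N -> Fmeas F k H -> (forall w, 0 <= H w) ->
  (\int[P]_w (H w * D k.+1 w)%:E = \int[P]_w (H w * D k w)%:E)%E.
Proof.
move=> kn mH H0; pose K w := H w * D k w * (m k w)^-1.
have mK : Fmeas F k K.
  apply: measurable_funM; first by apply: measurable_funM => //; exact: Fmeas_D (ltnW kn).
  by apply: Fmeas_inv; [exact: mm|move=> w; exact: m_gt0].
have K0 w : 0 <= K w.
  by rewrite !mulr_ge0 ?invr_ge0// ltW ?m_gt0// D_gt0// ltnW.
transitivity (\int[P]_w (K w * expR (lam * x k.+1 w))%:E)%E.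
  by apply: eq_integral => w _; congr _%:E; rewrite DS /K; ring.
rewrite mE//; apply: eq_integral => w _; congr _%:E.
by rewrite /K mulfVK// gt_eqF// m_gt0.
Qed.

(** The martingale property of the density process in integrated form, for weights known at time
    [k]. *)
Let chain_int k j H : (k <= j)%N -> (j <= n)%N -> Fmeas F k H -> (forall w, 0 <= H w) ->
  (\int[P]_w (H w * D j w)%:E = \int[P]_w (H w * D k w)%:E)%E.
Proof.
elim: j => [|j IH] kj jn mH H0; first by move: kj mH; rewrite leqn0 => /eqP ->.
move: kj; rewrite leq_eqVlt => /orP[/eqP ->//|]; rewrite ltnS => kj.
rewrite step_int//; first exact: IH kj (ltnW jn) mH H0.
exact: Fmeas_le' kj (ltnW jn) mH.
Qed.

Let D_int k : (k <= n)%N -> (\int[P]_w (D k w)%:E = 1)%E.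
Proof.
move=> kn; have m1 : Fmeas F 0 (fun _ : T => 1 : R) by exact: measurable_cst.
have := chain_int (leq0n k) kn m1 (fun=> ler01).
under eq_integral do rewrite mul1r.
move=> ->; rewrite -[RHS](@probability_setT _ _ _ P) -[RHS]mul1e -integral_cst//.
by apply: eq_integral => w _; rewrite /tilt_density big_ord0 mulr1.
Qed.

Let Ig_D k : (k <= n)%N -> Ig P (D k).
Proof.
move=> kn; apply: Ig_ge0; first exact: Fmeas_T' kn (Fmeas_D kn).
  by move=> w; rewrite ltW// D_gt0.
by rewrite D_int// ltry.
Qed.

Let mDn : measurable_fun setT (EFin \o D n).
Proof. exact/measurable_EFinP/(Fmeas_T' (leqnn n) (Fmeas_D (leqnn n))). Qed.

Let Dn0 w : (0 <= (EFin \o D n) w)%E.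
Proof. by rewrite lee_fin ltW// D_gt0. Qed.

Definition tilted_prob : probability T R := density_prob mDn Dn0 (D_int (leqnn n)).

Local Notation Q := tilted_prob.

Let Q_int (g : T -> R) : measurable_fun setT g -> (forall w, 0 <= g w) ->
  (\int[Q]_w (g w)%:E = \int[P]_w (g w * D n w)%:E)%E.
Proof.
move=> mg g0; under [RHS]eq_integral do rewrite EFinM.
apply: (@ge0_integral_density _ _ _ _ _ P Q idfun (EFin \o D n)) => //.
- exact: measurable_id.
- exact/measurable_EFinP.
Qed.

Lemma tilted_ae (A : T -> Prop) : {ae P, forall w, A w} -> {ae Q, forall w, A w}.
Proof.
move=> [N [mN N0 sN]]; exists N; split => //.
by apply: null_set_integral => //; exact: measurable_funTS.
Qed.

(** By the martingale property the density at time [n] may be replaced by that at time [k]. A signed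
    [H] is split, since [chain_int] is for nonnegative weights. *)
Lemma tilted_Ex k H : (k <= n)%N -> Fmeas F k H -> Ig P (fun w => H w * D k w) ->
  Ig Q H /\ Ex Q H = Ex P (fun w => H w * D k w).
Proof.
move=> kn mH IH; have mHT := Fmeas_T' kn mH; have mDT := Fmeas_T' kn (Fmeas_D kn).
pose Hp w := Num.max (H w) 0; pose Hn w := Num.max (- H w) 0.
have mp : Fmeas F k Hp by exact: measurable_maxr.
have mn : Fmeas F k Hn by apply: measurable_maxr => //; exact: measurableT_comp.
have p0 w : 0 <= Hp w by rewrite le_max lexx orbT.
have n0 w : 0 <= Hn w by rewrite le_max lexx orbT.
have HE w : H w = Hp w - Hn w.
  by rewrite /Hp /Hn; case: (leP (H w) 0); case: (leP (- H w) 0) => *; lra.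
have D0 w : 0 <= D k w by rewrite ltW// D_gt0.
have pos g : Fmeas F k g -> (forall w, 0 <= g w <= `|H w|) ->
    [/\ Ig Q g, Ig P (fun w => g w * D k w) & Ex Q g = Ex P (fun w => g w * D k w)].
  move=> mg gH; have g0 w : 0 <= g w by have /andP[] := gH w.
  have IgD_ : Ig P (fun w => g w * D k w).
    apply: Ig_dom (Ig_abs IH) => [|w].
      by apply: measurable_funM => //; exact: (Fmeas_T' kn mg).
    by rewrite !normrM; apply: ler_wpM2r => //; rewrite (ger0_norm (g0 w)); have /andP[] := gH w.
  have e : (\int[Q]_w (g w)%:E = (Ex P (fun w => g w * D k w))%:E)%E.
    rewrite Q_int//; last exact: (Fmeas_T' kn mg).
    by rewrite (chain_int kn (leqnn n) mg g0) Ex_fin.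
  have IQ : Ig Q g.
    by apply: Ig_ge0 => //; [exact: (Fmeas_T' kn mg)|rewrite e ltry].
  by split => //; apply: EFin_inj; rewrite Ex_fin.
have [|Iqp Ipp Ep] := pos _ mp.
  by move=> w; rewrite p0 /Hp ge_max ler_norm normr_ge0.
have [|Iqn Ipn En] := pos _ mn.
  by move=> w; rewrite n0 /Hn ge_max -normrN ler_norm normr_ge0.
have -> : H = (fun w => Hp w - Hn w) by apply/funext.
split; first exact: IgB.
rewrite ExB// Ep En -ExB//; apply: Ex_eq => w; ring.
Qed.

Section moments.
Variables (k : nat) (H : T -> R) (M : R).
Hypotheses (kn : (k < n)%N) (mH : Fmeas F k H) (H0 : forall w, 0 <= H w) (HM : forall w, H w <= M).

(** The weight that turns [Q]-moments of the next increment into exponential [P]-moments: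
    [H f D_(k+1) = K f exp (lam x_(k+1))]. *)
Let K w := H w * D k w * (m k w)^-1.

Let mK : Fmeas F k K.
Proof.
apply: measurable_funM; first by apply: measurable_funM => //; exact: Fmeas_D (ltnW kn).
by apply: Fmeas_inv; [exact: mm|move=> w; exact: m_gt0].
Qed.

Let D0 w : 0 <= D k w. Proof. by rewrite ltW// D_gt0// ltnW. Qed.

Let K0 w : 0 <= K w.
Proof. by rewrite !mulr_ge0 ?invr_ge0// ltW ?m_gt0. Qed.

Let KHD w : K w <= H w * D k w.
Proof.
rewrite /K ler_piMr ?mulr_ge0// invf_le1 ?m_gt0//; by have /andP[] := m_bd w kn.
Qed.

Let Ig_HD : Ig P (fun w => H w * D k w).
Proof.
apply: (@Ig_bM _ _ _ _ M) (Ig_D (ltnW kn)); first exact: (Fmeas_T' (ltnW kn) mH).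
by move=> w; rewrite ger0_norm.
Qed.

Let IK : Ig P K.
Proof.
apply: Ig_dom Ig_HD => [|w]; first exact: (Fmeas_T' (ltnW kn) mK).
by rewrite ger0_norm.
Qed.

Let Ig_HDs : Ig P (fun w => H w * D k w * s k.+1 w).
Proof.
rewrite (_ : (fun _ => _) = fun w => s k.+1 w * (H w * D k w)); last by apply/funext => w; rewrite mulrC.
apply: (@Ig_bM _ _ _ _ (eps ^+ 2)) Ig_HD; first exact: (Fmeas_T' (ltnW kn) (ms kn)).
by move=> w; rewrite ger0_norm.
Qed.

Let Ig_Ks : Ig P (fun w => K w * s k.+1 w).
Proof.
apply: Ig_dom Ig_HDs => [|w].
  by apply: measurable_funM; [exact: (Fmeas_T' (ltnW kn) mK)|exact: (Fmeas_T' (ltnW kn) (ms kn))].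
by rewrite (ger0_norm (mulr_ge0 (K0 w) (s0 k.+1 w))); exact: (ler_wpM2r (s0 k.+1 w) (KHD w)).
Qed.

Let Sq := Ex Q (fun w => H w * s k.+1 w).
Let Sk := Ex P (fun w => K w * s k.+1 w).

Let SqE : Ig Q (fun w => H w * s k.+1 w) /\ Sq = Ex P (fun w => H w * D k w * s k.+1 w).
Proof.
have := @tilted_Ex k (fun w => H w * s k.+1 w) (ltnW kn).
rewrite (_ : (fun w => H w * s k.+1 w * D k w) = fun w => H w * D k w * s k.+1 w); last first.
  by apply/funext => w; ring.
by apply=> //; apply: measurable_funM => //; exact: ms.
Qed.

Let Sq0 : 0 <= Sq. Proof. by apply: Ex_ge0 => w; rewrite mulr_ge0. Qed.
Let Sk_le : Sk <= Sq.
Proof.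
by have [_ ->] := SqE; apply: (Ex_le Ig_Ks Ig_HDs) => w; exact: (ler_wpM2r (s0 k.+1 w) (KHD w)).
Qed.

(** From [1 <= m <= 1 + lam^2 s]: the normalizer changes the variance by a relative [(lam eps)^2],
    which is at most [b]. *)
Let SqSk : Sq - Sk <= (lam * eps) ^+ 2 * Sq.
Proof.
have [_ E] := SqE; rewrite {1}E -(ExB Ig_HDs Ig_Ks) E -(ExZ _ Ig_HDs).
apply: (Ex_le (IgB Ig_HDs Ig_Ks) (IgZ _ Ig_HDs)) => w.
rewrite -mulrBl mulrA; apply: ler_wpM2r => //; rewrite /K -{1}[H w * D k w]mulr1 -mulrBr mulrC.
apply: ler_wpM2r; first exact: mulr_ge0.
have mw := m_gt0 w kn; have /andP[m1 m2] := m_bd w kn.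
have mi : m k w * (m k w)^-1 = 1 by rewrite divff ?gt_eqF.
have i1 : (m k w)^-1 <= 1 by rewrite invf_le1.
apply: le_trans (l2s k.+1 w); nra.
Qed.

Let tiltS f : Fmeas F k.+1 f -> Ig P (fun w => K w * (f w * expR (lam * x k.+1 w))) ->
  Ig Q (fun w => H w * f w) /\ Ex Q (fun w => H w * f w) = Ex P (fun w => K w * (f w * expR (lam * x k.+1 w))).
Proof.
move=> mf; have := @tilted_Ex k.+1 (fun w => H w * f w) kn.
rewrite (_ : (fun w => H w * f w * D k.+1 w) = fun w => K w * (f w * expR (lam * x k.+1 w))).
  by apply=> //; apply: measurable_funM => //; exact: Fmeas_S'.
by apply/funext => w; rewrite DS /K; ring.
Qed.

Lemma tilted_m1 : Ig Q (fun w => H w * x k.+1 w) /\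
  `|Ex Q (fun w => H w * x k.+1 w) - lam * Sq| <= 5 * a * Sq.
Proof.
have [[I1 E1] _ _] := stepP kn mK K0 IK; have [I E] := tiltS (mx kn) I1; split => //.
rewrite E (_ : _ - _ = Ex P (fun w => K w * (x k.+1 w * expR (lam * x k.+1 w))) - lam * Sk - lam * (Sq - Sk)); last by rewrite /Sk; ring.
apply: le_trans (ler_normB _ _) _; rewrite (ger0_norm (mulr_ge0 lam0 (_ : 0 <= Sq - Sk))) ?subr_ge0//.
apply: le_trans (lerD E1 (ler_wpM2l lam0 SqSk)) _.
have h1 : 4 * a * Sk <= 4 * a * Sq := ler_wpM2l (mulr_ge0 (ler0n _ 4) a0) Sk_le.
have h2 : lam * ((lam * eps) ^+ 2 * Sq) <= a * Sq.
  by rewrite mulrA aE; apply: (ler_wpM2r Sq0); exact: (ler_wpM2l lam0 le2b).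
by apply: le_trans (lerD h1 h2) _; rewrite le_eqVlt; apply/orP; left; apply/eqP; ring.
Qed.

Lemma tilted_m2 : Ig Q (fun w => H w * x k.+1 w ^+ 2) /\
  `|Ex Q (fun w => H w * x k.+1 w ^+ 2) - Sq| <= 5 * b * Sq.
Proof.
have [_ [I1 E1] _] := stepP kn mK K0 IK.
have mx2 : Fmeas F k.+1 (fun w => x k.+1 w ^+ 2) by apply: measurable_funX; exact: mx.
have [I E] := tiltS mx2 I1; split => //.
rewrite E (_ : _ - _ = Ex P (fun w => K w * (x k.+1 w ^+ 2 * expR (lam * x k.+1 w))) - Sk - (Sq - Sk)); last by rewrite /Sk; ring.
apply: le_trans (ler_normB _ _) _; rewrite (@ger0_norm _ (Sq - Sk)) ?subr_ge0//.
apply: le_trans (lerD E1 SqSk) _.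
have h1 : 4 * b * Sk <= 4 * b * Sq := ler_wpM2l (mulr_ge0 (ler0n _ 4) b0) Sk_le.
have h2 : (lam * eps) ^+ 2 * Sq <= b * Sq := ler_wpM2r Sq0 le2b.
by apply: le_trans (lerD h1 h2) _; rewrite le_eqVlt; apply/orP; left; apply/eqP; ring.
Qed.

Lemma tilted_mp : Ig Q (fun w => H w * `|x k.+1 w| `^ (2 + rho)) /\
  Ex Q (fun w => H w * `|x k.+1 w| `^ (2 + rho)) <= eps `^ rho * Sq.
Proof.
have [_ _ [I1 E1]] := stepP kn mK K0 IK.
have mxp : Fmeas F k.+1 (fun w => `|x k.+1 w| `^ (2 + rho)).
  by apply: measurable_powRl; apply: measurableT_comp => //; exact: mx.
have [I E] := tiltS mxp I1; split => //.
by rewrite E; apply: le_trans E1 _; exact: (ler_wpM2l e0 Sk_le).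
Qed.

End moments.

(** Under the tilted measure the conditional mean of [x] is [lam s] only approximately. Subtracting
    [lam s] and not the exact mean keeps the identity [X = Y + lam V] with [V] the original
    quadratic variation; this is why [approx_mds] tolerates a drift. *)
Definition tilted_eta i w := x i w - lam * s i w.

Local Notation eta := tilted_eta.

(** Expansion of [eta = x - lam s]. For the variance the square of [x], the cross term and the
    square of [lam s] cost [5 b], [10 b] and [b]; for the higher moment the constant is [8 (1 + 1)],
    as [(lam s)^(2+rho) <= eps^rho s]. *)
Let mom k H M : (k < n)%N -> Fmeas F k H -> (forall w, 0 <= H w) -> (forall w, H w <= M) ->
  [/\ Ig Q (fun w => H w * s k.+1 w), Ig Q (fun w => H w * eta k.+1 w),
     `|Ex Q (fun w => H w * eta k.+1 w)| <= 5 * a * Ex Q (fun w => H w * s k.+1 w),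
     Ig Q (fun w => H w * (eta k.+1 w ^+ 2 - s k.+1 w)) /\
     `|Ex Q (fun w => H w * (eta k.+1 w ^+ 2 - s k.+1 w))| <= 16 * b * Ex Q (fun w => H w * s k.+1 w) &
     Ig Q (fun w => H w * `|eta k.+1 w| `^ (2 + rho)) /\
     Ex Q (fun w => H w * `|eta k.+1 w| `^ (2 + rho)) <= 16 * eps `^ rho * Ex Q (fun w => H w * s k.+1 w)].
Proof.
move=> kn mH H0 HM; have mHT := Fmeas_T' (ltnW kn) mH.
have msT := Fmeas_T' (ltnW kn) (ms kn); have mxT := Fmeas_T' kn (mx kn).
have Mn w : `|H w| <= M by rewrite ger0_norm.
have Is : Ig Q (s k.+1) by apply: (@Ig_bdd _ _ _ _ (eps ^+ 2)) => // w; rewrite ger0_norm.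
have IHs : Ig Q (fun w => H w * s k.+1 w) := Ig_bM mHT Mn Is.
have one g Mg : Fmeas F k g -> (forall w, 0 <= g w) -> (forall w, g w <= Mg) ->
    Ig Q (fun w => g w * eta k.+1 w) /\
    `|Ex Q (fun w => g w * eta k.+1 w)| <= 5 * a * Ex Q (fun w => g w * s k.+1 w).
  move=> mg g0 gM; have [I1 E1] := tilted_m1 kn mg g0 gM.
  have gn w : `|g w| <= Mg by rewrite ger0_norm.
  have Igs : Ig Q (fun w => g w * s k.+1 w) := Ig_bM (Fmeas_T' (ltnW kn) mg) gn Is.
  have EE : (fun w => g w * eta k.+1 w) = (fun w => g w * x k.+1 w - lam * (g w * s k.+1 w)).
    by apply/funext => w; rewrite /tilted_eta; ring.
  rewrite EE (ExB I1 (IgZ lam Igs)) (ExZ _ Igs); split => //; exact: (IgB I1 (IgZ lam Igs)).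
have [Ie Ee] := one H M mH H0 HM.
have [I2 E2] := tilted_m2 kn mH H0 HM.
have [Ip Ep] := tilted_mp kn mH H0 HM.
set S := Ex Q (fun w => H w * s k.+1 w) in Ee E2 Ep *.
have S0 : 0 <= S by apply: Ex_ge0 => w; rewrite mulr_ge0.
have mHs : Fmeas F k (fun w => H w * s k.+1 w) by apply: measurable_funM => //; exact: ms.
have Hs0 w : 0 <= H w * s k.+1 w by rewrite mulr_ge0.
have HsM w : H w * s k.+1 w <= M * eps ^+ 2 by apply: ler_pM.
have [Ise Ese] := one _ _ mHs Hs0 HsM.
have Iss : Ig Q (fun w => H w * s k.+1 w * s k.+1 w).
  apply: (@Ig_bM _ _ _ _ (M * eps ^+ 2)) Is; first exact: (Fmeas_T' (ltnW kn) mHs).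
  by move=> w; rewrite ger0_norm//; exact: HsM.
have Ess : Ex Q (fun w => H w * s k.+1 w * s k.+1 w) <= eps ^+ 2 * S.
  rewrite /S -(ExZ _ IHs); apply: (Ex_le Iss (IgZ _ IHs)) => w.
  by rewrite [leRHS]mulrC; apply: (ler_wpM2l (Hs0 w)).
have Ess0 : 0 <= Ex Q (fun w => H w * s k.+1 w * s k.+1 w) by apply: Ex_ge0 => w; rewrite !mulr_ge0.
have bS : 0 <= b * S := mulr_ge0 b0 S0.
split => //.
  have EE : (fun w => H w * (eta k.+1 w ^+ 2 - s k.+1 w)) =
      (fun w => H w * x k.+1 w ^+ 2 - H w * s k.+1 w - 2 * lam * (H w * s k.+1 w * eta k.+1 w)
         - lam ^+ 2 * (H w * s k.+1 w * s k.+1 w)).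
    by apply/funext => w; rewrite /tilted_eta; ring.
  have J1 := IgB I2 IHs; have J2 := IgZ (2 * lam) Ise; have J3 := IgZ (lam ^+ 2) Iss.
  rewrite EE (ExB (IgB J1 J2) J3) (ExB J1 J2) (ExB I2 IHs) (ExZ _ Ise) (ExZ _ Iss) -/S.
  split; first exact: (IgB (IgB J1 J2) J3).
  have h1 : `|2 * lam * Ex Q (fun w => H w * s k.+1 w * eta k.+1 w)| <= 10 * (b * S).
    rewrite normrM (ger0_norm (mulr_ge0 (ler0n _ 2) lam0)).
    apply: le_trans (ler_wpM2l (mulr_ge0 (ler0n _ 2) lam0) Ese) _.
    apply: (@le_trans _ _ (10 * (lam * a * (eps ^+ 2 * S)))).
      have := ler_wpM2l (mulr_ge0 lam0 a0) Ess; move: (Ex Q _) => z; lra.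
    rewrite ler_pM2l// aE (_ : lam * (lam * b) * (eps ^+ 2 * S) = (lam * eps) ^+ 2 * (b * S)); last by ring.
    by rewrite ler_piMl// expr_le1.
  have h2 : `|lam ^+ 2 * Ex Q (fun w => H w * s k.+1 w * s k.+1 w)| <= b * S.
    rewrite ger0_norm ?(mulr_ge0 (sqr_ge0 _))//; apply: le_trans (ler_wpM2l (sqr_ge0 _) Ess) _.
    by rewrite mulrA -exprMn; apply: (ler_wpM2r S0).
  apply: le_trans (ler_normB _ _) _; apply: le_trans (lerD (ler_normB _ _) h2) _.
  apply: le_trans (lerD (lerD E2 h1) (lexx _)) _; rewrite -!mulrA.
  by rewrite le_eqVlt; apply/orP; left; apply/eqP; ring.
have ls w : (lam * s k.+1 w) `^ (2 + rho) <= eps `^ rho * s k.+1 w.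
  have [->|sn] := eqVneq (s k.+1 w) 0.
    by rewrite !mulr0 powR0// gt_eqF//; have := rho0; lra.
  have ls0 : 0 <= lam * s k.+1 w by rewrite mulr_ge0.
  have lse : lam * s k.+1 w <= eps.
    apply: (@le_trans _ _ (lam * eps ^+ 2)); first exact: ler_wpM2l.
    by rewrite expr2 mulrA ler_piMl// ltW.
  rewrite powRD_gt0 ?(powR_mulrn 2)//; last by have := rho0; lra.
  rewrite mulrC; apply: ler_pM; rewrite ?powR_ge0 ?sqr_ge0//.
    by apply: ge0_ler_powR; rewrite ?nnegrE ?(ltW rho0) ?(ltW eps0).
  rewrite (_ : (lam * s k.+1 w) ^+ 2 = s k.+1 w * (lam ^+ 2 * s k.+1 w)); last by ring.
  by rewrite ler_piMr//; apply: le_trans (l2s _ _) _; rewrite expr_le1.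
have Ils : Ig Q (fun w => H w * (lam * s k.+1 w) `^ (2 + rho)).
  apply: Ig_dom (IgZ (eps `^ rho) IHs) => [|w].
    by apply: measurable_funM => //; apply: measurable_powRl; exact: measurable_funM.
  by rewrite ger0_norm ?mulr_ge0 ?powR_ge0// mulrCA; apply: ler_wpM2l.
have h8 w : H w * `|eta k.+1 w| `^ (2 + rho) <=
    8 * (H w * `|x k.+1 w| `^ (2 + rho) + H w * (lam * s k.+1 w) `^ (2 + rho)).
  rewrite -mulrDr mulrCA; apply: (ler_wpM2l (H0 w)).
  have q3 : 0 <= 2 + rho <= 3 by have := rho0; have := rho1; move=> *; apply/andP; split; lra.
  have := powR_normB_le (x k.+1 w) (lam * s k.+1 w) q3.
  by rewrite (ger0_norm (mulr_ge0 lam0 (s0 _ _))).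
have I8 := IgZ 8 (IgD Ip Ils).
have Iep : Ig Q (fun w => H w * `|eta k.+1 w| `^ (2 + rho)).
  apply: Ig_dom I8 => [|w]; last by rewrite ger0_norm ?mulr_ge0 ?powR_ge0.
  apply: measurable_funM => //; apply: measurable_powRl; apply: measurableT_comp => //.
  by apply: measurable_funB => //; exact: measurable_funM.
split => //; apply: le_trans (Ex_le Iep I8 h8) _.
rewrite (ExZ _ (IgD Ip Ils)) (ExD Ip Ils).
have hl : Ex Q (fun w => H w * (lam * s k.+1 w) `^ (2 + rho)) <= eps `^ rho * S.
  rewrite /S -(ExZ _ IHs); apply: (Ex_le Ils (IgZ _ IHs)) => w.
  by rewrite mulrCA; apply: ler_wpM2l.
by apply: le_trans (ler_wpM2l (ler0n _ 8) (lerD Ep hl)) _; rewrite le_eqVlt; apply/orP; left; apply/eqP; ring.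
Qed.

(** Weights of arbitrary sign are split into positive and negative parts, which add up to [|H|]; 16
    is the largest constant of [mom]. *)
Lemma tilted_approx_mds : approx_mds Q n F eta s rho eps lam 16.
Proof.
split => //.
- move=> k kn; split; last exact: ms.
  apply: measurable_funB; first exact: mx.
  by apply: measurable_funM; [exact: measurable_cst|apply: Fmeas_S' => //; exact: ms].
move=> k kn; split.
  have m1 : Fmeas F k (fun _ : T => 1 : R) by exact: measurable_cst.
  have [_ _ _ _ [I _]] := mom kn m1 (fun=> ler01) (fun=> lexx _).
  by move: I; rewrite (_ : (fun w => 1 * _) = fun w => `|eta k.+1 w| `^ (2 + rho))//; apply/funext => w; rewrite mul1r.
move=> H mH [M HM].
pose Hp w := Num.max (H w) 0; pose Hn w := Num.max (- H w) 0.
have mp : Fmeas F k Hp by exact: measurable_maxr.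
have mn : Fmeas F k Hn by apply: measurable_maxr => //; exact: measurableT_comp.
have p0 w : 0 <= Hp w by rewrite le_max lexx orbT.
have n0 w : 0 <= Hn w by rewrite le_max lexx orbT.
have HE w : H w = Hp w - Hn w.
  by rewrite /Hp /Hn; case: (leP (H w) 0); case: (leP (- H w) 0) => *; lra.
have HA w : `|H w| = Hp w + Hn w.
  rewrite /Hp /Hn; case: (leP 0 (H w)) => h; [rewrite ger0_norm//|rewrite ltr0_norm//];
  by case: (leP (H w) 0); case: (leP (- H w) 0) => *; lra.
have pM w : Hp w <= M by apply: le_trans (HM w); rewrite HA lerDl.
have nM w : Hn w <= M by apply: le_trans (HM w); rewrite HA lerDr.
have [Ips Ipe Epe [Ip2 Ep2] _] := mom kn mp p0 pM.
have [Ins Ine Ene [In2 En2] _] := mom kn mn n0 nM.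
have mA : Fmeas F k (fun w => `|H w|) by exact: measurableT_comp.
have [_ _ _ _ [_ E3]] := mom kn mA (fun=> normr_ge0 _) HM.
have ES : Ex Q (fun w => `|H w| * s k.+1 w) = Ex Q (fun w => Hp w * s k.+1 w) + Ex Q (fun w => Hn w * s k.+1 w).
  by rewrite -(ExD Ips Ins); apply: Ex_eq => w; rewrite HA mulrDl.
have aS : 0 <= a * Ex Q (fun w => `|H w| * s k.+1 w).
  by apply: mulr_ge0 => //; apply: Ex_ge0 => w; rewrite mulr_ge0.
split.
- have -> : Ex Q (fun w => H w * eta k.+1 w) = Ex Q (fun w => Hp w * eta k.+1 w) - Ex Q (fun w => Hn w * eta k.+1 w).
    by rewrite -(ExB Ipe Ine); apply: Ex_eq => w; rewrite HE mulrBl.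
  apply: le_trans (ler_normB _ _) _; apply: le_trans (lerD Epe Ene) _.
  rewrite -mulrDr -ES -!(mulrA _ a).
  by apply: ler_wpM2r => //; lra.
- have -> : Ex Q (fun w => H w * (eta k.+1 w ^+ 2 - s k.+1 w)) =
      Ex Q (fun w => Hp w * (eta k.+1 w ^+ 2 - s k.+1 w)) - Ex Q (fun w => Hn w * (eta k.+1 w ^+ 2 - s k.+1 w)).
    by rewrite -(ExB Ip2 In2); apply: Ex_eq => w; rewrite HE mulrBl.
  apply: le_trans (ler_normB _ _) _; apply: le_trans (lerD Ep2 En2) _.
  by rewrite -mulrDr -ES.
- exact: E3.
Qed.

Let M k w := \prod_(i < k) m i w.

(** Each factor is [1 + lam^2 s / 2] up to [4 tau s]. Below, [1 - 1 / m <= ln m] costs a further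
    [(lam^2 s)^2 <= tau s], whence the 5. *)
Let M_bd k w : (k <= n)%N ->
    expR (lam ^+ 2 / 2 * psum s k w - 5 * tau * psum s k w) <= M k w <= expR (lam ^+ 2 / 2 * psum s k w + 5 * tau * psum s k w).
Proof.
elim: k => [_|k IH kn]; first by rewrite /M big_ord0 psum0 !mulr0 subr0 addr0 expR0 lexx.
have /andP[h1 h2] := IH (ltnW kn); rewrite /M big_ord_recr/= -/(M k w) psumS.
have /andP[m1 m2] := m_bd w kn; have mp := m_gt0 w kn.
have := mP w kn; rewrite ler_norml => /andP[q1 q2].
have u2 : expR (lam ^+ 2 / 2 * s k.+1 w - 5 * tau * s k.+1 w) <= m k w.
  rewrite -[leRHS](@lnK _ _) ?posrE// ler_expR.
  have lnm : 1 - (m k w)^-1 <= ln (m k w).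
    rewrite -[X in _ <= ln X]invrK lnV ?posrE ?invr_gt0//.
    have mi0 : 0 < (m k w)^-1 by rewrite invr_gt0.
    have h : -1 < (m k w)^-1 - 1 by lra.
    by have := le_ln1Dx h; rewrite addrC subrK; lra.
  apply: le_trans lnm; have mi : m k w * (m k w)^-1 = 1 by rewrite divff ?gt_eqF.
  have i1 : (m k w)^-1 <= 1 by rewrite invf_le1.
  have i0 : 0 <= (m k w)^-1 by rewrite invr_ge0 ltW.
  have sq : (lam ^+ 2 * s k.+1 w) ^+ 2 <= tau * s k.+1 w.
    rewrite (_ : (lam ^+ 2 * s k.+1 w) ^+ 2 = lam ^+ 2 * (lam ^+ 2 * s k.+1 w) * s k.+1 w); last by ring.
    apply: ler_wpM2r => //; rewrite tauE; apply: ler_wpM2l; first exact: sqr_ge0.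
    by apply: le_trans (l2s _ _) le2b.
  move: (m k w)^-1 mi i1 i0 => y mi i1 i0; nra.
have u1 : m k w <= expR (lam ^+ 2 / 2 * s k.+1 w + 5 * tau * s k.+1 w).
  apply: le_trans (expR_ge1Dx _); have := mulr_ge0 tau0 (s0 k.+1 w); lra.
apply/andP; split.
  rewrite [X in expR X](_ : _ = lam ^+ 2 / 2 * psum s k w - 5 * tau * psum s k w + (lam ^+ 2 / 2 * s k.+1 w - 5 * tau * s k.+1 w)); last by ring.
  by rewrite expRD; exact: (ler_pM (expR_ge0 _) (expR_ge0 _) h1 u2).
rewrite [X in _ <= expR X](_ : _ = lam ^+ 2 / 2 * psum s k w + 5 * tau * psum s k w + (lam ^+ 2 / 2 * s k.+1 w + 5 * tau * s k.+1 w)); last by ring.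
by rewrite expRD; exact: (ler_pM (le_trans (expR_ge0 _) h1) (ltW mp) h2 u1).
Qed.

Let DM k w : (k <= n)%N -> D k w * (expR (- lam * psum x k w) * M k w) = 1.
Proof.
elim: k => [_|k IH kn].
  by rewrite /tilt_density /M !big_ord0 psum0 mulr0 expR0 !mulr1.
rewrite DS /M big_ord_recr/= -/(M k w) psumS mulrDr expRD -[RHS](IH (ltnW kn)).
have mp := m_gt0 w kn; have xe : expR (lam * x k.+1 w) * expR (- lam * x k.+1 w) = 1.
  by rewrite -expRD mulNr subrr expR0.
transitivity (D k w * (expR (- lam * psum x k w) * M k w) * (expR (lam * x k.+1 w) * expR (- lam * x k.+1 w))).
  move: (expR _) (expR _) (expR _) (D k w) (M k w) => *.
  by field; rewrite gt_eqF.
by rewrite xe mulr1.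
Qed.

Let M0 w : 0 < M n w. Proof. by apply: prodr_gt0 => i _; exact: m_gt0. Qed.

Let mpsum (h : nat -> T -> R) j : (j <= n)%N -> (forall k, (k < j)%N -> measurable_fun setT (h k.+1)) ->
    measurable_fun setT (psum h j).
Proof.
elim: j => [_ _|j IH jn hm].
  rewrite (_ : psum h 0 = fun=> 0); first exact: measurable_cst.
  by apply/funext => w; rewrite psum0.
rewrite (_ : psum h j.+1 = fun w => psum h j w + h j.+1 w); last by apply/funext => w; rewrite psumS.
apply: measurable_funD; last exact: hm.
by apply: IH (ltnW jn) _ => k kj; apply: hm; exact: ltnW.
Qed.

Let mX : measurable_fun setT (psum x n).
Proof. by apply: mpsum => // k kn; exact: (Fmeas_T' kn (mx kn)). Qed.

Let mS : measurable_fun setT (psum s n).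
Proof. by apply: mpsum => // k kn; exact: (Fmeas_T' (ltnW kn) (ms kn)). Qed.

Let mM : measurable_fun setT (M n).
Proof.
rewrite (_ : M n = fun w => expR (lam * psum x n w) / D n w); last first.
  apply/funext => w; have D0 := D_gt0 w (leqnn n).
  rewrite -[LHS]mul1r -(expR0 R) (_ : 0 = lam * psum x n w + - lam * psum x n w); last by ring.
  rewrite expRD -[RHS]mulr1 -(DM w (leqnn n)) mulrA; field; by rewrite gt_eqF.
apply: measurable_funM; first by apply: measurable_expRl; exact: measurable_funM.
have D0 w := D_gt0 w (leqnn n).
exact: (Fmeas_T' (leqnn n) (Fmeas_inv (Fmeas_D (leqnn n)) D0)).
Qed.

(** [exp (lam X) = M_n D_n], so the Laplace transform is the [Q]-mean of [M_n]; with [V <= 5 / 4]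
    the error [5 tau V] is at most [7 tau]. It feeds the second moment argument of
    [lower_regime_eps]. *)
Lemma tilted_laplace v : (forall w, psum s n w <= 5 / 4) -> {ae Q, forall w, v <= psum s n w} ->
  Ig P (fun w => expR (lam * psum x n w)) /\
  expR (lam ^+ 2 / 2 * v - 7 * tau) <= Ex P (fun w => expR (lam * psum x n w)) <= expR (5 / 8 * lam ^+ 2 + 7 * tau).
Proof.
move=> V54 Vv.
have V0 w : 0 <= psum s n w by rewrite /psum sumr_ge0.
have tV w : 5 * tau * psum s n w <= 7 * tau by have := V54 w; have := tau0; nra.
have hi w : M n w <= expR (5 / 8 * lam ^+ 2 + 7 * tau).
  have /andP[_ h1] := M_bd w (leqnn n); apply: le_trans h1 _; rewrite ler_expR; apply: lerD => //.
  by have := ler_wpM2l (sqr_ge0 lam) (V54 w); lra.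
have IM : Ig Q (M n).
  by apply: (Ig_bdd Q mM (M := expR (5 / 8 * lam ^+ 2 + 7 * tau))) => w; rewrite ger0_norm// ltW.
have XE w : expR (lam * psum x n w) = M n w * D n w.
  have xe : expR (lam * psum x n w) * expR (- lam * psum x n w) = 1 by rewrite -expRD mulNr subrr expR0.
  rewrite -[LHS]mulr1 -(DM w (leqnn n)) (_ : _ * (_ * _) = expR (lam * psum x n w) * expR (- lam * psum x n w) * (M n w * D n w)).
    by rewrite xe mul1r.
  by move: (expR _) (expR _) (M _ _) (D _ _) => *; ring.
have me : measurable_fun setT (fun w => expR (lam * psum x n w)).
  by apply: measurable_expRl; exact: measurable_funM.
have hE : (\int[P]_w (expR (lam * psum x n w))%:E = \int[Q]_w (M n w)%:E)%E.
  rewrite Q_int//; last by move=> w; exact: ltW.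
  by apply: eq_integral => w _; rewrite XE.
have ee0 w : 0 <= expR (lam * psum x n w) := expR_ge0 _.
have Ie : Ig P (fun w => expR (lam * psum x n w)).
  by apply: Ig_ge0 => //; rewrite hE -Ex_fin// ltry.
have EE : Ex P (fun w => expR (lam * psum x n w)) = Ex Q (M n).
  by apply: EFin_inj; rewrite !Ex_fin.
split => //; rewrite EE; apply/andP; split; last exact: Ex_le_cst.
rewrite -(Ex_cst Q (expR (lam ^+ 2 / 2 * v - 7 * tau))).
apply: (Ex_ae_le (Ig_cst _ _) IM); apply: filterS Vv => w hv.
have /andP[h1 _] := M_bd w (leqnn n); apply: le_trans h1; rewrite ler_expR; apply: lerB => //.
by have := ler_wpM2l (sqr_ge0 lam) hv; lra.
Qed.

(** The inverse density is [exp (- lam X) M_n]. Substituting [X = Y + lam V] and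
    [M_n = exp (lam^2 V / 2)] up to [exp (7 tau)] leaves the exponent of [g]. *)
Lemma tilted_change A : measurable A -> (forall w, psum s n w <= 5 / 4) ->
  let g w := \1_A w * expR (- lam * psum eta n w - lam ^+ 2 / 2 * psum s n w) in
  [/\ Ig Q g, expR (- (7 * tau)) * Ex Q g <= Pr P A & Pr P A <= expR (7 * tau) * Ex Q g].
Proof.
move=> mA V54 g.
pose f w := \1_A w * (expR (- lam * psum x n w) * M n w).
have i0 w : 0 <= \1_A w :> R by rewrite indicE.
have f0 w : 0 <= f w by rewrite /f !mulr_ge0 ?expR_ge0// ltW.
have mf : measurable_fun setT f.
  apply: measurable_funM; first exact: measurable_indic.
  by apply: measurable_funM => //; apply: measurable_expRl; exact: measurable_funM.
have fP : (\int[Q]_w (f w)%:E = (Pr P A)%:E)%E.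
  rewrite Q_int// Pr_fin// -[in RHS](setIT A) -(integral_indic P measurableT mA).
  apply: eq_integral => w _; congr _%:E; rewrite /f.
  rewrite (_ : _ * _ * _ = \1_A w * (D n w * (expR (- lam * psum x n w) * M n w))); last by ring.
  by rewrite DM// mulr1.
have If : Ig Q f by apply: Ig_ge0 => //; rewrite fP ltry.
have EfP : Ex Q f = Pr P A by apply: EFin_inj; rewrite Ex_fin.
have XE w : - lam * psum x n w + lam ^+ 2 / 2 * psum s n w = - lam * psum eta n w - lam ^+ 2 / 2 * psum s n w.
  have -> : psum eta n w = psum x n w - lam * psum s n w.
    by rewrite /psum mulr_sumr -sumrB; apply: eq_bigr.
  by field.
have V0 w : 0 <= psum s n w by rewrite /psum sumr_ge0.
have tV w : 5 * tau * psum s n w <= 7 * tau by have := V54 w; have := tau0; nra.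
have lo w : expR (- (7 * tau)) * g w <= f w.
  rewrite /g /f mulrCA; apply: (ler_wpM2l (i0 w)); rewrite -XE -!expRD.
  have /andP[h1 _] := M_bd w (leqnn n).
  apply: le_trans (ler_wpM2l (expR_ge0 _) h1); rewrite -expRD ler_expR; have := tV w; lra.
have hi w : f w <= expR (7 * tau) * g w.
  rewrite /g /f [leRHS]mulrCA; apply: (ler_wpM2l (i0 w)); rewrite -XE -!expRD.
  have /andP[_ h1] := M_bd w (leqnn n).
  apply: le_trans (ler_wpM2l (expR_ge0 _) h1) _; rewrite -expRD ler_expR; have := tV w; lra.
have g0 w : 0 <= g w by rewrite mulr_ge0 ?expR_ge0.
have mg : measurable_fun setT g.
  apply: measurable_funM; first exact: measurable_indic.
  apply: measurable_expRl; rewrite (_ : (fun _ => _) = fun w => - lam * psum x n w + lam ^+ 2 / 2 * psum s n w); last first.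
    by apply/funext => w; rewrite XE.
  by apply: measurable_funD; exact: measurable_funM.
have Ig_ : Ig Q g.
  apply: Ig_dom mg _ (IgZ (expR (7 * tau)) If) => w; rewrite ger0_norm//.
  have -> : g w = expR (7 * tau) * (expR (- (7 * tau)) * g w) by rewrite mulrA -expRD subrr expR0 mul1r.
  exact: (ler_wpM2l (expR_ge0 _) (lo w)).
by rewrite -EfP -!(ExZ _ Ig_); split => //; apply: Ex_le => //; exact: IgZ.
Qed.

End tilted.

(** * Tilting the given martingale *)

Section tilt.
Context {d} {T : measurableType d} {R : realType}.
Variables (P : probability T R) (n : nat) (F : nat -> set (set T)) (xi s2 : nat -> T -> R).
Variables (rho eps delta : R).
Hypotheses (setup : mds_setup P n F xi s2) (A1 : condA1 P n F xi s2 rho eps)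
  (A2 : condA2 P n s2 delta).

Let sF k : (k <= n)%N -> sub_sigma_field (F k). Proof. by case: setup => _ h _ _ _; exact: h. Qed.
Let FF k : (k < n)%N -> F k `<=` F k.+1. Proof. by case: setup => _ _ h _ _; exact: h. Qed.
Let rho01 : 0 < rho <= 1. Proof. by case: A1. Qed.
Let eps0 : 0 < eps. Proof. by case: A1 => _ /andP[]. Qed.

Let step k : (k < n)%N ->
  [/\ Fmeas F k.+1 (xi k.+1), Ig P (fun w => xi k.+1 w ^+ 2), cexp_int P (F k) (xi k.+1) (fun=> 0) &
      cexp_nonneg P (F k) (fun w => (xi k.+1 w ^+ 2)%:E) (fun w => (s2 k.+1 w)%:E)].
Proof.
move=> kn; case: setup => _ _ _ _ /(_ k.+1) []; first by rewrite ltnS leq0n.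
by move=> /(G_measurableP (sF kn)).
Qed.

Let Zstep k : (k < n)%N -> exists Z : T -> \bar R,
  cexp_nonneg P (F k) (fun w => (`|xi k.+1 w| `^ (2 + rho) * expR (eps^-1 * Num.max (xi k.+1 w) 0))%:E) Z
  /\ {ae P, forall w, (Z w <= (eps `^ rho * s2 k.+1 w)%:E)%E}.
Proof. by move=> kn; case: A1 => _ _ /(_ k.+1); apply; rewrite ltnS leq0n. Qed.

Let mxT k : (k < n)%N -> measurable_fun setT (xi k.+1).
Proof.
by move=> kn; have [/(G_measurableP (sF kn)) h _ _ _] := step kn; exact: (G_measurable_meas (sF kn)).
Qed.

Let s20 k w : (k < n)%N -> 0 <= s2 k.+1 w.
Proof. by move=> /step[_ _ _ [_ h _ _]]; have := h w; rewrite lee_fin. Qed.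

Let ms2 k : (k < n)%N -> Fmeas F k (s2 k.+1).
Proof. by move=> kn; have [_ _ _ h] := step kn; exact: (step_ms2 (sF (ltnW kn)) h). Qed.

(* The conditional variances, cut predictably so that their bounds hold everywhere. *)
Definition cut_var i w :=
  if [&& (0 < i <= n)%N, s2 i w <= eps ^+ 2 & psum s2 i w <= 1 + delta ^+ 2] then s2 i w else 0.

Local Notation s := cut_var.

Let s01 k w : 0 <= s k w <= eps ^+ 2.
Proof.
rewrite /cut_var; case: ifPn => [/and3P[/andP[k0 kn] h _]|_]; last by rewrite lexx sqr_ge0.
by rewrite h andbT; case: k k0 kn {h} => // k _ kn; exact: s20.
Qed.

Let FmeasS k (f : T -> R) : (k < n)%N -> Fmeas F k f -> Fmeas F k.+1 f.
Proof.
move=> kn /(G_measurableP (sF (ltnW kn))) h; apply/(G_measurableP (sF kn)) => B mB.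
by apply: (FF kn); exact: h.
Qed.

Let mV2 k : (k < n)%N -> Fmeas F k (psum s2 k.+1).
Proof.
elim: k => [|k IH] kn.
  rewrite (_ : psum s2 1 = s2 1); first exact: ms2.
  by apply/funext => w; rewrite psumS psum0 add0r.
rewrite (_ : psum s2 k.+2 = fun w => psum s2 k.+1 w + s2 k.+2 w); last by apply/funext => w; rewrite psumS.
apply: measurable_funD; last exact: ms2.
by apply: FmeasS; [exact: ltnW|apply: IH; exact: ltnW].
Qed.

Let ms k : (k < n)%N -> Fmeas F k (s k.+1).
Proof.
move=> kn; have m1 := ms2 kn; have m2 := mV2 kn.
rewrite (_ : s k.+1 = fun w => if (s2 k.+1 w <= eps ^+ 2) && (psum s2 k.+1 w <= 1 + delta ^+ 2) then s2 k.+1 w else 0).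
  by apply: measurable_fun_ifT => //; apply: measurable_and; apply: measurable_fun_ler.
by apply/funext => w; rewrite /cut_var ltnS leq0n kn.
Qed.

Let V2_homo k j w : (k <= j)%N -> (j <= n)%N -> psum s2 k w <= psum s2 j w.
Proof.
move=> /subnK <-; elim: (j - k)%N => // i IH; rewrite addSn psumS => h.
by apply: le_trans (IH (ltnW h)) _; rewrite lerDl s20.
Qed.

Let s_le k w : (k < n)%N -> s k.+1 w <= s2 k.+1 w.
Proof. by move=> kn; rewrite /cut_var; case: ifP => // _; exact: s20. Qed.

Let V_le k w : (k <= n)%N -> psum s k w <= psum s2 k w.
Proof.
elim: k => [_|k IH kn]; first by rewrite !psum0.
by rewrite !psumS lerD ?s_le// IH// ltnW.
Qed.

(** If the last term is kept, its condition bounds the whole uncut sum; if it is cut, nothing is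
    added. *)
Lemma cut_var_sum w : psum s n w <= 1 + delta ^+ 2.
Proof.
have : (n <= n)%N by []; move: {-2}n => k; elim: k => [_|k IH kn].
  by rewrite psum0 addr_ge0// sqr_ge0.
rewrite psumS {2}/cut_var; case: ifPn => [/and3P[_ _ h]|_]; last by rewrite addr0 IH// ltnW.
by apply: le_trans h; rewrite psumS lerD2r V_le// ltnW.
Qed.

Let qvarE w : qvar n s2 w = psum s2 n w. Proof. by []. Qed.

(** Both cuts are almost surely inactive: the first by [step_s2_le], the second by (A2) and the
    monotonicity of the partial sums. *)
Lemma cut_var_ae k : (k < n)%N -> {ae P, forall w, s2 k.+1 w = s k.+1 w}.
Proof.
move=> kn; have [_ Ix2 cx cx2] := step kn; have [Z [cZ Zle]] := Zstep kn.
have h1 := step_s2_le (sF (ltnW kn)) rho01 eps0 (mxT kn) Ix2 cx2 cZ Zle.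
case: A2 => _ h2; apply: filterS2 h1 h2 => w h3; rewrite qvarE ler_norml => /andP[_ h4].
rewrite /cut_var ltnS leq0n kn h3/= ifT//.
have := V2_homo w kn (leqnn n); lra.
Qed.

Lemma cut_var_sum_ae : {ae P, forall w, psum s n w = psum s2 n w}.
Proof.
have : (n <= n)%N by []; move: {-2}n => k; elim: k => [_|k IH kn].
  by apply: aeW => w; rewrite !psum0.
by apply: filterS2 (IH (ltnW kn)) (cut_var_ae kn) => w h1 h2; rewrite !psumS h1 h2.
Qed.

Variable lam : R.
Hypotheses (lam0 : 0 <= lam) (small : (lam * eps) `^ rho <= 8^-1).

Let le1 : lam * eps <= 1.
Proof.
have r0 : 0 < rho by case/andP: rho01.
rewrite leNgt; apply/negP => h; have : 1 <= (lam * eps) `^ rho.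
  have := ler_powR (ltW h) (ltW r0); rewrite powRr0; exact.
by move=> /le_trans /(_ small); rewrite invf_ge1//; lra.
Qed.

Lemma tilt_exists : exists (Q : probability T R) (eta : nat -> T -> R),
  [/\ approx_mds Q n F eta s rho eps lam 16,
      {ae Q, forall w, 1 - delta ^+ 2 <= psum s n w},
      (forall w, psum eta n w = Xsum n xi w - lam * psum s n w),
      Ig P (fun w => expR (lam * Xsum n xi w)) /\
      (let tau := lam `^ (2 + rho) * eps `^ rho in
      expR (lam ^+ 2 / 2 * (1 - delta ^+ 2) - 7 * tau) <= Ex P (fun w => expR (lam * Xsum n xi w))
        <= expR (5 / 8 * lam ^+ 2 + 7 * tau)) &
      forall A, measurable A ->
      let g w := \1_A w * expR (- lam * psum eta n w - lam ^+ 2 / 2 * psum s n w) in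
      let tau := lam `^ (2 + rho) * eps `^ rho in
      [/\ Ig Q g, expR (- (7 * tau)) * Ex Q g <= Pr P A & Pr P A <= expR (7 * tau) * Ex Q g]].
Proof.
have hm k : exists m : T -> R, (k < n)%N ->
  [/\ Fmeas F k m, (forall w, `|m w - (1 + lam ^+ 2 / 2 * s k.+1 w)| <= 4 * (lam `^ (2 + rho) * eps `^ rho) * s k.+1 w) &
  forall K, Fmeas F k K -> (forall w, 0 <= K w) ->
    (\int[P]_w (K w * expR (lam * xi k.+1 w))%:E = \int[P]_w (K w * m w)%:E)%E].
  have [kn|kn] := ltnP k n; last by exists (fun=> 0).
  have [_ Ix2 cx cx2] := step kn; have [Z [cZ Zle]] := Zstep kn.
  have [m hm] := step_normalizer (sF (ltnW kn)) rho01 eps0 (mxT kn) cx cx2 cZ Zle (ms kn) (s01 k.+1) (cut_var_ae kn) lam0 le1.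
  by exists m.
have [m {}hm] := choice hm.
have mx k : (k < n)%N -> Fmeas F k.+1 (xi k.+1) by move=> /step[].
have mm k : (k < n)%N -> Fmeas F k (m k) by move=> /hm[].
have mP k w : (k < n)%N -> `|m k w - (1 + lam ^+ 2 / 2 * s k.+1 w)| <= 4 * (lam `^ (2 + rho) * eps `^ rho) * s k.+1 w by move=> /hm[].
have mE k K : (k < n)%N -> Fmeas F k K -> (forall w, 0 <= K w) ->
    (\int[P]_w (K w * expR (lam * xi k.+1 w))%:E = \int[P]_w (K w * m k w)%:E)%E by move=> /hm[_ _]; exact.
exists (tilted_prob sF FF mx mm s01 rho01 eps0 lam0 small mP mE), (tilted_eta xi s lam).
have V54 w : psum s n w <= 5 / 4.
  by apply: le_trans (cut_var_sum w) _; case: A2 => /andP[d0 d1] _; nra.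
have Vge : {ae tilted_prob sF FF mx mm s01 rho01 eps0 lam0 small mP mE, forall w, 1 - delta ^+ 2 <= psum s n w}.
  apply: tilted_ae; case: A2 => _ h; apply: filterS2 h cut_var_sum_ae => w.
  by rewrite qvarE ler_norml => /andP[h1 _] ->; lra.
split.
- apply: tilted_approx_mds => // k K kn mK K0 IK.
  have [_ _ cx cx2] := step kn; have [Z [cZ Zle]] := Zstep kn; have sk := ltnW kn.
  have sa := cut_var_ae kn; have mk := mxT kn; have msk := ms kn.
  split.
  + exact: (step_expx (sF sk) rho01 eps0 mk cx cx2 cZ Zle msk (s01 k.+1) sa lam0 le1 mK K0 IK).
  + exact: (step_expx2 (sF sk) rho01 eps0 mk cx cx2 cZ Zle msk (s01 k.+1) sa lam0 le1 mK K0 IK).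
  + exact: (step_expp (sF sk) eps0 mk cx cx2 cZ Zle msk (s01 k.+1) sa lam0 le1 mK K0 IK).
- exact: Vge.
- by move=> w; rewrite /psum /Xsum mulr_sumr -sumrB; apply: eq_bigr.
- exact: (tilted_laplace V54 Vge).
by move=> A mA /=; apply: tilted_change.
Qed.

End tilt.

(** * Tail probabilities under the tilted measure *)

Section tilted_rep.
Context {d} {T : measurableType d} {R : realType}.
Variables (P : probability T R) (X : T -> R).

(* [X = Y + lam V], where [Y] is nearly standard normal under the tilted probability [Q]. *)
Definition tilted_rep (lam delta tau kap rad : R) :=
  exists (Q : probability T R) (Y V : T -> R),
  [/\ measurable_fun setT Y /\ measurable_fun setT V,
      (forall w, 0 <= V w <= 1 + delta ^+ 2),
      {ae Q, forall w, 1 - delta ^+ 2 <= V w},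
      (forall w, X w = Y w + lam * V w) &
      [/\ (forall t, `|Pr Q [set w | Y w <= t] - Phi t| <= kap),
          20^-1 <= Pr Q [set w | `|Y w| <= rad] &
          forall A, measurable A -> let g w := \1_A w * expR (- lam * Y w - lam ^+ 2 / 2 * V w) in
          [/\ Ig Q g, expR (- (7 * tau)) * Ex Q g <= Pr P A & Pr P A <= expR (7 * tau) * Ex Q g]]].

Variables (lam delta tau kap rad x : R).
Hypotheses (rep : tilted_rep lam delta tau kap rad) (lam0 : 0 <= lam).

Let mtail (Y V : T -> R) : measurable_fun setT Y -> measurable_fun setT V ->
  (forall w, X w = Y w + lam * V w) -> measurable [set w | x < X w].
Proof.
move=> mY mV XE; have mX : measurable_fun setT X.
  have -> : X = (fun w => Y w + lam * V w) by exact/funext.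
  by apply: measurable_funD => //; exact: measurable_funM.
rewrite -[X in measurable X]setTI; exact: measurable_fun_ltr.
Qed.

(** As [V <= 1 + delta^2], the event [X > x] forces [Y > 0]; the weight is then bounded through
    [V >= 1 - delta^2]. *)
Lemma rep_upper : lam * (1 + delta ^+ 2) = x ->
  Pr P [set w | x < X w] <= expR (7 * tau + lam ^+ 2 / 2 * delta ^+ 2 - lam ^+ 2 / 2) * (mills lam + 2 * kap).
Proof.
move=> xE; have [Q [Y [V [[mY mV] V01 Vge XE [KS _ ch]]]]] := rep.
have [Ig_ _ up] := ch _ (mtail mY mV XE); apply: le_trans up _.
rewrite (_ : 7 * tau + _ - _ = 7 * tau + - (lam ^+ 2 / 2 * (1 - delta ^+ 2))); last by ring.
rewrite expRD -mulrA; apply: ler_wpM2l; first exact: expR_ge0.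
have mt : measurable_fun setT (fun w => tilt_pos lam (Y w)).
  by apply: measurableT_comp => //; exact: measurable_tilt_pos.
have It : Ig Q (fun w => tilt_pos lam (Y w)).
  by apply: (@Ig_bdd _ _ _ _ 1) => // w; rewrite ger0_norm ?tilt_pos_ge0 ?tilt_pos_le1.
apply: (@le_trans _ _ (expR (- (lam ^+ 2 / 2 * (1 - delta ^+ 2))) * Ex Q (fun w => tilt_pos lam (Y w)))); last first.
  apply: ler_wpM2l; first exact: expR_ge0.
  by have := KS_tilt mY KS lam0; rewrite ler_norml => /andP[_]; lra.
rewrite -(ExZ _ It); apply: (Ex_ae_le Ig_ (IgZ _ It)); apply: filterS Vge => w hV.
rewrite indicE; case: (boolP (w \in _)) => wA; last by rewrite mul0r mulr_ge0 ?expR_ge0 ?tilt_pos_ge0.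
move: wA; rewrite inE /= XE mul1r => wA; have /andP[_ V1] := V01 w.
have Y0 : 0 < Y w by have := ler_wpM2l lam0 V1; lra.
rewrite /tilt_pos Y0 -expRD ler_expR.
by have := ler_wpM2l (sqr_ge0 lam) hV; lra.
Qed.

(** The roles of the bounds on [V] are exchanged: [V >= 1 - delta^2] makes [Y > 0] imply [X > x],
    and [V <= 1 + delta^2] bounds the weight from below. *)
Lemma rep_lower : lam * (1 - delta ^+ 2) = x ->
  expR (- (7 * tau + lam ^+ 2 / 2 * delta ^+ 2 + lam ^+ 2 / 2)) * (mills lam - 2 * kap) <= Pr P [set w | x < X w].
Proof.
move=> xE; have [Q [Y [V [[mY mV] V01 Vge XE [KS _ ch]]]]] := rep.
have [Ig_ dn _] := ch _ (mtail mY mV XE); apply: le_trans dn.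
rewrite (_ : - (7 * tau + _ + _) = - (7 * tau) + - (lam ^+ 2 / 2 * (1 + delta ^+ 2))); last by ring.
rewrite expRD -mulrA; apply: ler_wpM2l; first exact: expR_ge0.
have mt : measurable_fun setT (fun w => tilt_pos lam (Y w)).
  by apply: measurableT_comp => //; exact: measurable_tilt_pos.
have It : Ig Q (fun w => tilt_pos lam (Y w)).
  by apply: (@Ig_bdd _ _ _ _ 1) => // w; rewrite ger0_norm ?tilt_pos_ge0 ?tilt_pos_le1.
apply: (@le_trans _ _ (expR (- (lam ^+ 2 / 2 * (1 + delta ^+ 2))) * Ex Q (fun w => tilt_pos lam (Y w)))).
  apply: ler_wpM2l; first exact: expR_ge0.
  by have := KS_tilt mY KS lam0; rewrite ler_norml => /andP[+ _]; lra.
rewrite -(ExZ _ It); apply: (Ex_ae_le (IgZ _ It) Ig_); apply: filterS Vge => w hV.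
rewrite /tilt_pos; case: ifPn => Y0; last by rewrite mulr0 mulr_ge0 ?expR_ge0// indicE.
have /andP[_ V1] := V01 w.
have wA : x < X w by rewrite XE; have := ler_wpM2l lam0 hV; lra.
rewrite indicE mem_set// mul1r -expRD ler_expR.
by have := ler_wpM2l (sqr_ge0 lam) V1; lra.
Qed.

(** Any event of [Y] alone that forces [X > x] and bounds [lam Y] yields a lower bound. It is chosen
    for an arbitrary pair [Q], [Y], because [rep] hides the actual one and supplies its Kolmogorov
    and concentration bounds. *)
Lemma rep_event (c : R) (p : R) :
  (forall Q : probability T R, forall Y : T -> R, measurable_fun setT Y ->
     (forall t, `|Pr Q [set w | Y w <= t] - Phi t| <= kap) -> 20^-1 <= Pr Q [set w | `|Y w| <= rad] ->
     exists B : R -> bool, [/\ measurable [set w | B (Y w)], p <= Pr Q [set w | B (Y w)] &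
       forall y, B y -> x < y + lam * (1 - delta ^+ 2) /\ lam * y <= c]) ->
  expR (- (7 * tau + c + lam ^+ 2 / 2 * (1 + delta ^+ 2))) * p <= Pr P [set w | x < X w].
Proof.
move=> H; have [Q [Y [V [[mY mV] V01 Vge XE [KS cn ch]]]]] := rep.
have [B [mB pB hB]] := H Q Y mY KS cn.
have [Ig_ dn _] := ch _ (mtail mY mV XE); apply: le_trans dn.
rewrite (_ : - (7 * tau + _ + _) = - (7 * tau) + - (c + lam ^+ 2 / 2 * (1 + delta ^+ 2))); last by ring.
rewrite expRD -mulrA; apply: ler_wpM2l; first exact: expR_ge0.
apply: le_trans (ler_wpM2l (expR_ge0 _) pB) _.
have Ib : Ig Q (fun w => (B (Y w))%:R).
  apply: (@Ig_bdd _ _ _ _ 1) => [|w]; last by case: (B _); rewrite ?normr1 ?normr0.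
  rewrite (_ : (fun _ => _) = \1_[set w | B (Y w)]); first exact: measurable_indic.
  apply/funext => w; rewrite indicE; congr (_%:R).
  by case E : (B (Y w)); [rewrite mem_set|rewrite memNset//= E].
rewrite -(Ex_bool Q mB) -(ExZ _ Ib); apply: (Ex_ae_le (IgZ _ Ib) Ig_); apply: filterS Vge => w hV.
case E : (B (Y w)); last by rewrite mulr0 mulr_ge0 ?expR_ge0// indicE.
have [h1 h2] := hB _ E; have /andP[_ V1] := V01 w.
have wA : x < X w by rewrite XE; have := ler_wpM2l lam0 hV; lra.
rewrite mulr1 indicE mem_set// mul1r ler_expR.
by have := ler_wpM2l (sqr_ge0 lam) V1; lra.
Qed.

Lemma rep_window (g : R) : 0 <= g -> lam * (1 - delta ^+ 2) = x ->
  expR (- (7 * tau + lam * g + lam ^+ 2 / 2 * (1 + delta ^+ 2))) * (Phi g - 2^-1 - 2 * kap) <=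
    Pr P [set w | x < X w].
Proof.
move=> g0 xE; apply: rep_event => Q Y mY KS _.
have mle t : measurable [set w | Y w <= t].
  by rewrite -[X in measurable X]setTI; exact: measurable_fun_ler.
exists (fun y => 0 < y <= g).
have E : [set w | 0 < Y w <= g] = [set w | Y w <= g] `\` [set w | Y w <= 0].
  apply/seteqP; split => w /=; first by move=> /andP[Y0 ->]; split => //; apply/negP; rewrite -ltNge.
  by move=> [-> /negP]; rewrite -ltNge => ->.
split; first by rewrite E; exact: measurableD.
- rewrite E PrD//; last by move=> w /= /le_trans; apply.
  have := KS g; have := KS 0; rewrite Phi0 !ler_norml => /andP[? ?] /andP[? ?]; lra.
by move=> y /andP[y0 yg]; split; [lra|exact: ler_wpM2l].
Qed.

(** [lam] is taken so large that already [Y >= - rad] implies [X > x]; the event is a ball, whose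
    mass is known without a useful Kolmogorov bound. *)
Lemma rep_concentration (r : R) : rad < r -> x + r <= lam * (1 - delta ^+ 2) ->
  expR (- (7 * tau + lam * r + lam ^+ 2 / 2 * (1 + delta ^+ 2))) / 20 <= Pr P [set w | x < X w].
Proof.
move=> rr xr; apply: rep_event => Q Y mY _ cn; exists (fun y => `|y| <= rad); split => //.
  by rewrite -[X in measurable X]setTI; apply: measurable_fun_ler => //; exact: measurableT_comp.
move=> y; rewrite ler_norml => /andP[y1 y2]; split; first lra.
by apply: ler_wpM2l => //; lra.
Qed.

End tilted_rep.

Lemma tilted_rep_exists {R : realType} (rho : R) : 0 < rho <= 1 -> exists C1 : R, 1 <= C1 /\
  forall (d : measure_display) (T : measurableType d) (P : probability T R) (n : nat)
    (F : nat -> set (set T)) (xi s2 : nat -> T -> R) (eps delta : R),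
  mds_setup P n F xi s2 -> condA1 P n F xi s2 rho eps -> condA2 P n s2 delta ->
  forall lam, 0 <= lam -> (lam * eps) `^ rho <= 128^-1 ->
  let tau := lam `^ (2 + rho) * eps `^ rho in
  let a := lam `^ (1 + rho) * eps `^ rho in
  tilted_rep P (Xsum n xi) lam delta tau (C1 * (be_rate rho eps + a + delta)) (10 * (2 + 320 * a)) /\
  Ig P (fun w => expR (lam * Xsum n xi w)) /\
  expR (lam ^+ 2 / 2 * (1 - delta ^+ 2) - 7 * tau) <= Ex P (fun w => expR (lam * Xsum n xi w))
        <= expR (5 / 8 * lam ^+ 2 + 7 * tau).
Proof.
move=> rho01; have h16 : 1 <= 16 :> R by rewrite ler1n.
have [C1 [C11 BE]] := approx_mds_berry_esseen rho01 h16.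
exists C1; split => // d T P n F xi s2 eps delta setup A1 A2 lam lam0 small tau a.
have eps01 : 0 < eps <= 2^-1 by case: A1.
have del01 : 0 <= delta <= 2^-1 by case: A2.
have small8 : (lam * eps) `^ rho <= 8^-1 by move: (_ `^ _) small => z; lra.
have [Q [eta [am Vge XE lap ch]]] := tilt_exists setup A1 A2 lam0 small8.
(* The threshold is [128 = 16 * 8]: 16 is the constant of the tilted differences and [1 / 8] the
   smallness asked by the Berry-Esseen bound. *)
have bC : 16 * (lam `^ rho * eps `^ rho) <= 8^-1.
  by rewrite -powRM//; [move: (_ `^ _) small => z; lra|have /andP[/ltW] := eps01].
have Vle w : psum (cut_var n s2 eps delta) n w <= 1 + delta ^+ 2 := cut_var_sum eps delta setup w.
have V0 w : 0 <= psum (cut_var n s2 eps delta) n w := V_ge0 am n w.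
split; last exact: lap.
exists Q, (psum eta n), (psum (cut_var n s2 eps delta) n); split => //.
- split; first exact: (Fmeas_T am (leqnn n) (Fmeas_Y am (leqnn n))).
  exact: (Fmeas_T am (leqnn n) (Fmeas_V am (leqnn n))).
- by move=> w; rewrite V0 Vle.
- by move=> w; rewrite XE subrK.
split => //; first exact: (BE _ _ _ _ _ _ _ _ _ _ am).
have V54 w : psum (cut_var n s2 eps delta) n w <= 5 / 4.
  by apply: le_trans (Vle w) _; case/andP: del01 => d0 d1; nra.
have := approx_mds_concentration am rho01 h16 bC V54.
by rewrite (_ : 10 * (2 + 20 * (16 * _)) = 10 * (2 + 320 * a))// /a; ring.
Qed.

(** * Comparison with the normal tail *)

Lemma expR_le_subr {R : realType} (u : R) : 0 <= u <= 2^-1 -> expR (- (2 * u)) <= 1 - u.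
Proof.
move=> /andP[u0 u1]; rewrite expRN; have h := expR_ge1Dx (2 * u).
have p : 0 < 1 + 2 * u by lra.
apply: (@le_trans _ _ (1 + 2 * u)^-1); first by rewrite lef_pV2 ?posrE ?expR_gt0.
by rewrite -div1r ler_pdivrMr//; nra.
Qed.

Lemma expR_mills {R : realType} (lam u v : R) :
  expR u * (mills lam * expR v) = (1 - Phi lam) * expR (u + lam ^+ 2 / 2 + v).
Proof. by rewrite /mills !expRD; ring. Qed.

Lemma phi1_ge {R : realType} : phi 0 / 2 <= phi 1 :> R.
Proof.
rewrite (phiE 1); apply: ler_wpM2l; first exact: phi_ge0.
by rewrite expr1n mulN1r expRN lef_pV2 ?posrE ?expR_gt0//; exact: expR_half_le2.
Qed.

Lemma quadratic_dominates {R : realType} (B x b : R) : 600 <= B -> 0 <= x -> 0 <= b ->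
  756 * b + 525 * x + 14 * B + 7 / 3 * (B * (x + b)) + 11 / 3 * (2 * B ^+ 2 * (1 + b)) + 6 * b
     <= 9 * B ^+ 2 * (1 + x + b).
Proof.
move=> hB x0 b0; have b2 : 600 * B <= B ^+ 2 by rewrite expr2; apply: ler_wpM2r => //; lra.
move: (B ^+ 2) b2 => c b2; have Bx := ler_wpM2r x0 hB; have Bb := ler_wpM2r b0 hB.
have cx := ler_wpM2r x0 b2; have cb := ler_wpM2r b0 b2; lra.
Qed.

(** * The error term and the ranges of the comparison *)

Section rates.
Context {R : realType}.
Variables (rho eps delta L x : R).
Hypotheses (rho01 : 0 < rho <= 1) (eps0 : 0 < eps) (del01 : 0 <= delta <= 2^-1)
  (L0 : 0 <= L) (epsL : eps `^ rho <= 2 * L) (x0 : 0 <= x).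

(** [L] stands for [be_rate rho eps], which treats both cases of the theorem at once. *)
Definition md_bound := x `^ (2 + rho) * eps `^ rho + x ^+ 2 * delta ^+ 2 + (1 + x) * (L + delta).

Local Notation Bd := md_bound.

Let d0 : 0 <= delta. Proof. by case/andP: del01. Qed.
Let d1 : delta <= 2^-1. Proof. by case/andP: del01. Qed.
Let e0 : 0 <= eps `^ rho. Proof. exact: powR_ge0. Qed.
Let t0 : 0 <= x `^ (2 + rho) * eps `^ rho. Proof. by rewrite mulr_ge0 ?powR_ge0. Qed.
Let xd0 : 0 <= x ^+ 2 * delta ^+ 2. Proof. by rewrite mulr_ge0 ?sqr_ge0. Qed.
Let xL0 : 0 <= x * L. Proof. exact: mulr_ge0. Qed.
Let xdl0 : 0 <= x * delta. Proof. exact: mulr_ge0. Qed.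

Lemma md_bound_ge0 : 0 <= Bd. Proof. rewrite /md_bound; have := t0; have := xd0; have := xL0; have := xdl0; have := L0; have := d0; lra. Qed.

Lemma md_bound_tau0 : x `^ (2 + rho) * eps `^ rho <= Bd. Proof. rewrite /md_bound; have := t0; have := xd0; have := xL0; have := xdl0; have := L0; have := d0; lra. Qed.

Lemma md_bound_sqr : x ^+ 2 * delta ^+ 2 <= Bd. Proof. rewrite /md_bound; have := t0; have := xd0; have := xL0; have := xdl0; have := L0; have := d0; lra. Qed.

Lemma md_bound_lin : (1 + x) * (L + delta) <= Bd. Proof. rewrite /md_bound; have := t0; have := xd0; have := xL0; have := xdl0; have := L0; have := d0; lra. Qed.

(** Pays for passing between [lam] and [x] in [Phi_ratio], as [|x - lam|] is of order [x delta^2];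
    the part linear in [x] uses [delta^2 <= delta]. *)
Lemma md_bound_sqr1 : (1 + x) * (x * delta ^+ 2) <= Bd.
Proof.
have h : x * delta ^+ 2 <= x * delta.
  rewrite expr2 mulrA; apply: ler_piMr; [exact: xdl0|have := d1; lra].
rewrite /md_bound mulrDl mul1r mulrA -expr2; have := t0; have := xd0; have := xL0; have := xdl0; have := L0; have := d0; move: h; move: (x * delta ^+ 2) => z.
by rewrite mulrDr !mulrDl !mul1r; move: (x ^+ 2 * delta ^+ 2) (x * L) (x * delta) (x `^ (2 + rho) * eps `^ rho) => z1 z2 z3 z4; lra.
Qed.

Lemma md_bound_tau lam : 0 <= lam <= 2 * x -> lam `^ (2 + rho) * eps `^ rho <= 8 * Bd.
Proof.
move=> /andP[l0 l2]; have /andP[r0 r1] := rho01.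
apply: (@le_trans _ _ (8 * (x `^ (2 + rho) * eps `^ rho))); last by have := md_bound_tau0; lra.
rewrite mulrA; apply: ler_wpM2r => //.
apply: (@le_trans _ _ ((2 * x) `^ (2 + rho))).
  by apply: ge0_ler_powR; rewrite ?nnegrE ?mulr_ge0//; lra.
rewrite powRM//; apply: ler_wpM2r; first exact: powR_ge0.
rewrite (_ : 8 = 2 `^ 3%:R :> R); first by apply: ler_powR; [rewrite ler1n|lra].
by rewrite powR_mulrn// -natrX.
Qed.

Lemma powR_le_1D (q lam : R) : 0 <= lam -> 0 <= q -> lam `^ q <= 1 + lam * lam `^ q.
Proof.
move=> l0 q0; have h := powR_ge0 lam q; have [l1|l1] := leP lam 1; last by nra.
apply: ler_wpDr; first exact: mulr_ge0.
have [->|ln] := eqVneq lam 0; first by rewrite /powR; case: eqP => // ; case: eqP.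
by rewrite -(powRr0 lam); apply: ger_powR => //; rewrite l1 andbT lt_def ln.
Qed.

Lemma powRS (q lam : R) : 0 <= lam -> 0 < q -> lam `^ (1 + q) = lam * lam `^ q.
Proof. by move=> l0 q0; rewrite powRD_gt0 ?powRr1//; lra. Qed.

Lemma md_bound_a lam : 0 <= lam <= 2 * x -> lam `^ (1 + rho) * eps `^ rho <= 10 * Bd.
Proof.
move=> l02; have /andP[l0 l2] := l02; have /andP[r0 r1] := rho01.
have tE : lam `^ (2 + rho) = lam * lam `^ (1 + rho).
  by rewrite -powRS//; [congr (_ `^ _); lra|lra].
have r10 : 0 <= 1 + rho by lra.
have h := ler_wpM2r e0 (powR_le_1D l0 r10).
apply: le_trans h _; rewrite mulrDl mul1r -tE; have := md_bound_tau l02.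
have := md_bound_lin; have := epsL; rewrite mulrDr !mulrDl !mul1r; have := xL0; have := xdl0; have := d0; lra.
Qed.

(** [(1 + lam) kap] is the Kolmogorov error relative to the Mills ratio. The product of [lam] and
    the drift error is [lam^(2+rho) eps^rho], the first term of the bound. *)
Lemma md_bound_kap C1 lam : 0 <= C1 -> 0 <= lam <= 2 * x ->
  C1 * (L + lam `^ (1 + rho) * eps `^ rho + delta) * (1 + lam) <= 20 * C1 * Bd.
Proof.
move=> C10 l02; have /andP[l0 l2] := l02; have /andP[r0 r1] := rho01.
have tE : lam `^ (2 + rho) = lam * lam `^ (1 + rho).
  by rewrite -powRS//; [congr (_ `^ _); lra|lra].
rewrite (_ : 20 * C1 * Bd = C1 * (20 * Bd)); last by ring.
rewrite -mulrA; apply: ler_wpM2l => //.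
have := md_bound_tau l02; have := md_bound_a l02; rewrite tE; have := md_bound_lin.
set a := lam `^ (1 + rho); have := ler_wpM2r L0 l2; have := ler_wpM2r d0 l2.
rewrite (_ : (L + a * eps `^ rho + delta) * (1 + lam) = L + a * eps `^ rho + delta + lam * L + lam * a * eps `^ rho + lam * delta); last by ring.
rewrite -!(mulrA 2); have := xL0; have := xdl0; have := d0; have := L0; rewrite !(mulrDr _ L) !mulrDl !mul1r.
move: (lam * L) (lam * delta) (x * L) (x * delta) => y1 y2 y3 y4; rewrite -?(mulrA lam); move: (lam * (a * eps `^ rho)) (a * eps `^ rho) (Bd) => z1 z2 z3; lra.
Qed.

Local Notation p0 := (phi (0 : R)).
Local Notation tau lam := (lam `^ (2 + rho) * eps `^ rho).
Local Notation a lam := (lam `^ (1 + rho) * eps `^ rho).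
Local Notation kap C1 lam := (C1 * (L + a lam + delta)).

Lemma mills_inv lam : 0 <= lam -> (mills lam)^-1 <= 8 * (1 + lam) / p0.
Proof.
move=> l0; have h := mills_ge l0; have q0 := @phi0_gt0 R.
have h0 : 0 < p0 / (8 * (1 + lam)) by rewrite divr_gt0//; lra.
by rewrite -[leRHS]invf_div lef_pV2 ?posrE//; exact: lt_le_trans h.
Qed.

(** The sum [mills + 2 kap] becomes a product through [1 + u <= exp u] with [u = 2 kap / mills], of
    order [(1 + lam) kap]; then [Phi_ratio] replaces [lam] by [x]. *)
Lemma upper_regime C1 p lam : 0 <= C1 -> 0 <= lam -> lam * (1 + delta ^+ 2) = x ->
  p <= expR (7 * tau lam + lam ^+ 2 / 2 * delta ^+ 2 - lam ^+ 2 / 2) * (mills lam + 2 * kap C1 lam) ->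
  p <= (1 - Phi x) * expR ((66 + 320 * C1 / p0) * Bd).
Proof.
move=> C10 l0 lx /le_trans; apply.
have q0 := @phi0_gt0 R; have dd := sqr_ge0 delta.
have llx : lam <= x by rewrite -lx; have := mulr_ge0 l0 dd; lra.
have l02 : 0 <= lam <= 2 * x by have := x0; lra.
have tB := md_bound_tau l02; have kB := md_bound_kap C10 l02.
have k0 : 0 <= kap C1 lam.
  by rewrite !mulr_ge0// !addr_ge0// mulr_ge0// powR_ge0.
have m0 : 0 < mills lam by rewrite /mills mulr_gt0 ?expR_gt0 ?Phi_lt1.
have h1 : mills lam + 2 * kap C1 lam <= mills lam * expR (320 * C1 / p0 * Bd).
  have -> : mills lam + 2 * kap C1 lam = mills lam * (1 + 2 * kap C1 lam / mills lam).
    by field; rewrite gt_eqF.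
  apply: ler_wpM2l; first exact: ltW.
  apply: le_trans (expR_ge1Dx _) _; rewrite ler_expR.
  apply: (@le_trans _ _ (2 * kap C1 lam * (8 * (1 + lam) / p0))).
    by apply: ler_wpM2l; [rewrite mulr_ge0|exact: mills_inv].
  rewrite (_ : 2 * _ * _ = 16 / p0 * (kap C1 lam * (1 + lam))); last by field; rewrite gt_eqF.
  apply: le_trans (ler_wpM2l _ kB) _; first by rewrite divr_ge0// ltW.
  by rewrite le_eqVlt; apply/orP; left; apply/eqP; field; rewrite gt_eqF.
apply: le_trans (ler_wpM2l (expR_ge0 _) h1) _.
have -> : mills lam = expR (lam ^+ 2 / 2) * (1 - Phi lam) by [].
have h2 := Phi_ratio l0 llx.
rewrite [leLHS](_ : _ = (1 - Phi lam) * expR (7 * tau lam + lam ^+ 2 / 2 * delta ^+ 2 + 320 * C1 / p0 * Bd)); last first.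
  rewrite (_ : 7 * tau lam + lam ^+ 2 / 2 * delta ^+ 2 + 320 * C1 / p0 * Bd =
    (7 * tau lam + lam ^+ 2 / 2 * delta ^+ 2 - lam ^+ 2 / 2) + lam ^+ 2 / 2 + 320 * C1 / p0 * Bd); last by ring.
  by rewrite !expRD; ring.
apply: le_trans (ler_wpM2r (expR_ge0 _) h2) _.
rewrite -[leLHS]mulrA -expRD; apply: ler_wpM2l; first by rewrite ltW// Phi_lt1.
rewrite ler_expR.
have h3 : (1 + x) * (x - lam) <= Bd.
  apply: le_trans md_bound_sqr1; apply: ler_wpM2l; first by have := x0; lra.
  by rewrite -{1}lx; have := ler_wpM2r dd llx; lra.
have h4 : lam ^+ 2 * delta ^+ 2 <= Bd.
  by apply: le_trans md_bound_sqr; apply: ler_wpM2r => //; apply: lerXn2r; rewrite ?nnegrE.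
rewrite [leRHS]mulrDl; move: (320 * C1 / p0 * Bd) md_bound_ge0 tB => z.
rewrite -(mulrA 9) (mulrAC _ 2^-1); move: h3 h4; move: ((1 + x) * (x - lam)) (lam ^+ 2 * delta ^+ 2) (tau lam) (Bd) => z1 z2 z3 z4; lra.
Qed.

Lemma lower_lam lam : lam * (1 - delta ^+ 2) = x -> 0 <= lam <= 2 * x /\
  lam ^+ 2 * delta ^+ 2 <= 2 * Bd /\ x <= lam /\
  1 - Phi x <= (1 - Phi lam) * expR (36 * Bd).
Proof.
move=> lx; have dd := sqr_ge0 delta.
have dd4 : delta ^+ 2 <= 4^-1 by have := d0; have := d1; nra.
have l0 : 0 <= lam by rewrite -(@pmulr_lge0 _ (1 - delta ^+ 2)) ?lx//; lra.
have llx : x <= lam by rewrite -lx; have := mulr_ge0 l0 dd; lra.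
have l43 : lam <= 4 / 3 * x by rewrite -lx; have := ler_wpM2l l0 dd4; lra.
split; first by rewrite l0 /=; have := x0; lra.
split.
  apply: (@le_trans _ _ (2 * (x ^+ 2 * delta ^+ 2))); last by have := md_bound_sqr; lra.
  rewrite mulrA; apply: ler_wpM2r => //.
  by rewrite -subr_ge0; have := x0; nra.
split => //; apply: le_trans (Phi_ratio x0 llx) _.
apply: ler_wpM2l; first by rewrite ltW// Phi_lt1.
rewrite ler_expR (_ : 36 * Bd = 9 * (4 * Bd)); last by ring.
rewrite -mulrA; apply: ler_wpM2l => //.
apply: (@le_trans _ _ (4 * ((1 + x) * (x * delta ^+ 2)))); last by have := md_bound_sqr1; lra.
rewrite (_ : 4 * _ = (2 * (1 + x)) * (2 * (x * delta ^+ 2))); last by ring.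
have x1 := x0; apply: ler_pM; [lra|lra|lra|].
rewrite -{1}lx mulrA; have l2 : lam <= 2 * x by lra.
by have := ler_wpM2r dd l2; lra.
Qed.

(* When [kap] dominates the Mills ratio, only the event [0 < Y <= g] with [g] proportional to [kap] is
   kept; then [(1 + lam) * kap], hence [md_bound], is bounded below and absorbs constant factors. *)
Lemma lower_regime_small C1 p lam : 0 <= C1 -> lam * (1 - delta ^+ 2) = x ->
  kap C1 lam <= p0 / 6 ->
  expR (- (7 * tau lam + lam ^+ 2 / 2 * delta ^+ 2 + lam ^+ 2 / 2)) * (mills lam - 2 * kap C1 lam) <= p ->
  (forall g, 0 <= g -> expR (- (7 * tau lam + lam * g + lam ^+ 2 / 2 * (1 + delta ^+ 2))) *
     (Phi g - 2^-1 - 2 * kap C1 lam) <= p) ->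
  (1 - Phi x) * expR (- ((93 + 1400 * C1 / p0) * Bd)) <= p.
Proof.
move=> C10 lx k6 low win; have [l02 [ld [xl Pxl]]] := lower_lam lx.
have [l0 l2] := andP l02.
have q0 := @phi0_gt0 R; have B0 := md_bound_ge0.
have tB := md_bound_tau l02; have kB := md_bound_kap C10 l02.
have k0 : 0 <= kap C1 lam.
  by rewrite !mulr_ge0// !addr_ge0// mulr_ge0// powR_ge0.
have m0 : 0 < mills lam by rewrite /mills mulr_gt0 ?expR_gt0 ?Phi_lt1.
have P0 : 0 < 1 - Phi lam by rewrite Phi_lt1.
have kB' : kap C1 lam * (1 + lam) / p0 <= 20 * C1 / p0 * Bd.
  by rewrite (mulrAC _ p0^-1); apply: ler_wpM2r => //; rewrite invr_ge0 ltW.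
apply: le_trans (ler_wpM2r (expR_ge0 _) Pxl) _; rewrite -[leLHS]mulrA -expRD.
rewrite (_ : (93 + 1400 * C1 / p0) * Bd = 93 * Bd + 70 * (20 * C1 / p0 * Bd)); last by field; rewrite gt_eqF.
have c0 : 0 <= 20 * C1 / p0 * Bd by rewrite mulr_ge0// divr_ge0 ?mulr_ge0// ltW.
(* If [kap] is at most a quarter of the Mills ratio, [1 - u >= exp (- 2 u)] for
   [u = 2 kap / mills <= 1 / 2] turns the difference into a product. *)
have [h|h] := leP (4 * kap C1 lam) (mills lam).
  apply: le_trans low.
  have u1 : 0 <= 2 * kap C1 lam / mills lam <= 2^-1.
    apply/andP; split; last by rewrite ler_pdivrMr//; move: (kap C1 lam) h => z; lra.
    by apply: divr_ge0 (ltW m0); apply: mulr_ge0.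
  have h1 := expR_le_subr u1.
  have h2 : 2 * (2 * kap C1 lam / mills lam) <= 32 * (20 * C1 / p0 * Bd).
    apply: (@le_trans _ _ (4 * kap C1 lam * (8 * (1 + lam) / p0))).
      rewrite (_ : 2 * _ = 4 * kap C1 lam * (mills lam)^-1); last by ring.
      by apply: ler_wpM2l; [rewrite mulr_ge0|exact: mills_inv].
    rewrite (_ : 4 * _ * _ = 32 * (kap C1 lam * (1 + lam) / p0)); last by field; rewrite gt_eqF.
    exact: ler_wpM2l.
  rewrite (_ : mills lam - 2 * kap C1 lam = mills lam * (1 - 2 * kap C1 lam / mills lam)); last first.
    by field; rewrite gt_eqF.
  apply: le_trans (ler_wpM2l (expR_ge0 _) (ler_wpM2l (ltW m0) h1)).
  rewrite expR_mills; apply: ler_wpM2l; first exact: ltW.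
  rewrite ler_expR.
  rewrite (mulrAC _ 2^-1); move: (2 * (2 * kap C1 lam / mills lam)) h2 => z h2.
  move: c0 h2 tB ld B0; move: (20 * C1 / p0 * Bd) (tau lam) (lam ^+ 2 * delta ^+ 2) (lam ^+ 2) (Bd) => z1 z2 z3 z4 z5; lra.
have kl : p0 < 32 * (kap C1 lam * (1 + lam)).
  have := le_lt_trans (mills_ge l0) h; rewrite ltr_pdivrMr; last by rewrite mulr_gt0//; lra.
  by move: (kap C1 lam) => z; lra.
have B2 : 2 <= 64 * (20 * C1 / p0 * Bd).
  apply: le_trans (ler_wpM2l _ kB') => //; rewrite mulrA ler_pdivlMr//.
  by move: (kap C1 lam * (1 + lam)) kl => z; lra.
(* The window [g = 6 kap / phi 0] is at most 1 by hypothesis, and [phi >= phi 0 / 2] on it, so it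
   has normal mass at least [3 kap]; two thirds pay for the Kolmogorov error. *)
have g0 : 0 <= 6 * kap C1 lam / p0 by apply: divr_ge0 (ltW q0); apply: mulr_ge0.
have g1 : 6 * kap C1 lam / p0 <= 1 by rewrite ler_pdivrMr//; lra.
have lg : lam * (6 * kap C1 lam / p0) <= 6 * (20 * C1 / p0 * Bd).
  apply: le_trans (ler_wpM2l _ kB') => //.
  rewrite (_ : lam * _ = 6 * (kap C1 lam * lam / p0)); last by ring.
  apply: ler_wpM2l => //; apply: ler_wpM2r; first by rewrite invr_ge0 ltW.
  by apply: ler_wpM2l => //; lra.
apply: le_trans (win _ g0).
have hg : kap C1 lam <= Phi (6 * kap C1 lam / p0) - 2^-1 - 2 * kap C1 lam.
  have [+ _] := andP (Phi_incr (lexx 0) g0); rewrite Phi0 subr0.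
  have h1 : p0 / 2 <= phi (6 * kap C1 lam / p0).
    apply: (@le_trans _ _ (phi 1)); last exact: phi_le_homo.
    exact: phi1_ge.
  have := ler_wpM2r g0 h1; rewrite (_ : p0 / 2 * _ = 3 * kap C1 lam); last by field; rewrite gt_eqF.
  move=> u1 u2; have := le_trans u1 u2; move: (Phi _) => z; move: (kap C1 lam) => y; lra.
apply: le_trans (ler_wpM2l (expR_ge0 _) hg).
apply: (@le_trans _ _ (expR (- (7 * tau lam + lam * (6 * kap C1 lam / p0) + lam ^+ 2 / 2 * (1 + delta ^+ 2))) * (mills lam * expR (-2)))); last first.
  apply: ler_wpM2l; first exact: expR_ge0.
  have e4 : 4 <= expR 2 :> R.
    rewrite (_ : 2 = 1 + 1 :> R)// expRD; have := expR_ge1Dx (1 : R).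
    by move: (expR 1) => z; nra.
  rewrite expRN ler_pdivrMr ?expR_gt0//.
  by have := ler_wpM2l k0 e4; move: (kap C1 lam) h => z; lra.
rewrite expR_mills; apply: ler_wpM2l; first exact: ltW.
rewrite ler_expR.
rewrite (mulrDr (lam ^+ 2 / 2)) (mulrAC _ 2^-1) mulr1; move: (lam * (6 * kap C1 lam / p0)) lg => z lg.
move: c0 lg tB ld B0 B2; move: (20 * C1 / p0 * Bd) (tau lam) (lam ^+ 2 * delta ^+ 2) (lam ^+ 2) (Bd) => z1 z2 z3 z4 z5; lra.
Qed.

(** [lam] is at most twice the larger of [3 x] and [2 B0], and [1 + rho <= 2]: this gives [6^2 = 36]
    in one case and [(4 B0)^2 = 16 B0^2] in the other. *)
Lemma shifted_a_le B0 lam : 1 <= B0 -> 16 * B0 ^+ 2 * eps `^ rho <= 1 -> 0 <= lam <= 3 * x + 2 * B0 ->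
  a lam <= 36 * (x * (x * eps) `^ rho) + 1.
Proof.
move=> B1 B2 /andP[l0 l1]; have /andP[r0 r1] := rho01; have x1 := x0.
have SE : x * (x * eps) `^ rho = x `^ (1 + rho) * eps `^ rho.
  by rewrite powRM ?(ltW eps0)// mulrA powRS.
have r10 : 0 <= 1 + rho by lra.
have p12 c : 1 <= c -> c `^ (1 + rho) <= c ^+ 2.
  by move=> c1; rewrite -powR_mulrn//; [apply: ler_powR => //; lra|lra].
have h : lam `^ (1 + rho) <= (6 * x) `^ (1 + rho) + (4 * B0) `^ (1 + rho).
  have [c|c] := leP (3 * x) (2 * B0).
    apply: (@le_trans _ _ ((4 * B0) `^ (1 + rho))); last by rewrite lerDr powR_ge0.
    by apply: ge0_ler_powR; rewrite ?nnegrE//; lra.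
  apply: (@le_trans _ _ ((6 * x) `^ (1 + rho))); last by rewrite lerDl powR_ge0.
  by apply: ge0_ler_powR; rewrite ?nnegrE//; lra.
apply: le_trans (ler_wpM2r e0 h) _; rewrite SE mulrDl; apply: lerD.
  rewrite powRM// -mulrA; apply: ler_wpM2r; first by rewrite mulr_ge0 ?powR_ge0.
  by apply: le_trans (p12 _ _) _; [lra|rewrite -natrX].
apply: le_trans B2; apply: ler_wpM2r => //; apply: le_trans (p12 _ _) _; first lra.
by rewrite exprMn -natrX.
Qed.

End rates.

(* Here [kap] is bounded below and gives no information, but [1 + x] is at most a multiple of
   [md_bound]: factors [exp (- C (1 + x))] are affordable, and it suffices that [Y] is bounded by [r]
   with probability at least 1/20. *)
Lemma lower_regime_large {R : realType} (rho eps delta L x C2 B0 p : R) :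
  0 < rho <= 1 -> 0 < eps -> 0 <= delta <= 2^-1 -> 0 <= L -> 0 <= x ->
  0 <= C2 -> 1 + x <= C2 * md_bound rho eps delta L x ->
  10 * 320 * 37 <= B0 -> B0 * (x * eps) `^ rho <= 1 -> 16 * B0 ^+ 2 * eps `^ rho <= 1 ->
  (forall lam r, 0 <= lam <= 3 * x + 2 * B0 ->
     10 * (2 + 320 * (lam `^ (1 + rho) * eps `^ rho)) < r -> x + r <= lam * (1 - delta ^+ 2) ->
     expR (- (7 * (lam `^ (2 + rho) * eps `^ rho) + lam * r + lam ^+ 2 / 2 * (1 + delta ^+ 2))) / 20 <= p) ->
  (1 - Phi x) * expR (- ((9 * B0 ^+ 2 * (C2 + 1) + 7 * C2) * md_bound rho eps delta L x)) <= p.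
Proof.
move=> rho01 eps0 del01 L0 x0 C20 xB hB B1 B2 H; have /andP[r0 r1] := rho01; have x1 := x0.
have /andP[d0 d1] := del01; have Bge := md_bound_ge0 rho eps del01 L0 x0.
have xdB := md_bound_sqr rho eps del01 L0 x0; have tauB := md_bound_tau0 rho eps del01 L0 x0.
set Bd := md_bound rho eps delta L x in xB Bge xdB tauB *.
pose q := (x * eps) `^ rho; have q0 : 0 <= q by exact: powR_ge0.
have B00 : 600 <= B0 by lra.
have q1 : q <= 1 by have := B1; rewrite -/q; nra.
(* [S] is [x^(1+rho) eps^rho], the drift error at [lam = x]; [x S] is a term of the error, so
   [x S <= Bd]. *)
pose S := x * q; have S0 : 0 <= S by rewrite mulr_ge0.
have Sx : S <= x by rewrite ler_piMr.
have BS : B0 * S <= x by rewrite /S mulrCA ler_piMr.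
have xS : x * S <= Bd.
  apply: le_trans tauB; rewrite /S /q powRM ?(ltW eps0)// !mulrA.
  by rewrite (_ : 2 + rho = 1 + (1 + rho)) ?powRS ?mulrA//; lra.
have SS : S ^+ 2 <= Bd by apply: le_trans xS; rewrite expr2; apply: ler_wpM2r.
(* By [shifted_a_le] the concentration radius is at most [20 + 3200 (36 S + 1)], below [B0 (1 + S)]
   once [B0 >= 10 * 320 * 37]; [lam] solves [lam (1 - delta^2) = x + r]. *)
pose r := B0 * (1 + S); pose u := delta ^+ 2; pose lam := (x + r) / (1 - u).
have u0 : 0 <= u by exact: sqr_ge0.
have u4 : u <= 4^-1 by rewrite /u; clear -d0 d1; nra.
have r00 : 0 <= r by rewrite mulr_ge0//; lra.
have rE : r = B0 + B0 * S by rewrite /r; ring.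
have lE : lam * (1 - u) = x + r by rewrite /lam divfK// gt_eqF//; lra.
have l0 : 0 <= lam by rewrite divr_ge0//; lra.
have l1 : lam <= 4 / 3 * (x + r) by rewrite -lE; have := ler_wpM2l l0 u4; lra.
clearbody lam.
have l2 : 0 <= lam <= 3 * x + 2 * B0 by rewrite l0 /=; lra.
have l3 : lam <= 3 * x + 2 * B0 by case/andP: l2.
pose a := lam `^ (1 + rho) * eps `^ rho; pose tau := lam `^ (2 + rho) * eps `^ rho.
have B01 : 1 <= B0 by clear -B00; lra.
have ha : a <= 36 * S + 1 := shifted_a_le rho01 eps0 x0 B01 B2 l2.
have a0 : 0 <= a by rewrite mulr_ge0 ?powR_ge0.
have hr : 10 * (2 + 320 * a) < r.
  by rewrite rE; have := ler_wpM2r S0 hB; clear -ha hB S0; lra.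
apply: le_trans (H lam r l2 hr _); last by rewrite lE.
have tE : tau = lam * a.
  by rewrite mulrA -powRS//; clear -r0; [congr (_ `^ _ * _); lra|lra].
have ht : tau <= 108 * Bd + 3 * x + 72 * x + 2 * B0.
  rewrite tE; apply: le_trans (ler_pM l0 a0 l3 ha) _.
  rewrite (_ : (_ + _) * _ = 108 * (x * S) + 3 * x + 72 * (B0 * S) + 2 * B0); last by ring.
  by lra.
have xr : x * r <= B0 * (x + Bd).
  rewrite (_ : x * r = B0 * (x + x * S)); last by rewrite /r; ring.
  by apply: ler_wpM2l; clear -xS B00; lra.
have rr : r ^+ 2 <= 2 * B0 ^+ 2 * (1 + Bd).
  rewrite /r exprMn [leRHS](_ : _ = B0 ^+ 2 * (2 * (1 + Bd))); last by ring.
  apply: ler_wpM2l; first exact: sqr_ge0.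
  by have := sqr_ge0 (1 - S); clear -SS; nra.
have hl : lam * r <= 4 / 3 * (x * r + r ^+ 2).
  by apply: le_trans (ler_wpM2r r00 l1) _; rewrite expr2; clear; lra.
have hl2 : lam ^+ 2 * (1 + u) <= (x + r) ^+ 2 * (1 + 6 * u).
  rewrite -lE [leRHS](_ : _ = lam ^+ 2 * ((1 - u) ^+ 2 * (1 + 6 * u))); last by ring.
  apply: ler_wpM2l; first exact: sqr_ge0.
  rewrite -subr_ge0 (_ : _ - _ = u * (3 - 11 * u + 6 * u ^+ 2)); last by ring.
  by apply: mulr_ge0 => //; have := sqr_ge0 u; clear -u0 u4; lra.
have h6 : (x + r) ^+ 2 * u <= 2 * Bd + r ^+ 2 / 2.
  apply: (@le_trans _ _ ((2 * x ^+ 2 + 2 * r ^+ 2) * u)).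
    by apply: ler_wpM2r => //; have := sqr_ge0 (x - r); rewrite !expr2; clear; lra.
  have h : x ^+ 2 * u <= Bd by exact: xdB.
  by have := ler_wpM2l (sqr_ge0 r) u4; clear -h; lra.
(* The leading term [x^2 / 2] is that of the normal tail. The terms in [x r] and [r^2] are of order
   [B0 (x + Bd)] and [B0^2 (1 + Bd)], by [x S <= Bd] and [S^2 <= Bd]. *)
have expo : 7 * tau + lam * r + lam ^+ 2 / 2 * (1 + u) <= x ^+ 2 / 2 + 9 * B0 ^+ 2 * (1 + x + Bd).
  have K : 756 * Bd + 525 * x + 14 * B0 + 7/3 * (B0 * (x + Bd)) + 11 / 3 * (2 * B0 ^+ 2 * (1 + Bd)) + 6 * Bd
     <= 9 * B0 ^+ 2 * (1 + x + Bd).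
    exact: quadratic_dominates.
  apply: (le_trans _ (lerD (lexx (x ^+ 2 / 2)) K)).
  have := sqr_ge0 r; move: hl2 hl h6 xr rr ht; rewrite (_ : (x + r) ^+ 2 * (1 + 6 * u) = x ^+ 2 + 2 * (x * r) + r ^+ 2 + 6 * ((x + r) ^+ 2 * u)); last by ring.
  rewrite (mulrAC _ 2^-1).
  clear -Bge; move: (lam ^+ 2 * (1 + u)) (lam * r) ((x + r) ^+ 2 * u) (x * r) (r ^+ 2) (tau) (B0 * (x + Bd)) (2 * B0 ^+ 2 * (1 + Bd)) (x ^+ 2) (Bd) Bge => z1 z2 z3 z4 z5 z6 z7 z8 z9 z10 z11; lra.
have q00 := @phi0_gt0 R.
have P4 : 1 - Phi x <= 4 * expR (- (x ^+ 2 / 2)).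
  have hm := mills_le x1; have -> : 1 - Phi x = mills x * expR (- (x ^+ 2 / 2)).
    by rewrite /mills mulrAC -expRD subrr expR0 mul1r.
  apply: ler_wpM2r; first exact: expR_ge0.
  by apply: le_trans hm _; clear -x1; rewrite ler_pdivrMr; lra.
(* [80 = 4 * 20] collects the constants of [P4] and of the concentration bound; [exp 7] is paid by
   [7 C2 Bd >= 7 (1 + x)]. *)
have e7 : 80 <= expR 7 :> R.
  have -> : expR 7 = expR 1 ^+ 7 :> R by rewrite -expRM_natl mulr1.
  apply: (@le_trans _ _ (2 ^+ 7)); first by rewrite -natrX ler_nat.
  by apply: lerXn2r; rewrite ?nnegrE ?expR_ge0//; have := expR_ge1Dx (1 : R); clear; lra.
apply: le_trans (ler_wpM2r (expR_ge0 _) P4) _.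
rewrite ler_pdivlMr//.
have -> : 4 * expR (- (x ^+ 2 / 2)) * expR (- ((9 * B0 ^+ 2 * (C2 + 1) + 7 * C2) * Bd)) * 20 =
  80 * expR (- (x ^+ 2 / 2) - (9 * B0 ^+ 2 * (C2 + 1) + 7 * C2) * Bd) by rewrite expRD; ring.
apply: le_trans (ler_wpM2r (expR_ge0 _) e7) _; rewrite -expRD ler_expR.
have h1 := ler_wpM2l (mulr_ge0 (ler0n R 9) (sqr_ge0 B0)) xB.
rewrite (_ : (9 * B0 ^+ 2 * (C2 + 1) + 7 * C2) * Bd = 9 * B0 ^+ 2 * (C2 * Bd) + 9 * B0 ^+ 2 * Bd + 7 * (C2 * Bd)); last by ring.
move: expo; rewrite (mulrDr (9 * B0 ^+ 2)).
clear -h1 x1 xB; move: (7 * tau + _ + _) (9 * B0 ^+ 2 * Bd) h1 => z1 z2; move: (9 * B0 ^+ 2 * _) (9 * B0 ^+ 2 * _) (x ^+ 2 / 2) => z3 z4 z5; lra.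
Qed.

(* Paley-Zygmund for [exp (l X)], through [2 z <= c z^2 + 1 / c]. *)
Lemma exp_lower_tail {d} {T : measurableType d} {R : realType} (P : probability T R) (X : T -> R) (l x t M : R) :
  Ig P (fun w => expR (l * X w)) -> Ig P (fun w => expR (2 * l * X w)) -> measurable_fun setT X ->
  0 < l -> 0 < t -> 0 < M ->
  expR (l * x) + t <= Ex P (fun w => expR (l * X w)) -> Ex P (fun w => expR (2 * l * X w)) <= M ->
  t ^+ 2 / M <= Pr P [set w | x < X w].
Proof.
move=> I1 I2 mX l0 t0 M0 h1 h2; pose c := t / M; have c0 : 0 < c by rewrite divr_gt0.
have mA : measurable [set w | x < X w].
  by rewrite -[X in measurable X]setTI; exact: measurable_fun_ltr.
have IA : Ig P (fun w => (x < X w)%R%:R : R).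
  by apply: Ig_bool; exact: measurable_fun_ltr.
have pw w : expR (l * X w) <= expR (l * x) + (c / 2 * expR (2 * l * X w) + (2 * c)^-1 * (x < X w)%R%:R).
  have -> : expR (2 * l * X w) = expR (l * X w) ^+ 2 by rewrite -mulrA expRM_natl.
  have z0 := expR_ge0 (l * X w); case: ltP => hx.
    apply: ler_wpDl; first exact: expR_ge0.
    have i0 : 0 <= (2 * c)^-1 by rewrite invr_ge0 mulr_ge0// ltW.
    have := mulr_ge0 i0 (sqr_ge0 (c * expR (l * X w) - 1)).
    rewrite (_ : _ * (_ - _) ^+ 2 = c / 2 * expR (l * X w) ^+ 2 + (2 * c)^-1 - expR (l * X w)).
      by rewrite mulr1 subr_ge0.
    by field; rewrite gt_eqF.
  apply: ler_wpDr; last by rewrite ler_expR; apply: ler_wpM2l => //; exact: ltW.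
  by rewrite mulr0 addr0 mulr_ge0 ?sqr_ge0// divr_ge0// ltW.
have I3 := IgD (IgZ (c / 2) I2) (IgZ (2 * c)^-1 IA).
have := Ex_le I1 (IgD (Ig_cst P (expR (l * x))) I3) pw.
rewrite (ExD (Ig_cst P _) I3) Ex_cst (ExD (IgZ _ I2) (IgZ _ IA)) (ExZ _ I2) (ExZ _ IA) (Ex_bool P mA) => h3.
have h4 := ler_wpM2l (ltW (divr_gt0 c0 (ltr0n R 2))) h2.
have h5 : t / 2 <= (2 * c)^-1 * Pr P [set w | x < X w].
  have : c / 2 * M = t / 2 by rewrite /c; field; rewrite gt_eqF.
  by lra.
have c20 : 0 <= 2 * c by rewrite mulr_ge0// ltW.
have c2n : 2 * c != 0 by rewrite mulf_neq0// gt_eqF.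
have := ler_wpM2l c20 h5; rewrite (mulVKf c2n); apply: le_trans.
by rewrite le_eqVlt; apply/orP; left; apply/eqP; rewrite /c; field; rewrite gt_eqF.
Qed.

Lemma powR_le_root {R : realType} (rho c z : R) : 0 < rho -> 0 <= c -> 0 <= z <= c `^ rho^-1 -> z `^ rho <= c.
Proof.
move=> r0 c0 /andP[z0 zc].
apply: (@le_trans _ _ ((c `^ rho^-1) `^ rho)).
  by apply: ge0_ler_powR; rewrite ?nnegrE ?powR_ge0// ltW.
by rewrite -powRrM mulVf ?gt_eqF// powRr1.
Qed.

Lemma ln_ratio_le {R : realType} (p q u : R) : 0 < q -> q * expR (- u) <= p -> p <= q * expR u ->
  0 < p /\ `|ln (p / q)| <= u.
Proof.
move=> q0 h1 h2; have p0 : 0 < p by apply: lt_le_trans h1; rewrite mulr_gt0 ?expR_gt0.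
split => //; have pq : 0 < p / q by rewrite divr_gt0.
rewrite ler_norml -(ler_expR (- u)) -(ler_expR _ u) lnK ?posrE//.
by rewrite ler_pdivlMr// ler_pdivrMr// mulrC h1 mulrC h2.
Qed.

Lemma const_le_expR {R : realType} (p b B : R) : 0 < p -> 0 < b -> b <= B -> expR (- ((p * b)^-1 * B)) <= p.
Proof.
move=> p0 b0 bB; have pb : 0 < p * b by rewrite mulr_gt0.
have h : p^-1 <= (p * b)^-1 * B.
  by rewrite invfM -mulrA; apply: ler_peMr; [rewrite invr_ge0 ltW|rewrite mulrC ler_pdivlMr// mul1r].
rewrite expRN -[leRHS]invrK lef_pV2 ?posrE ?invr_gt0 ?expR_gt0//.
by apply: le_trans h _; have := expR_ge1Dx ((p * b)^-1 * B); lra.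
Qed.

(** Meant for [eps] bounded below: then [x] is bounded, no normal approximation is available, and a
    constant lower bound of the tail is enough. It comes from the first two moments of [exp (l X)]
    for a small fixed [l]. *)
Lemma lower_regime_eps {R : realType} (rho : R) : 0 < rho <= 1 -> exists p0 : R, 0 < p0 /\
  forall (d : measure_display) (T : measurableType d) (P : probability T R) (n : nat)
    (F : nat -> set (set T)) (xi s2 : nat -> T -> R) (eps delta : R),
  mds_setup P n F xi s2 -> condA1 P n F xi s2 rho eps -> condA2 P n s2 delta ->
  forall x, 0 <= x <= 128^-1 `^ rho^-1 / 8 -> p0 <= tailX P n xi x.
Proof.
move=> rho01; have [C1 [_ H]] := tilted_rep_exists rho01; have /andP[r0 r1] := rho01.
pose l : R := 128^-1 `^ rho^-1; have l0 : 0 < l by rewrite powR_gt0// invr_gt0.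
have l1 : l <= 1.
  rewrite /l -[leRHS](powRr0 (128^-1)); apply: ger_powR; first by lra.
  by rewrite invr_ge0 ltW.
have l20 : 0 < l ^+ 2 by rewrite exprn_gt0.
have l21 : l ^+ 2 <= 1 by rewrite expr_le1// ltW.
(* As [(l eps)^rho <= 1 / 128] and [delta^2 <= 1 / 4], the mean of [exp (l X)] is at least
   [exp (5/16 l^2)], while [exp (l x) <= exp (1/8 l^2)]; [3/16] is the difference of the
   exponents. *)
pose t := 1 - expR (- (3 / 16 * l ^+ 2)).
have t0 : 0 < t by rewrite subr_gt0 expR_lt1; lra.
exists (t ^+ 2 / expR 3); split; first by rewrite divr_gt0 ?exprn_gt0 ?expR_gt0.
move=> d T P n F xi s2 eps delta setup A1 A2 x /andP[x0 xl].
have /andP[e0 e1] : 0 < eps <= 2^-1 by case: A1.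
have /andP[d0 d1] : 0 <= delta <= 2^-1 by case: A2.
have s1 : (l * eps) `^ rho <= 128^-1.
  by apply: powR_le_root => //; rewrite -/l; apply/andP; split; nra.
have s2' : (2 * l * eps) `^ rho <= 128^-1.
  by apply: powR_le_root => //; rewrite -/l; apply/andP; split; nra.
have tauE lam : 0 < lam -> lam `^ (2 + rho) * eps `^ rho = lam ^+ 2 * (lam * eps) `^ rho.
  by move=> lam0; rewrite powRD_gt0 ?powR_mulrn ?powRM ?(ltW lam0) ?(ltW e0)// ?mulrA//; lra.
have [rep [I1 /andP[h1 _]]] := H _ _ _ _ _ _ _ _ _ setup A1 A2 l (ltW l0) s1.
have l2p : 0 < 2 * l by lra.
have [_ [I2 /andP[_ h2]]] := H _ _ _ _ _ _ _ _ _ setup A1 A2 (2 * l) (ltW l2p) s2'.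
rewrite tauE// in h1; rewrite tauE// in h2.
have mX : measurable_fun setT (Xsum n xi).
  have [Q [Y [V [[mY mV] _ _ XE _]]]] := rep.
  have -> : Xsum n xi = (fun w => Y w + l * V w) by exact/funext.
  by apply: measurable_funD => //; exact: measurable_funM.
apply: (exp_lower_tail I1 I2 mX) => //.
  apply: le_trans h1.
  have k1 := ler_wpM2l (ltW l20) s1.
  have dd : delta ^+ 2 <= 4^-1 by nra.
  have k2 := ler_wpM2l (ltW l20) dd.
  apply: (@le_trans _ _ (expR (5 / 16 * l ^+ 2))); last by rewrite ler_expR; lra.
  have e8 : expR (l * x) <= expR (8^-1 * l ^+ 2).
    by rewrite ler_expR; have := ler_wpM2l (ltW l0) xl; rewrite -/l; lra.
  have E1 : 1 <= expR (5 / 16 * l ^+ 2) by have := expR_ge1Dx (5 / 16 * l ^+ 2); lra.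
  have EE : expR (8^-1 * l ^+ 2) = expR (5 / 16 * l ^+ 2) * (1 - t).
    by rewrite /t subKr -expRD; congr expR; field.
  by move: e8; rewrite EE; have := ler_wpM2r (ltW t0) E1; lra.
apply: le_trans h2 _; rewrite ler_expR exprMn.
have := ler_wpM2l (mulr_ge0 (ler0n R 4) (ltW l20)) s2'.
by rewrite (_ : 2 ^+ 2 = 4 :> R) -?natrX//; lra.
Qed.

Lemma moderate_deviation {R : realType} (rho : R) : 0 < rho <= 1 ->
  exists alpha c : R, 0 < alpha /\ 0 < c /\
    forall (n : nat) (d : measure_display) (T : measurableType d) (P : probability T R)
      (F : nat -> set (set T)) (xi s2 : nat -> T -> R) (eps delta : R),
    mds_setup P n F xi s2 -> condA1 P n F xi s2 rho eps -> condA2 P n s2 delta ->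
    forall x : R, 0 <= x <= alpha / eps ->
      0 < tailX P n xi x /\
      `|ln (tailX P n xi x / (1 - Phi x))| <= c * md_bound rho eps delta (be_rate rho eps) x.
Proof.
move=> rho01; have [C1 [C11 H]] := tilted_rep_exists rho01; have /andP[r0 r1] := rho01.
have [pm [pm0 HI]] := lower_regime_eps rho01.
have [B0 hB] : exists B0 : R, 10 * 320 * 37 <= B0 by exists (10 * 320 * 37).
have B00 : 1 <= B0 by lra.
have q0 := @phi0_gt0 R.
(* [y] is the largest [lam eps] that [tilted_rep_exists] admits; [y1] and [y2] invert the conditions
   [16 B0^2 eps^rho <= 1] and [B0 (x eps)^rho <= 1] of [lower_regime_large]. *)
pose y : R := 128^-1 `^ rho^-1; have y0 : 0 < y by rewrite powR_gt0// invr_gt0.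
pose y1 : R := (16 * B0 ^+ 2)^-1 `^ rho^-1.
have B2 : 0 < 16 * B0 ^+ 2 by rewrite mulr_gt0// exprn_gt0//; lra.
have y10 : 0 < y1 by rewrite powR_gt0// invr_gt0.
pose y2 : R := B0^-1 `^ rho^-1; have y20 : 0 < y2 by rewrite powR_gt0// invr_gt0; lra.
pose eps0 := Num.min (y / (4 * B0)) y1.
have e00 : 0 < eps0 by rewrite lt_min y10 divr_gt0//; lra.
(* [y / 6] covers [lam <= 2 x] and, together with [B0 eps <= y / 4], also [lam <= 3 x + 2 B0]; the
   last entry gives [x <= y / 8] as soon as [eps > eps0]. *)
pose alpha := Num.min (y / 6) (Num.min y2 (eps0 * (y / 8))).
have al0 : 0 < alpha by rewrite !lt_min y20 divr_gt0//= mulr_gt0// divr_gt0.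
have al1 : alpha <= y / 6 by rewrite ge_min lexx.
have al2 : alpha <= y2 by rewrite !ge_min lexx orbT.
have al3 : alpha <= eps0 * (y / 8) by rewrite !ge_min lexx !orbT.
(* A lower bound of the error when [eps > eps0], from [eps^rho <= 2 L]. *)
pose b0 := eps0 `^ rho / 2; have b00 : 0 < b0 by rewrite divr_gt0// powR_gt0.
pose C2 := 120 * C1 / phi (0 : R).
have C10 : 0 <= C1 by lra.
have C20 : 0 <= C2 by rewrite divr_ge0 ?mulr_ge0// ltW.
have k1 : 0 <= C1 / phi (0 : R) by rewrite divr_ge0// ltW.
have k2 : 0 <= (pm * b0)^-1 by rewrite invr_ge0 mulr_ge0// ltW.
pose cu := 66 + 320 * C1 / phi (0 : R); pose cs := 93 + 1400 * C1 / phi (0 : R).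
pose cl := 9 * B0 ^+ 2 * (C2 + 1) + 7 * C2.
have cu0 : 0 < cu by rewrite /cu -mulrA; lra.
have cs0 : 0 <= cs by rewrite /cs -mulrA; lra.
have cl0 : 0 <= cl by apply: addr_ge0; apply: mulr_ge0 => //; [exact: mulr_ge0 (sqr_ge0 _)|lra].
pose ct := cu + cs + cl + (pm * b0)^-1.
have [ct0 [ctu [cts [ctl ctp]]]] : 0 < ct /\ cu <= ct /\ cs <= ct /\ cl <= ct /\ (pm * b0)^-1 <= ct.
  rewrite /ct; clear -cu0 cs0 cl0 k2; move: (_^-1) cu cs cl k2 cu0 cs0 cl0 => z1 z2 z3 z4 *.
  by repeat split; lra.
clearbody ct; exists alpha, ct; do 2 split => //.
move=> n d T P F xi s2 eps delta setup A1 A2 x /andP[x0 xa].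
have e01 : 0 < eps <= 2^-1 by case: A1.
have d01 : 0 <= delta <= 2^-1 by case: A2.
have /andP[e0 e1] := e01; have /andP[d0 d1] := d01.
have xe : x * eps <= alpha by rewrite -ler_pdivlMr.
have xe0 : 0 <= x * eps by rewrite mulr_ge0// ltW.
have L0 := be_rate_ge0 rho e0; have eL := be_rate_ge rho01 e01.
set L := be_rate rho eps in L0 eL *; set B := md_bound rho eps delta L x.
have Bge : 0 <= B := md_bound_ge0 rho eps d01 L0 x0.
have Blin : (1 + x) * (L + delta) <= B := md_bound_lin rho eps d01 L0 x0.
have rep lam : 0 <= lam -> lam * eps <= y -> tilted_rep P (Xsum n xi) lam delta (lam `^ (2 + rho) * eps `^ rho)
    (C1 * (L + lam `^ (1 + rho) * eps `^ rho + delta)) (10 * (2 + 320 * (lam `^ (1 + rho) * eps `^ rho))).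
  move=> l0 le; have s : (lam * eps) `^ rho <= 128^-1.
    by apply: powR_le_root => //; rewrite le andbT mulr_ge0// ltW.
  by have [] := H _ _ _ _ _ _ _ _ _ setup A1 A2 lam l0 s.
have rep2 lam : 0 <= lam <= 2 * x -> lam * eps <= y.
  move=> /andP[_ l2]; apply: le_trans (ler_wpM2r (ltW e0) l2) _; rewrite -mulrA; clear -xe al1 y0; lra.
have tE : tailX P n xi x = Pr P [set w | x < Xsum n xi w] by [].
have P0 := Phi_lt1 x0; have P1 : 1 - Phi x <= 1 by rewrite gerBl; exact: Phi_ge0.
have weak K p : 0 <= K -> K <= ct ->
    (1 - Phi x) * expR (- (K * B)) <= p -> (1 - Phi x) * expR (- (ct * B)) <= p.
  move=> K0 Kc; apply: le_trans; apply: ler_wpM2l; first exact: ltW.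
  by rewrite ler_expR lerN2; apply: ler_wpM2r.
have dd0 := sqr_ge0 delta; have dd4 : delta ^+ 2 <= 4^-1 by clear -d0 d1; nra.
apply: ln_ratio_le => //.
  pose lam := x / (1 - delta ^+ 2).
  have lx : lam * (1 - delta ^+ 2) = x by rewrite /lam divfK// gt_eqF//; clear -dd4; lra.
  have [l02 _] := lower_lam rho eps d01 L0 x0 lx.
  have /andP[l0 l2] := l02.
  have R1 := rep _ l0 (rep2 _ l02).
  (* The threshold [phi 0 / 6] keeps the window of [lower_regime_small] inside [[0, 1]]; above it,
     [md_bound_kap] makes [1 + x] at most [C2 * B]. *)
  have [hk|hk] := leP (C1 * (L + lam `^ (1 + rho) * eps `^ rho + delta)) (phi 0 / 6).
    apply: (weak cs) => //.
    apply: (lower_regime_small rho01 d01 L0 eL x0 C10 lx hk); first exact: rep_lower R1 l0 lx.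
    by move=> g g0; apply: rep_window R1 l0 _ g0 lx.
  have [he|he] := leP eps eps0.
    apply: (weak cl) => //.
    apply: (lower_regime_large rho01 e0 d01 L0 x0 C20 _ hB).
    - have := md_bound_kap rho01 d01 L0 eL x0 C10 l02; rewrite -/B.
      move: (C1 * (_ + _ + _)) hk => k hk hB'.
      have l1x : x <= lam by rewrite -lx ler_piMr// gerBl.
      have h1 : phi 0 / 6 * (1 + x) <= 20 * C1 * B.
        apply: le_trans hB'; apply: ler_pM; [|exact: addr_ge0|exact: ltW|by rewrite lerD2l].
        by rewrite divr_ge0// ltW.
      rewrite /C2 (_ : _ * B = 6 * (20 * C1 * B) / phi 0); last by ring.
      by rewrite ler_pdivlMr//; clear -h1; move: h1; move: (20 * C1 * B) => z; lra.
    - have h : (x * eps) `^ rho <= B0^-1.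
        by apply: powR_le_root => //; [rewrite invr_ge0 (le_trans ler01)|rewrite xe0 (le_trans xe)].
      by have := ler_wpM2l (ltW (lt_le_trans ltr01 B00)) h; rewrite divff// gt_eqF// (lt_le_trans ltr01).
    - have h : eps `^ rho <= (16 * B0 ^+ 2)^-1.
        by apply: powR_le_root => //; [rewrite invr_ge0 ltW|rewrite (ltW e0) (le_trans he)// ge_min lexx orbT].
      by have := ler_wpM2l (ltW B2) h; rewrite divff// gt_eqF.
    move=> lam' r /andP[l'0 l'1] hr hx.
    have h : B0 * eps <= y / 4.
      have : eps <= y / (4 * B0) by apply: le_trans he _; rewrite ge_min lexx.
      have B40 : 0 < 4 * B0 by rewrite mulr_gt0// (lt_le_trans ltr01).
      by clear -B40; rewrite ler_pdivlMr//; lra.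
    have ly : lam' * eps <= y by apply: le_trans (ler_wpM2r (ltW e0) l'1) _; clear -h xe al1; lra.
    have hc := rep_concentration (rep _ l'0 ly) l'0.
    exact: hc x r hr hx.
  (* Now [eps > eps0]: the error is at least [b0], and a large multiple of it brings the normal tail
     below the constant [pm]. *)
  apply: (weak (pm * b0)^-1) => //.
  apply: (@le_trans _ _ (expR (- ((pm * b0)^-1 * B)))); first by rewrite ler_piMl ?expR_ge0.
  apply: le_trans (const_le_expR pm0 b00 _) _.
    apply: (@le_trans _ _ L).
      rewrite /b0 ler_pdivrMr// mulrC; apply: le_trans eL.
      by apply: ge0_ler_powR; rewrite ?nnegrE// ltW.
    by apply: le_trans Blin; clear -x0 L0 d0; nra.
  apply: HI setup A1 A2 _ _; rewrite x0 /= -/y.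
  have : x * eps0 <= eps0 * (y / 8).
    by apply: le_trans al3; apply: le_trans xe; apply: ler_wpM2l => //; exact: ltW.
  by rewrite mulrC ler_pM2l.
(* A large Kolmogorov error only multiplies the upper bound by a factor that the error term absorbs,
   so one regime covers all [x]. *)
pose lam := x / (1 + delta ^+ 2).
have lx : lam * (1 + delta ^+ 2) = x by rewrite /lam divfK// gt_eqF//; clear -dd0; lra.
have l0 : 0 <= lam by rewrite divr_ge0// addr_ge0.
have l02 : 0 <= lam <= 2 * x by rewrite l0 -lx /=; have := mulr_ge0 l0 dd0; clear -l0; lra.
apply: (@le_trans _ _ ((1 - Phi x) * expR (cu * B))).
  apply: (upper_regime rho01 d01 L0 eL x0 C10 l0 lx).
  exact: rep_upper (rep _ l0 (rep2 _ l02)) l0 lx.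
apply: ler_wpM2l; first exact: ltW.
by rewrite ler_expR; apply: ler_wpM2r.
Qed.

Theorem theorem1 (R : realType) :
  (* [i] rho in (0,1) *)
  (forall rho : R, 0 < rho < 1 ->
    exists alpha c : R, 0 < alpha /\ 0 < c /\
    forall (n : nat) (d : measure_display) (T : measurableType d)
      (P : probability T R) (F : nat -> set (set T)) (xi s2 : nat -> T -> R)
      (eps delta : R),
      (1 <= n)%N ->
      mds_setup P n F xi s2 ->
      condA1 P n F xi s2 rho eps ->
      condA2 P n s2 delta ->
      forall x : R, 0 <= x <= alpha / eps ->
        0 < tailX P n xi x /\
        `|ln (tailX P n xi x / (1 - Phi x))| <=
          c * (x `^ (2 + rho) * eps `^ rho + x ^+ 2 * delta ^+ 2
               + (1 + x) * (eps `^ rho + delta)))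
  /\
  (* [ii] rho = 1 *)
  (exists alpha c : R, 0 < alpha /\ 0 < c /\
    forall (n : nat) (d : measure_display) (T : measurableType d)
      (P : probability T R) (F : nat -> set (set T)) (xi s2 : nat -> T -> R)
      (eps delta : R),
      (1 <= n)%N ->
      mds_setup P n F xi s2 ->
      condA1 P n F xi s2 1 eps ->
      condA2 P n s2 delta ->
      forall x : R, 0 <= x <= alpha / eps ->
        0 < tailX P n xi x /\
        `|ln (tailX P n xi x / (1 - Phi x))| <=
          c * (x ^+ 3 * eps + x ^+ 2 * delta ^+ 2
               + (1 + x) * (eps * `|ln eps| + delta))).
Proof.
split.
  move=> rho /andP[r0 r1]; have rho01 : 0 < rho <= 1 by rewrite r0 ltW.
  have [alpha [c [a0 [c0 H]]]] := moderate_deviation rho01.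
  exists alpha, c; do 2 split => //; move=> n d T P F xi s2 eps delta _ setup A1 A2 x hx.
  by have := H _ _ _ _ _ _ _ _ _ setup A1 A2 x hx; rewrite /md_bound /be_rate lt_eqF.
have r01 : 0 < (1 : R) <= 1 by rewrite ltr01 lexx.
have [alpha [c [a0 [c0 H]]]] := moderate_deviation r01.
exists alpha, c; do 2 split => //; move=> n d T P F xi s2 eps delta _ setup A1 A2 x hx.
have [_ /andP[e0 _] _] := A1; have /andP[x0 _] := hx.
have := H _ _ _ _ _ _ _ _ _ setup A1 A2 x hx; rewrite /md_bound /be_rate eqxx.
have -> : x `^ (2 + 1) = x ^+ 3 by rewrite -powR_mulrn//; congr (_ `^ _); lra.
by rewrite (powRr1 (ltW e0)).
Qed.
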